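(* Let $\alpha\in(2,\infty]$, $c_*>0$, and let $a:\bar B_1\to[0,\infty]$ be radial, i.e. $a(z)=a(|z|)$ for all $z\in\bar B_1$, with $\int_{\{|z|\le1\}}|z|^2a(z)\,\mathrm dz<\infty$. Let $$\nu(\mathrm dz)=a(z)\mathbf 1_{\{|z|\le1\}}\,\mathrm dz+\frac{c_*}{|z|^{d+\alpha}}\mathbf 1_{\{|z|>1\}}\,\mathrm dz$$ be non-zero. Let $\beta,\gamma>0$, $0\neq\lambda\in\mathbb R$, $F(t,x)=(1+t)^{-\beta}\lambda x(1+|x|^2)^{\frac12(\gamma-1)}$, and let $(X_t^\mu)_{t\ge0}$ be the solution of $\mathrm dX_t=F(t,X_t)\,\mathrm dt+\mathrm dL_t$ with initial law $\mu$, where $(L_t)_{t\ge0}$ is a pure-jump Lévy process with Lévy measure $\nu$. Suppose that one of the following holds: (a) $\beta>(1+\gamma)/2$, and either (i) $\lambda>0$ and $\gamma\in(0,1]$, or (ii) $\lambda<0$ and $0<\gamma<\alpha$; (b) $\beta=(1+\gamma)/2$, $\lambda<0$ and $1\vee(3-d/2)<\gamma<\alpha$; (c) $\beta<(1+\gamma)/2$, $\lambda<0$ and $1\vee(3-d/2)<\gamma<\alpha$. Let $(B_t)_{t\ge0}$ be a $d$-dimensional Brownian motion with covariance matrix $\frac1d\nu(|\cdot|^2)I_d$. Then in case (a) (resp. case (b)) there exist constants $\lambda_1,t_1>0$ such that for all $t\ge t_1$ and $\mu\in\mathcal P_\gamma(\mathbb R^d)$, $$\mathrm d_{\mathcal F_c}\big(\mathscr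 L_{t^{-1/2}X_t^\mu},\pi\big)\le C_1t^{-\lambda_1},$$ where $\pi$ is the unique invariant probability measure of $\mathrm d\overline Y_t=-\frac12\overline Y_t\,\mathrm dt+\mathrm dB_t$ (resp. of $\mathrm d\overline Y_t=\big(-\frac12\overline Y_t+\lambda\overline Y_t|\overline Y_t|^{\gamma-1}\big)\mathrm dt+\mathrm dB_t$). In case (c) there exist constants $\lambda_2,t_2>0$ such that for all $t\ge t_2$ and $\mu\in\mathcal P_\gamma(\mathbb R^d)$, $$\mathrm d_{\mathcal F_c}\big(\mathscr L_{t^{-\beta/(1+\gamma)}X_t^\mu},\pi\big)\le C_2t^{-\lambda_2},$$ where $\pi$ is the unique invariant probability measure of $\mathrm d\overline Y_t=\lambda\overline Y_t|\overline Y_t|^{\gamma-1}\mathrm dt+\mathrm dB_t$. The constants $C_1,C_2>0$ depend on $\mu$ and $\pi$ (not on $t$).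
   Context: $d\ge1$; $\bar B_1=\{z\in\mathbb R^d:|z|\le1\}$; $a\vee b=\max\{a,b\}$; $I_d$ is the identity matrix; $\nu(|\cdot|^2)=\int|z|^2\nu(\mathrm dz)$. When $\alpha=\infty$ the second term in $\nu$ is $0$. $\mathscr L_\xi$ is the law of $\xi$; $\mathcal P_p(\mathbb R^d)$ is the set of probability measures on $\mathbb R^d$ with finite $p$-th moment. A pure-jump Lévy process with Lévy measure $\nu$ is a Lévy process with $\mathbb E e^{i\langle\xi,L_t\rangle}=\exp\big(-t\int_{\mathbb R^d}(1-e^{i\langle\xi,z\rangle}+i\langle\xi,z\rangle\mathbf 1_{\{|z|\le1\}})\,\nu(\mathrm dz)\big)$. The SDE for $X$ is assumed to have a unique strong solution. A Brownian motion with covariance matrix $\Sigma$ means one with $\mathrm{Cov}(B_t)=t\Sigma$. $\mathrm d_{\mathcal F_c}(\mu_1,\mu_2)=\sup_{f\in\mathcal F_c}|\mu_1(f)-\mu_2(f)|$ with $\mathcal F_c=\{f\in C_c^\infty(\mathbb R^d):\sum_{i=0}^3\|\nabla^if\|_\infty\le1\}$. *)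

(* Defs.v *)
From HB Require Import structures.
From mathcomp Require Import all_boot all_order all_algebra.
From mathcomp Require Import all_classical all_reals all_analysis.
From mathcomp Require Import measurable_realfun.
From mathcomp Require Import complex.

Set Implicit Arguments.
Unset Strict Implicit.
Unset Printing Implicit Defensive.

Import Order.TTheory GRing.Theory Num.Theory.
Import numFieldNormedType.Exports.

Local Open Scope classical_set_scope.
Local Open Scope ring_scope.

(* R^d is 'rV[R]_d.  The library's norm on matrices is the sup norm, so the
   Euclidean norm is introduced separately; both induce the same topology. *)
Definition inner (R : realType) (d : nat) (x y : 'rV[R]_d) : R :=
  \sum_i x 0 i * y 0 i.

Definition enorm (R : realType) (d : nat) (x : 'rV[R]_d) : R :=
  Num.sqrt (\sum_i x 0 i ^+ 2).

Definition unit_ball (R : realType) (d : nat) : set 'rV[R]_d :=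
  [set z | enorm z <= 1].

(* R^d carries the sigma-algebra generated by the coordinates, as n.-tuple
   does in the library; since R is second countable this is the Borel
   sigma-algebra. *)
Definition rV_display : measure_display.
Proof. exact: default_measure_display. Qed.

Section measurable_rV.
Variables (R : realType) (d : nat).

Let coors : 'I_d -> 'rV[R]_d -> R := fun i x => x 0 i.

Let rV_set0 : g_sigma_preimage coors set0.
Proof. exact: sigma_algebra0. Qed.

Let rV_setC A : g_sigma_preimage coors A -> g_sigma_preimage coors (~` A).
Proof. exact: sigma_algebraC. Qed.

Let rV_bigcup (F : _^nat) : (forall i, g_sigma_preimage coors (F i)) ->
  g_sigma_preimage coors (\bigcup_i (F i)).
Proof. exact: sigma_algebra_bigcup. Qed.

HB.instance Definition _ := @isMeasurable.Build rV_display
  'rV[R]_d (g_sigma_preimage coors) rV_set0 rV_setC rV_bigcup.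

End measurable_rV.


Lemma measurable_coord (R : realType) (d : nat) (i : 'I_d) :
  measurable_fun [set: 'rV[R]_d] (fun x => x 0 i).
Proof.
move=> _ Y mY; rewrite setTI; apply: sub_sigma_algebra => /=.
rewrite -bigcup_seq/=; exists i => /=; first by rewrite mem_index_enum.
by exists Y => //; rewrite setTI.
Qed.

Lemma measurable_fun_rV (R : realType) (d : nat) (disp : measure_display)
    (T : measurableType disp) (f : T -> 'rV[R]_d) :
  (forall i, measurable_fun [set: T] (fun t => f t 0 i)) ->
  measurable_fun [set: T] f.
Proof.
move=> mf; apply: (@measurability _ _ _ _ setT f
  (\big[setU/set0]_(i < d)
    preimage_set_system setT (fun x : 'rV[R]_d => x 0 i) measurable)) => //.
move=> _ [B + <-]; rewrite -bigcup_seq => -[i _ [C mC <-]].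
by rewrite setTI; exact: mf.
Qed.

Section lebesgue_rV.
Variable R : realType.

Definition rV_cons (n : nat) (p : measurableTypeR R * 'rV[R]_n) : 'rV[R]_n.+1 :=
  \row_i (if unlift ord0 i is Some j then p.2 0 j else p.1).

Definition rV_uncons (n : nat) (x : 'rV[R]_n.+1) :
    measurableTypeR R * 'rV[R]_n :=
  (x 0 ord0, \row_j x 0 (lift ord0 j)).

Lemma rV_consK n : cancel (@rV_cons n) (@rV_uncons n).
Proof.
move=> [a v]; rewrite /rV_uncons /rV_cons mxE unlift_none; congr pair.
by apply/rowP => j; rewrite !mxE liftK.
Qed.

Lemma rV_unconsK n : cancel (@rV_uncons n) (@rV_cons n).
Proof.
move=> x; apply/rowP => i; rewrite mxE.
by case: unliftP => [j|] -> //=; rewrite mxE.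
Qed.

Lemma measurable_rV_cons n : measurable_fun setT (@rV_cons n).
Proof.
apply: measurable_fun_rV => i; rewrite /rV_cons.
case: (unliftP ord0 i) => [j|] ij.
  rewrite (_ : (fun _ => _) = (fun x : 'rV[R]_n => x 0 j) \o snd).
    by apply: measurableT_comp => //; exact: measurable_coord.
  by apply/funext => p /=; rewrite mxE ij liftK.
rewrite (_ : (fun _ => _) = fst) //.
by apply/funext => p /=; rewrite mxE ij unlift_none.
Qed.

Lemma measurable_rV_uncons n : measurable_fun setT (@rV_uncons n).
Proof.
apply/measurable_fun_pairP; split => /=; first exact: measurable_coord.
apply: measurable_fun_rV => j.
rewrite (_ : (fun _ => _) = (fun x : 'rV[R]_n.+1 => x 0 (lift ord0 j))).
  exact: measurable_coord.
by apply/funext => x; rewrite /= mxE.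
Qed.

Section step.
Variables (n : nat).
Variable m1 : {sigma_finite_measure set (measurableTypeR R) -> \bar R}.
Variable m : {sigma_finite_measure set 'rV[R]_n -> \bar R}.

(* The product measure m1 \x m on R x R^n, carried to R^(n+1). *)
Definition prod_cons : set 'rV[R]_n.+1 -> \bar R :=
  pushforward (m1 \x m)%E (@rV_cons n).

Let mpre (A : set 'rV[R]_n.+1) :
  measurable A -> measurable (@rV_cons n @^-1` A).
Proof.
by move=> mA; rewrite -[X in measurable X]setTI; exact: measurable_rV_cons.
Qed.

Let prod_cons0 : prod_cons set0 = 0%E.
Proof. by rewrite /prod_cons /pushforward preimage_set0 measure0. Qed.

Let prod_cons_ge0 A : (0 <= prod_cons A)%E.
Proof. by rewrite /prod_cons /pushforward measure_ge0. Qed.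

Let prod_cons_sigma_additive : semi_sigma_additive prod_cons.
Proof.
move=> F mF tF mUF; rewrite /prod_cons /pushforward preimage_bigcup.
apply: measure_semi_sigma_additive.
- by move=> k; exact: mpre.
- apply/trivIsetP => /= i j _ _ ij; rewrite -preimage_setI.
  by move/trivIsetP : tF => /(_ _ _ _ _ ij) ->//; rewrite preimage_set0.
- by rewrite -preimage_bigcup; exact: mpre.
Qed.

HB.instance Definition _ := isMeasure.Build _ _ _ prod_cons
  prod_cons0 prod_cons_ge0 prod_cons_sigma_additive.

Let prod_cons_sigma_finite : sigma_finite setT prod_cons.
Proof.
have /sigma_finiteP[F [TF ndF Foo]] := sigma_finiteT m1.
have /sigma_finiteP[G [TG ndG Goo]] := sigma_finiteT m.
exists (fun k => @rV_uncons n @^-1` (F k `*` G k)).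
  rewrite -preimage_bigcup -[LHS](preimage_setT (@rV_uncons n)).
  congr (_ @^-1` _); rewrite -setXTT TF TG predeqE => -[x y]; split.
    move=> [/= [i _ Fix] [k _ Gky]]; exists (maxn i k) => //; split.
    - by move: x Fix; exact/subsetPset/ndF/leq_maxl.
    - by move: y Gky; exact/subsetPset/ndG/leq_maxr.
  by move=> [i _ []/= ? ?]; split; exists i.
move=> k; have [mF Fk] := Foo k; have [mG Gk] := Goo k; split.
  rewrite -[X in measurable X]setTI; apply: measurable_rV_uncons => //.
  exact: measurableX.
rewrite /prod_cons /pushforward -comp_preimage.
rewrite (_ : _ \o _ = id); last by apply/funext => p; exact: rV_consK.
by rewrite preimage_id product_measure1E// lte_mul_pinfty// ge0_fin_numE.
Qed.

HB.instance Definition _ := Measure_isSigmaFinite.Build _ _ _ prod_cons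
  prod_cons_sigma_finite.

End step.

Fixpoint lebesgue_rV (n : nat) : {sigma_finite_measure set 'rV[R]_n -> \bar R} :=
  match n return {sigma_finite_measure set 'rV[R]_n -> \bar R} with
  | 0 => \d_(0 : 'rV[R]_0)
  | n'.+1 => prod_cons (@lebesgue_measure R) (lebesgue_rV n')
  end.

End lebesgue_rV.

Section characteristic_functions.
Variables (R : realType) (disp : measure_display) (T : measurableType disp).
Local Open Scope complex_scope.

Definition cexp (z : R[i]) : R[i] :=
  (expR (complex.Re z))%:C * (cos (complex.Im z) +i* sin (complex.Im z)).

Definition cintegral (m : {measure set T -> \bar R}) (f : T -> R[i]) : R[i] :=
  (\int[m]_x complex.Re (f x)) +i* (\int[m]_x complex.Im (f x)).

Definition charfun (d : nat) (m : {measure set T -> \bar R})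
    (X : T -> 'rV[R]_d) (xi : 'rV[R]_d) : R[i] :=
  cintegral m (fun w => cexp (0 +i* inner xi (X w))).

End characteristic_functions.

Definition levy_symbol (R : realType) (d : nat)
    (nu : {measure set 'rV[R]_d -> \bar R}) (xi : 'rV[R]_d) : R[i] :=
  (cintegral nu (fun z =>
     1 - cexp (0 +i* inner xi z) +
     (0 +i* (inner xi z * \1_(@unit_ball R d) z))))%C.

Section processes.
Variables (R : realType) (d : nat).
Variables (disp : measure_display) (Omega : measurableType disp).
Variable P : probability Omega R.
Implicit Types X Y Z L B : R -> Omega -> 'rV[R]_d.

(* Processes are indexed by R, but only the times t >= 0 matter. *)

Definition measurable_process X : Prop :=
  forall t, 0 <= t -> measurable_fun [set: Omega] (X t).

Definition cadlag (x : R -> 'rV[R]_d) : Prop :=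
  (forall t, 0 <= t -> x s @[s --> t^'+] --> x t) /\
  (forall t, 0 < t -> cvg (x s @[s --> t^'-])).

Definition increment X (s t : R) (w : Omega) : 'rV[R]_d := X t w - X s w.

Definition independent_increments X : Prop :=
  forall (n : nat) (t : nat -> R) (A : nat -> set 'rV[R]_d),
    0 <= t 0 -> (forall i, t i <= t i.+1) -> (forall i, measurable (A i)) ->
    P (\bigcap_(i < n) increment X (t i) (t i.+1) @^-1` A i) =
    (\prod_(i < n) P (increment X (t i) (t i.+1) @^-1` A i))%E.

Definition stationary_increments X : Prop :=
  forall (s t : R) (A : set 'rV[R]_d),
    0 <= s -> s <= t -> measurable A ->
    P (increment X s t @^-1` A) = P (increment X 0 (t - s) @^-1` A).

Definition is_levy X : Prop :=
  [/\ measurable_process X,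
      {ae P, forall w, X 0 w = 0},
      independent_increments X,
      stationary_increments X &
      {ae P, forall w, cadlag (fun t => X t w)}].

Definition is_pure_jump_levy (nu : {measure set 'rV[R]_d -> \bar R}) L : Prop :=
  is_levy L /\
  forall (t : R) (xi : 'rV[R]_d), 0 <= t ->
    charfun P (L t) xi = (cexp (- (t%:C * levy_symbol nu xi)))%C.

(* Gaussian laws, possibly degenerate, through their characteristic function. *)
Definition is_gaussian (X : Omega -> 'rV[R]_d) (m : 'rV[R]_d)
    (Sigma : 'M[R]_d) : Prop :=
  forall xi : 'rV[R]_d,
    charfun P X xi =
    (cexp ((0 +i* inner xi m) - (2^-1 * inner (xi *m Sigma) xi)%:C))%C.

Definition is_brownian (Sigma : 'M[R]_d) B : Prop :=
  [/\ measurable_process B,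
      {ae P, forall w, B 0 w = 0},
      independent_increments B,
      (forall s t, 0 <= s -> s <= t ->
         is_gaussian (increment B s t) 0 ((t - s) *: Sigma)) &
      {ae P, forall w, {within `[0, +oo[, continuous (fun t => B t w)}}].

Definition independent_of_process (X0 : Omega -> 'rV[R]_d) Z : Prop :=
  forall (n : nat) (t : nat -> R) (A0 : set 'rV[R]_d) (A : nat -> set 'rV[R]_d),
    (forall i, 0 <= t i) -> measurable A0 -> (forall i, measurable (A i)) ->
    P (X0 @^-1` A0 `&` \bigcap_(i < n) (Z (t i) @^-1` A i)) =
    (P (X0 @^-1` A0) * P (\bigcap_(i < n) (Z (t i) @^-1` A i)))%E.

(* The sigma-algebra generated by X0 and by Z_s for 0 <= s <= t. *)
Definition history (X0 : Omega -> 'rV[R]_d) Z (t : R) : set (set Omega) :=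
  <<s [set E | (exists2 A, measurable A & E = X0 @^-1` A) \/
               (exists s A, [/\ 0 <= s, s <= t, measurable A &
                                E = Z s @^-1` A])] >>.

(* X is adapted to the P-completion of the history of (X0, Z). *)
Definition completed_adapted (X0 : Omega -> 'rV[R]_d) Z X : Prop :=
  forall (t : R) (A : set 'rV[R]_d), 0 <= t -> measurable A ->
    exists2 E, history X0 Z t E &
      P.-negligible ((X t @^-1` A `\` E) `|` (E `\` X t @^-1` A)).

(* dX_t = b(t, X_t) dt + dZ_t: as the noise is additive, the equation is read
   pathwise as X_t = X_0 + \int_0^t b(s, X_s) ds + Z_t, with Z_0 = 0. *)
Definition is_strong_solution (b : R -> 'rV[R]_d -> 'rV[R]_d) Z X : Prop :=
  [/\ measurable_process X,
      independent_of_process (X 0) Z,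
      completed_adapted (X 0) Z X,
      {ae P, forall w, cadlag (fun t => X t w)} &
      {ae P, forall w, forall t, 0 <= t -> forall i : 'I_d,
        X t w 0 i = X 0 w 0 i
          + \int[@lebesgue_measure R]_(s in `[0, t]) b s (X s w) 0 i
          + Z t w 0 i}].

(* pi is invariant for the Markov semigroup P_t f(x) = E f(Y_t^x) of
   dY_t = b(Y_t) dt + dB_t: pi P_t = pi for every t >= 0. *)
Definition is_invariant (b : 'rV[R]_d -> 'rV[R]_d) B
    (pi : probability 'rV[R]_d R) : Prop :=
  exists Y : 'rV[R]_d -> R -> Omega -> 'rV[R]_d,
    (forall x, is_strong_solution (fun _ => b) B (Y x) /\
               {ae P, forall w, Y x 0 w = x}) /\
    (forall (t : R) (A : set 'rV[R]_d), 0 <= t -> measurable A ->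
       (\int[pi]_x P (Y x t @^-1` A))%E = pi A).

Definition is_unique_invariant (b : 'rV[R]_d -> 'rV[R]_d) B
    (pi : probability 'rV[R]_d R) : Prop :=
  is_invariant b B pi /\
  forall pi' : probability 'rV[R]_d R, is_invariant b B pi' ->
    forall A, measurable A -> pi' A = pi A.

End processes.

Definition has_unique_strong_solution (R : realType) (d : nat)
    (nu : {measure set 'rV[R]_d -> \bar R})
    (b : R -> 'rV[R]_d -> 'rV[R]_d) : Prop :=
  forall (disp : measure_display) (Omega : measurableType disp)
    (P : probability Omega R) (L : R -> Omega -> 'rV[R]_d),
  is_pure_jump_levy P nu L ->
  (forall X0 : Omega -> 'rV[R]_d,
     measurable_fun [set: Omega] X0 -> independent_of_process P X0 L ->
     exists X, is_strong_solution P b L X /\ {ae P, forall w, X 0 w = X0 w}) /\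
  (forall X X' : R -> Omega -> 'rV[R]_d,
     is_strong_solution P b L X -> is_strong_solution P b L X' ->
     {ae P, forall w, X 0 w = X' 0 w} ->
     {ae P, forall w, forall t, 0 <= t -> X t w = X' t w}).

Section smooth_distance.
Variables (R : realType) (d : nat).

Definition partials (s : seq 'I_d) (f : 'rV[R]_d -> R) : 'rV[R]_d -> R :=
  foldr (fun i g => 'D_(delta_mx 0 i) g) f s.

Definition smooth (f : 'rV[R]_d -> R) : Prop :=
  forall s : seq 'I_d,
    continuous (partials s f) /\
    forall x i, derivable (partials s f) x (delta_mx 0 i).

(* Euclidean (Hilbert-Schmidt) norm of the k-th derivative tensor at x. *)
Definition nabla_norm (k : nat) (f : 'rV[R]_d -> R) (x : 'rV[R]_d) : R :=
  Num.sqrt (\sum_(s : k.-tuple 'I_d) partials s f x ^+ 2).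

Definition nabla_sup (k : nat) (f : 'rV[R]_d -> R) : \bar R :=
  ereal_sup [set (nabla_norm k f x)%:E | x in [set: 'rV[R]_d]].

Definition Fc : set ('rV[R]_d -> R) :=
  [set f | [/\ smooth f, compact (closure [set x | f x != 0]) &
               (\sum_(i < 4) nabla_sup i f <= 1)%E]].

Definition dFc (mu1 mu2 : set 'rV[R]_d -> \bar R) : \bar R :=
  ereal_sup [set (`| \int[mu1]_x (f x)%:E - \int[mu2]_x (f x)%:E |)%E | f in Fc].

Definition finite_moment (p : R) (mu : set 'rV[R]_d -> \bar R) : Prop :=
  (\int[mu]_x (enorm x `^ p)%:E < +oo)%E.

End smooth_distance.

Section the_equation.
Variables (R : realType) (d : nat).

Definition is_radial_on_ball (a : 'rV[R]_d -> \bar R) : Prop :=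
  forall z z' : 'rV[R]_d, enorm z <= 1 -> enorm z' = enorm z -> a z' = a z.

(* c_* / |z|^(d + alpha), which is 0 when alpha = +oo. *)
Definition tail_density (c : R) (alpha : \bar R) (z : 'rV[R]_d) : \bar R :=
  if alpha is r%:E then (c / enorm z `^ (d%:R + r))%:E else 0%E.

Definition levy_density (a : 'rV[R]_d -> \bar R) (c : R) (alpha : \bar R)
    (z : 'rV[R]_d) : \bar R :=
  if enorm z <= 1 then a z else tail_density c alpha z.

Definition drift (beta gamma lambda : R) (t : R) (x : 'rV[R]_d) : 'rV[R]_d :=
  ((1 + t) `^ (- beta) * lambda * (1 + enorm x ^+ 2) `^ (2^-1 * (gamma - 1)))
    *: x.

Definition power_drift (gamma lambda : R) (y : 'rV[R]_d) : 'rV[R]_d :=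
  (lambda * enorm y `^ (gamma - 1)) *: y.

Definition second_moment (nu : {measure set 'rV[R]_d -> \bar R}) : R :=
  \int[nu]_z (enorm z ^+ 2).

(* Polynomial convergence of the law of t^(- theta) X_t^mu to pi.  The exponent
   and the starting time do not depend on mu, the constant C does; X^mu ranges
   over the solutions with initial law mu on all probability spaces. *)
Definition polynomial_convergence (nu : {measure set 'rV[R]_d -> \bar R})
    (b : R -> 'rV[R]_d -> 'rV[R]_d) (gamma theta : R)
    (pi : probability 'rV[R]_d R) : Prop :=
  exists kappa t0 : R, [/\ 0 < kappa, 0 < t0 &
    forall mu : probability 'rV[R]_d R, finite_moment gamma mu ->
    exists2 C : R, 0 < C &
    forall (disp : measure_display) (Omega : measurableType disp)
      (P : probability Omega R) (L X : R -> Omega -> 'rV[R]_d),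
    is_pure_jump_levy P nu L ->
    is_strong_solution P b L X ->
    (forall A, measurable A -> P (X 0 @^-1` A) = mu A) ->
    forall t : R, t0 <= t ->
    (dFc (pushforward P (fun w => t `^ (- theta) *: X t w)) pi
       <= (C * t `^ (- kappa))%:E)%E].

End the_equation.

(* Main.v *)
(** Proof idea.  The rescaled process [X (t k) / r k], along a mesh with
    [t (k + 1) - t k = h (r k)^2], is compared with the implicit Euler scheme of
    the limit equation, driven by the increments of [L] divided by [r k].  The
    limit drift [bbar y = - (kap + ell |y|^q) y] is monotone, so that one step of
    the scheme is 1-Lipschitz and local errors only add up.  A quantitative
    central limit theorem, from the expansion [s2 |xi|^2 / 2 + O(|xi|^(2 + del))] of
    the Levy symbol and trigonometric approximation of the test function, makes
    these increments Gaussian; the scheme then forgets its starting point.  In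
    cases (a) and (b) [r k] is [sqrt (t k)] and the mesh is geometric; in case (c)
    [r k] is constant, on a final window short compared with [t].  All parameters
    are powers of one natural number, a small power of [t]. *)

Require Import Defs.
From HB Require Import structures.
From mathcomp Require Import all_boot all_order all_algebra all_fingroup.
From mathcomp Require Import all_classical all_reals all_analysis.
From mathcomp Require Import measurable_realfun.
From mathcomp Require Import complex.
From mathcomp Require Import ring lra zify.

Set Implicit Arguments.
Unset Strict Implicit.
Unset Printing Implicit Defensive.

Import Order.TTheory GRing.Theory Num.Theory.
Import numFieldNormedType.Exports.

Local Open Scope classical_set_scope.
Local Open Scope ring_scope.

(** The obstacle is a drift that need not be globally Lipschitz, followed over a growing horizon:
    Gronwall factors would destroy any polynomial rate. The inverse of an implicit step [y - h b(y)]
    is nonexpansive whatever the size of [y], so Lipschitz constants enter only through local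
    defects on a ball of polynomial radius, where a fine mesh beats them. Because the noise is
    additive, the same scheme run along a fixed path also yields existence, uniqueness, the flow and
    measurability for the limit equation, and the law of the scheme depends only on characteristic
    exponents; weak uniqueness and the Markov property thus come without stochastic integrals. The
    invariant law is a pull-back limit: reverse the noise on [[0, T]], start ever further in the
    past, observe now. Finally, the noise does not oscillate little on all steps at once; a bad step
    is therefore charged with its weight [h] times its probability instead of being excluded. *)

Lemma le_of_eq (disp : Order.disp_t) (T : porderType disp) (x y : T) : x = y -> (x <= y)%O.
Proof. by move->. Qed.

(** * Euclidean geometry and measurability in row vectors *)

Section euclidean_norm.
Variables (R : realType) (d : nat).
Implicit Types x y z : 'rV[R]_d.

Lemma innerC x y : inner x y = inner y x.
Proof. by apply: eq_bigr => i _; rewrite mulrC. Qed.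

Lemma innerDl x y z : inner (x + y) z = inner x z + inner y z.
Proof. by rewrite -big_split; apply: eq_bigr => i _; rewrite mxE mulrDl. Qed.

Lemma innerZl a x z : inner (a *: x) z = a * inner x z.
Proof. by rewrite [RHS]mulr_sumr; apply: eq_bigr => i _; rewrite mxE mulrA. Qed.

Lemma innerNl x z : inner (- x) z = - inner x z.
Proof. by rewrite -scaleN1r innerZl mulN1r. Qed.

Lemma innerDr x y z : inner z (x + y) = inner z x + inner z y.
Proof. by rewrite !(innerC z) innerDl. Qed.

Lemma innerZr a x z : inner z (a *: x) = a * inner z x.
Proof. by rewrite !(innerC z) innerZl. Qed.

Lemma innerNr x z : inner z (- x) = - inner z x.
Proof. by rewrite !(innerC z) innerNl. Qed.

Lemma inner0l x : inner 0 x = 0.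
Proof. by rewrite -(scale0r 0) innerZl mul0r. Qed.

Lemma inner0r x : inner x 0 = 0.
Proof. by rewrite innerC inner0l. Qed.

Lemma inner_ge0 x : 0 <= inner x x.
Proof. by apply: sumr_ge0 => i _; rewrite -expr2 sqr_ge0. Qed.

Lemma enormE x : enorm x = Num.sqrt (inner x x).
Proof. by congr (Num.sqrt _); apply: eq_bigr => i _; rewrite expr2. Qed.

Lemma enorm_ge0 x : 0 <= enorm x.
Proof. exact: sqrtr_ge0. Qed.
Hint Resolve enorm_ge0 : core.

Lemma enorm_sqr x : enorm x ^+ 2 = inner x x.
Proof. by rewrite enormE sqr_sqrtr ?inner_ge0. Qed.

Lemma enorm0 : enorm (0 : 'rV[R]_d) = 0.
Proof. by rewrite enormE inner0l sqrtr0. Qed.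

Lemma enormZ a x : enorm (a *: x) = `|a| * enorm x.
Proof.
rewrite enormE innerZl innerZr mulrA -expr2 sqrtrM ?sqr_ge0//.
by rewrite sqrtr_sqr enormE.
Qed.

Lemma enormN x : enorm (- x) = enorm x.
Proof. by rewrite -scaleN1r enormZ normrN1 mul1r. Qed.

Lemma enormBC x y : enorm (x - y) = enorm (y - x).
Proof. by rewrite -opprB enormN. Qed.

Lemma inner_enorm x y : inner x y <= enorm x * enorm y.
Proof.
have [x0|x0] := eqVneq (enorm x) 0.
  suff -> : x = 0 by rewrite inner0l enorm0 mul0r.
  apply/rowP => i; rewrite mxE.
  have : inner x x == 0 by rewrite -enorm_sqr x0 expr0n.
  rewrite psumr_eq0 => [/allP/(_ i (mem_index_enum _))/=|j _].
    by rewrite -expr2 sqrf_eq0 => /eqP.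
  by rewrite -expr2 sqr_ge0.
have X0 : 0 < enorm x by rewrite lt_neqAle eq_sym x0 enorm_ge0.
have := inner_ge0 (enorm x ^+ 2 *: y - inner x y *: x).
rewrite innerDl !innerDr !innerZl !innerZr !innerNl !innerNr !innerZl !innerZr.
rewrite -!enorm_sqr (innerC y x) => H.
have {}H : inner x y ^+ 2 <= (enorm x * enorm y) ^+ 2.
  rewrite exprMn.
  have e2 : 0 < enorm x ^+ 2 by rewrite exprn_gt0.
  rewrite -(ler_pM2l e2); nra.
have [xy|/ltW xy] := leP (inner x y) 0.
  by rewrite (le_trans xy)// mulr_ge0.
by rewrite -(@ler_sqr _ (inner x y)) ?nnegrE ?mulr_ge0.
Qed.

Lemma ler_enormD x y : enorm (x + y) <= enorm x + enorm y.
Proof.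
rewrite -(@ler_sqr _ (enorm _)) ?nnegrE ?addr_ge0//.
rewrite enorm_sqr innerDl !innerDr -!enorm_sqr (innerC y x).
have := inner_enorm x y; nra.
Qed.

Lemma ler_enormB x y : enorm (x - y) <= enorm x + enorm y.
Proof. by rewrite (le_trans (ler_enormD _ _))// enormN. Qed.

Lemma enorm_triangle y x z : enorm (x - z) <= enorm (x - y) + enorm (y - z).
Proof. by rewrite (le_trans _ (ler_enormD _ _))// addrA subrK. Qed.

Lemma ler_enorm_sub x y : enorm x - enorm y <= enorm (x - y).
Proof. by rewrite lerBlDr (le_trans _ (ler_enormD _ _))// subrK. Qed.

Lemma ler_dist_enorm x y : `|enorm x - enorm y| <= enorm (x - y).
Proof. by rewrite ler_norml lerNl opprB ler_enorm_sub enormBC ler_enorm_sub. Qed.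

Lemma coord_enorm x i : `|x 0 i| <= enorm x.
Proof.
rewrite -sqrtr_sqr ler_wsqrtr// (bigD1 i)//= lerDl.
by apply: sumr_ge0 => j _; rewrite sqr_ge0.
Qed.

Lemma ler_enorm_sum n (F : 'I_n -> 'rV[R]_d) :
  enorm (\sum_i F i) <= \sum_i enorm (F i).
Proof.
elim/big_ind2 : _ => [|a b c e ab ce|//]; first by rewrite enorm0.
by rewrite (le_trans (ler_enormD _ _))// lerD.
Qed.

Lemma enorm_delta (i : 'I_d) : enorm (delta_mx 0 i : 'rV[R]_d) = 1.
Proof.
rewrite /enorm (bigD1 i)//= big1 ?mxE ?eqxx ?expr1n ?addr0 ?sqrtr1// => j ji.
by rewrite mxE (negbTE ji) andbF expr0n.
Qed.

Lemma enorm_le_sum x : enorm x <= \sum_i `|x 0 i|.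
Proof.
rewrite [in leLHS](row_sum_delta x) (le_trans (ler_enorm_sum _))//.
by apply: ler_sum => i _; rewrite enormZ enorm_delta mulr1.
Qed.

Lemma enorm_eq0 x : (enorm x == 0) = (x == 0).
Proof.
apply/eqP/eqP => [x0|->]; last exact: enorm0.
apply/rowP => i; rewrite mxE; apply/eqP; rewrite -normr_le0 -x0.
exact: coord_enorm.
Qed.

Lemma le_enorm_coord x (a : R) : (forall i, `|x 0 i| <= a) -> enorm x <= d%:R * a.
Proof.
move=> xa; rewrite (le_trans (enorm_le_sum x))//.
by rewrite (le_trans (ler_sum _ (fun i _ => xa i)))// sumr_const card_ord mulr_natl.
Qed.

End euclidean_norm.
#[export] Hint Extern 0 (is_true (0 <= enorm _)) => exact: enorm_ge0 : core.
#[export] Hint Extern 0 (is_true (0 <= _ `^ _)) => exact: powR_ge0 : core.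

Section measurability.
Variables (R : realType) (d : nat).

Lemma measurable_rowP (disp : measure_display) (T : measurableType disp)
    (f : T -> 'rV[R]_d) :
  measurable_fun [set: T] f <->
  forall i, measurable_fun [set: T] (fun t => f t 0 i).
Proof.
split=> [mf i|]; last exact: measurable_fun_rV.
exact: measurableT_comp (measurable_coord i) mf.
Qed.

Lemma measurable_rowD (disp : measure_display) (T : measurableType disp)
    (f g : T -> 'rV[R]_d) :
  measurable_fun [set: T] f -> measurable_fun [set: T] g ->
  measurable_fun [set: T] (fun t => f t + g t).
Proof.
move=> /measurable_rowP mf /measurable_rowP mg; apply/measurable_rowP => i.
rewrite (_ : (fun _ => _) = (fun t => f t 0 i + g t 0 i)).
  exact: measurable_funD.
by apply/funext => t; rewrite mxE.
Qed.

Lemma measurable_rowZ (disp : measure_display) (T : measurableType disp)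
    (a : T -> R) (f : T -> 'rV[R]_d) :
  measurable_fun [set: T] a -> measurable_fun [set: T] f ->
  measurable_fun [set: T] (fun t => a t *: f t).
Proof.
move=> ma /measurable_rowP mf; apply/measurable_rowP => i.
rewrite (_ : (fun _ => _) = (fun t => a t * f t 0 i)).
  exact: measurable_funM.
by apply/funext => t; rewrite mxE.
Qed.

Lemma measurable_rowB (disp : measure_display) (T : measurableType disp)
    (f g : T -> 'rV[R]_d) :
  measurable_fun [set: T] f -> measurable_fun [set: T] g ->
  measurable_fun [set: T] (fun t => f t - g t).
Proof.
move=> /measurable_rowP mf /measurable_rowP mg; apply/measurable_rowP => i.
rewrite (_ : (fun _ => _) = (fun t => f t 0 i - g t 0 i)).
  exact: measurable_funB.
by apply/funext => t; rewrite !mxE.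
Qed.

Lemma measurable_sum_ord (disp : measure_display) (T : measurableType disp) n
    (F : 'I_n -> T -> R) : (forall i, measurable_fun [set: T] (F i)) ->
  measurable_fun [set: T] (fun t => \sum_i F i t).
Proof.
move=> mF; rewrite (_ : (fun _ => _) = (fun t => \sum_(i <- index_enum 'I_n) F i t))//.
exact: measurable_sum.
Qed.

Lemma measurable_inner (xi : 'rV[R]_d) : measurable_fun setT (inner xi).
Proof.
apply: measurable_sum_ord => i; apply: measurable_funM => //.
exact: measurable_coord.
Qed.

Lemma measurable_enorm : measurable_fun setT (@enorm R d).
Proof.
apply: measurableT_comp.
  exact: continuous_measurable_fun (@sqrt_continuous R).
apply: measurable_sum_ord => i; apply: measurable_funX.
exact: measurable_coord.
Qed.

Lemma measurable_enorm_sqr : measurable_fun setT (fun x : 'rV[R]_d => (enorm x ^+ 2)%:E).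
Proof. by apply/measurable_EFinP; apply: measurable_funX; exact: measurable_enorm. Qed.

End measurability.

Lemma cvg_le_harmonic (R : realType) (u : nat -> R) (l C : R) :
  (forall n, `|u n - l| <= C / n.+1%:R) -> u n @[n --> \oo] --> l.
Proof.
move=> ul; apply/cvgrPdist_le => e e0.
have : (fun n => C * harmonic n) @ \oo --> C * 0.
  by apply: cvgMr; exact: cvg_harmonic.
rewrite mulr0 => /cvgrPdist_le/(_ _ e0) [N _ HN]; exists N => // n Nn.
have := HN n Nn; rewrite /= sub0r normrN => He.
by rewrite distrC (le_trans (ul n))// (le_trans _ He)// ler_norm.
Qed.

Lemma measurable_forall_ord (disp : measure_display) (T : measurableType disp)
    n (P : 'I_n -> set T) : (forall i, measurable (P i)) ->
  measurable [set x | forall i, P i x].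
Proof.
move=> mP; rewrite (_ : [set x | _] = ~` (\bigcup_i (~` P i))).
  apply: measurableC; apply: countable_bigcupT_measurable => //.
  by move=> i; exact: measurableC.
by rewrite setC_bigcup; apply/seteqP; split => [x Px i _|x Px i];
  [rewrite setCK; exact: Px|have := Px i I; rewrite setCK].
Qed.

Definition lip (R : realType) (d : nat) (C : R) (f : 'rV[R]_d -> R) :=
  forall x y, `|f x - f y| <= C * enorm (x - y).

(** The sigma-algebra is generated by the coordinates, so continuity does not help directly.
    Rounding the argument to the grid of mesh [1 / (n + 1)] makes [f] constant on countably many
    measurable cells, and these roundings of [f] converge pointwise. *)
Lemma lip_measurable (R : realType) (d : nat) (C : R) (f : 'rV[R]_d -> R) :
  lip C f -> measurable_fun setT f.
Proof.
move=> lf.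
pose g n (x : 'rV[R]_d) : 'rV[R]_d :=
  \row_i ((Num.floor (x 0 i * n.+1%:R))%:~R / n.+1%:R).
apply: (@measurable_fun_cvg _ _ _ _ (fun n => f \o g n)) => [n|x _].
- move=> _ Y mY; rewrite setTI.
  pose h (k : {ffun 'I_d -> int}) := f (\row_i ((k i)%:~R / n.+1%:R)).
  rewrite (_ : (f \o g n) @^-1` Y = \bigcup_(k : {ffun 'I_d -> int})
     [set x | Y (h k) /\ forall i, Num.floor (x 0 i * n.+1%:R) = k i]); last first.
    apply/seteqP; split => x /=.
      move=> Yx; exists [ffun i => Num.floor (x 0 i * n.+1%:R)] => //=.
      split; last by move=> i; rewrite ffunE.
      by congr (Y (f _)): Yx; apply/rowP => i; rewrite !mxE ffunE.
    move=> [k _ [Yk xk]]; congr (Y (f _)): Yk.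
    by apply/rowP => i; rewrite !mxE xk.
  apply: countable_bigcupT_measurable => [|k]; first exact: countableP.
  have [Yk|nYk] := pselect (Y (h k)); last first.
    rewrite (_ : [set x | _] = set0); first exact: measurable0.
    by apply/seteqP; split => // x [].
  rewrite (_ : [set x | _] =
      [set x | forall i, ((k i)%:~R <= x 0 i * n.+1%:R < (k i + 1)%:~R)]).
    apply: (@measurable_forall_ord _ _ _ (fun i => [set x : 'rV[R]_d |
      (k i)%:~R <= x 0 i * n.+1%:R < (k i + 1)%:~R])) => i.
    rewrite (_ : [set x | _] = (fun x : 'rV[R]_d => x 0 i * n.+1%:R) @^-1`
        `[(k i)%:~R, (k i + 1)%:~R[%classic).
      rewrite -[X in measurable X]setTI; apply: measurable_funM => //.
      exact: measurable_coord.
    by apply/seteqP; split => x /=; rewrite in_itv.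
  apply/seteqP; split => x /=.
    by move=> [_ kx] i; rewrite -floor_eq kx.
  by move=> kx; split => // i; apply/eqP; rewrite floor_eq.
- apply: (@cvg_le_harmonic _ _ _ (`|C| * d%:R)) => n /=.
  rewrite (le_trans (lf _ _))//.
  rewrite -mulrA (@le_trans _ _ (`|C| * enorm (g n x - x)))//.
    by apply: ler_wpM2r; [exact: enorm_ge0|exact: ler_norm].
  rewrite ler_wpM2l//; apply: le_enorm_coord => i; rewrite !mxE.
  have n0 : 0 < n.+1%:R :> R by [].
  rewrite -(ler_pM2r n0) mulVf ?gt_eqF// -[X in _ * X](gtr0_norm n0) -normrM.
  rewrite mulrBl divfK ?gt_eqF// distrC.
  have /andP[a b] := floor_itv (x 0 i * n.+1%:R).
  by rewrite ger0_norm ?subr_ge0// lerBlDr addrC -intrD1 ltW.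
Qed.

(** * Monotone drift and implicit Euler scheme *)

Section power_function.
Variable R : realType.
Implicit Types (a b r x y : R).

Lemma powR_mono (q a b : R) : 0 <= q -> 0 <= a -> a <= b -> a `^ q <= b `^ q.
Proof.
move=> q0 a0 ab; apply: ge0_ler_powR => //; rewrite nnegrE//.
exact: le_trans a0 ab.
Qed.

Lemma powRS (q a : R) : 0 < q -> 0 <= a -> a `^ (q + 1) = a `^ q * a.
Proof.
move=> q0 a0; rewrite powRD ?powRr1//.
by apply/implyP => /eqP q1; exfalso; lra.
Qed.

(** Mean value theorem for the power [q + 1]: its derivative stays bounded near 0 even if [q < 1],
    where [a^q] alone is not Lipschitz. The two lemmas below recover differences of [q]-th powers,
    tempered by a factor [a] or [b]. *)
Lemma powR_sub_le (q a b : R) : 0 < q -> 0 <= b -> b <= a ->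
  a `^ (q + 1) - b `^ (q + 1) <= (q + 1) * a `^ q * (a - b).
Proof.
move=> q0 b0 ba; have a0 := le_trans b0 ba.
have [->|bn0] := eqVneq b 0.
  rewrite powR0 ?gt_eqF ?addr_gt0// !subr0 powRS// -mulrA.
  by rewrite ler_peMl ?mulr_ge0 ?powR_ge0//; lra.
have {b0} b0 : 0 < b by rewrite lt_neqAle eq_sym bn0.
have [->|anb] := eqVneq a b; first by rewrite !subrr mulr0.
have {ba} ba : b < a by rewrite lt_neqAle eq_sym anb.
have dp x : b <= x -> is_derive x 1 (@powR R ^~ (q + 1)) ((q + 1) * x `^ (q + 1 - 1)).
  by move=> bx; apply: is_derive1_powR; exact: lt_le_trans bx.
have [||c] := @MVT R (@powR R ^~ (q + 1))
  (fun x => (q + 1) * x `^ (q + 1 - 1)) b a ba.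
- by move=> x; rewrite in_itv/= => /andP[bc _]; apply: dp; exact: ltW.
- apply: derivable_within_continuous => x; rewrite in_itv/= => /andP[bx _].
  exact: (@ex_derive _ _ _ _ _ _ _ (dp x bx)).
rewrite in_itv/= => /andP[bc ca] ->; rewrite addrK.
rewrite ler_wpM2r ?subr_ge0 ?(ltW ba)// ler_wpM2l ?addr_ge0 ?(ltW q0)//.
by apply: powR_mono; rewrite ?ltW// (lt_trans b0 bc).
Qed.

Lemma powR_sub_mul (q a b : R) : 0 < q -> 0 <= b -> b <= a ->
  (a `^ q - b `^ q) * b <= (q + 1) * a `^ q * (a - b).
Proof.
move=> q0 b0 ba; have a0 := le_trans b0 ba.
apply: le_trans (powR_sub_le q0 b0 ba).
rewrite !powRS// mulrBl lerD2r ler_wpM2l ?powR_ge0//.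
Qed.

Lemma powR_sub_mulr (q a b : R) : 0 < q -> 0 <= b -> b <= a ->
  (a `^ q - b `^ q) * a <= (q + 1) * a `^ q * (a - b).
Proof.
move=> q0 b0 ba; have a0 := le_trans b0 ba.
apply: le_trans (powR_sub_le q0 b0 ba).
by rewrite !powRS// mulrBl lerD2l lerN2 ler_wpM2l ?powR_ge0.
Qed.

End power_function.

Section drift.
Variables (R : realType) (d : nat).
Implicit Types x y : 'rV[R]_d.

(* Every scaled drift is [A^q x] with [A] close to, and above, [|x|]. *)
Lemma power_field_lip (q K A A' : R) x y : 0 < q ->
  enorm x <= A -> A <= K -> enorm y <= A' -> A' <= K ->
  enorm (A `^ q *: x - A' `^ q *: y) <=
    K `^ q * (enorm (x - y) + (q + 1) * `|A - A'|).
Proof.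
move=> q0 xA AK yA' A'K.
have A0 : 0 <= A by exact: le_trans (enorm_ge0 x) xA.
have A'0 : 0 <= A' by exact: le_trans (enorm_ge0 y) yA'.
rewrite (_ : _ - _ = A `^ q *: (x - y) + (A `^ q - A' `^ q) *: y); last first.
  by rewrite scalerBr scalerBl addrA subrK.
rewrite (le_trans (ler_enormD _ _))// !enormZ ger0_norm ?powR_ge0// mulrDr.
apply: lerD; first by rewrite ler_wpM2r//; apply: powR_mono => //; exact: ltW.
have [AA'|/ltW AA'] := leP A A'.
  rewrite !ler0_norm ?subr_le0 ?powR_mono ?(ltW q0)// !opprB.
  apply: (@le_trans _ _ ((A' `^ q - A `^ q) * A')).
    by rewrite ler_wpM2l// subr_ge0 powR_mono// (ltW q0).
  apply: (le_trans (powR_sub_mulr q0 A0 AA')).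
  rewrite (mulrC (q + 1)) mulrA ler_wpM2r ?subr_ge0//.
  by rewrite ler_wpM2r ?addr_ge0 ?(ltW q0)// powR_mono ?(ltW q0).
rewrite !ger0_norm ?subr_ge0 ?powR_mono ?(ltW q0)//.
apply: (@le_trans _ _ ((A `^ q - A' `^ q) * A')).
  by rewrite ler_wpM2l// subr_ge0 powR_mono// (ltW q0).
apply: (le_trans (powR_sub_mul q0 A'0 AA')).
rewrite (mulrC (q + 1)) mulrA ler_wpM2r ?subr_ge0//.
by rewrite ler_wpM2r ?addr_ge0 ?(ltW q0)// powR_mono ?(ltW q0).
Qed.

Variables (kap ell q : R).
Hypotheses (kap0 : 0 <= kap) (ell0 : 0 <= ell) (q0 : 0 < q).

(** One family for the three limits: [kap = 1 / 2] in cases (a) and (b), where rescaling by [sqrt t]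
    adds a linear term, and [kap = 0] in case (c); [ell = 0] in case (a), [ell = - lambda] and
    [q = gamma - 1] otherwise. *)
Definition bbar y : 'rV[R]_d := - (kap + ell * enorm y `^ q) *: y.

Lemma enorm_bbar y : enorm (bbar y) = (kap + ell * enorm y `^ q) * enorm y.
Proof.
by rewrite /bbar enormZ normrN ger0_norm// addr_ge0 ?mulr_ge0 ?powR_ge0.
Qed.

Lemma bbar_bound (K : R) y : enorm y <= K ->
  enorm (bbar y) <= (kap + ell * K `^ q) * K.
Proof.
move=> yK; rewrite enorm_bbar ler_pM ?addr_ge0 ?mulr_ge0 ?powR_ge0//.
by rewrite lerD2l ler_wpM2l//; apply: powR_mono => //; exact: ltW.
Qed.

Lemma bbar_lip (K : R) x y : enorm x <= K -> enorm y <= K ->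
  enorm (bbar x - bbar y) <= (kap + ell * K `^ q * (q + 2)) * enorm (x - y).
Proof.
move=> xK yK.
rewrite (_ : bbar x - bbar y = - (kap *: (x - y)) -
    (ell *: (enorm x `^ q *: x - enorm y `^ q *: y))); last first.
  apply/rowP => i; rewrite !mxE; ring.
rewrite (le_trans (ler_enormB _ _))// enormN !enormZ !ger0_norm//.
rewrite mulrDl lerD2l -!mulrA ler_wpM2l//.
apply: (le_trans (power_field_lip q0 (lexx _) xK (lexx _) yK)).
rewrite ler_wpM2l ?powR_ge0//.
have q1 : 0 <= q + 1 by rewrite addr_ge0 ?ltW.
by have := ler_wpM2l q1 (ler_dist_enorm x y); lra.
Qed.

(** With [X], [Y], [D] the norms of [x], [y], [x - y], twice the inner product equals [(X^q + Y^q)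
    D^2 + (X^q - Y^q) (X^2 - Y^2)]. The last product is nonnegative, and the larger of [X] and [Y]
    is at least [D / 2]. *)
Lemma power_monotone x y :
  2^-1 * (2^-1 * enorm (x - y)) `^ q * enorm (x - y) ^+ 2 <=
  inner (x - y) (enorm x `^ q *: x - enorm y `^ q *: y).
Proof.
have E2 : enorm (x - y) ^+ 2 = enorm x ^+ 2 + enorm y ^+ 2 - 2 * inner x y.
  by rewrite !enorm_sqr !(innerDl, innerDr, innerNl, innerNr) (innerC y x); ring.
set D := enorm (x - y) in E2 *.
rewrite !(innerDl, innerDr, innerNl, innerNr, innerZl, innerZr) (innerC y x).
rewrite -!enorm_sqr.
set X := enorm x; set Y := enorm y; set p := inner x y.
rewrite -/X -/Y -/p in E2.
have X0 : 0 <= X := enorm_ge0 x.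
have Y0 : 0 <= Y := enorm_ge0 y.
have D0 : 0 <= D := enorm_ge0 _.
have DXY : D <= X + Y by exact: ler_enormB.
have -> : X `^ q * X ^+ 2 - Y `^ q * p - (X `^ q * p - Y `^ q * Y ^+ 2) =
  2^-1 * (X `^ q + Y `^ q) * D ^+ 2 +
  2^-1 * ((X `^ q - Y `^ q) * (X ^+ 2 - Y ^+ 2)) by rewrite E2; field.
have H1 : (2^-1 * D) `^ q <= X `^ q + Y `^ q.
  have [XY|/ltW XY] := leP X Y.
    apply: (@le_trans _ _ (Y `^ q)); last by rewrite lerDr powR_ge0.
    by apply: powR_mono; [exact: ltW|lra|lra].
  apply: (@le_trans _ _ (X `^ q)); last by rewrite lerDl powR_ge0.
  by apply: powR_mono; [exact: ltW|lra|lra].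
have H2 : 0 <= (X `^ q - Y `^ q) * (X ^+ 2 - Y ^+ 2).
  have [XY|/ltW XY] := leP X Y.
    by rewrite mulr_le0// subr_le0 ?ler_sqr ?nnegrE// powR_mono ?(ltW q0).
  by rewrite mulr_ge0// subr_ge0 ?ler_sqr ?nnegrE// powR_mono ?(ltW q0).
apply: (@le_trans _ _ (2^-1 * (X `^ q + Y `^ q) * D ^+ 2)); last first.
  by rewrite lerDl mulr_ge0// invr_ge0.
by rewrite ler_wpM2r ?sqr_ge0// ler_wpM2l.
Qed.

(** Multiply by the distance, then use Cauchy-Schwarz and [power_monotone]. The gain that depends on
    the distance is kept because it is the only contraction when [kap = 0]; it fades as the points
    meet. *)
Lemma resolvent_contract (h : R) x y : 0 <= h ->
  enorm (x - y) * (1 + h * (kap + ell * (2^-1 * (2^-1 * enorm (x - y)) `^ q)))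
  <= enorm (x - h *: bbar x - (y - h *: bbar y)).
Proof.
move=> h0; set D := enorm (x - y).
have D0 : 0 <= D := enorm_ge0 _.
have [->|Dn0] := eqVneq D 0; first by rewrite mul0r enorm_ge0.
have {}D0 : 0 < D by rewrite lt_neqAle eq_sym Dn0.
rewrite -(ler_pM2l D0) mulrA -expr2.
rewrite (le_trans _ (inner_enorm _ _))//.
rewrite (_ : _ - (y - _) = (x - y) + (h * kap) *: (x - y) +
  (h * ell) *: (enorm x `^ q *: x - enorm y `^ q *: y)); last first.
  by apply/rowP => i; rewrite !mxE; ring.
rewrite !(innerDr _ _ (x - y)) !(innerZr _ _ (x - y)) -enorm_sqr -/D.
have := power_monotone x y; rewrite -/D => H.
have he : 0 <= h * ell by rewrite mulr_ge0.
have E : D ^+ 2 = inner (x - y) x + inner (x - y) (- y) by rewrite -innerDr -enorm_sqr.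
by have := ler_wpM2l he H; rewrite -E; lra.
Qed.

Lemma resolvent_contract1 (h : R) x y : 0 <= h ->
  enorm (x - y) <= enorm (x - h *: bbar x - (y - h *: bbar y)).
Proof.
move=> h0; apply: le_trans (resolvent_contract x y h0).
by rewrite ler_peMr// lerDl mulr_ge0// addr_ge0// !mulr_ge0.
Qed.

(** The drift is radial, so [y] is sought on the ray of [x]: its length [r] solves [r c(r) = |x|],
    by the intermediate value theorem between [|x| / c(|x|)] and [|x|]. The lower end is positive,
    which keeps the powers differentiable. *)
Lemma resolvent_exists (h : R) x : 0 <= h -> exists y, y - h *: bbar y = x.
Proof.
move=> h0; have [->|xn0] := eqVneq x 0.
  by exists 0; rewrite /bbar !scaler0 subr0.
have X0 : 0 < enorm x by rewrite lt_neqAle eq_sym enorm_eq0 xn0 enorm_ge0.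
set X := enorm x in X0.
pose c r := 1 + h * (kap + ell * r `^ q).
have c1 r : 1 <= c r by rewrite lerDl mulr_ge0// addr_ge0// mulr_ge0// powR_ge0.
have cgt0 r : 0 < c r by apply: lt_le_trans (c1 r).
pose r0 := X / c X.
have r00 : 0 < r0 by rewrite divr_gt0.
have r0X : r0 <= X by rewrite ler_pdivrMr// ler_peMr// ltW.
have [||r rr rX] := @IVT R (fun r => r * c r) r0 X X r0X.
- apply: derivable_within_continuous => r; rewrite in_itv/= => /andP[rr _].
  apply: derivableM; first exact: derivable_id.
  apply: derivableD; first exact: derivable_cst.
  apply: derivableM; first exact: derivable_cst.
  apply: derivableD; first exact: derivable_cst.
  apply: derivableM; first exact: derivable_cst.
  by apply: (@ex_derive _ _ _ _ _ _ _ (is_derive1_powR _ _)); exact: lt_le_trans rr.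
- have -> : X <= Num.max (r0 * c r0) (X * c X).
    by rewrite le_max; apply/orP; right; rewrite ler_peMr// ltW.
  rewrite andbT ge_min; apply/orP; left.
  rewrite {1}/r0 mulrAC ler_pdivrMr// ler_wpM2l ?(ltW X0)//.
  by rewrite /c lerD2l ler_wpM2l// lerD2l ler_wpM2l// powR_mono// ltW.
have r0' : 0 < r by move: rr; rewrite in_itv/= => /andP[rr _]; exact: lt_le_trans rr.
exists ((c r)^-1 *: x).
have E : enorm ((c r)^-1 *: x) = r.
  by rewrite enormZ gtr0_norm ?invr_gt0// -/X -rX mulrC mulfK ?gt_eqF.
rewrite /bbar E scaleNr scalerN opprK !scalerA -scalerDl.
have cr : c r != 0 by rewrite gt_eqF.
by rewrite -{1}(mul1r (c r)^-1) -mulrDl mulfV ?scale1r.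
Qed.

Definition resolvent (h : R) x := xget 0 [set y | y - h *: bbar y = x].

Lemma resolventP (h : R) x : 0 <= h ->
  resolvent h x - h *: bbar (resolvent h x) = x.
Proof. by move=> h0; have [y yx] := resolvent_exists x h0; exact: (@xgetPex _ 0 [set y | y - h *: bbar y = x] (ex_intro _ y yx)). Qed.

Lemma resolvent_lip (h : R) x y : 0 <= h ->
  enorm (resolvent h x - resolvent h y) <= enorm (x - y).
Proof.
by move=> h0; rewrite (le_trans (resolvent_contract1 _ _ h0))// !resolventP.
Qed.

(** From [r^q r >= r - 1]: superlinear damping is traded for linear damping and a constant, so that
    one second-moment bound serves all values of [kap], [ell] and [q]. *)
Lemma resolvent_growth (h : R) x : 0 <= h ->
  (1 + h * (kap + ell)) * enorm (resolvent h x) <= enorm x + h * (kap + ell).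
Proof.
move=> h0; set y := resolvent h x.
have -> : enorm x = (1 + h * (kap + ell * enorm y `^ q)) * enorm y.
  rewrite -(resolventP x h0) -/y /bbar scaleNr scalerN opprK scalerA.
  rewrite -{1}[y]scale1r -scalerDl enormZ ger0_norm//.
  by rewrite addr_ge0// mulr_ge0// addr_ge0// mulr_ge0// powR_ge0.
have Y0 : 0 <= enorm y by [].
have H : ell * enorm y - ell <= ell * (enorm y `^ q * enorm y).
  rewrite -{2}(mulr1 ell) -mulrBr ler_wpM2l//.
  have [y1|/ltW y1] := leP (enorm y) 1.
    by rewrite (@le_trans _ _ 0) ?subr_le0// mulr_ge0 ?powR_ge0.
  rewrite (@le_trans _ _ (enorm y))// ?lerBlDr ?lerDl// ler_peMl//.
  by rewrite -(@powRr0 R (enorm y)) ler_powR// ltW.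
have := ler_wpM2l h0 H.
have : 0 <= h * kap by rewrite mulr_ge0.
nra.
Qed.

Lemma measurable_resolvent (h : R) : 0 <= h -> measurable_fun setT (resolvent h).
Proof.
move=> h0; apply/measurable_rowP => i; apply: (@lip_measurable _ _ 1) => x y.
rewrite mul1r (le_trans _ (resolvent_lip _ _ h0))//.
by rewrite (le_trans _ (coord_enorm _ i))// !mxE.
Qed.

Definition euler (h : nat -> R) (z : nat -> 'rV[R]_d) x : nat -> 'rV[R]_d :=
  fix e k := if k is k'.+1 then resolvent (h k') (e k' + z k') else x.

Lemma eulerS (h : nat -> R) (z : nat -> 'rV[R]_d) x k : euler h z x k.+1 = resolvent (h k) (euler h z x k + z k).
Proof. by []. Qed.

(** The defect is measured with the drift at the new point [y k.+1]. Both sequences are then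
    compared through the map [y - h bbar y], which expands distances, and no Lipschitz constant of
    [bbar] multiplies the defects. *)
Lemma euler_perturbed (h : nat -> R) (z y : nat -> 'rV[R]_d) (e : nat -> R) n :
  (forall k, 0 <= h k) ->
  (forall k, (k < n)%N ->
     enorm (y k.+1 - y k - z k - h k *: bbar (y k.+1)) <= e k) ->
  enorm (y n - euler h z (y 0%N) n) <= \sum_(k < n) e k.
Proof.
move=> h0; elim: n => [|n IH] H.
  by rewrite big_ord0 subrr enorm0.
rewrite big_ord_recr/= (le_trans (resolvent_contract1 _ _ (h0 n)))//.
rewrite resolventP//.
have -> : y n.+1 - h n *: bbar (y n.+1) - (euler h z (y 0) n + z n) =
  (y n - euler h z (y 0) n) + (y n.+1 - y n - z n - h n *: bbar (y n.+1)).
  by apply/rowP => i; rewrite !mxE; ring.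
rewrite (le_trans (ler_enormD _ _))// lerD ?H//.
by apply: IH => k kn; apply: H; exact: ltnW.
Qed.

Lemma euler_contract_exp (h : R) z x y n : 0 <= h ->
  enorm (euler (fun=> h) z x n - euler (fun=> h) z y n) * (1 + h * kap) ^+ n
    <= enorm (x - y).
Proof.
move=> h0; elim: n => [|n IH]; first by rewrite expr0 mulr1.
rewrite (le_trans _ IH)//= exprS mulrA ler_wpM2r ?exprn_ge0 ?addr_ge0 ?mulr_ge0//.
set u := resolvent _ _; set v := resolvent _ _.
have := resolvent_contract u v h0; rewrite !resolventP//.
rewrite opprD addrACA subrr addr0; apply: le_trans.
by rewrite ler_wpM2l// lerD2l ler_wpM2l// lerDl !mulr_ge0.
Qed.

(** While the distance exceeds [a], step [k] divides it by at least [1 + h k c], with [c] the rate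
    at distance [a]; once below [a] it stays there, a step being 1-Lipschitz. A threshold is
    unavoidable for [kap = 0], where the rate vanishes with the distance. *)
Lemma euler_contract_max (h : nat -> R) z x y n (a : R) : (forall k, 0 <= h k) ->
  0 <= a ->
  enorm (euler h z x n - euler h z y n) <= a \/
  enorm (euler h z x n - euler h z y n) *
    (1 + (\sum_(k < n) h k) * (kap + ell * (2^-1 * (2^-1 * a) `^ q)))
    <= enorm (x - y).
Proof.
move=> h0 a0; set c := kap + _.
have c0 : 0 <= c by rewrite addr_ge0// !mulr_ge0 ?powR_ge0 ?invr_ge0.
elim: n => [|n [IH|IH]]; first by right; rewrite big_ord0 mul0r addr0 mulr1.
  left; apply: le_trans IH; rewrite (le_trans (resolvent_lip _ _ (h0 n)))//.
  by rewrite opprD addrACA subrr addr0.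
set u := euler _ _ _ _; set v := euler _ _ _ _.
have [|/ltW uva] := leP (enorm (u - v)) a; first by left.
right; apply: le_trans IH.
have H := resolvent_contract u v (h0 n).
rewrite !resolventP// opprD addrACA subrr addr0 in H.
have cc : c <= kap + ell * (2^-1 * (2^-1 * enorm (u - v)) `^ q).
  rewrite lerD2l ler_wpM2l// ler_wpM2l ?invr_ge0//; apply: powR_mono; first exact: ltW.
    by rewrite mulr_ge0 ?invr_ge0.
  by rewrite ler_wpM2l ?invr_ge0.
rewrite big_ord_recr/=.
have S0 : 0 <= \sum_(k < n) h k by exact: sumr_ge0.
set S := \sum_(k < n) h k in S0 *.
apply: (@le_trans _ _ (enorm (u - v) * (1 + h n * c) * (1 + S * c))).
  rewrite -mulrA ler_wpM2l//.
  have : 0 <= h n * c * (S * c) by rewrite !mulr_ge0.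
  lra.
rewrite ler_wpM2r ?addr_ge0 ?mulr_ge0//; apply: le_trans H.
by rewrite ler_wpM2l// lerD2l ler_wpM2l.
Qed.

End drift.

(** * Laws and chains driven by independent noise *)

Section law.
Variables (R : realType) (d1 d2 : measure_display).
Variables (T1 : measurableType d1) (T2 : measurableType d2).
Variables (f : T1 -> T2) (mf : measurable_fun setT f).

(** The proof of measurability is an argument of the pushforward, so that the structures of measure
    and probability can be attached to it. *)
Definition law (m : {measure set T1 -> \bar R}) & measurable_fun setT f :=
  pushforward m f.

Variable m : {measure set T1 -> \bar R}.

Let law0 : law m mf set0 = 0%E.
Proof. by rewrite /law /pushforward preimage_set0 measure0. Qed.

Let law_ge0 A : (0 <= law m mf A)%E.
Proof. exact: measure_ge0. Qed.

Let law_sigma_additive : semi_sigma_additive (law m mf).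
Proof.
have mpre A : measurable A -> measurable (f @^-1` A).
  by move=> mA; rewrite -[X in measurable X]setTI; exact: mf.
move=> F mF tF mUF; rewrite /law /pushforward preimage_bigcup.
apply: measure_semi_sigma_additive.
- by move=> k; exact: mpre.
- apply/trivIsetP => /= i j _ _ ij; rewrite -preimage_setI.
  by move/trivIsetP : tF => /(_ _ _ _ _ ij) ->//; rewrite preimage_set0.
- by rewrite -preimage_bigcup; exact: mpre.
Qed.

HB.instance Definition _ := isMeasure.Build _ _ _ (law m mf)
  law0 law_ge0 law_sigma_additive.

End law.

Section law_probability.
Variables (R : realType) (d1 d2 : measure_display).
Variables (T1 : measurableType d1) (T2 : measurableType d2).
Variables (f : T1 -> T2) (mf : measurable_fun setT f) (P : probability T1 R).

Let law_setT : law P mf [set: _] = 1%E.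
Proof. by rewrite /law /pushforward preimage_setT; exact: probability_setT. Qed.

HB.instance Definition _ := Measure_isProbability.Build _ _ _ (law P mf) law_setT.

End law_probability.

Section bounded_expectation.
Variables (R : realType) (d1 : measure_display) (T : measurableType d1).
Variable P : probability T R.
Implicit Types (f g : T -> R) (M : R).

Lemma bounded_integrable f M : measurable_fun setT f ->
  (forall x, `|f x| <= M) -> P.-integrable setT (EFin \o f).
Proof.
move=> mf fM; apply: measurable_bounded_integrable => //.
  by rewrite /= probability_setT ltry.
exists M; split; first exact: num_real.
by move=> N MN x _ /=; rewrite (le_trans (fM x))// ltW.
Qed.

Lemma fin_num_prob (A : set T) : measurable A -> P A \is a fin_num.
Proof. by move=> mA; exact: fin_num_measure. Qed.

Lemma Rintegral_EFin f M : measurable_fun setT f -> (forall x, `|f x| <= M) ->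
  (\int[P]_x (f x)%:E)%E = (\int[P]_x f x)%:E.
Proof.
move=> mf fM; rewrite /Rintegral fineK//.
exact: integrable_fin_num (bounded_integrable mf fM).
Qed.

Lemma expect_cst (a : R) : \int[P]_x a = a.
Proof. by rewrite Rintegral_cst//= probability_setT mulr1. Qed.

Lemma expect_le f g M : measurable_fun setT f -> measurable_fun setT g ->
  (forall x, `|f x| <= M) -> (forall x, `|g x| <= M) ->
  (forall x, f x <= g x) -> \int[P]_x f x <= \int[P]_x g x.
Proof.
move=> mf mg fM gM fg; apply: le_Rintegral => //.
- exact: bounded_integrable mf fM.
- exact: bounded_integrable mg gM.
Qed.

Lemma expect_abs_le f M : measurable_fun setT f ->
  (forall x, `|f x| <= M) -> `|\int[P]_x f x| <= M.
Proof.
move=> mf fM; have M0 : 0 <= M by exact: le_trans (normr_ge0 _) (fM point).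
rewrite ler_norml -{1}(expect_cst (- M)) -{2}(expect_cst M).
have fM' x : -M <= f x <= M by rewrite -ler_norml.
apply/andP; split; apply: (@expect_le _ _ M) => // x; rewrite ?normrN ?ger0_norm//.
- by have /andP[] := fM' x.
- by have /andP[] := fM' x.
Qed.

Lemma expectB f g M : measurable_fun setT f -> measurable_fun setT g ->
  (forall x, `|f x| <= M) -> (forall x, `|g x| <= M) ->
  \int[P]_x (f x - g x) = \int[P]_x f x - \int[P]_x g x.
Proof.
move=> mf mg fM gM; apply: RintegralB => //.
- exact: bounded_integrable mf fM.
- exact: bounded_integrable mg gM.
Qed.

Lemma expectD f g M : measurable_fun setT f -> measurable_fun setT g ->
  (forall x, `|f x| <= M) -> (forall x, `|g x| <= M) ->
  \int[P]_x (f x + g x) = \int[P]_x f x + \int[P]_x g x.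
Proof.
move=> mf mg fM gM; apply: RintegralD => //.
- exact: bounded_integrable mf fM.
- exact: bounded_integrable mg gM.
Qed.

Lemma expectZl (a : R) f M : measurable_fun setT f -> (forall x, `|f x| <= M) ->
  \int[P]_x (a * f x) = a * \int[P]_x f x.
Proof.
by move=> mf fM; apply: RintegralZl => //; exact: bounded_integrable mf fM.
Qed.

Lemma expect_sum (I : finType) (F : I -> T -> R) (M : R) :
  (forall i, measurable_fun setT (F i)) -> (forall i x, `|F i x| <= M) ->
  \int[P]_x (\sum_i F i x) = \sum_i \int[P]_x F i x.
Proof.
move=> mF FM; rewrite /Rintegral.
under eq_integral do rewrite -sumEFin.
rewrite integral_sum//; last by move=> i; exact: bounded_integrable (mF i) (FM i).
rewrite sum_fine// => i _.
exact: integrable_fin_num (bounded_integrable (mF i) (FM i)).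
Qed.

Lemma expect_indic (A : set T) : measurable A ->
  \int[P]_x (\1_A x : R) = fine (P A).
Proof. by move=> mA; rewrite /Rintegral integral_indic// setIT. Qed.

Lemma indic_norm_le (A : set T) x : `|\1_A x : R| <= 1.
Proof. by rewrite indicE; case: (x \in A); rewrite ?normr1 ?normr0. Qed.

(** The form in which all splittings into good and bad events are used: [c0] is the error on the
    good event, and each bad event is paid with its own weight [c i], not with a common bound on
    [f - g]. *)
Lemma expect_near f g M n (c0 : R) (c : 'I_n -> R) (A : 'I_n -> set T) :
  measurable_fun setT f -> measurable_fun setT g ->
  (forall x, `|f x| <= M) -> (forall x, `|g x| <= M) ->
  (forall i, measurable (A i)) ->
  (forall x, `|f x - g x| <= c0 + \sum_i c i * \1_(A i) x) ->
  `|\int[P]_x f x - \int[P]_x g x| <= c0 + \sum_i c i * fine (P (A i)).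
Proof.
move=> mf mg fM gM mA fgc.
pose C := \sum_i `|c i|.
have mcA i : measurable_fun setT (fun x => c i * \1_(A i) x).
  by apply: measurable_funM => //; exact: measurable_indic.
have cAC i x : `|c i * \1_(A i) x| <= C.
  rewrite normrM (@le_trans _ _ `|c i|)// ?ler_piMr ?indic_norm_le//.
  by rewrite /C (bigD1 i)//= lerDl sumr_ge0.
have -> : c0 + \sum_i c i * fine (P (A i)) =
    \int[P]_x (c0 + \sum_i c i * \1_(A i) x).
  rewrite (@expectD _ _ (`|c0| + \sum_(i < n) C))//.
  - rewrite expect_cst (expect_sum mcA cAC); congr (_ + _).
    apply: eq_bigr => i _; rewrite (@expectZl _ _ 1) ?expect_indic//.
    by move=> x; exact: indic_norm_le.
  - exact: measurable_sum_ord.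
  - by move=> x; rewrite lerDl sumr_ge0// => i _; rewrite sumr_ge0.
  - move=> x; rewrite (le_trans (ler_norm_sum _ _ _))//.
    rewrite (@le_trans _ _ (\sum_(i < n) C)) ?lerDr//.
    by apply: ler_sum => i _; exact: cAC.
set K := `|c0| + (\sum_(i < n) C) + (M + M).
have M0 : 0 <= M by exact: le_trans (normr_ge0 _) (fM point).
have S0 : 0 <= \sum_(i < n) C by apply: sumr_ge0 => i _; exact: sumr_ge0.
have mS : measurable_fun setT (fun x => c0 + \sum_i c i * \1_(A i) x).
  by apply: measurable_funD => //; exact: measurable_sum_ord.
have bS x : `|c0 + \sum_i c i * \1_(A i) x| <= K.
  rewrite /K (le_trans (ler_normD _ _))// -addrA lerD2l ler_wpDr ?addr_ge0//.
  rewrite (le_trans (ler_norm_sum _ _ _))//.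
  by apply: ler_sum => i _; exact: cAC.
have bfg x : `|f x - g x| <= K.
  rewrite (le_trans (ler_normB _ _))// /K ler_wpDl ?addr_ge0//.
  by rewrite lerD.
have mfg : measurable_fun setT (fun x => f x - g x) by exact: measurable_funB.
rewrite -(expectB mf mg fM gM) ler_norml; apply/andP; split.
  rewrite lerNl -mulN1r -(expectZl _ mfg bfg).
  apply: (@expect_le _ _ K) => //; first exact: measurable_funM.
    by move=> x; rewrite normrM normrN1 mul1r.
  by move=> x; rewrite mulN1r (le_trans _ (fgc x))// -normrN ler_norm.
apply: (@expect_le _ _ K) => // x.
by rewrite (le_trans _ (fgc x))// ler_norm.
Qed.

End bounded_expectation.

Section independence.
Variables (R : realType) (d1 d2 d3 : measure_display).
Variables (T : measurableType d1) (U : measurableType d2) (V : measurableType d3).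
Variable P : probability T R.
Variables (X : T -> U) (Y : T -> V).
Hypotheses (mX : measurable_fun setT X) (mY : measurable_fun setT Y).
Hypothesis XY : forall A B, measurable A -> measurable B ->
  P (X @^-1` A `&` Y @^-1` B) = (P (X @^-1` A) * P (Y @^-1` B))%E.

Lemma ge0_integral_indep (H : U * V -> \bar R) : measurable_fun setT H ->
  (forall p, (0 <= H p)%E) ->
  (\int[P]_w H (X w, Y w) = \int[P]_w \int[P]_w' H (X w, Y w'))%E.
Proof.
move=> mH H0.
have mXY : measurable_fun setT (fun w => (X w, Y w)) by exact: measurable_fun_pair.
have -> : (\int[P]_w H (X w, Y w) = \int[law P mXY]_p H p)%E.
  by rewrite ge0_integral_pushforward.
rewrite (eq_measure_integral (law P mX \x law P mY)%E); last first.
  move=> A mA _; apply/esym; exact: product_measure_unique.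
rewrite fubini_tonelli1// ge0_integral_pushforward//=; last 2 first.
- exact: measurable_fun_fubini_tonelli_F.
- by move=> y _; exact: integral_ge0.
apply: eq_integral => w _; rewrite /fubini_F ge0_integral_pushforward//.
exact: measurable_fun_pair2.
Qed.

Lemma expect_indep (H : U * V -> R) (M : R) : measurable_fun setT H ->
  (forall p, `|H p| <= M) ->
  \int[P]_w H (X w, Y w) = \int[P]_w \int[P]_w' H (X w, Y w').
Proof.
move=> mH HM.
have HM' p : -M <= H p <= M by rewrite -ler_norml.
have M0 : 0 <= M by exact: le_trans (normr_ge0 _) (HM point).
have mXY : measurable_fun setT (fun w => H (X w, Y w)).
  by apply: measurableT_comp => //; exact: measurable_fun_pair.
have mXw w : measurable_fun setT (fun w' => H (X w, Y w')).
  by apply: measurableT_comp => //; exact: measurable_fun_pair.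
(* Adding [M] makes the integrand nonnegative, so that Tonelli's theorem applies; the constant is
   cancelled from both sides at the end. *)
pose G (p : U * V) := (H p + M)%:E.
have G0 p : (0 <= G p)%E.
  by rewrite lee_fin -lerBlDr sub0r; have /andP[] := HM' p.
have mG : measurable_fun setT G.
  by apply/measurable_EFinP; apply: measurable_funD.
have HMM p : `|H p + M| <= M + M.
  by rewrite (le_trans (ler_normD _ _))// (ger0_norm M0) lerD2r.
have inner w : (\int[P]_w' G (X w, Y w') = (\int[P]_w' H (X w, Y w') + M)%:E)%E.
  rewrite (@Rintegral_EFin _ _ _ _ _ (M + M))//; last exact: measurable_funD.
  by rewrite (@expectD _ _ _ _ _ _ M) ?expect_cst// => x; rewrite ger0_norm.
have := ge0_integral_indep mG G0.
under [X in _ = X -> _]eq_integral do rewrite inner.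
have mi : measurable_fun setT (fun w => \int[P]_w' H (X w, Y w')).
  have : measurable_fun setT (fun w => \int[P]_w' G (X w, Y w') - M%:E)%E.
    apply: emeasurable_funB => //.
    apply: (measurableT_comp (f := fun x => \int[P]_w' G (x, Y w'))%E) => //.
    rewrite (_ : (fun _ => _) = fubini_F (law P mY) G).
      exact: measurable_fun_fubini_tonelli_F.
    apply/funext => x; rewrite /fubini_F ge0_integral_pushforward//.
    exact: measurable_fun_pair2.
  rewrite (_ : (fun _ => _) = EFin \o (fun w => \int[P]_w' H (X w, Y w'))).
    by move/measurable_EFinP.
  by apply/funext => w /=; rewrite inner -EFinB addrK.
have bi w : `|\int[P]_w' H (X w, Y w')| <= M by exact: expect_abs_le.
rewrite (@Rintegral_EFin _ _ _ _ _ (M + M))//; last exact: measurable_funD.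
rewrite (@Rintegral_EFin _ _ _ _ _ (M + M))//; last 2 first.
- exact: measurable_funD.
- by move=> w; rewrite (le_trans (ler_normD _ _))// (ger0_norm M0) lerD2r.
have cM : forall x : T, `|M| <= M by move=> _; rewrite ger0_norm.
rewrite (@expectD _ _ _ _ _ _ M)// (@expectD _ _ _ _ _ _ M)// !expect_cst.
by case => /addIr.
Qed.

End independence.

Section chain.
Variables (R : realType) (d : nat) (disp : measure_display).
Variables (Omega : measurableType disp) (P : probability Omega R).
Local Notation V := 'rV[R]_d.
Variable z : nat -> Omega -> V.
Hypothesis mz : forall k, measurable_fun setT (z k).

Definition indep_seq n := forall A : nat -> set V, (forall i, measurable (A i)) ->
  P (\bigcap_(i < n) z i @^-1` A i) = (\prod_(i < n) P (z i @^-1` A i))%E.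

Variables (Phi : nat -> V -> V -> V) (x : V).
Hypothesis mPhi : forall k, measurable_fun setT (fun p : V * V => Phi k p.1 p.2).

Definition chain : nat -> Omega -> V :=
  fix y k w := if k is k'.+1 then Phi k' (y k' w) (z k' w) else x.

Lemma measurable_chain k : measurable_fun setT (chain k).
Proof.
elim: k => [|k IH]; first exact: measurable_cst.
exact: (measurableT_comp (mPhi k) (measurable_fun_pair IH (mz k))).
Qed.

Lemma measurable_preimage (d' : measure_display) (T' : measurableType d')
    (f : Omega -> T') (A : set T') :
  measurable_fun setT f -> measurable A -> measurable (f @^-1` A).
Proof. by move=> mf mA; rewrite -[X in measurable X]setTI; exact: mf. Qed.

(* [chain k] is independent of the future noise: by induction on [k], since the
   pair (chain k, z k) has on every future event the law of a product. *)
Lemma chain_future n k A0 (A : nat -> set V) : indep_seq n -> (k <= n)%N ->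
  measurable A0 -> (forall i, measurable (A i)) ->
  (forall i, (i < k)%N -> A i = setT) ->
  P (chain k @^-1` A0 `&` \bigcap_(i < n) z i @^-1` A i) =
  (P (chain k @^-1` A0) * P (\bigcap_(i < n) z i @^-1` A i))%E.
Proof.
move=> zn; elim: k A0 A => [|k IH] A0 A kn mA0 mA AT.
  have [A0x|nA0x] := pselect (A0 x).
    rewrite (_ : chain 0 @^-1` A0 = setT); last by apply/seteqP; split.
    by rewrite setTI probability_setT mul1e.
  rewrite (_ : chain 0 @^-1` A0 = set0); last by apply/seteqP; split.
  by rewrite set0I measure0 mul0e.
set E := \bigcap_(i < n) z i @^-1` A i.
have mcap (B : nat -> set V) : (forall i, measurable (B i)) ->
    measurable (\bigcap_(i < n) z i @^-1` B i).
  move=> mB; rewrite (_ : \bigcap_(i < n) _ = [set w | forall i : 'I_n, B i (z i w)]).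
    by apply: (measurable_forall_ord (P := fun i : 'I_n => z i @^-1` B i)) => i;
      exact: measurable_preimage.
  by apply/seteqP; split => w Bw i => [|iN]; [exact: (Bw i (ltn_ord i))|exact: (Bw (Ordinal iN))].
have mE : measurable E by exact: mcap.
have mp : measurable_fun setT (fun w => (chain k w, z k w)).
  by apply: measurable_fun_pair => //; exact: measurable_chain.
have PE : P E \is a fin_num by exact: fin_num_prob.
have PE0 : 0 <= fine (P E) by rewrite fine_ge0.
have H (A1 B : set V) : measurable A1 -> measurable B ->
    P (chain k @^-1` A1 `&` (z k @^-1` B `&` E)) =
    (P (chain k @^-1` A1) * (P (z k @^-1` B) * P E))%E.
  move=> mA1 mB; pose A' i := if i == k then B else A i.
  have mA' i : measurable (A' i) by rewrite /A'; case: ifP.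
  have -> : z k @^-1` B `&` E = \bigcap_(i < n) z i @^-1` A' i.
    apply/seteqP; split => [w [Bw Ew] i /= iN|w Aw].
      by rewrite /A'; case: eqP => [->//|_]; exact: Ew.
    split; first by have := Aw k kn; rewrite /A' eqxx.
    move=> i /= iN; have := Aw i iN; rewrite /A'; case: eqP => // -> _.
    by rewrite AT.
  rewrite IH ?(ltnW kn)//; last first.
    by move=> i ik; rewrite /A' ltn_eqF// AT// ltnS ltnW.
  congr (_ * _)%E; rewrite !zn// (bigD1 (Ordinal kn))//= [in RHS](bigD1 (Ordinal kn))//=.
  rewrite /A' eqxx AT ?ltnS// preimage_setT probability_setT mul1e.
  congr (_ * _)%E; apply: eq_bigr => i /negP ik; case: eqP => // ik'.
  by exfalso; apply: ik; apply/eqP/val_inj.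
pose pr w := (chain k w, z k w).
(* As functions of [C] both sides are finite measures: the law of the pair under [P] restricted to
   [E], and its law under [P] scaled by [P E]. They agree on rectangles. *)
have key C : measurable C -> P (pr @^-1` C `&` E) = (P E * P (pr @^-1` C))%E.
  have -> : (P E * P (pr @^-1` C))%E = mscale (NngNum PE0) (law P mp) C.
    by rewrite /mscale /= fineK.
  rewrite -[LHS]/(law (mrestr P mE) mp C); move: C.
  apply: (measure_unique
    [set A `*` B | A in measurable & B in measurable] (fun=> setT)).
  - exact: measurable_prod_measurableType.
  - move=> _ _ [B1 mB1 [C1 mC1 <-]] [B2 mB2 [C2 mC2 <-]].
    exists (B1 `&` B2); first exact: measurableI.
    by exists (C1 `&` C2); [exact: measurableI|rewrite setXI].
  - by move=> _; exists setT => //; exists setT => //; rewrite setXTT.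
  - by rewrite bigcup_const//; exists 0%N.
  - move=> _ [B mB [C mC <-]].
    have H1 := H B C mB mC.
    have H2 : P (chain k @^-1` B `&` z k @^-1` C) =
        (P (chain k @^-1` B) * P (z k @^-1` C))%E.
      pose A' i := if i == k then C else setT.
      have mA' i : measurable (A' i) by rewrite /A'; case: ifP.
      have E' : \bigcap_(i < n) z i @^-1` A' i = z k @^-1` C.
        apply/seteqP; split => [w Aw|w Cw i /= iN].
          by have := Aw k kn; rewrite /A' eqxx.
        by rewrite /A'; case: eqP => [->//|_].
      rewrite -E' IH ?(ltnW kn)// => i ik.
      by rewrite /A' ltn_eqF.
    rewrite -[RHS]/((fine (P E))%:E * law P mp (B `*` C))%E fineK//.
    rewrite -[LHS]/(P ((chain k @^-1` B `&` z k @^-1` C) `&` E)) -setIA H1.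
    by rewrite muleA -H2 muleC.
  - move=> _; rewrite -[X in (X < _)%E]/(P (setT `&` E)) setTI.
    by rewrite (le_lt_trans (probability_le1 _ _))// ltry.
have := key ((fun p => Phi k p.1 p.2) @^-1` A0).
rewrite muleC; apply.
by rewrite -[X in measurable X]setTI; exact: mPhi.
Qed.

Lemma chain_indep n k A B : indep_seq n -> (k < n)%N ->
  measurable A -> measurable B ->
  P (chain k @^-1` A `&` z k @^-1` B) =
  (P (chain k @^-1` A) * P (z k @^-1` B))%E.
Proof.
move=> zn kn mA mB; pose A' i := if i == k then B else setT.
have mA' i : measurable (A' i) by rewrite /A'; case: ifP.
have E' : \bigcap_(i < n) z i @^-1` A' i = z k @^-1` B.
  apply/seteqP; split => [w Aw|w Cw i /= iN].
    by have := Aw k kn; rewrite /A' eqxx.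
  by rewrite /A'; case: eqP => [->//|_].
rewrite -E'; apply: chain_future => //; first exact: ltnW.
by move=> i ik; rewrite /A' ltn_eqF.
Qed.

Lemma chain_second_moment n (a b : nat -> R) : indep_seq n ->
  (forall k, 0 <= a k) -> (forall k, 0 <= b k) ->
  (forall k y, (k < n)%N ->
    (\int[P]_w (enorm (Phi k y (z k w)) ^+ 2)%:E <= (a k * enorm y ^+ 2 + b k)%:E)%E) ->
  forall (M : nat -> R), enorm x ^+ 2 <= M 0%N ->
  (forall k, (k < n)%N -> a k * M k + b k <= M k.+1) ->
  forall k, (k <= n)%N -> (\int[P]_w (enorm (chain k w) ^+ 2)%:E <= (M k)%:E)%E.
Proof.
move=> zn a0 b0 Hk M M0 MS; elim=> [|k IH] kn.
  by rewrite /= integral_cst//= probability_setT mule1 lee_fin.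
have mc := measurable_chain k.
have msq (T' : measurableType _) (f : T' -> V) : measurable_fun setT f ->
    measurable_fun setT (fun w => (enorm (f w) ^+ 2)%:E).
  move=> mf; apply/measurable_EFinP; apply: measurable_funX.
  exact: (measurableT_comp (@measurable_enorm R d)).
rewrite (@ge0_integral_indep _ _ _ _ _ _ _ P (chain k) (z k) mc (mz k) _
  (fun p => (enorm (Phi k p.1 p.2) ^+ 2)%:E)); last 3 first.
- by move=> A B mA mB; exact: (chain_indep zn kn mA mB).
- exact: msq.
- by move=> p; rewrite lee_fin sqr_ge0.
apply: (@le_trans _ _ (\int[P]_w ((a k)%:E * (enorm (chain k w) ^+ 2)%:E + (b k)%:E))%E).
  apply: ge0_le_integral => //.
  - by move=> w _; apply: integral_ge0 => w' _; rewrite lee_fin sqr_ge0.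
  - have mlaw := @measurable_fun_fubini_tonelli_F _ _ _ _ R
      (law P (mz k)) (fun p : V * V => (enorm (Phi k p.1 p.2) ^+ 2)%:E).
    have /(measurableT_comp)/(_ mc) : measurable_fun setT
        (fubini_F (law P (mz k)) (fun p : V * V => (enorm (Phi k p.1 p.2) ^+ 2)%:E)).
      by apply: mlaw; [exact: msq|by move=> p; rewrite lee_fin sqr_ge0].
    congr measurable_fun; apply/funext => w.
    rewrite /= /fubini_F ge0_integral_pushforward//; last first.
      by move=> y _; rewrite lee_fin sqr_ge0.
    apply: msq; apply: (measurable_fun_pair2 (f := fun p : V * V => Phi k p.1 p.2)).
    exact: mPhi.
  - apply: emeasurable_funD => //; apply: emeasurable_funM => //; exact: msq.
  - by move=> w _; rewrite -EFinM -EFinD; exact: Hk.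
rewrite ge0_integralD//; last 3 first.
- by move=> w _; rewrite mule_ge0// lee_fin ?sqr_ge0.
- by apply: emeasurable_funM => //; exact: msq.
- by move=> w _; rewrite lee_fin.
rewrite ge0_integralZl_EFin//; last 2 first.
- by move=> w _; rewrite lee_fin sqr_ge0.
- exact: msq.
rewrite integral_cst//= probability_setT mule1.
apply: (@le_trans _ _ ((a k)%:E * (M k)%:E + (b k)%:E)%E).
  by apply: leeD => //; apply: lee_wpmul2l; rewrite ?lee_fin// IH// ltnW.
by rewrite -EFinM -EFinD lee_fin MS.
Qed.

End chain.

Section centered.
Variables (R : realType) (d : nat).
Local Notation V := 'rV[R]_d.

Definition centered (s : R) (mu : probability V R) :=
  (\int[mu]_z (enorm z ^+ 2)%:E <= s%:E)%E /\
  forall i, (\int[mu]_z (z 0 i)%:E = 0)%E.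

Lemma enorm_sqr_integrable_prob (s : R) (mu : probability V R) :
  (\int[mu]_z (enorm z ^+ 2)%:E <= s%:E)%E -> mu.-integrable setT (fun z => (enorm z ^+ 2)%:E).
Proof.
move=> mus; apply/integrableP; split.
  exact: measurable_enorm_sqr.
under eq_integral do rewrite gee0_abs ?lee_fin ?sqr_ge0//.
by rewrite (le_lt_trans mus)// ltry.
Qed.

Lemma centered_shift s mu y : centered s mu ->
  (\int[mu]_z (enorm (y + z) ^+ 2)%:E <= (enorm y ^+ 2 + s)%:E)%E.
Proof.
move=> [mus mu0].
have i2 := enorm_sqr_integrable_prob mus.
have icst (a : R) : mu.-integrable setT (fun=> a%:E).
  by apply: (@bounded_integrable _ _ _ mu (fun=> a) `|a|).
have i1 i : mu.-integrable setT (fun z : V => (z 0 i)%:E).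
  apply: (le_integrable _ _ _ (integrableD _ (icst 1) i2)) => //.
    by apply/measurable_EFinP; exact: measurable_coord.
  move=> z _ /=; rewrite lee_fin; have := coord_enorm z i => H.
  rewrite (le_trans H)// ger0_norm ?addr_ge0 ?sqr_ge0//.
  have := enorm_ge0 z; nra.
have is_ : mu.-integrable setT (fun z : V => \sum_i ((2 * y 0 i) * z 0 i)%:E)%E.
  apply: integrable_sum => // i _.
  rewrite (_ : (fun _ => _) = (fun z : V => (2 * y 0 i)%:E * (z 0 i)%:E)%E).
    exact: integrableZl.
  by apply/funext => z; rewrite EFinM.
rewrite (_ : (fun _ => _) = ((fun z => (enorm y ^+ 2)%:E) \+
   (fun z : V => \sum_i ((2 * y 0 i) * z 0 i)%:E)) \+ (fun z => (enorm z ^+ 2)%:E))%E.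
  rewrite integralD//; last exact: integrableD.
  rewrite integralD// integral_cst//= probability_setT mule1 integral_sum//; last first.
    move=> i; rewrite (_ : (fun _ => _) = (fun z : V => (2 * y 0 i)%:E * (z 0 i)%:E)%E).
      exact: integrableZl.
    by apply/funext => z; rewrite EFinM.
  rewrite big1 ?adde0 ?EFinD ?leeD2l// => i _.
  by under eq_integral do rewrite EFinM; rewrite integralZl// mu0 mule0.
apply/funext => z /=; rewrite sumEFin -!EFinD; congr EFin.
rewrite !enorm_sqr !innerDl !innerDr (innerC z y).
have -> : \sum_i 2 * y 0 i * z 0 i = 2 * inner y z.
  by rewrite /inner mulr_sumr; apply: eq_bigr => i _; rewrite mulrA.
ring.
Qed.

End centered.

(** * Quantitative central limit theorem *)

Section trigonometric_bounds.
Variable R : realType.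
Implicit Types x y : R.

Lemma sin_le_abs x : `|sin x| <= `|x|.
Proof.
wlog x0 : x / 0 < x.
  move=> H; have [x0|x0|x0] := ltgtP 0 x; last by rewrite -x0 sin0.
    exact: H.
  by have := H (- x); rewrite oppr_gt0 sinN !normrN; exact.
have [|c _] := @MVT R (@sin R) (@cos R) 0 x x0.
  by apply: continuous_subspaceT; exact: continuous_sin.
rewrite sin0 !subr0 => ->; rewrite normrM ler_piMl//.
exact: cos_max.
Qed.

Lemma cos_half x : 1 - cos x = 2 * sin (x / 2) ^+ 2.
Proof.
have -> : cos x = cos (x / 2 + x / 2) by congr cos; field.
by rewrite cosD -!expr2; have := cos2Dsin2 (x / 2); lra.
Qed.

Lemma cos_ub x : 1 - cos x <= x ^+ 2 / 2.
Proof.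
rewrite cos_half; have := sin_le_abs (x / 2) => H.
have {}H : sin (x / 2) ^+ 2 <= (x / 2) ^+ 2.
  by rewrite -[leLHS]real_normK ?num_real// -[leRHS]real_normK ?num_real// ler_sqr ?nnegrE.
have E : (x / 2) ^+ 2 = x ^+ 2 / 4 by field.
by rewrite E in H; lra.
Qed.

(** A quadratic bound, valid for all [x], is what second moments can absorb when [x] is replaced by
    [L sin (x / L)]. *)
Lemma subr_sin_le x : `|x - sin x| <= x ^+ 2.
Proof.
wlog x0 : x / 0 < x.
  move=> H; have [x0|x0|<-] := ltgtP 0 x; last by rewrite sin0 subrr normr0 sqr_ge0.
    exact: H.
  by have := H (- x); rewrite oppr_gt0 sinN -opprD normrN sqrrN; exact.
have [|c c0] := @MVT R (fun y => y - sin y) (fun y => 1 - cos y) 0 x x0.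
  apply: continuous_subspaceT => y; apply: cvgB; first exact: cvg_id.
  exact: continuous_sin.
rewrite sin0 !subr0 => ->.
have c1 : 0 <= 1 - cos c by rewrite subr_ge0 cos_le1.
rewrite ger0_norm ?mulr_ge0 ?(ltW x0)// expr2 ler_wpM2r ?(ltW x0)//.
move: c0; rewrite in_itv/= => /andP[c0 cx].
have := cos_ub c; have := cos_geN1 c => H1 H2.
have [x2|x2] := leP x 2; nra.
Qed.

Lemma cos_lb x : x ^+ 2 / 2 - (1 - cos x) <= `|x| ^+ 3.
Proof.
rewrite cos_half; set v := x / 2; have -> : x = 2 * v by rewrite /v; field.
have H1 := subr_sin_le v; have H2 := sin_le_abs v.
have -> : (2 * v) ^+ 2 / 2 - 2 * sin v ^+ 2 = 2 * ((v - sin v) * (v + sin v)) by field.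
have H3 : (v - sin v) * (v + sin v) <= v ^+ 2 * (2 * `|v|).
  rewrite (le_trans (ler_norm _))// normrM ler_pM//.
  by rewrite (le_trans (ler_normD _ _))//; lra.
rewrite normrM normr_nat exprMn.
have : 0 <= `|v| ^+ 3 by rewrite exprn_ge0.
have E : v ^+ 2 * (2 * `|v|) = 2 * `|v| ^+ 3.
  by rewrite -[v ^+ 2]real_normK ?num_real//; ring.
by rewrite E in H3; lra.
Qed.

(** The right-hand side is [|e^(ix) - e^(iy)|^2], the squared chord that [fejer_bound] controls. *)
Lemma sin_dist x y : (sin x - sin y) ^+ 2 <= 2 - 2 * cos (x - y).
Proof.
rewrite cosB; have := cos2Dsin2 x; have := cos2Dsin2 y.
have := sqr_ge0 (cos x - cos y); nra.
Qed.

Lemma sin_period x (p : nat) : sin (x + p%:R * (2 * pi)) = sin x.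
Proof.
elim: p => [|p IH]; first by rewrite mul0r addr0.
rewrite -{}IH -natr1 mulrDl mul1r addrA.
have -> : 2 * pi = pi *+ 2 :> R by rewrite mulr_natl.
exact: sinD2pi.
Qed.

(* Lagrange's identity, the kernel of a telescoping sum. *)
Lemma sum_cos_arith (a b : R) n :
  2 * sin (b / 2) * (\sum_(j < n) cos (a + j%:R * b)) =
  sin (a - b / 2 + n%:R * b) - sin (a - b / 2).
Proof.
elim: n => [|n IH]; first by rewrite big_ord0 mulr0 mul0r addr0 subrr.
rewrite big_ord_recr/= mulrDr IH.
set t := a + n%:R * b.
have -> : a - b / 2 + n%:R * b = t - b / 2 by rewrite /t; ring.
have -> : a - b / 2 + n.+1%:R * b = t + b / 2.
  by rewrite -natr1 /t; field.
by rewrite [sin (t - _)]sinB [sin (t + _)]sinD; ring.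
Qed.

End trigonometric_bounds.

(** * Fejer kernel and trigonometric approximation *)

Section fejer.
Variables (R : realType) (n : nat).
Hypothesis n0 : (0 < n)%N.
Implicit Types u : R.
Let N : R := n%:R.

Let N0 : 0 < N.
Proof. by rewrite ltr0n. Qed.

Definition cos_sum m u : R := \sum_(k < m) cos (k%:R * u).
Definition sin_sum m u : R := \sum_(k < m) sin (k%:R * u).
Definition node (j : 'I_n) : R := j%:R * (2 * pi / N).

(** The Fejer kernel [|sum_(k < n) e^(iku)|^2 / n^2], normalised so that its translates to the [n]
    equidistant nodes sum to 1. *)
Definition fejer u : R := N ^- 2 * (cos_sum n u ^+ 2 + sin_sum n u ^+ 2).

Lemma fejer_ge0 u : 0 <= fejer u.
Proof. by rewrite mulr_ge0 ?invr_ge0 ?exprn_ge0 ?addr_ge0 ?sqr_ge0 ?ltW. Qed.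

(** Real and imaginary parts of [(e^(iu) - 1) sum_(k < m) e^(iku) = e^(imu) - 1]. *)
Lemma sums_telescope m u :
  (cos u - 1) * cos_sum m u - sin u * sin_sum m u = cos (m%:R * u) - 1 /\
  sin u * cos_sum m u + (cos u - 1) * sin_sum m u = sin (m%:R * u).
Proof.
elim: m => [|m [IH1 IH2]].
  by rewrite /cos_sum /sin_sum !big_ord0 mul0r cos0 sin0; split; ring.
have E : m.+1%:R * u = m%:R * u + u by rewrite -natr1; ring.
rewrite /cos_sum /sin_sum !big_ord_recr/= -/(cos_sum m u) -/(sin_sum m u).
by rewrite E cosD sinD; split; [move: IH1|move: IH2] => IH; lra.
Qed.

Lemma fejer_bound u : fejer u * (2 - 2 * cos u) <= 4 / N ^+ 2.
Proof.
have [H1 H2] := sums_telescope n u.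
have H3 := cos2Dsin2 u; have H4 := cos2Dsin2 (n%:R * u).
have E : (cos_sum n u ^+ 2 + sin_sum n u ^+ 2) * (2 - 2 * cos u) =
    2 - 2 * cos (n%:R * u).
  have -> : 2 - 2 * cos (n%:R * u) =
      (cos (n%:R * u) - 1) ^+ 2 + sin (n%:R * u) ^+ 2 by move: H4; lra.
  have -> : 2 - 2 * cos u = (cos u - 1) ^+ 2 + sin u ^+ 2 by move: H3; lra.
  by rewrite -H1 -H2; ring.
rewrite /fejer -mulrA E mulrC ler_wpM2r ?invr_ge0 ?exprn_ge0 ?(ltW N0)//.
by have := cos_geN1 (n%:R * u); lra.
Qed.

Lemma fejer_cos u :
  fejer u = \sum_(p : 'I_n * 'I_n) N ^- 2 * cos ((p.1%:R - p.2%:R) * u).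
Proof.
rewrite /fejer -mulr_sumr; congr (_ * _).
rewrite -(pair_bigA _ (fun k l : 'I_n => cos ((k%:R - l%:R) * u)))/=.
rewrite !expr2 /cos_sum /sin_sum !big_distrlr -big_split/=.
apply: eq_bigr => k _; rewrite -big_split/=; apply: eq_bigr => l _.
by rewrite mulrBl cosB.
Qed.

(** Exchanging the two indices changes the sign. This is the hypothesis under which [prod_sum_cos]
    expands a product over the coordinates into cosines alone. *)
Lemma sum_sin_diff u : \sum_(p : 'I_n * 'I_n) sin ((p.1%:R - p.2%:R) * u) = 0.
Proof.
rewrite -(pair_bigA _ (fun k l : 'I_n => sin ((k%:R - l%:R) * u)))/=.
set S := LHS; suff : S = - S by move=> H; lra.
rewrite {1}/S exchange_big/= -sumrN; apply: eq_bigr => k _.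
rewrite -sumrN; apply: eq_bigr => l _.
by rewrite -sinN -mulNr opprB.
Qed.

(** Orthogonality of roots of unity: for a frequency [0 < p < n] Lagrange's sum runs over full
    periods and vanishes, and [sin (b / 2)] is nonzero because [0 < p / n < 1]. *)
Lemma sum_cos_nodes u (k l : 'I_n) : k != l ->
  \sum_j cos ((k%:R - l%:R) * (u - node j)) = 0.
Proof.
wlog kl : k l / (l < k)%N.
  move=> H kl; have := kl; rewrite -(inj_eq val_inj) neq_ltn => /orP[lk|lk].
    rewrite -[RHS](H l k lk) 1?eq_sym//; apply: eq_bigr => j _.
    by rewrite -[in LHS]cosN -mulNr opprB.
  exact: H.
move=> _; pose p := (k - l)%N.
have Ep : k%:R - l%:R = p%:R :> R by rewrite natrB// ltnW.
have p0 : (0 < p)%N by rewrite subn_gt0.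
have pn : (p < n)%N by rewrite (leq_ltn_trans (leq_subr _ _)).
pose b : R := p%:R * (2 * pi / N).
have H := sum_cos_arith (- (p%:R * u)) b n.
have sb : 0 < sin (b / 2).
  apply: sin_gt0_pi; have := pi_gt0 R => pi0.
  have -> : b / 2 = p%:R / N * pi by rewrite /b; field; rewrite gt_eqF.
  rewrite mulr_gt0 ?divr_gt0 ?ltr0n//= gtr_pMl// ltr_pdivrMr// mul1r.
  by rewrite ltr_nat.
rewrite (_ : n%:R * b = p%:R * (2 * pi)) in H; last first.
  by rewrite /b -/N; field; rewrite gt_eqF.
rewrite sin_period subrr in H.
have s2 : 2 * sin (b / 2) != 0 by rewrite mulf_neq0 ?gt_eqF.
have S0 : \sum_(j < n) cos (- (p%:R * u) + j%:R * b) = 0.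
  by apply/eqP; move/eqP: H; rewrite mulf_eq0 (negbTE s2).
rewrite -[RHS]S0; apply: eq_bigr => j _; rewrite Ep -[LHS]cosN; congr cos.
by rewrite /node /b; ring.
Qed.

Lemma fejer_sum u : \sum_j fejer (u - node j) = 1.
Proof.
under eq_bigr do rewrite fejer_cos.
rewrite exchange_big/=.
rewrite (eq_bigr (fun p : 'I_n * 'I_n => if p.1 == p.2 then N^-1 else 0)); last first.
  move=> [k l] _ /=; case: eqP => [->|/eqP kl].
    under eq_bigr do rewrite subrr mul0r cos0 mulr1.
    by rewrite sumr_const card_ord -mulr_natl -/N; field; rewrite gt_eqF.
  by rewrite -mulr_sumr sum_cos_nodes// mulr0.
rewrite -(pair_bigA _ (fun k l : 'I_n => if k == l then N^-1 else 0))/=.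
rewrite (eq_bigr (fun=> N^-1)); last first.
  by move=> i _; rewrite -big_mkcond/= (big_pred1 i)// => j; rewrite eq_sym.
by rewrite sumr_const card_ord -mulr_natl mulfV// gt_eqF.
Qed.

(** Young's inequality [v <= s / 2 + v^2 / (2 s)] for the chord [v]: the first term is summed
    against the partition of unity, the second against [fejer_bound]. The parameter [s] is left free
    for later balancing. *)
Lemma fejer_dist_sum u (s : R) : 0 < s ->
  \sum_j fejer (u - node j) * `|sin u - sin (node j)| <= (s + 4 / N / s) / 2.
Proof.
move=> s0.
apply: (@le_trans _ _ (\sum_j (fejer (u - node j) * (s / 2) +
    (4 / N ^+ 2) * (s^-1 / 2)))).
  apply: ler_sum => j _.
  set v := `|_|.
  have v0 : 0 <= v by exact: normr_ge0.
  have H1 : v ^+ 2 <= 2 - 2 * cos (u - node j).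
    by rewrite real_normK ?num_real// sin_dist.
  have H2 : v <= s / 2 + v ^+ 2 * (s^-1 / 2).
    rewrite -(ler_pM2r s0).
    have -> : (s / 2 + v ^+ 2 * (s^-1 / 2)) * s = (s ^+ 2 + v ^+ 2) / 2.
      by field; rewrite gt_eqF.
    by have := sqr_ge0 (s - v); nra.
  have F0 := fejer_ge0 (u - node j).
  apply: (le_trans (ler_wpM2l F0 H2)).
  rewrite mulrDr lerD2l [leLHS]mulrA; apply: ler_wpM2r.
    by rewrite mulr_ge0 ?invr_ge0 ?(ltW s0).
  apply: le_trans (fejer_bound (u - node j)).
  by rewrite ler_wpM2l.
rewrite big_split/= -mulr_suml fejer_sum sumr_const card_ord -mulr_natl -/N.
apply: le_of_eq; field.
by rewrite !gt_eqF.
Qed.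

End fejer.

Section product_of_cosines.
Variable R : realType.
Local Open Scope complex_scope.

Let e (t : R) : R[i] := cos t +i* sin t.

Let eD s t : e (s + t) = e s * e t.
Proof. by rewrite /e cosD sinD; apply/eqP; rewrite eq_complex/= !eqxx addrC eqxx. Qed.

Let e_sum (I : finType) (F : I -> R) : e (\sum_i F i) = \prod_i e (F i).
Proof.
apply: (big_morph e eD).
by rewrite /e cos0 sin0.
Qed.

Let Re_sum (I : finType) (F : I -> R[i]) :
  complex.Re (\sum_i F i) = \sum_i complex.Re (F i).
Proof. by apply: (big_morph (@complex.Re R)) => // -[a b] [c d]. Qed.

(** Expand the product of the sums of [e^(i F i j)]. Each factor is real because its sines cancel,
    and the real part of the expansion is a sum of cosines. *)
Lemma prod_sum_cos (I J : finType) (F : I -> J -> R) :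
  (forall i, \sum_j sin (F i j) = 0) ->
  \prod_i \sum_j cos (F i j) =
  \sum_(f : {ffun I -> J}) cos (\sum_i F i (f i)).
Proof.
move=> F0.
have H : \prod_i \sum_j e (F i j) = \sum_(f : {ffun I -> J}) e (\sum_i F i (f i)).
  by rewrite bigA_distr_bigA; apply: eq_bigr => f _; rewrite e_sum.
have E i : \sum_j e (F i j) = (\sum_j cos (F i j))%:C.
  have H1 : forall s : seq J, \sum_(j <- s) e (F i j) =
      (\sum_(j <- s) cos (F i j)) +i* (\sum_(j <- s) sin (F i j)).
    elim=> [|j s IH]; first by rewrite !big_nil.
    by rewrite !big_cons IH /e; apply/eqP; rewrite eq_complex/= !eqxx.
  by rewrite H1 F0.
have := congr1 (@complex.Re R) H; rewrite Re_sum/=.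
by under eq_bigr do rewrite E; rewrite -(rmorph_prod (real_complex R)).
Qed.

End product_of_cosines.

Section clt.
Variables (R : realType) (d : nat).
Local Notation V := 'rV[R]_d.
Implicit Types (mu : probability V R) (f g : V -> R) (C : R).

Definition blip C f := (forall x, `|f x| <= 1) /\ lip C f.

Lemma blip_measurable C f : blip C f -> measurable_fun setT f.
Proof. by move=> [_ /lip_measurable]. Qed.

Lemma sum_diff_le (I : finType) mu1 mu2 (g : I -> V -> R) (c : I -> R) (eps : R) :
  (forall j, measurable_fun setT (g j)) -> (forall j x, `|g j x| <= 1) ->
  (forall j, `|\int[mu1]_x g j x - \int[mu2]_x g j x| <= eps) ->
  `|\int[mu1]_x (\sum_j c j * g j x) - \int[mu2]_x (\sum_j c j * g j x)| <=
    (\sum_j `|c j|) * eps.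
Proof.
move=> mg g1 ge.
have mcg j : measurable_fun setT (fun x => c j * g j x) by exact: measurable_funM.
have bcg j x : `|c j * g j x| <= \sum_j `|c j|.
  rewrite normrM (@le_trans _ _ `|c j|)// ?ler_piMr//.
  by rewrite (bigD1 j)//= lerDl sumr_ge0.
rewrite !(expect_sum _ mcg bcg) -sumrB mulr_suml (le_trans (ler_norm_sum _ _ _))//.
apply: ler_sum => j _.
by rewrite !(expectZl _ _ (mg j) (g1 j)) -mulrBr normrM ler_wpM2l.
Qed.

Variables (L : R) (n : nat).
Hypotheses (L0 : 0 < L) (n0 : (0 < n)%N).

(* The torus [L sin(x / L)] turns [f] into a periodic Lipschitz function. *)
Let wrap (x : V) : V := \row_i (L * sin (x 0 i / L)).

Let grid (j : {ffun 'I_d -> 'I_n}) : V := \row_i (L * sin (node R (j i))).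

Let weight (j : {ffun 'I_d -> 'I_n}) (x : V) : R :=
  \prod_i fejer n (x 0 i / L - node R (j i)).

Let weight_ge0 j x : 0 <= weight j x.
Proof. by apply: prodr_ge0 => i _; exact: fejer_ge0. Qed.

Let weight_sum x : \sum_j weight j x = 1.
Proof.
rewrite -(bigA_distr_bigA (fun i j => fejer n (x 0 i / L - node R j))).
by apply: big1 => i _; exact: fejer_sum.
Qed.

Let weight_dist x i (s : R) : 0 < s ->
  \sum_j weight j x * `|sin (x 0 i / L) - sin (node R (j i))| <=
  (s + 4 / n%:R / s) / 2.
Proof.
move=> s0; apply: le_trans (fejer_dist_sum n0 (x 0 i / L) s0).
pose F i' (j : 'I_n) := fejer n (x 0 i' / L - node R j) *
  (if i' == i then `|sin (x 0 i / L) - sin (node R j)| else 1).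
have -> : \sum_j weight j x * `|sin (x 0 i / L) - sin (node R (j i))| =
    \sum_(j : {ffun 'I_d -> 'I_n}) \prod_i' F i' (j i').
  apply: eq_bigr => j _; rewrite /F big_split/=; congr (_ * _).
  rewrite (bigD1 i)//= eqxx big1 ?mulr1// => i' /negbTE ->//.
rewrite -bigA_distr_bigA (bigD1 i)//= [X in _ * X]big1; last first.
  move=> i' /negbTE ii'; rewrite -[RHS](@fejer_sum R n n0 (x 0 i' / L)).
  by apply: eq_bigr => j _; rewrite /F ii' mulr1.
by rewrite mulr1; apply: ler_sum => j _; rewrite /F eqxx.
Qed.

(** The weights sum to 1, so the error is an average of [f (wrap x) - f (grid j)]; the Lipschitz
    bound splits it over coordinates, where the one-dimensional estimate applies. *)
Let smooth_approx C f x (s : R) : 0 < s -> 0 <= C -> blip C f ->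
  `|f (wrap x) - \sum_j f (grid j) * weight j x| <=
    C * L * d%:R * ((s + 4 / n%:R / s) / 2).
Proof.
move=> s0 C0 [f1 fC].
rewrite -[f (wrap x)]mulr1 -{1}(weight_sum x) mulr_sumr -sumrB.
rewrite (le_trans (ler_norm_sum _ _ _))//.
apply: (@le_trans _ _ (\sum_j \sum_i
    (C * L) * (weight j x * `|sin (x 0 i / L) - sin (node R (j i))|))).
  apply: ler_sum => j _; rewrite -mulrBl normrM (ger0_norm (weight_ge0 _ _)).
  rewrite -mulr_sumr -mulr_sumr mulrCA mulrC ler_wpM2l ?weight_ge0//.
  rewrite (le_trans (fC _ _))// -mulrA ler_wpM2l//.
  rewrite (le_trans (enorm_le_sum _))// mulr_sumr ler_sum// => i _.
  by rewrite !mxE -mulrBr normrM gtr0_norm.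
rewrite exchange_big/=; set e := (s + _) / 2.
apply: (@le_trans _ _ (\sum_(i < d) C * L * e)); last first.
  by rewrite sumr_const card_ord -[leLHS]mulr_natl mulrCA mulrA.
apply: ler_sum => i _; rewrite -mulr_sumr.
by apply: ler_wpM2l; [rewrite mulr_ge0// ltW|exact: weight_dist].
Qed.

(** There are [n^d] grid points and [n^(2d)] frequency pairs, each with a coefficient of size at
    most [n^(-2d)]: the total weight is [n^d]. *)
Let trig_diff mu1 mu2 f (eps : R) : (forall x, `|f x| <= 1) ->
  (forall (th : V) (a : R), (forall i, `|th 0 i| <= n%:R / L) ->
    `|\int[mu1]_x cos (inner th x - a) - \int[mu2]_x cos (inner th x - a)| <= eps) ->
  `|\int[mu1]_x (\sum_j f (grid j) * weight j x) -
    \int[mu2]_x (\sum_j f (grid j) * weight j x)| <= n%:R ^+ d * eps.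
Proof.
move=> f1 He.
pose th (k : {ffun 'I_d -> 'I_n * 'I_n}) : V :=
  \row_i (((k i).1%:R - (k i).2%:R) / L).
pose a (j : {ffun 'I_d -> 'I_n}) (k : {ffun 'I_d -> 'I_n * 'I_n}) : R :=
  \sum_i ((k i).1%:R - (k i).2%:R) * node R (j i).
have weightE j x : weight j x =
    n%:R ^- 2 ^+ d * \sum_k cos (inner (th k) x - a j k).
  rewrite /weight.
  under eq_bigr do rewrite fejer_cos -mulr_sumr.
  rewrite big_split/= prodr_const card_ord; congr (_ * _).
  rewrite prod_sum_cos; last by move=> i; exact: sum_sin_diff.
  apply: eq_bigr => k _; congr cos.
  rewrite /inner /a -sumrB; apply: eq_bigr => i _.
  by rewrite mxE mulrBr mulrAC -mulrA.
pose T := ({ffun 'I_d -> 'I_n} * {ffun 'I_d -> 'I_n * 'I_n})%type.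
pose g (q : T) x := cos (inner (th q.2) x - a q.1 q.2).
pose c (q : T) := n%:R ^- 2 ^+ d * f (grid q.1).
have E x : \sum_j f (grid j) * weight j x = \sum_p c p * g p x.
  rewrite -(pair_bigA _ (fun j k => (n%:R ^- 2 ^+ d * f (grid j)) *
    cos (inner (th k) x - a j k)))/=.
  by apply: eq_bigr => j _; rewrite weightE -mulr_sumr; ring.
under eq_Rintegral do rewrite E.
under [X in _ - X]eq_Rintegral do rewrite E.
apply: (@le_trans _ _ ((\sum_p `|c p|) * eps)).
  apply: sum_diff_le.
  - move=> p; apply: (measurableT_comp (f := @cos R)).
      by apply: continuous_measurable_fun; exact: continuous_cos.
    by apply: measurable_funB => //; exact: measurable_inner.
  - by move=> p x; exact: cos_max.
  - move=> p; apply: He => i; rewrite mxE normrM normfV (gtr0_norm L0).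
    rewrite ler_pM2r ?invr_gt0//.
    set k := p.2 i; rewrite ler_norml lerNl opprB !lerBlDr.
    by apply/andP; split; apply: (@le_trans _ _ n%:R);
      rewrite ?ler_nat ?(ltnW (ltn_ord _)) ?lerDl ?ler0n.
have eps0 : 0 <= eps.
  apply: le_trans (He 0 0 _); first exact: normr_ge0.
  by move=> i; rewrite mxE normr0 divr_ge0// ltW.
rewrite ler_wpM2r//.
apply: (@le_trans _ _ (\sum_(p : T) n%:R ^- 2 ^+ d)).
  apply: ler_sum => p _; rewrite normrM ger0_norm.
    by rewrite ler_piMr// exprn_ge0// invr_ge0 exprn_ge0.
  by rewrite exprn_ge0// invr_ge0 exprn_ge0.
rewrite sumr_const card_prod !card_ffun card_prod !card_ord.
rewrite -[leLHS]mulr_natl natrM !natrX natrM.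
have N0 : (n%:R : R) != 0 by rewrite pnatr_eq0 -lt0n.
rewrite -mulrA -exprMn -expr2 mulfV ?expr1n ?mulr1//.
by rewrite expf_neq0.
Qed.

(** The three errors are: replacing [x] by [L sin (x / L)], which costs [|x|^2 / L] and hence a
    second moment; smoothing with the Fejer weights; and the comparison of a finite trigonometric
    sum under both laws. *)
Lemma expect_charfun_close C mu1 mu2 f (s1 s2 s eps : R) : 0 < s -> 0 <= C ->
  blip C f -> centered s1 mu1 -> centered s2 mu2 ->
  (forall (th : V) (a : R), (forall i, `|th 0 i| <= n%:R / L) ->
    `|\int[mu1]_x cos (inner th x - a) - \int[mu2]_x cos (inner th x - a)| <= eps) ->
  `|\int[mu1]_x f x - \int[mu2]_x f x| <=
    C / L * (s1 + s2) + C * L * d%:R * (s + 4 / n%:R / s) + n%:R ^+ d * eps.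
Proof.
move=> s0 C0 fC c1 c2 He; have [f1 fl] := fC.
have mf := blip_measurable fC.
have mw : measurable_fun setT wrap.
  apply/measurable_rowP => i; rewrite (_ : (fun _ => _) =
      fun t : V => L * sin (t 0 i * L^-1)); last by apply/funext => t; rewrite mxE.
  apply: measurable_funM => //; apply: (measurableT_comp (f := @sin R)).
    by apply: continuous_measurable_fun; exact: continuous_sin.
  by apply: measurable_funM => //; exact: measurable_coord.
have mfw : measurable_fun setT (fun x => f (wrap x)) by exact: measurableT_comp.
have wr mu si : centered si mu ->
    `|\int[mu]_x f x - \int[mu]_x f (wrap x)| <= C / L * si.
  move=> [m2 _].
  rewrite -(expectB _ mf mfw f1) => [|x]; last exact: f1.
  have mfB : measurable_fun setT (fun x => f x - f (wrap x)) by exact: measurable_funB.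
  have bfB x : `|f x - f (wrap x)| <= 2.
    by rewrite (le_trans (ler_normB _ _))//; have := f1 x; have := f1 (wrap x); lra.
  have ifB := bounded_integrable mu mfB bfB.
  rewrite -lee_fin EFin_normr_Rintegral//.
  rewrite (le_trans (le_abse_integral _ _ _))//; first exact/measurable_EFinP.
  rewrite EFinM (@le_trans _ _ ((C / L)%:E * \int[mu]_z (enorm z ^+ 2)%:E)%E)//; last first.
    by rewrite lee_wpmul2l// lee_fin divr_ge0// ltW.
  have m2m : measurable_fun setT (fun z : V => (enorm z ^+ 2)%:E).
    exact: measurable_enorm_sqr.
  rewrite -ge0_integralZl_EFin//; last 2 first.
  - by move=> x _; rewrite lee_fin sqr_ge0.
  - by rewrite divr_ge0// ltW.
  apply: ge0_le_integral => //.
  - by apply/measurable_EFinP; exact: measurableT_comp.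
  - exact: emeasurable_funM.
  - move=> x _ /=; rewrite lee_fin (le_trans (fl _ _))// -mulrA ler_wpM2l//.
    rewrite (le_trans (enorm_le_sum _))//.
    rewrite enorm_sqr /inner mulr_sumr.
    apply: ler_sum => i _; rewrite !mxE -expr2.
    have := ler_wpM2l (ltW L0) (subr_sin_le (x 0 i / L)).
    have -> : L * (x 0 i / L) ^+ 2 = L^-1 * x 0 i ^+ 2 by field; rewrite gt_eqF.
    apply: le_trans; rewrite -[X in _ <= X * _](gtr0_norm L0) -normrM mulrBr.
    by rewrite mulrCA mulfV ?mulr1 ?gt_eqF.
pose G x := \sum_j f (grid j) * weight j x.
have mweight j : measurable_fun setT (weight j).
  rewrite /weight (_ : (fun _ => _) = fun x : V =>
    \prod_(i <- index_enum 'I_d) fejer n (x 0 i / L - node R (j i)))//.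
  apply: measurable_prod => i _.
  rewrite (_ : (fun _ => _) = fun x : V => \sum_(p : 'I_n * 'I_n) n%:R ^- 2 *
      cos ((p.1%:R - p.2%:R) * (x 0 i / L - node R (j i)))); last first.
    by apply/funext => x; rewrite fejer_cos.
  apply: measurable_sum => p; apply: measurable_funM => //.
  apply: (measurableT_comp (f := @cos R)).
    by apply: continuous_measurable_fun; exact: continuous_cos.
  apply: measurable_funM => //; apply: measurable_funB => //.
  by apply: measurable_funM => //; exact: measurable_coord.
have mG : measurable_fun setT G.
  by apply: measurable_sum => j; exact: measurable_funM.
have bG x : `|G x| <= 1.
  rewrite (le_trans (ler_norm_sum _ _ _))// -[leRHS](weight_sum x).
  apply: ler_sum => j _; rewrite normrM (ger0_norm (weight_ge0 j x)).
  by rewrite ler_piMl.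
have H2 mu : `|\int[mu]_x f (wrap x) - \int[mu]_x G x| <=
    C * L * d%:R * ((s + 4 / n%:R / s) / 2).
  have := @expect_near _ _ _ mu (fun x => f (wrap x)) G 1 0
    (C * L * d%:R * ((s + 4 / n%:R / s) / 2)) (fun=> 0) (fun=> set0).
  rewrite !big_ord0 addr0; apply => // x.
  rewrite big_ord0 addr0; exact: smooth_approx.
have H3 := trig_diff f1 He; rewrite -/G in H3.
have W1 := wr mu1 s1 c1; have W2 := wr mu2 s2 c2.
have G1 := H2 mu1; have G2 := H2 mu2.
set A1 := (\int[mu1]_x f x) in W1 *; set A2 := (\int[mu2]_x f x) in W2 *.
set B1 := (\int[mu1]_x f (wrap x)) in W1 G1; set B2 := (\int[mu2]_x f (wrap x)) in W2 G2.
set D1 := (\int[mu1]_x G x) in G1 H3; set D2 := (\int[mu2]_x G x) in G2 H3.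
move: W1 W2 G1 G2 H3; rewrite !ler_norml.
move=> /andP[? ?] /andP[? ?] /andP[? ?] /andP[? ?] /andP[? ?].
by apply/andP; split; lra.
Qed.

End clt.

Section characteristic_function.
Variables (R : realType) (d : nat).
Local Notation V := 'rV[R]_d.

Lemma charfunE (disp : measure_display) (T : measurableType disp)
    (m : {measure set T -> \bar R}) (X : T -> V) xi :
  charfun m X xi = Complex (\int[m]_w cos (inner xi (X w)))
                           (\int[m]_w sin (inner xi (X w))).
Proof.
rewrite /charfun /cintegral; congr Complex; apply: eq_Rintegral => w _;
  by rewrite /cexp/= expR0; ring.
Qed.

Lemma measurable_cosl (xi : V) : measurable_fun setT (fun x : V => cos (inner xi x)).
Proof.
apply: (measurableT_comp (f := @cos R)).
  by apply: continuous_measurable_fun; exact: continuous_cos.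
exact: measurable_inner.
Qed.

Lemma measurable_sinl (xi : V) : measurable_fun setT (fun x : V => sin (inner xi x)).
Proof.
apply: (measurableT_comp (f := @sin R)).
  by apply: continuous_measurable_fun; exact: continuous_sin.
exact: measurable_inner.
Qed.

Lemma expect_cosB (mu : probability V R) xi a :
  \int[mu]_x sin (inner xi x) = 0 ->
  \int[mu]_x cos (inner xi x - a) = \int[mu]_x cos (inner xi x) * cos a.
Proof.
move=> s0.
have mc := measurable_cosl xi; have ms := measurable_sinl xi.
have bc (x : V) : `|cos (inner xi x)| <= 1 by exact: cos_max.
have bs (x : V) : `|sin (inner xi x)| <= 1 by exact: sin_max.
under eq_Rintegral do rewrite cosB.
rewrite (@expectD _ _ _ mu _ _ 1).
- under eq_Rintegral do rewrite mulrC.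
  rewrite (expectZl _ _ mc bc) mulrC.
  under [X in _ + X]eq_Rintegral do rewrite mulrC.
  by rewrite (expectZl _ _ ms bs) s0 mulr0 addr0.
- exact: measurable_funM.
- exact: measurable_funM.
- by move=> x; rewrite normrM mulr_ile1// cos_max.
- by move=> x; rewrite normrM mulr_ile1// ?sin_max.
Qed.

(** Characteristic function [exp (- A)], written with real integrals; the vanishing sine part
    expresses the symmetry of the noise. *)
Definition symmetric_charfun (A : V -> R) (mu : probability V R) := forall xi,
  \int[mu]_x cos (inner xi x) = expR (- A xi) /\ \int[mu]_x sin (inner xi x) = 0.

Lemma inner_delta (u : R) (i : 'I_d) (x : V) :
  inner (u *: delta_mx 0 i) x = u * x 0 i.
Proof.
rewrite innerZl /inner (bigD1 i)//= mxE !eqxx mul1r big1 ?addr0// => j ji.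
by rewrite mxE (negbTE ji) andbF mul0r.
Qed.

(** Second moments: [2 n^2 (1 - cos (z / n))] tends to [z^2] and its mean is bounded through [A], so
    Fatou's lemma applies. Means: [n sin (z / n)] has mean 0, tends to [z] and is dominated by
    [1 + |z|^2]. *)
Lemma symmetric_charfun_centered (A : V -> R) (mu : probability V R) (s : R) :
  symmetric_charfun A mu ->
  (forall u (i : 'I_d), A (u *: delta_mx 0 i) <= u ^+ 2 * s / 2) ->
  centered (d%:R * s) mu.
Proof.
move=> muA As.
have m1 (i : 'I_d) : measurable_fun setT (fun z : V => z 0 i) by exact: measurable_coord.
have m2 (i : 'I_d) : measurable_fun setT (fun z : V => (z 0 i ^+ 2)%:E).
  by apply/measurable_EFinP; exact: measurable_funX.
have second i : (\int[mu]_z (z 0 i ^+ 2)%:E <= s%:E)%E.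
  pose N n : R := n.+1%:R.
  pose g n (z : V) := N n ^+ 2 * (2 * (1 - cos ((N n)^-1 * z 0 i))).
  have g0 n z : 0 <= g n z.
    by rewrite mulr_ge0 ?sqr_ge0// mulr_ge0// subr_ge0 cos_le1.
  have mc n : measurable_fun setT (fun z : V => cos ((N n)^-1 * z 0 i)).
    apply: (measurableT_comp (f := @cos R)).
      by apply: continuous_measurable_fun; exact: continuous_cos.
    exact: measurable_funM.
  have mg n : measurable_fun setT (g n).
    by do 2 apply: measurable_funM => //; exact: measurable_funB.
  have bc n (z : V) : `|cos ((N n)^-1 * z 0 i)| <= 1 by exact: cos_max.
  have b1 n (z : V) : `|1 - cos ((N n)^-1 * z 0 i)| <= 2.
    by rewrite (le_trans (ler_normB _ _))// normr1 (_ : 2 = 1 + 1)// lerD2l.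
  have ig n : (\int[mu]_z (g n z)%:E <= s%:E)%E.
    rewrite (@Rintegral_EFin _ _ _ _ _ (N n ^+ 2 * (2 * 2)))//; last first.
      move=> z; rewrite ger0_norm ?g0// /g ler_wpM2l ?sqr_ge0// ler_wpM2l//.
      by have := cos_geN1 ((N n)^-1 * z 0 i); lra.
    have m1c : measurable_fun setT (fun z : V => 1 - cos ((N n)^-1 * z 0 i)).
      exact: measurable_funB.
    rewrite lee_fin /g (@expectZl _ _ _ _ _ _ 4); last 2 first.
    - exact: measurable_funM.
    - by move=> z; rewrite normrM normr_nat; have := b1 n z; lra.
    rewrite (expectZl _ _ m1c (b1 n)).
    rewrite (@expectB _ _ _ _ _ _ 1) ?expect_cst//; last by move=> ?; rewrite normr1.
    have := (muA ((N n)^-1 *: delta_mx 0 i)).1.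
    under eq_Rintegral do rewrite inner_delta.
    move=> ->; have := As (N n)^-1 i; set a := A _ => Aa.
    have E : 1 - expR (- a) <= a by have := expR_ge1Dx (- a); lra.
    have n0 : 0 < N n ^+ 2 by rewrite exprn_gt0// ltr0n.
    have H : 2 * (1 - expR (- a)) <= (N n)^-1 ^+ 2 * s.
      by move: Aa; set b := _ * s; lra.
    have := ler_wpM2l (ltW n0) H.
    rewrite [X in _ <= X -> _]mulrA -exprMn mulfV ?expr1n ?mul1r//.
    by rewrite gt_eqF// ltr0n.
  have cg z : (g n z)%:E @[n --> \oo] --> (z 0 i ^+ 2)%:E.
    apply/cvg_EFin; first by near=> n.
    apply: (@cvg_le_harmonic _ _ _ (2 * `|z 0 i| ^+ 3)) => n /=.
    rewrite /g; set y := _^-1 * _.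
    have n0 : 0 < N n by rewrite ltr0n.
    have -> : z 0 i = N n * y by rewrite /y mulrA mulfV ?mul1r// gt_eqF.
    have H1 := cos_ub y; have H2 := cos_lb y.
    rewrite ler0_norm; last first.
      by rewrite subr_le0 exprMn ler_wpM2l ?sqr_ge0//; lra.
    rewrite normrM (gtr0_norm n0) opprB.
    rewrite -(ler_pM2r n0) divfK ?gt_eqF//.
    have n2 : 0 < N n ^+ 3 by rewrite exprn_gt0.
    by have := ler_wpM2l (ltW n2) H2; rewrite -/(N n); nra.
  have mge n : measurable_fun setT (fun z => (g n z)%:E) by exact/measurable_EFinP.
  have ge0 n z : setT z -> (0 <= (g n z)%:E)%E by rewrite lee_fin.
  rewrite (eq_integral (fun z => limn_einf (fun n => (g n z)%:E))); last first.
    by move=> z _; have [-> _] := cvg_limn_einf_sup (cg z).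
  apply: (le_trans (fatou mu measurableT mge ge0)).
  rewrite limn_einf_lim; apply: lime_le; first exact: is_cvg_einfs.
  near=> n; apply: ereal_inf_le; exists (\int[mu]_z (g n z)%:E)%E; last exact: ig.
  by exists n => /=.
have sum2 : (\int[mu]_z (enorm z ^+ 2)%:E <= (d%:R * s)%:E)%E.
  under eq_integral do (rewrite enorm_sqr /inner -sumEFin; under eq_bigr do rewrite -expr2).
  rewrite ge0_integral_sum//; last by move=> i z _; rewrite lee_fin sqr_ge0.
  apply: (@le_trans _ _ (\sum_(i < d) s%:E)%E); first exact: lee_sum.
  by rewrite sumEFin sumr_const card_ord mulr_natl.
split=> // i.
have i2 := enorm_sqr_integrable_prob sum2.
have icst (a : R) : mu.-integrable setT (fun=> a%:E).
  by apply: (@bounded_integrable _ _ _ mu (fun=> a) `|a|).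
have idom := integrableD measurableT (icst 1) i2.
pose g n (z : V) := n.+1%:R * sin (n.+1%:R^-1 * z 0 i) : R.
have ms n : measurable_fun setT (fun z : V => sin (n.+1%:R^-1 * z 0 i)).
  apply: (measurableT_comp (f := @sin R)).
    by apply: continuous_measurable_fun; exact: continuous_sin.
  exact: measurable_funM.
have mg n : measurable_fun setT (g n) by exact: measurable_funM.
have bg n (z : V) : `|g n z| <= `|z 0 i|.
  rewrite normrM normr_nat (@le_trans _ _ (n.+1%:R * `|n.+1%:R^-1 * z 0 i|))//.
    by rewrite ler_wpM2l// sin_le_abs.
  by rewrite normrM normfV normr_nat mulrA mulfV ?mul1r.
have ig n : (\int[mu]_z (g n z)%:E = 0)%E.
  rewrite (@Rintegral_EFin _ _ _ _ _ n.+1%:R)//; last first.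
    by move=> z; rewrite normrM normr_nat ler_piMr// sin_max.
  rewrite (@expectZl _ _ _ _ _ _ 1)//; last by move=> z; exact: sin_max.
  have := (muA (n.+1%:R^-1 *: delta_mx 0 i)).2.
  under eq_Rintegral do rewrite inner_delta.
  by move=> ->; rewrite mulr0.
have [|||||_ _] := @dominated_convergence _ _ _ mu setT measurableT
  (fun n z => (g n z)%:E) (fun z => (z 0 i)%:E)
  (fun z => 1 + (enorm z ^+ 2)%:E)%E.
- by move=> n; exact/measurable_EFinP.
- exact/measurable_EFinP.
- apply: aeW => z _; apply/cvg_EFin; first by near=> n.
  apply: (@cvg_le_harmonic _ _ _ (`|z 0 i| ^+ 2)) => n /=.
  rewrite /g; set y := _^-1 * _.
  have n0 : 0 < n.+1%:R :> R by [].
  have -> : z 0 i = n.+1%:R * y by rewrite /y mulrA mulfV ?mul1r// gt_eqF.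
  rewrite -mulrBr normrM (gtr0_norm n0) distrC normrM (gtr0_norm n0).
  rewrite -(ler_pM2r n0) divfK ?gt_eqF//.
  have := subr_sin_le y; rewrite -[y ^+ 2]real_normK ?num_real// => H.
  have n2 : 0 < (n.+1%:R : R) ^+ 2 by rewrite exprn_gt0.
  by have := ler_wpM2l (ltW n2) H; nra.
- exact: idom.
- apply: aeW => z n _ /=; rewrite -EFinD lee_fin (le_trans (bg n z))//.
  by have := coord_enorm z i; have := enorm_ge0 z; nra.
rewrite (_ : (fun n => _) = cst 0%E); last by apply/funext => n; exact: ig.
by move/(cvg_unique (@ereal_hausdorff R)) => /(_ _ (cvg_cst _)) ->.
Unshelve. all: by end_near.
Qed.

(** Taken with [n^2] nodes and [s = 1 / n], so that the smoothing error [s + 4 / (n^2 s)] becomes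
    [5 / n]. As the sine parts vanish, the phase [a] only contributes a factor [cos a], and
    [exp (- x)] is 1-Lipschitz on [x >= 0]. *)
Lemma charfun_expect_close (C : R) (A1 A2 : V -> R) mu1 mu2 f (s L : R) (n : nat) (eps : R) :
  (0 < n)%N -> 0 < L -> 0 <= C -> blip C f ->
  symmetric_charfun A1 mu1 -> symmetric_charfun A2 mu2 ->
  centered s mu1 -> centered s mu2 ->
  (forall xi, 0 <= A1 xi) -> (forall xi, 0 <= A2 xi) ->
  (forall xi : V, (forall i, `|xi 0 i| <= (n ^ 2)%:R / L) -> `|A1 xi - A2 xi| <= eps) ->
  `|\int[mu1]_x f x - \int[mu2]_x f x| <=
    2 * C * s / L + 5 * C * L * d%:R / n%:R + n%:R ^+ (2 * d) * eps.
Proof.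
move=> n0 L0 C0 fC c1 c2 m1 m2 A1_ge0 A2_ge0 Aeps.
have N0 : 0 < n%:R :> R by rewrite ltr0n.
have n20 : (0 < n ^ 2)%N by rewrite expn_gt0 n0.
have := @expect_charfun_close R d L (n ^ 2)%N L0 n20 C mu1 mu2 f s s n%:R^-1 eps.
have -> : C / L * (s + s) = 2 * C * s / L by ring.
have -> : n%:R^-1 + 4 / (n ^ 2)%:R / n%:R^-1 = 5 / n%:R :> R.
  by rewrite natrX; field; rewrite gt_eqF.
have -> : (n ^ 2)%:R ^+ d = n%:R ^+ (2 * d) :> R by rewrite natrX exprM.
have -> : C * L * d%:R * (5 / n%:R) = 5 * C * L * d%:R / n%:R by ring.
apply => //; first by rewrite invr_gt0.
move=> th a tha.
have [e1 z1] := c1 th; have [e2 z2] := c2 th.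
rewrite !expect_cosB// e1 e2 -mulrBl normrM.
rewrite (@le_trans _ _ `|expR (- A1 th) - expR (- A2 th)|)//.
  by rewrite ler_piMr// cos_max.
apply: le_trans (Aeps th tha).
have := A1_ge0 th; have := A2_ge0 th; move: (A1 th) (A2 th) => x y.
wlog xy : x y / x <= y.
  move=> H x0 y0; have [|/ltW] := leP x y; first by move=> /H; exact.
  by move=> /H; rewrite distrC (distrC x); exact.
move=> y0 x0; rewrite (ler0_norm (_ : x - y <= 0)) ?subr_le0//.
rewrite ger0_norm ?subr_ge0 ?ler_expR ?lerN2// opprB.
have -> : expR (- y) = expR (- x) * expR (x - y).
  by rewrite -expRD; congr expR; ring.
have H1 := expR_ge1Dx (x - y).
have H2 : expR (- x) <= 1 by rewrite -expR0 ler_expR oppr_le0.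
have H3 := expR_gt0 (- x).
nra.
Qed.

End characteristic_function.

(** * The Levy symbol near the origin *)

Section lebesgue_boxes.
Variable R : realType.

Lemma measurable_box d (A : 'I_d -> set R) : (forall i, measurable (A i)) ->
  measurable [set z : 'rV[R]_d | forall i, A i (z 0 i)].
Proof.
move=> mA; apply: (measurable_forall_ord (P := fun i => [set z : 'rV[R]_d | A i (z 0 i)])) => i.
by rewrite -[X in measurable X]setTI; exact: measurable_coord.
Qed.

Lemma lebesgue_rV_box n (A : 'I_n -> set R) : (forall i, measurable (A i)) ->
  lebesgue_rV R n [set z | forall i, A i (z 0 i)] =
  (\prod_i @lebesgue_measure R (A i))%E.
Proof.
elim: n A => [|n IH] A mA.
  rewrite big_ord0 /= diracE (_ : 0 \in _)// inE => -[].
  by [].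
rewrite big_ord_recl /= /prod_cons /pushforward.
rewrite (_ : @rV_cons R n @^-1` _ = A ord0 `*`
    [set z : 'rV[R]_n | forall i, A (lift ord0 i) (z 0 i)]); last first.
  apply/seteqP; split => [[x z] /= H|[x z] /= [H1 H2] i].
    split=> [|i /=]; first by have := H ord0; rewrite mxE unlift_none.
    by have := H (lift ord0 i); rewrite mxE liftK.
  by rewrite mxE; case: unliftP => [j|] ->.
rewrite product_measure1E; [|exact: mA|exact: (measurable_box (A := A \o lift ord0) (fun i => mA _))].
by congr (_ * _)%E; exact: (IH (A \o lift ord0) (fun i => mA _)).
Qed.

Variable d : nat.
Local Notation V := 'rV[R]_d.

Definition cube (n : nat) : set V :=
  [set z | forall i, (`[- n%:R, n%:R]%classic : set R) (z 0 i)].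

Definition boxes : set (set V) :=
  [set B | exists2 A : 'I_d -> set R, (forall i, measurable (A i)) &
           B = [set z : V | forall i, A i (z 0 i)]].

Lemma measurable_boxes : (@measurable _ V) = <<s boxes >>.
Proof.
apply/seteqP; split.
  apply: smallest_sub; first exact: smallest_sigma_algebra.
  move=> B; rewrite -bigcup_seq => -[i _ [C mC <-]].
  apply: sub_sigma_algebra.
  exists (fun j => if j == i then C else setT) => [j|]; first by case: ifP.
  rewrite setTI; apply/seteqP; split => [z Cz j|z Hz] /=.
    by case: eqP => // ->.
  by have := Hz i; rewrite eqxx.
apply: smallest_sub; first exact: sigma_algebra_measurable.
by move=> _ [A mA ->]; exact: measurable_box.
Qed.

Lemma boxes_setI_closed : setI_closed boxes.
Proof.
move=> _ _ [A mA ->] [B mB ->]; exists (fun i => A i `&` B i).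
  by move=> i; exact: measurableI.
by apply/seteqP; split => [z [Az Bz] i|z H]; [split|split=> i; have [] := H i].
Qed.

Lemma measure_eq_boxes (m1 m2 : {measure set V -> \bar R}) :
  (forall A : 'I_d -> set R, (forall i, measurable (A i)) ->
     m1 [set z | forall i, A i (z 0 i)] = m2 [set z | forall i, A i (z 0 i)]) ->
  (forall n, (m1 (cube n) < +oo)%E) ->
  forall A, measurable A -> m1 A = m2 A.
Proof.
move=> m12 m1oo A mA.
apply: (measure_unique boxes cube) => //.
- exact: measurable_boxes.
- exact: boxes_setI_closed.
- by move=> n; exists (fun=> `[- n%:R, n%:R]%classic : set R).
- apply/seteqP; split => // z _.
  have [n zn] : exists n : nat, enorm z <= n%:R.
    exists (Num.truncn (enorm z)).+1; rewrite ltW//; exact: truncnS_gt.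
  exists n => // i /=; rewrite in_itv/= -ler_norml.
  exact: le_trans (coord_enorm z i) zn.
- by move=> _ [B mB ->]; exact: m12.
Qed.

(** The isometries through which radial symmetry is used. They map boxes to boxes, so the product
    formula makes Lebesgue measure invariant, and they suffice to make the covariance scalar and the
    symbol real. *)
Definition signed_perm (s : 'I_d -> bool) (p : 'S_d) (z : V) : V :=
  \row_i ((-1) ^+ s i * z 0 (p i)).

Lemma measurable_signed_perm s p : measurable_fun setT (signed_perm s p).
Proof.
apply/measurable_rowP => i; rewrite (_ : (fun _ => _) =
  fun z : V => (-1) ^+ s i * z 0 (p i)); last by apply/funext => z; rewrite mxE.
by apply: measurable_funM => //; exact: measurable_coord.
Qed.

Lemma enorm_signed_perm s p z : enorm (signed_perm s p z) = enorm z.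
Proof.
rewrite /enorm [in RHS](reindex_inj (@perm_inj _ p))/=; congr Num.sqrt.
by apply: eq_bigr => i _; rewrite mxE exprMn sqrr_sign mul1r.
Qed.

Lemma lebesgue_box_fin (n : nat) :
  lebesgue_rV R d (cube n) = ((2 * n%:R) ^+ d)%:E.
Proof.
rewrite (lebesgue_rV_box (A := fun=> `[- n%:R, n%:R]%classic : set R))//.
rewrite (eq_bigr (fun=> (2 * n%:R)%:E)); last first.
  move=> i _; rewrite lebesgue_measure_itv/= lte_fin.
  case: ltP => [_|H]; first by rewrite -EFinB; congr EFin; ring.
  have n0 : 0 <= n%:R :> R by [].
  by congr EFin; lra.
by rewrite prodEFin prodr_const card_ord.
Qed.

Lemma lebesgue_signed_perm s p A : measurable A ->
  lebesgue_rV R d (signed_perm s p @^-1` A) = lebesgue_rV R d A.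
Proof.
move=> mA; apply/esym.
apply: (measure_eq_boxes (m1 := lebesgue_rV R d)
  (m2 := law (lebesgue_rV R d) (measurable_signed_perm s p))) => //; last first.
  move=> n; apply: le_lt_trans (ltry ((2 * n%:R) ^+ d)).
  by apply: le_of_eq; exact: lebesgue_box_fin.
move=> {mA}A mA.
rewrite -[RHS]/(lebesgue_rV R d (signed_perm s p @^-1` [set z : V | forall i, A i (z 0 i)])).
(* The constraint at position [j] bears on the coordinate [p j]; seen from the coordinate [i], it is
   therefore the one at position [p^-1 i], sign included. *)
pose A' i : set R := (fun x : R => (-1) ^+ s ((p^-1)%g i) * x) @^-1` A ((p^-1)%g i).
have mA' i : measurable (A' i).
  rewrite /A' -[X in measurable X]setTI.
  by apply: measurable_funM => //; exact: mA.
rewrite (_ : signed_perm s p @^-1` _ = [set z : V | forall i, A' i (z 0%R i)]); last first.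
  apply/seteqP; split => [z H i|z H i].
    by have := H ((p^-1)%g i); rewrite mxE permKV.
  by have := H (p i); rewrite mxE /A' permK.
transitivity (\prod_i lebesgue_measure (A i))%E; first exact: lebesgue_rV_box.
transitivity (\prod_i lebesgue_measure (A' i))%E; last by apply/esym; exact: lebesgue_rV_box.
rewrite [in LHS](reindex_inj (@perm_inj _ (p^-1)%g))/=.
apply: eq_bigr => i _; rewrite /A'; case: (s _).
  by rewrite -(lebesgue_measureN (mA _)) /pushforward; congr (lebesgue_measure _);
    apply/seteqP; split => x /=; rewrite expr1 mulN1r.
by congr (lebesgue_measure _); apply/seteqP; split => x /=; rewrite expr0 mul1r.
Qed.

End lebesgue_boxes.

Lemma powRX (R : realType) (x r : R) k : 0 <= x -> (x ^+ k) `^ r = (x `^ r) ^+ k.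
Proof.
by move=> x0; rewrite -(powR_mulrn k x0) -(powR_mulrn k (powR_ge0 x r)) -!powRrM mulrC.
Qed.

(** * Moments of the Levy measure and expansion of its symbol *)

Section levy_measure.
Variables (R : realType) (d : nat).
Local Notation V := 'rV[R]_d.
Variables (alpha : \bar R) (c : R) (a : V -> \bar R).
Variable nu : {measure set V -> \bar R}.
Hypotheses (alpha2 : (2%:E < alpha)%E) (c0 : 0 < c).
Hypothesis a_meas : measurable_fun (@unit_ball R d) a.
Hypothesis a_ge0 : forall z, enorm z <= 1 -> (0 <= a z)%E.
Hypothesis a_radial : is_radial_on_ball a.
Hypothesis a_mom : (\int[lebesgue_rV R d]_(z in @unit_ball R d)
              ((enorm z ^+ 2)%:E * a z) < +oo)%E.
Hypothesis nuE : forall A, measurable A ->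
     nu A = (\int[lebesgue_rV R d]_(z in A) levy_density a c alpha z)%E.

Let mball : measurable (@unit_ball R d).
Proof.
rewrite -[X in measurable X]setTI (_ : @unit_ball R d = @enorm R d @^-1` (`]-oo, 1]%classic : set R)); last first.
  by apply/seteqP; split => z /=; rewrite in_itv/=.
exact: measurable_enorm.
Qed.

Let dens := levy_density a c alpha.

Let dens_ge0 z : (0 <= dens z)%E.
Proof.
rewrite /dens /levy_density; case: ifP => [|_]; first exact: a_ge0.
rewrite /tail_density; case: (alpha) => [r| |]//.
by rewrite lee_fin divr_ge0// ltW.
Qed.

Let measurable_dens : measurable_fun setT dens.
Proof.
rewrite /dens /levy_density.
apply: measurable_fun_if => //.
- by apply: measurable_fun_ler => //; exact: measurable_enorm.
- rewrite setTI (_ : _ @^-1` _ = @unit_ball R d)//.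
- apply: measurable_funTS.
  rewrite /tail_density; case: alpha => [r| |]//.
  apply/measurable_EFinP; apply: measurable_funM => //.
  under eq_fun do rewrite -powRN.
  by apply: (measurableT_comp (measurable_powR _)); exact: measurable_enorm.
Qed.

Lemma levy_signed_perm s p A : measurable A ->
  nu (signed_perm s p @^-1` A) = nu A.
Proof.
move=> mA; have mT := @measurable_signed_perm R d s p.
rewrite !nuE//; last by rewrite -[X in measurable X]setTI; exact: mT.
transitivity (\int[law (lebesgue_rV R d) mT]_(z in A) dens z)%E; last first.
  by apply: eq_measure_integral => B mB _; exact: lebesgue_signed_perm.
rewrite (@ge0_integral_pushforward _ _ _ _ _ _ mT (lebesgue_rV R d) A dens mA); last 2 first.
- exact: measurable_funTS measurable_dens.
- by move=> z _; exact: dens_ge0.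
apply: eq_integral => z _; rewrite /dens /levy_density /= enorm_signed_perm.
case: ifP => z1; first exact: esym (a_radial z1 (enorm_signed_perm s p z)).
by rewrite /tail_density enorm_signed_perm.
Qed.

Lemma integral_signed_perm s p (f : V -> \bar R) : measurable_fun setT f ->
  (forall z, (0 <= f z)%E) ->
  (\int[nu]_z f (signed_perm s p z) = \int[nu]_z f z)%E.
Proof.
move=> mf f0; have mT := @measurable_signed_perm R d s p.
transitivity (\int[law nu mT]_z f z)%E.
  rewrite (@ge0_integral_pushforward _ _ _ _ _ _ mT nu setT f measurableT) ?preimage_setT//.
by apply: eq_measure_integral => B mB _; exact: levy_signed_perm.
Qed.

(** Dyadic shells stand in for polar coordinates: on each of them the norm is known up to a factor
    2. *)
Let inner_shell k : set V := [set z | 2^-1 ^+ k.+1 < enorm z <= 2^-1 ^+ k].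
Let outer_shell k : set V := [set z | 2 ^+ k < enorm z <= 2 ^+ k.+1].

Let mshell (x y : R) : measurable [set z : V | x < enorm z <= y].
Proof.
rewrite -[X in measurable X]setTI (_ : [set z | _] = @enorm R d @^-1` (`]x, y]%classic : set R)); last first.
  by apply/seteqP; split => z /=; rewrite in_itv/=.
exact: measurable_enorm.
Qed.

Let pow2_gt (x : R) : exists k : nat, x < 2 ^+ k.
Proof.
exists (Num.truncn x).+1; rewrite (lt_trans (truncnS_gt x))//.
by rewrite -natrX ltr_nat ltn_expl.
Qed.

Let inner_shell_ex z : 0 < enorm z -> enorm z <= 1 -> exists k, inner_shell k z.
Proof.
move=> z0 z1; have ex : exists k, 2^-1 ^+ k.+1 < enorm z.
  have [k kz] := pow2_gt (enorm z)^-1; exists k.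
  rewrite exprVn -[ltRHS]invrK ltf_pV2 ?posrE ?exprn_gt0 ?invr_gt0//.
  by rewrite (lt_trans kz)// exprS ltr_pMl ?exprn_gt0// ltr1n.
case: (ex_minnP ex) => -[|k] zk kmin; first by exists 0%N; rewrite /inner_shell/= zk expr0.
exists k.+1; rewrite /inner_shell/= zk leNgt; apply/negP => H.
by have := kmin k H; rewrite ltnn.
Qed.

Let outer_shell_ex z : 1 < enorm z -> exists k, outer_shell k z.
Proof.
move=> z1; have ex : exists k, enorm z <= 2 ^+ k.+1.
  have [k kz] := pow2_gt (enorm z); exists k.
  by rewrite (le_trans (ltW kz))// exprS ler_peMl ?exprn_ge0// ler1n.
case: (ex_minnP ex) => -[|k] zk kmin; first by exists 0%N; rewrite /outer_shell/= zk expr0 z1.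
exists k.+1; rewrite /outer_shell/= zk andbT ltNge; apply/negP => H.
by have := kmin k H; rewrite ltnn.
Qed.

Let trivIset_inner : trivIset setT inner_shell.
Proof.
apply/trivIsetP => i j _ _; wlog ij : i j / (i < j)%N.
  move=> H; rewrite neq_ltn => /orP[ij|ji]; first by apply: H => //; rewrite ltn_eqF.
  by rewrite setIC; apply: H => //; rewrite ltn_eqF.
move=> _; apply/seteqP; split => // z [/andP[iz _] /andP[_ zj]].
have := lt_le_trans iz zj; rewrite ltNge; apply/negP; rewrite negbK.
by apply: ler_wiXn2l => //; rewrite invf_le1// ler1n.
Qed.

Let inner_sum : (\sum_(k <oo) (4^-1 ^+ k)%:E * nu (inner_shell k) < +oo)%E.
Proof.
have m4 : measurable_fun setT (fun z : V => 4%:E * ((enorm z ^+ 2)%:E * dens z))%E.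
  apply: emeasurable_funM => //; apply: emeasurable_funM => //.
  exact: measurable_enorm_sqr.
apply: (@le_lt_trans _ _ (\sum_(k <oo) \int[lebesgue_rV R d]_(z in inner_shell k)
    (4%:E * ((enorm z ^+ 2)%:E * dens z)))%E).
  apply: lee_nneseries => [k _ _|k _]; first by rewrite mule_ge0.
  rewrite nuE; last exact: mshell.
  rewrite -(ge0_integralZl_EFin _ (mshell _ _) (fun z _ => dens_ge0 z)
    (measurable_funTS measurable_dens) (exprn_ge0 k _)) ?invr_ge0//.
  apply: ge0_le_integral.
  - exact: mshell.
  - by move=> z _; rewrite mule_ge0// lee_fin exprn_ge0// invr_ge0.
  - by apply: emeasurable_funM => //; exact: measurable_funTS measurable_dens.
  - exact: measurable_funTS m4.
  - move=> z /= /andP[zk _]; rewrite muleA -EFinM lee_wpmul2r// lee_fin.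
    have -> : 4^-1 ^+ k = 4 * (2^-1 ^+ k.+1) ^+ 2 :> R.
      by rewrite -exprM mulnC exprM (exprS (2^-1 ^+ 2)) (_ : 2^-1 ^+ 2 = 4^-1 :> R);
        field.
    rewrite ler_wpM2l//; rewrite ler_sqr ?nnegrE ?exprn_ge0 ?invr_ge0//.
    exact: ltW.
have f0 (z : V) : (0 <= 4%:E * ((enorm z ^+ 2)%:E * dens z))%E.
  by rewrite !mule_ge0// lee_fin sqr_ge0.
rewrite -ge0_integral_bigcup//; last 2 first.
- by move=> k; exact: mshell.
- exact: measurable_funTS m4.
apply: (@le_lt_trans _ _ (\int[lebesgue_rV R d]_(z in @unit_ball R d)
    (4%:E * ((enorm z ^+ 2)%:E * dens z)))%E).
  apply: ge0_subset_integral => //.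
  - by apply: bigcup_measurable => k _; exact: mshell.
  - exact: measurable_funTS m4.
  - move=> z [k _ /andP[_ zk]]; rewrite /unit_ball/= (le_trans zk)//.
    by rewrite exprn_ile1// ?invr_ge0// invf_le1// ler1n.
have me : measurable_fun (@unit_ball R d) (fun z => (enorm z ^+ 2)%:E * dens z)%E.
  apply: emeasurable_funM; last exact: measurable_funTS measurable_dens.
  apply/measurable_EFinP; apply: measurable_funX.
  by apply: measurable_funTS; exact: measurable_enorm.
rewrite ge0_integralZl_EFin//; last by move=> z _; rewrite mule_ge0// lee_fin sqr_ge0.
rewrite lte_mul_pinfty//.
rewrite (_ : integral _ _ _ = \int[lebesgue_rV R d]_(z in @unit_ball R d)
              ((enorm z ^+ 2)%:E * a z))%E//.
by apply: eq_integral => z /[!inE] z1; rewrite /dens /levy_density ifT.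
Qed.

(** On shell [k] the density is at most its value at radius [2^k], and the shell lies in a cube of
    volume [(4 2^k)^d], whence the factor [4^d]. *)
Let outer_bound : exists r C : R, [/\ 2 < r, 0 <= C &
  forall k, (nu (outer_shell k) <= (C * (2 `^ (- r)) ^+ k)%:E)%E].
Proof.
have big z k : outer_shell k z -> (enorm z <= 1) = false.
  move=> /andP[zk _]; apply/negbTE; rewrite -ltNge (le_lt_trans _ zk)//.
  by rewrite exprn_ege1// ler1n.
case: alpha alpha2 @dens dens_ge0 measurable_dens nuE => [r| |]// r2 f f0 mf fE.
  exists r, (c * 4 ^+ d); split => //.
    by rewrite mulr_ge0 ?exprn_ge0// ltW.
  move=> k; rewrite fE; last exact: mshell.
  pose K : R := c / (2 ^+ k) `^ (d%:R + r).
  have K0 : 0 <= K by rewrite divr_ge0// ltW.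
  apply: (@le_trans _ _ (\int[lebesgue_rV R d]_(z in outer_shell k) K%:E)%E).
    apply: ge0_le_integral.
    - exact: mshell.
    - by move=> z _; exact: f0.
    - exact: measurable_funTS mf.
    - done.
    - move=> z zk; rewrite /levy_density (big _ _ zk)//= lee_fin ler_wpM2l ?(ltW c0)//.
      have z0 : 0 < enorm z by move/andP: zk => [/(lt_trans _) ->]//; rewrite exprn_gt0.
      rewrite lef_pV2 ?posrE ?powR_gt0 ?exprn_gt0//.
      apply: powR_mono; [by rewrite addr_ge0// ltW// (lt_trans _ (r2 : 2 < r))|exact: exprn_ge0|].
      by move/andP: zk => [/ltW].
  rewrite integral_cst; last exact: mshell.
  apply: (@le_trans _ _ (K%:E * ((2 * (2 ^ k.+1)%:R) ^+ d)%:E)%E).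
    rewrite lee_wpmul2l ?lee_fin// -lebesgue_box_fin le_measure ?inE//.
    - exact: mshell.
    - exact: (measurable_box (A := fun=> `[- _, _]%classic : set R)).
    - move=> z /andP[_ zk] i /=; rewrite in_itv/= -ler_norml natrX.
      exact: le_trans (coord_enorm z i) zk.
  rewrite -EFinM lee_fin /K; apply: le_of_eq.
  rewrite natrX exprS mulrA exprMn (_ : 2 * 2 = 4 :> R); last by ring.
  have k0 : (2 ^+ k : R) != 0 by rewrite expf_neq0.
  rewrite powRD; last by apply/implyP.
  rewrite powR_mulrn ?exprn_ge0// powRN invfM.
  rewrite (_ : (2 ^+ k) `^ r = (2 `^ r) ^+ k); last first.
    exact: powRX.
  rewrite exprVn.
  have kd0 : (2 ^+ k : R) ^+ d != 0 by rewrite expf_neq0.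
  have r0 : (2 `^ r : R) ^+ k != 0 by rewrite expf_neq0// gt_eqF// powR_gt0.
  by field; rewrite kd0 r0.
(* For [alpha = +oo] there is no mass outside the ball: [C = 0], and 3 is some exponent above 2. *)
exists 3, 0; split => //; first by rewrite ltr_nat.
move=> k; rewrite fE; last exact: mshell.
rewrite mul0r (eq_integral (cst 0%E)) ?integral0// => z /[!inE] zk.
by rewrite /levy_density (big _ _ zk).
Qed.

Let ler_wnpowR' (x p q : R) : 0 <= x -> x <= 1 -> x != 0 -> p <= q -> x `^ q <= x `^ p.
Proof.
move=> x0 x1 xn0 pq; rewrite /powR (negbTE xn0) ler_expR ler_wnM2r//.
exact: ln_le0.
Qed.

Let weight (del : R) (z : V) : R :=
  if enorm z <= 1 then enorm z ^+ 2 else enorm z `^ (2 + del).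

Let measurable_weight del : measurable_fun setT
  (fun z : V => if enorm z <= 1 then enorm z ^+ 2 else enorm z `^ (2 + del)).
Proof.
apply: (@measurable_fun_ifT _ _ V R _ _ (fun z => enorm z <= 1)).
- by apply: measurable_fun_ler => //; exact: measurable_enorm.
- by apply: measurable_funX; exact: measurable_enorm.
- by apply: (measurableT_comp (measurable_powR _)); exact: measurable_enorm.
Qed.

(** Two series over dyadic shells: the inner one is compared with the integral of [|z|^2 a], the
    outer one is geometric as soon as [2 + del] stays below the tail exponent. *)
Lemma levy_moment : exists2 del : R, 0 < del <= 1 & exists2 m : R, 0 <= m &
  (\int[nu]_z (if enorm z <= 1 then enorm z ^+ 2 else enorm z `^ (2 + del))%:E
   <= m%:E)%E.
Proof.
have [r [C [r2 C0 HC]]] := outer_bound.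
(* Half of the available room, so that [2 + del < r] strictly; the cap at 1 is for the cubic Taylor
   bound [cos_lb]. *)
pose del := Num.min 1 ((r - 2) / 2).
have del0 : 0 < del by rewrite lt_min ltr01 divr_gt0// subr_gt0.
have delr : 2 + del < r.
  have : del <= (r - 2) / 2 by rewrite ge_min lexx orbT.
  by move=> H; have : (r - 2) / 2 < r - 2; lra.
exists del; first by rewrite del0 ge_min lexx.
suff : (\int[nu]_z (weight del z)%:E < +oo)%E.
  have I0 : (0 <= \int[nu]_z (weight del z)%:E)%E.
    by apply: integral_ge0 => z _; rewrite lee_fin /weight; case: ifP; rewrite ?sqr_ge0.
  move=> Ioo; exists (fine (\int[nu]_z (weight del z)%:E)%E); first exact: fine_ge0.
  by rewrite fineK// ge0_fin_numE.
pose g1 k (z : V) : \bar R := ((4^-1 ^+ k)%:E * (\1_(inner_shell k) z)%:E)%E.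
pose g2 k (z : V) : \bar R :=
  (((2 ^+ k.+1) `^ (2 + del))%:E * (\1_(outer_shell k) z)%:E)%E.
have mg1 k : measurable_fun setT (g1 k).
  apply: emeasurable_funM => //; apply/measurable_EFinP.
  by apply: measurable_indic; exact: mshell.
have mg2 k : measurable_fun setT (g2 k).
  apply: emeasurable_funM => //; apply/measurable_EFinP.
  by apply: measurable_indic; exact: mshell.
have g10 k z : (0 <= g1 k z)%E.
  by rewrite mule_ge0// lee_fin ?exprn_ge0 ?invr_ge0// indicE.
have g20 k z : (0 <= g2 k z)%E by rewrite mule_ge0// lee_fin ?indicE.
have ind0 (S : set V) (z : V) (_ : setT z) : (0 <= (\1_S z : R)%:E)%E.
  by rewrite lee_fin indicE.
have mind (S : set V) : measurable S -> measurable_fun setT (fun z => (\1_S z : R)%:E).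
  by move=> mS; apply/measurable_EFinP; exact: measurable_indic.
have mw : measurable_fun setT (fun z => (weight del z)%:E).
  by apply/measurable_EFinP; exact: measurable_weight.
apply: (@le_lt_trans _ _ (\int[nu]_z (\sum_(k <oo) g1 k z + \sum_(k <oo) g2 k z))%E).
  apply: ge0_le_integral => //.
  - by move=> z _; rewrite lee_fin /weight; case: ifP; rewrite ?sqr_ge0.
  - apply: emeasurable_funD; apply: ge0_emeasurable_sum => //.
  - move=> z _; rewrite /weight; case: ifP => [|/negbT]; rewrite -?ltNge => z1.
      have [->|zn0] := eqVneq (enorm z) 0.
        by rewrite expr0n/= adde_ge0// nneseries_ge0.
      have z0 : 0 < enorm z by rewrite lt_neqAle eq_sym zn0 enorm_ge0.
      have [k kz] := inner_shell_ex z0 z1.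
      rewrite (@le_trans _ _ (\sum_(k <oo) g1 k z)%E)//; last by rewrite leeDl// nneseries_ge0.
      apply: le_trans (nneseries_lim_ge k.+1 _) => //.
      rewrite big_nat_recr//= (@le_trans _ _ (g1 k z))//; last first.
        by rewrite leeDr// sume_ge0.
      rewrite /g1 indicE mem_set// mule1 lee_fin.
      rewrite (_ : 4^-1 ^+ k = (2^-1 ^+ k) ^+ 2 :> R); last first.
        by rewrite -exprM mulnC exprM (_ : 2^-1 ^+ 2 = 4^-1 :> R)//; field.
      rewrite ler_sqr ?nnegrE ?exprn_ge0 ?invr_ge0//.
      by move/andP : kz => [].
    have [k kz] := outer_shell_ex z1.
    rewrite (@le_trans _ _ (\sum_(k <oo) g2 k z)%E)//; last by rewrite leeDr// nneseries_ge0.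
    apply: le_trans (nneseries_lim_ge k.+1 _) => //.
    rewrite big_nat_recr//= (@le_trans _ _ (g2 k z))//; last first.
      by rewrite leeDr// sume_ge0.
    rewrite /g2 indicE mem_set// mule1 lee_fin.
    apply: powR_mono => //; first by rewrite addr_ge0// ltW.
    by move/andP : kz => [].
rewrite ge0_integralD//; last 4 first.
- by move=> z _; exact: nneseries_ge0.
- exact: ge0_emeasurable_sum.
- by move=> z _; exact: nneseries_ge0.
- exact: ge0_emeasurable_sum.
rewrite !integral_nneseries//.
rewrite (eq_eseriesr (g := fun k => ((4^-1 ^+ k)%:E * nu (inner_shell k))%E)); last first.
  move=> k _; rewrite (ge0_integralZl_EFin _ measurableT (ind0 _) (mind _ (mshell _ _)) (exprn_ge0 k _)) ?invr_ge0//.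
  by rewrite integral_indic ?setIT//; exact: mshell.
rewrite lte_add_pinfty//.
(* Ratio of the series with terms [(2^(k + 1))^(2 + del) 2^(- r k)]. *)
pose rho : R := 2 `^ (2 + del - r).
have rho0 : 0 < rho by rewrite powR_gt0.
have rho1 : rho < 1.
  rewrite /rho (_ : 2 + del - r = - (r - (2 + del))); last by ring.
  rewrite powRN invf_lt1 ?powR_gt0//.
  have e0 : 0 < r - (2 + del) by rewrite subr_gt0.
  have := @gt0_ltr_powR R _ e0 1 2; rewrite powR1 !nnegrE; apply => //.
  by rewrite ltr1n.
apply: (@le_lt_trans _ _ (C * 2 `^ (2 + del) * (1 - rho)^-1)%:E); last exact: ltry.
apply: lime_le; first by apply: is_cvg_nneseries => k _ _; apply: integral_ge0 => z _; exact: g20.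
near=> n.
apply: (@le_trans _ _ (series (geometric (C * 2 `^ (2 + del)) rho) n)%:E); last first.
  rewrite lee_fin; apply: geometric_le_lim => //; first by rewrite mulr_ge0.
  by rewrite gtr0_norm.
rewrite /series/= -sumEFin; apply: lee_sum => k _.
rewrite (ge0_integralZl_EFin _ measurableT (ind0 _) (mind _ (mshell (2 ^+ k) (2 ^+ k.+1))) (powR_ge0 _ _)).
rewrite integral_indic ?setIT//.
apply: (le_trans (lee_wpmul2l _ (HC k))); first by rewrite lee_fin.
rewrite -EFinM lee_fin; apply: le_of_eq => /=.
rewrite exprS powRM// ?exprn_ge0//.
have -> : (2 ^+ k) `^ (2 + del) = (2 `^ (2 + del)) ^+ k :> R.
  exact: powRX.
have -> : rho = 2 `^ (2 + del) * 2 `^ (- r) by rewrite /rho powRD//; apply/implyP.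
by rewrite exprMn; ring.
Unshelve. all: by end_near.
Qed.

Lemma Rintegral_odd s p (h : V -> R) : measurable_fun setT h ->
  (forall z, h (signed_perm s p z) = - h z) -> \int[nu]_z h z = 0.
Proof.
move=> mh hodd; rewrite /Rintegral integralE.
have m1 : measurable_fun setT ((EFin \o h)^\+)%E.
  by apply: measurable_funepos; exact/measurable_EFinP.
have <- : (\int[nu]_z ((EFin \o h)^\+ z) = \int[nu]_z ((EFin \o h)^\- z))%E.
  rewrite -(integral_signed_perm s p m1)//.
  apply: eq_integral => z _; rewrite funeposE funenegE /= hodd.
  by rewrite EFinN.
case: (integral _ _ _) => [x| |]//=.
by rewrite subrr.
Qed.

Hypothesis d_gt0 : (0 < d)%N.

Lemma enorm_sqr_integrable :
  nu.-integrable setT (fun z => (enorm z ^+ 2)%:E).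
Proof.
have [del /andP[del0 _] [m m0 Hm]] := levy_moment.
apply/integrableP; split.
  exact: measurable_enorm_sqr.
apply: le_lt_trans (ltry m); apply: le_trans Hm.
apply: ge0_le_integral => //.
- apply: measurableT_comp => //.
  exact: measurable_enorm_sqr.
- apply/measurable_EFinP; exact: measurable_weight.
move=> z _; rewrite /= lee_fin ger0_norm ?sqr_ge0//.
case: ifP => // /negbT; rewrite -ltNge => z1.
rewrite -powR_mulrn//; apply: ler_powR; first exact: ltW.
by rewrite lerDl ltW.
Qed.

Lemma levy_integrable_mul (f : V -> R) (K : R) : measurable_fun setT f ->
  (forall z, `|f z| <= K * enorm z ^+ 2) -> nu.-integrable setT (EFin \o f).
Proof.
move=> mf fK.
have i2 := integrableZl measurableT K enorm_sqr_integrable.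
apply: (le_integrable measurableT _ _ i2).
  exact/measurable_EFinP.
move=> z _ /=; rewrite lee_fin; apply: le_trans (fK z) _.
exact: ler_norm.
Qed.

Let coord2_int i j : nu.-integrable setT (EFin \o (fun z : V => z 0 i * z 0 j)).
Proof.
apply: (@levy_integrable_mul _ 1).
  by apply: measurable_funM; exact: measurable_coord.
by move=> z; rewrite mul1r normrM expr2 ler_pM// coord_enorm.
Qed.

Let coord2_diag i j : \int[nu]_z (z 0 i * z 0 i) = \int[nu]_z (z 0 j * z 0 j).
Proof.
have m2 : measurable_fun setT (fun z : V => (z 0 i * z 0 i)%:E).
  by apply/measurable_EFinP; apply: measurable_funM; exact: measurable_coord.
rewrite /Rintegral -(integral_signed_perm (fun=> false) (tperm i j) m2)//; last first.
  by move=> z; rewrite lee_fin -expr2 sqr_ge0.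
by congr fine; apply: eq_integral => z _; rewrite mxE expr0 mul1r tpermL.
Qed.

Let coord2_off i j : i != j -> \int[nu]_z (z 0 i * z 0 j) = 0.
Proof.
move=> ij; apply: (@Rintegral_odd (fun k => k == i) 1%g).
  by apply: measurable_funM; exact: measurable_coord.
move=> z; rewrite !mxE !perm1 eqxx eq_sym (negbTE ij) expr0 expr1.
by ring.
Qed.

Let Rint_sum (I : finType) (F : I -> V -> R) :
  (forall i, nu.-integrable setT (EFin \o F i)) ->
  \int[nu]_z (\sum_i F i z) = \sum_i \int[nu]_z F i z.
Proof.
move=> iF; rewrite /Rintegral.
under eq_integral do rewrite -sumEFin.
rewrite (integral_sum measurableT (fun i => iF i)) sum_fine// => i _.
exact: integrable_fin_num (iF i).
Qed.

(** Changing one sign kills the mixed second moments, and a transposition equates the diagonal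
    ones. *)
Lemma levy_second_moment_inner xi :
  \int[nu]_z (inner xi z ^+ 2) = second_moment nu / d%:R * enorm xi ^+ 2.
Proof.
pose i0 := Ordinal d_gt0.
pose D := \int[nu]_z (z 0%R i0 * z 0%R i0 : R).
have -> : second_moment nu = d%:R * D.
  rewrite /second_moment.
  under eq_Rintegral do rewrite enorm_sqr /inner.
  rewrite (Rint_sum (F := fun i z => z 0 i * z 0 i))//.
  by rewrite (eq_bigr (fun=> D)) ?sumr_const ?card_ord ?mulr_natl// => i _; exact: coord2_diag.
rewrite [d%:R * D]mulrC mulfK ?pnatr_eq0 -?lt0n//.
transitivity (\int[nu]_z \sum_(p : 'I_d * 'I_d) (xi 0 p.1 * xi 0 p.2) * (z 0 p.1 * z 0 p.2)).
  apply: eq_Rintegral => z _; rewrite expr2 /inner mulr_suml.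
  under eq_bigr do rewrite mulr_sumr.
  by rewrite pair_bigA/=; apply: eq_bigr => -[i j] _ /=; ring.
rewrite (Rint_sum (F := fun p z => (xi 0 p.1 * xi 0 p.2) * (z 0 p.1 * z 0 p.2))); last first.
  by move=> p; exact: (integrableZl measurableT _ (coord2_int p.1 p.2)).
rewrite (eq_bigr (fun p => xi 0 p.1 * xi 0 p.2 * \int[nu]_z (z 0 p.1 * z 0 p.2))); last first.
  by move=> p _; rewrite RintegralZl//; exact: (coord2_int p.1 p.2).
rewrite -(pair_bigA _ (fun i j => xi 0 i * xi 0 j * \int[nu]_z (z 0 i * z 0 j)))/=.
rewrite enorm_sqr /inner mulr_sumr; apply: eq_bigr => i _.
rewrite (bigD1 i)//= big1 ?addr0.
  by rewrite (coord2_diag i i0) -/D mulrC.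
by move=> j ji; rewrite coord2_off ?mulr0// eq_sym.
Qed.

Let abs_inner_le (x y : V) : `|inner x y| <= enorm x * enorm y.
Proof.
by rewrite ler_norml lerNl -innerNl inner_enorm andbT -(enormN x) inner_enorm.
Qed.

Let inner_sqr_le (x y : V) : inner x y ^+ 2 <= enorm x ^+ 2 * enorm y ^+ 2.
Proof.
rewrite -exprMn -[leLHS](real_normK (num_real _)).
by rewrite lerXn2r ?nnegrE ?mulr_ge0// abs_inner_le.
Qed.

(** Interpolation between the cubic bound [cos_lb] for [|x| <= 1] and a quadratic bound beyond. *)
Let cos_taylor (x del : R) : 0 < del <= 1 ->
  `|1 - cos x - x ^+ 2 / 2| <= `|x| `^ (2 + del).
Proof.
move=> /andP[del0 del1]; rewrite distrC ger0_norm; last by rewrite subr_ge0 cos_ub.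
have [x1|x1] := leP `|x| 1.
  apply: le_trans (cos_lb x) _.
  have [->|x0] := eqVneq x 0; first by rewrite normr0 expr0n/= powR_ge0.
  rewrite -powR_mulrn//; by apply: ler_wnpowR' => //; rewrite ?normr_eq0//; lra.
have c1 : cos x <= 1 by exact: cos_le1.
apply: (@le_trans _ _ (`|x| ^+ 2)).
  rewrite real_normK ?num_real//.
  by have := sqr_ge0 x; lra.
rewrite -powR_mulrn//; apply: ler_powR; first exact: ltW.
by rewrite lerDl ltW.
Qed.

Lemma levy_symbolE xi : levy_symbol nu xi =
  Complex (\int[nu]_z (1 - cos (inner xi z)))
    (\int[nu]_z (inner xi z * \1_(@unit_ball R d) z - sin (inner xi z))).
Proof.
rewrite /levy_symbol /cintegral; congr Complex; apply: eq_Rintegral => z _;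
  by rewrite /cexp/= expR0; ring.
Qed.

(** The reflection [z -> - z] kills the imaginary part, compensator included. In the real part the
    quadratic term is the covariance, and [cos_taylor] leaves a remainder integrable by
    [levy_moment]. *)
Lemma levy_symbol_est : exists del m : R, [/\ 0 < del <= 1, 0 <= m &
  forall xi, [/\ complex.Im (levy_symbol nu xi) = 0,
    0 <= complex.Re (levy_symbol nu xi),
    complex.Re (levy_symbol nu xi) <= second_moment nu / d%:R / 2 * enorm xi ^+ 2 &
    `|complex.Re (levy_symbol nu xi) - second_moment nu / d%:R / 2 * enorm xi ^+ 2|
      <= m * enorm xi `^ (2 + del)]].
Proof.
have [del del01 [m m0 Hm]] := levy_moment.
have /andP[del0 del1] := del01.
exists del, m; split => // xi; rewrite levy_symbolE/=.
have mc := @measurable_cosl R d xi.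
have mi := @measurable_inner R d xi.
have i2 : nu.-integrable setT (EFin \o (fun z => inner xi z ^+ 2 / 2)).
  apply: (@levy_integrable_mul _ (enorm xi ^+ 2)).
    by apply: measurable_funM => //; exact: measurable_funX.
  move=> z; rewrite ger0_norm ?divr_ge0 ?sqr_ge0//.
  apply: (@le_trans _ _ (inner xi z ^+ 2)); first by have := sqr_ge0 (inner xi z); lra.
  exact: inner_sqr_le.
have i1 : nu.-integrable setT (EFin \o (fun z => 1 - cos (inner xi z))).
  apply: (@levy_integrable_mul _ (enorm xi ^+ 2)); first exact: measurable_funB.
  move=> z; rewrite ger0_norm ?subr_ge0 ?cos_le1//.
  apply: (@le_trans _ _ (inner xi z ^+ 2)); first by have := sqr_ge0 (inner xi z); have := cos_ub (inner xi z); lra.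
  exact: inner_sqr_le.
have E2 : second_moment nu / d%:R / 2 * enorm xi ^+ 2 = \int[nu]_z (inner xi z ^+ 2 / 2).
  rewrite -mulrA [2^-1 * _]mulrC mulrA -levy_second_moment_inner.
  rewrite RintegralZr//.
  apply: (@levy_integrable_mul _ (enorm xi ^+ 2)); first exact: measurable_funX.
  by move=> z; rewrite ger0_norm ?sqr_ge0//; exact: inner_sqr_le.
split.
- apply: (@Rintegral_odd (fun=> true) 1%g).
    apply: measurable_funB; last exact: measurable_sinl.
    by apply: measurable_funM; [exact: measurable_inner|exact: measurable_indic].
  move=> z; have -> : signed_perm (fun=> true) 1%g z = - z.
    by apply/rowP => i; rewrite !mxE perm1 expr1 mulN1r.
  rewrite innerNr sinN.
  have -> : \1_(@unit_ball R d) (- z) = \1_(@unit_ball R d) z :> R.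
    rewrite !indicE; congr (_ %:R); congr nat_of_bool.
    by apply/idP/idP; rewrite !inE /unit_ball/= enormN.
  by ring.
- apply: Rintegral_ge0 => z _; rewrite subr_ge0; exact: cos_le1.
- rewrite E2; apply: le_Rintegral => // z _; exact: cos_ub.
rewrite E2.
rewrite -RintegralB//.
have i3 : nu.-integrable setT (EFin \o (fun z => 1 - cos (inner xi z) - inner xi z ^+ 2 / 2)).
  exact: (integrableB measurableT i1 i2).
apply: le_trans (le_normr_Rintegral measurableT i3) _.
rewrite /Rintegral.
have H : (\int[nu]_z (`|1 - cos (inner xi z) - inner xi z ^+ 2 / 2|)%:E
    <= (m * enorm xi `^ (2 + del))%:E)%E.
  rewrite mulrC EFinM; apply: le_trans (lee_wpmul2l _ Hm); last by rewrite lee_fin powR_ge0.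
  rewrite -ge0_integralZl_EFin ?powR_ge0//; last 2 first.
  - by move=> z _; rewrite lee_fin; case: ifP; rewrite ?sqr_ge0 ?powR_ge0.
  - apply/measurable_EFinP; exact: measurable_weight.
  apply: ge0_le_integral => //.
  - apply/measurable_EFinP; apply: measurableT_comp => //.
    by have /integrableP[/measurable_EFinP] := i3.
  - apply: emeasurable_funM => //; apply/measurable_EFinP; exact: measurable_weight.
  move=> z _; rewrite -EFinM lee_fin; apply: le_trans (cos_taylor _ del01) _.
  apply: (@le_trans _ _ ((enorm xi * enorm z) `^ (2 + del))).
    by apply: powR_mono; [rewrite addr_ge0// ltW|exact: normr_ge0|exact: abs_inner_le].
  rewrite powRM// ler_wpM2l ?powR_ge0//; case: ifP => z1 //.
  have [->|z0] := eqVneq (enorm z) 0.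
    by rewrite expr0n/= powR0// gt_eqF// addr_gt0.
  rewrite -powR_mulrn//; by apply: ler_wnpowR' => //; rewrite ?normr_eq0//; lra.
have [fi fin] : (0 <= \int[nu]_z (`|1 - cos (inner xi z) - inner xi z ^+ 2 / 2|)%:E)%E /\
  (\int[nu]_z (`|1 - cos (inner xi z) - inner xi z ^+ 2 / 2|)%:E < +oo)%E.
  split; first by apply: integral_ge0 => z _; rewrite lee_fin.
  exact: le_lt_trans H (ltry _).
by rewrite -lee_fin fineK ?ge0_fin_numE.
Qed.

End levy_measure.

(** * Transition kernels of the implicit scheme *)

Section kernels.
Variables (R : realType) (d : nat) (kap ell q : R).
Hypotheses (kap0 : 0 <= kap) (ell0 : 0 <= ell) (q0 : 0 < q).
Local Notation V := 'rV[R]_d.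
Local Notation J := (@resolvent R d kap ell q).
Variable C : R.
Hypothesis C0 : 0 <= C.
Implicit Types f g : V -> R.

Definition step (h : R) (mu : probability V R) f (y : V) : R :=
  \int[mu]_z f (J h (y + z)).

(** Backward recursion: the kernel of the last step acts first on [f]. *)
Definition iter_step (h : nat -> R) (mu : nat -> probability V R) :
    nat -> (V -> R) -> V -> R :=
  fix F n f := if n is n'.+1 then F n' (step (h n') (mu n') f) else f.

Let blip_shift h y f : 0 <= h -> blip C f -> blip C (fun z => f (J h (y + z))).
Proof.
move=> h0 [f1 fC]; split => // z z'.
apply: le_trans (fC _ _) _; rewrite ler_wpM2l//.
apply: le_trans (resolvent_lip kap0 ell0 q0 _ _ h0) _.
by rewrite opprD addrACA subrr add0r.
Qed.

Lemma step_blip h mu f : 0 <= h -> blip C f -> blip C (step h mu f).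
Proof.
move=> h0 fC; have bs y := blip_shift y h0 fC.
have ms y := blip_measurable (bs y).
have [f1 fL] := fC.
split; first by move=> y; apply: expect_abs_le => //; have [] := bs y.
move=> y y'.
rewrite /step -(expectB _ (M := 1))//; try by have [] := bs y; have [] := bs y'.
apply: expect_abs_le; first exact: measurable_funB.
move=> z; apply: le_trans (fL _ _) _; rewrite ler_wpM2l//.
apply: le_trans (resolvent_lip kap0 ell0 q0 _ _ h0) _.
by rewrite opprD addrACA subrr addr0.
Qed.

Lemma iter_step_blip h (mu : nat -> probability V R) n f : (forall k, 0 <= h k) -> blip C f ->
  blip C (iter_step h mu n f).
Proof.
by move=> h0; elim: n f => //= n IH f fC; apply: IH; exact: step_blip.
Qed.

Lemma step_sup h mu f g e : 0 <= h -> blip C f -> blip C g ->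
  (forall y, `|f y - g y| <= e) -> forall y, `|step h mu f y - step h mu g y| <= e.
Proof.
move=> h0 fC gC fg y.
have bf := blip_shift y h0 fC; have bg := blip_shift y h0 gC.
have mf := blip_measurable bf; have mg := blip_measurable bg.
rewrite /step -(expectB _ (M := 1))//; try by [case: bf|case: bg].
by apply: expect_abs_le => //; exact: measurable_funB.
Qed.

Lemma iter_step_sup h (mu : nat -> probability V R) n f g e : (forall k, 0 <= h k) -> blip C f -> blip C g ->
  (forall y, `|f y - g y| <= e) ->
  forall y, `|iter_step h mu n f y - iter_step h mu n g y| <= e.
Proof.
move=> h0; elim: n f g => //= n IH f g fC gC fg y.
apply: IH; [exact: step_blip|exact: step_blip|move=> {}y].
exact: step_sup fC gC fg y.
Qed.

(** Lindeberg's replacement, one step at a time: every intermediate function stays in [blip C], so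
    exchanging the law of step [k] costs [eps k], and the kernels of the other steps do not increase
    a uniform error. *)
Lemma iter_step_close h (mu mu' : nat -> probability V R) n f (eps : nat -> R) : (forall k, 0 <= h k) ->
  (forall k g, (k < n)%N -> blip C g ->
     `|\int[mu k]_z g z - \int[mu' k]_z g z| <= eps k) ->
  blip C f -> forall x,
  `|iter_step h mu n f x - iter_step h mu' n f x| <= \sum_(k < n) eps k.
Proof.
move=> h0; elim: n f => [|n IH] f He fC x /=; first by rewrite subrr normr0 big_ord0.
rewrite big_ord_recr/=.
apply: le_trans (ler_distD (iter_step h mu' n (step (h n) (mu n) f) x) _ _) _.
apply: lerD.
  by apply: IH; [move=> k g kn; apply: He; rewrite ltnW|exact: step_blip].
apply: iter_step_sup => //; try exact: step_blip.
by move=> y; apply: He => //; exact: blip_shift.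
Qed.

Section expectation.
Variables (disp : measure_display) (Omega : measurableType disp).
Variable P : probability Omega R.
Variable z : nat -> Omega -> V.
Hypothesis mz : forall k, measurable_fun setT (z k).
Variable h : nat -> R.
Hypothesis h0 : forall k, 0 <= h k.

Let Phi k (y x : V) := J (h k) (y + x).

Let mPhi k : measurable_fun setT (fun p : V * V => Phi k p.1 p.2).
Proof.
apply: (measurableT_comp (measurable_resolvent kap0 ell0 q0 (h0 k))).
exact: (measurable_rowD measurable_fst measurable_snd).
Qed.

Let eulerE x k w : euler kap ell q h (z ^~ w) x k = chain z Phi x k w.
Proof. by elim: k => //= k <-. Qed.

Lemma measurable_euler x k : measurable_fun setT (fun w => euler kap ell q h (z ^~ w) x k).
Proof.
by under eq_fun do rewrite eulerE; exact: measurable_chain.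
Qed.

Lemma expect_iter_step (mu : nat -> probability V R) N n f x :
  indep_seq P z N -> (n <= N)%N ->
  (forall k A, (k < N)%N -> measurable A -> P (z k @^-1` A) = mu k A) ->
  blip C f ->
  \int[P]_w f (euler kap ell q h (z ^~ w) x n) = iter_step h mu n f x.
Proof.
move=> zN + Hmu; elim: n f => [|n IH] f nN fC /=.
  exact: expect_cst.
rewrite -(IH _ (ltnW nN) (step_blip (mu n) (h0 n) fC)).
have mf := blip_measurable fC.
transitivity (\int[P]_w f (Phi n (chain z Phi x n w) (z n w))).
  by apply: eq_Rintegral => w _; rewrite /= eulerE.
have [f1 _] := fC.
rewrite (@expect_indep _ _ _ _ _ _ _ P (chain z Phi x n) (z n) (measurable_chain mz x mPhi n) (mz n)
  _ (fun p => f (Phi n p.1 p.2)) 1).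
- apply: eq_Rintegral => w _; rewrite eulerE /step /Rintegral; congr fine.
  have ms := blip_measurable (blip_shift (chain z Phi x n w) (h0 n) fC).
  transitivity (\int[law P (mz n)]_x0 (f (J (h n) (chain z Phi x n w + x0)))%:E)%E; last first.
    by apply: eq_measure_integral => A mA _; exact: Hmu.
  symmetry; apply: (integral_pushforward (mz n)).
  - exact/measurable_EFinP.
  - rewrite preimage_setT; apply: (@bounded_integrable _ _ _ P (fun w' => f (J (h n) (chain z Phi x n w + z n w'))) 1).
      exact: measurableT_comp ms (mz n).
    by move=> w'; exact: f1.
  - exact: measurableT.
- by move=> A B mA mB; exact: (chain_indep mz x mPhi zN nN mA mB).
- exact: (measurableT_comp mf (mPhi n)).
- by move=> p; exact: f1.
Qed.

Lemma resolvent_sqr (k : nat) (x : V) :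
  (1 + h k * (kap + ell)) * enorm (J (h k) x) ^+ 2 <= enorm x ^+ 2 + h k * (kap + ell).
Proof.
have := resolvent_growth kap0 ell0 q0 x (h0 k).
have := enorm_ge0 (J (h k) x); have := enorm_ge0 x.
set b := enorm _; set a := enorm _; set c := h k * _ => b0 a0 H.
have c0 : 0 <= c by rewrite mulr_ge0 ?addr_ge0.
have c1 : 0 < 1 + c by lra.
rewrite -(ler_pM2l c1).
have : ((1 + c) * a) ^+ 2 <= (b + c) ^+ 2.
  by rewrite lerXn2r ?nnegrE ?mulr_ge0 ?addr_ge0//; lra.
(* The difference of the two sides is [c (b - 1)^2]. *)
have : (b + c) ^+ 2 <= (1 + c) * (b ^+ 2 + c).
  by have := mulr_ge0 c0 (sqr_ge0 (b - 1)); rewrite !expr2; lra.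
by rewrite exprMn; nra.
Qed.

(** With [c = kap + ell], a bound [M >= s / c + 1] is preserved by
    [M -> (M + s h + c h) / (1 + c h)] for every step [h] at once. *)
Lemma euler_second_moment (mu : nat -> probability V R) (s M : R) N x :
  indep_seq P z N -> 0 <= s -> 0 < kap + ell ->
  (forall k A, (k < N)%N -> measurable A -> P (z k @^-1` A) = mu k A) ->
  (forall k, (k < N)%N -> centered (s * h k) (mu k)) ->
  enorm x ^+ 2 <= M -> s / (kap + ell) + 1 <= M ->
  (\int[P]_w (enorm (euler kap ell q h (z ^~ w) x N) ^+ 2)%:E <= M%:E)%E.
Proof.
move=> zN s0 c0 Hmu Hc xM sM; set c := kap + ell in c0 sM *.
have hc k : 0 < 1 + h k * c by rewrite ltr_wpDr// mulr_ge0// ltW.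
under eq_integral do rewrite eulerE.
apply: (@chain_second_moment _ _ _ _ P z mz Phi x mPhi N
  (fun k => (1 + h k * c)^-1) (fun k => (1 + h k * c)^-1 * (s * h k + h k * c)) zN
  _ _ _ (fun=> M)) => //.
- by move=> k; rewrite invr_ge0 ltW.
- by move=> k; rewrite mulr_ge0 ?addr_ge0 ?mulr_ge0// ?invr_ge0 ltW.
- move=> k y kN.
  have mz2 : measurable_fun setT (fun w => (enorm (y + w) ^+ 2)%:E : \bar R).
    apply/measurable_EFinP; apply: measurable_funX.
    by apply: (measurableT_comp (@measurable_enorm R d)); apply: measurable_rowD.
  apply: (@le_trans _ _ (\int[P]_w (((1 + h k * c)^-1)%:E * ((enorm (y + z k w) ^+ 2)%:E + (h k * c)%:E)))%E).
    apply: ge0_le_integral => //.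
    - by move=> w _; rewrite lee_fin sqr_ge0.
    - apply/measurable_EFinP; apply: measurable_funX.
      apply: (measurableT_comp (@measurable_enorm R d)).
      exact: (measurableT_comp (mPhi k) (measurable_fun_pair (measurable_cst y) (mz k))).
    - apply: emeasurable_funM => //; apply: emeasurable_funD => //.
      exact: (measurableT_comp mz2 (mz k)).
    - move=> w _; rewrite -EFinD -EFinM lee_fin -(ler_pM2l (hc k)) mulrA divff ?gt_eqF// mul1r.
      exact: resolvent_sqr.
  rewrite ge0_integralZl_EFin//; last 3 first.
  - by move=> w _; rewrite adde_ge0// lee_fin ?sqr_ge0// mulr_ge0// ltW.
  - by apply: emeasurable_funD => //; exact: (measurableT_comp mz2 (mz k)).
  - by rewrite invr_ge0 ltW.
  rewrite ge0_integralD//; last 3 first.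
  - by move=> w _; rewrite lee_fin sqr_ge0.
  - exact: (measurableT_comp mz2 (mz k)).
  - by move=> w _; rewrite lee_fin mulr_ge0// ltW.
  rewrite integral_cst//= probability_setT mule1.
  have -> : (\int[P]_x0 (enorm (y + z k x0) ^+ 2)%:E = \int[mu k]_x0 (enorm (y + x0) ^+ 2)%:E)%E.
    transitivity (\int[law P (mz k)]_x0 (enorm (y + x0) ^+ 2)%:E)%E; last first.
      by apply: eq_measure_integral => A mA _; exact: Hmu.
    rewrite (@ge0_integral_pushforward _ _ _ _ _ _ (mz k) P setT _ measurableT mz2) ?preimage_setT//.
    by move=> y' _; rewrite lee_fin sqr_ge0.
  apply: (@le_trans _ _ (((1 + h k * c)^-1)%:E * ((enorm y ^+ 2 + s * h k)%:E + (h k * c)%:E))%E).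
    rewrite lee_wpmul2l ?lee_fin ?invr_ge0 ?(ltW (hc k))//.
    by apply: leeD => //; apply: centered_shift; exact: Hc.
  by rewrite -EFinD -EFinM lee_fin -mulrDr addrA.
- move=> k kN; rewrite -mulrDr -(ler_pM2l (hc k)) mulrA divff ?gt_eqF// mul1r.
  have : s + c <= c * M.
    by rewrite -(ler_pM2l c0) in sM; move: sM; rewrite mulrDr mulr1 mulrCA divff ?mulr1// gt_eqF.
  have := h0 k; nra.
Qed.

End expectation.
End kernels.

(** * Laws determined by Lipschitz functions *)

Section determination.
Variables (R : realType) (d : nat).
Local Notation V := 'rV[R]_d.

(** With equal exponents the last error of [charfun_expect_close] vanishes; a large [L], then an [n]
    large in terms of [L], bring each of the two others below [e / 2]. *)
Lemma charfun_unique (C : R) (A : V -> R) (mu1 mu2 : probability V R) f (s : R) :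
  0 <= C -> blip C f -> symmetric_charfun A mu1 -> symmetric_charfun A mu2 ->
  centered s mu1 -> centered s mu2 -> (forall xi, 0 <= A xi) ->
  \int[mu1]_x f x = \int[mu2]_x f x.
Proof.
move=> C0 fC A1 A2 c1 c2 A0.
apply/eqP; rewrite -subr_eq0 -normr_le0; apply/ler_addgt0Pr => e e0; rewrite add0r.
have d0 : 0 <= d%:R :> R by [].
have s0 : 0 <= s.
  by rewrite -lee_fin; apply: le_trans (c1.1); apply: integral_ge0 => z _; rewrite lee_fin sqr_ge0.
pose L := (4 * C * s + 1) / e + 1.
have L0 : 0 < L by rewrite ltr_wpDl// divr_ge0 ?(ltW e0)// addr_ge0// !mulr_ge0.
pose n := (Num.truncn (10 * C * L * d%:R / e)).+1.
have H := charfun_expect_close (ltn0Sn _ : (0 < n)%N) L0 C0 fC A1 A2 c1 c2 A0 A0 (eps := 0)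
  (fun xi _ => _).
apply: le_trans (H _) _; first by move=> xi; rewrite subrr normr0.
rewrite mulr0 addr0.
have n0 : 0 < n%:R :> R by rewrite ltr0n.
have : 2 * C * s / L <= e / 2.
  rewrite ler_pdivrMr// /L mulrDr mulr1.
  have -> : e / 2 * ((4 * C * s + 1) / e) = (4 * C * s + 1) / 2.
    by field; rewrite gt_eqF.
  by lra.
have : 5 * C * L * d%:R / n%:R <= e / 2.
  rewrite ler_pdivrMr//.
  have : 10 * C * L * d%:R / e < n%:R by exact: truncnS_gt.
  by rewrite ltr_pdivrMr// => H'; lra.
by lra.
Qed.

Definition orthant (a : 'I_d -> R) : set V := [set x | forall i, x 0 i <= a i].

Lemma measurable_orthant a : measurable (orthant a).
Proof.
apply: (measurable_forall_ord (P := fun i => [set x : V | x 0 i <= a i])) => i.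
rewrite (_ : [set x : V | _] = (fun x : V => x 0 i) @^-1` (`]-oo, a i]%classic : set R)); last first.
  by apply/seteqP; split => x /=; rewrite in_itv.
by apply: measurable_preimage => //; exact: measurable_coord.
Qed.

Lemma measurable_orthants : (@measurable _ V) = <<s range orthant >>.
Proof.
apply/seteqP; split; last first.
  apply: smallest_sub; first exact: sigma_algebra_measurable.
  by move=> _ [a _ <-]; exact: measurable_orthant.
apply: smallest_sub; first exact: smallest_sigma_algebra.
move=> B; rewrite -bigcup_seq => -[i _ [C mC <-]]; rewrite setTI.
have [S0 SC SU] := @smallest_sigma_algebra V setT (range orthant).
pose G := [set C : set R | <<s range orthant >> ((fun x : V => x 0 i) @^-1` C)].
have E : (@measurable _ (measurableTypeR R)) = <<s @RGenOInfty.G R>> := RGenOInfty.measurableE R.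
have mC' : <<s @RGenOInfty.G R>> C by rewrite -E.
suff H : <<s @RGenOInfty.G R >> `<=` G by exact: H.
apply: smallest_sub.
  split; rewrite /G/=.
  - by rewrite preimage_set0.
  - by move=> A GA; rewrite setTD preimage_setC -setTD; exact: SC.
  - by move=> F GF; rewrite preimage_bigcup; exact: SU.
move=> _ [x ->]; rewrite /G/=.
rewrite (_ : _ @^-1` _ = setT `\` [set y : V | y 0 i <= x]); last first.
  rewrite setTD; apply/seteqP; split => y /=; rewrite in_itv/= andbT => H.
    by apply/negP; rewrite -ltNge.
  by rewrite ltNge; apply/negP.
apply: SC.
rewrite (_ : [set y : V | _] = \bigcup_n orthant (fun j => if j == i then x else n%:R)); last first.
  apply/seteqP; split => [y /= yx|y [n _] /(_ i)]; last by rewrite eqxx.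
  exists (Num.truncn (enorm y)).+1 => // j; case: eqP => [->//|_].
  apply: le_trans (ler_norm _) _; apply: le_trans (coord_enorm y j) _.
  by rewrite ltW// truncnS_gt.
by apply: SU => n; apply: sub_sigma_algebra; exists (fun j => if j == i then x else n%:R).
Qed.

(** Lipschitz, equal to 1 on the orthant and tending to 0 at each point off it. *)
Let ramp (n : nat) (a : 'I_d -> R) (x : V) : R :=
  1 - Num.min 1 (n%:R * \sum_i Num.max 0 (x 0 i - a i)).

Let ramp_blip n a : blip (n%:R * d%:R) (ramp n a).
Proof.
have S0 (x : V) : 0 <= n%:R * \sum_i Num.max 0 (x 0 i - a i).
  by rewrite mulr_ge0// sumr_ge0// => i _; rewrite le_max lexx.
split=> [x|x y].
  rewrite /ramp ler_norml; have := S0 x.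
  by case: (leP 1) => H1 H2; apply/andP; split; lra.
have maxl (u v : R) : `|Num.max 0 u - Num.max 0 v| <= `|u - v|.
  by rewrite !maxEle; case: (leP 0 u); case: (leP 0 v) => *; rewrite ler_norml;
     have := ler_norm (u - v); have := ler_norm (v - u); rewrite (distrC v u) => *;
     apply/andP; split; lra.
have minl (u v : R) : `|(1 - Num.min 1 u) - (1 - Num.min 1 v)| <= `|u - v|.
  by rewrite !minEle; case: (leP 1 u); case: (leP 1 v) => *; rewrite ler_norml;
     have := ler_norm (u - v); have := ler_norm (v - u); rewrite (distrC v u) => *;
     apply/andP; split; lra.
apply: le_trans (minl _ _) _.
rewrite -mulrBr normrM ger0_norm// -mulrA ler_wpM2l// -sumrB.
apply: le_trans (ler_norm_sum _ _ _) _.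
rewrite mulrC -[d in d%:R](card_ord d) mulr_natr -sumr_const; apply: ler_sum => i _.
apply: le_trans (maxl _ _) _.
rewrite opprB addrA subrK; have := coord_enorm (x - y) i.
by rewrite !mxE.
Qed.

Lemma expect_dominated (disp : measure_display) (T : measurableType disp)
    (mu : probability T R) (f : nat -> T -> R) (g : T -> R) (M : R) :
  (forall n, measurable_fun setT (f n)) -> measurable_fun setT g ->
  (forall n x, `|f n x| <= M) ->
  (forall x, f n x @[n --> \oo] --> g x) ->
  \int[mu]_x f n x @[n --> \oo] --> \int[mu]_x g x.
Proof.
move=> mf mg fM fg.
have gM x : `|g x| <= M.
  have /(cvg_norm) H := fg x.
  have -> : `|g x| = lim (`|f n x| @[n --> \oo]) by apply/esym/cvg_lim.
  by apply: limr_le; [apply/cvg_ex; exists (`|g x|)|exact: nearW].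
have iM : mu.-integrable setT (EFin \o (fun=> M) : T -> \bar R).
  by apply: (@bounded_integrable _ _ _ mu (fun=> M) `|M|).
have [] := @dominated_convergence _ T R mu setT measurableT (fun n => EFin \o f n) (EFin \o g) (EFin \o (fun=> M)).
- by move=> n; exact/measurable_EFinP.
- exact/measurable_EFinP.
- by apply: aeW => x _; apply: cvg_EFin; [exact: nearW|exact: fg].
- exact: iM.
- by apply: aeW => x n _ /=; rewrite lee_fin.
move=> _ _ H.
apply: fine_cvg; rewrite /Rintegral fineK.
  exact: H.
by rewrite (Rintegral_EFin _ mg gM).
Qed.

(** Orthants form a pi-system that generates the sigma-algebra, and their indicators are bounded
    limits of the functions [ramp n]. *)
Lemma measure_eq_blip (mu1 mu2 : probability V R) :
  (forall C f, 0 <= C -> blip C f -> \int[mu1]_x f x = \int[mu2]_x f x) ->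
  forall A, measurable A -> mu1 A = mu2 A.
Proof.
move=> H A mA.
apply: (measure_unique (range orthant) (fun n => orthant (fun=> n%:R))) => //.
- exact: measurable_orthants.
- move=> _ _ [a _ <-] [b _ <-]; exists (fun i => Num.min (a i) (b i)) => //.
  apply/seteqP; split => x /=.
    by move=> xab; split => i; have := xab i; rewrite le_min => /andP[].
  by move=> [xa xb] i; rewrite le_min xa xb.
- apply/seteqP; split => // x _; exists (Num.truncn (enorm x)).+1 => // i.
  apply: le_trans (ler_norm _) _; apply: le_trans (coord_enorm x i) _.
  by rewrite ltW// truncnS_gt.
- move=> _ [a _ <-]; have ma := measurable_orthant a.
  have key (mu : probability V R) : \int[mu]_x ramp n a x @[n --> \oo] --> \int[mu]_x (\1_(orthant a) x : R).
    apply: (@expect_dominated _ _ mu _ _ 1).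
    - by move=> n; exact: blip_measurable (ramp_blip n a).
    - exact: measurable_indic.
    - by move=> n x; have [] := ramp_blip n a.
    - move=> x; have [xa|xa] := pselect (orthant a x).
        rewrite indicE mem_set//= (_ : (fun n => ramp n a x) = fun=> 1); first exact: cvg_cst.
        apply/funext => n; rewrite /ramp big1 ?mulr0; last first.
          by move=> i _; apply/max_idPl; rewrite subr_le0.
        by rewrite (elimT min_idPr)// subr0.
      rewrite indicE memNset//=.
      pose e := \sum_i Num.max 0 (x 0 i - a i).
      have e0 : 0 < e.
        have [i xi] : exists i, a i < x 0 i.
          apply: contrapT => /forallNP Hn; apply: xa => i; rewrite leNgt; exact/negP.
        rewrite /e (bigD1 i)//= ltr_wpDr//.
          by rewrite sumr_ge0// => j _; rewrite le_max lexx.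
        by rewrite lt_max subr_gt0 xi orbT.
      apply/cvgrPdist_le => eps eps0; near=> n.
      rewrite sub0r normrN /ramp -/e (elimT min_idPl) ?subrr ?normr0 ?(ltW eps0)//.
      rewrite -ler_pdivrMr// mul1r; near: n; exact: nbhs_infty_ger.
  have e1 := key mu1; have e2 := key mu2.
  have E : \int[mu1]_x (\1_(orthant a) x : R) = \int[mu2]_x (\1_(orthant a) x : R).
    apply: (cvg_unique (@norm_hausdorff _ _) e1); rewrite (_ : (fun n => \int[mu1]_x ramp n a x) = (fun n => \int[mu2]_x ramp n a x))//.
    by apply/funext => n; apply: (H (n%:R * d%:R)); [rewrite mulr_ge0|exact: ramp_blip].
  rewrite !expect_indic// in E.
  have F1 := fineK (fin_num_prob mu1 ma); have F2 := fineK (fin_num_prob mu2 ma).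
  by rewrite -[LHS]F1 -[RHS]F2 E.
- by move=> n; rewrite (le_lt_trans (probability_le1 _ (measurable_orthant _)))// ltry.
Unshelve. all: by end_near.
Qed.

End determination.

Lemma ge0_integral_law (R : realType) (d1 d2 : measure_display)
    (T1 : measurableType d1) (T2 : measurableType d2) (f : T1 -> T2)
    (m : {measure set T1 -> \bar R}) (mf : measurable_fun setT f) (g : T2 -> \bar R) :
  measurable_fun setT g -> (forall y, 0 <= g y)%E ->
  (\int[law m mf]_y g y = \int[m]_x g (f x))%E.
Proof.
move=> mg g0; have H := @ge0_integral_pushforward _ _ _ _ _ _ mf m setT g measurableT mg
  (fun y _ => g0 y).
by rewrite preimage_setT in H.
Qed.

Section convergence.
Variables (R : realType) (d : nat).
Local Notation V := 'rV[R]_d.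

(** The topology of rows comes from the sup norm; this lemma and the next one pass to the Euclidean
    norm and back. *)
Lemma cvg_enorm_lt (T : Type) (F : set_system T) {FF : Filter F} (x : T -> V) (l : V) e :
  x @ F --> l -> 0 < e -> \forall s \near F, enorm (x s - l) < e.
Proof.
move=> xl e0; have e'0 : 0 < e / d.+1%:R by rewrite divr_gt0.
have /cvg_ballP/(_ _ e'0) := xl; apply: filterS => s Hs.
apply: le_lt_trans (enorm_le_sum _) _.
apply: (@le_lt_trans _ _ (\sum_(i < d) e / d.+1%:R)).
  apply: ler_sum => i _; have /ltW := Hs.2 0 i.
  by rewrite distrC !mxE.
rewrite sumr_const card_ord -[X in X < _]mulr_natr mulrAC ltr_pdivrMr//.
by rewrite ltr_pM2l// ltr_nat.
Qed.

Lemma enorm_lt_cvg (T : Type) (F : set_system T) {FF : Filter F} (x : T -> V) (l : V) :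
  (forall e, 0 < e -> \forall s \near F, enorm (x s - l) < e) -> x @ F --> l.
Proof.
move=> H; apply/cvg_ballP => e e0; apply: filterS (H e e0) => s Hs; split => // i j.
rewrite /ball/= (ord1 i) distrC; apply: le_lt_trans Hs.
by have := coord_enorm (x s - l) j; rewrite !mxE.
Qed.

Lemma markov_enorm (disp : measure_display) (T : measurableType disp)
    (P : probability T R) (X : T -> V) (M r : R) :
  measurable_fun setT X -> 0 < r -> (\int[P]_w (enorm (X w) ^+ 2)%:E <= M%:E)%E ->
  measurable [set w | r < enorm (X w)] /\
  (P [set w | (r < enorm (X w))%R] <= (M / r ^+ 2)%:E)%E.
Proof.
move=> mX r0 HM.
have mE : measurable_fun setT (fun w => enorm (X w)).
  exact: (measurableT_comp (@measurable_enorm R d) mX).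
have mA : measurable [set w | r < enorm (X w)].
  rewrite (_ : [set w | _] = (fun w => enorm (X w)) @^-1` (`]r, +oo[%classic : set R)); last first.
    by apply/seteqP; split => w /=; rewrite in_itv/= andbT.
  exact: measurable_preimage.
split => //; set A := [set w | _] in mA *.
have r2 : 0 < r ^+ 2 by rewrite exprn_gt0.
rewrite -[leLHS]mul1e -(@divff _ (r ^+ 2)) ?gt_eqF// mulrC EFinM -muleA.
rewrite [(M / _)%:E]EFinM [in leRHS]muleC lee_wpmul2l ?lee_fin ?invr_ge0 ?(ltW r2)//.
apply: le_trans HM; rewrite -(setIT A) -integral_indic//.
rewrite -ge0_integralZl_EFin ?(ltW r2)//; last first.
- by apply/measurable_EFinP; exact: measurable_indic.
apply: ge0_le_integral => //.
- by move=> w _; rewrite mule_ge0// lee_fin ?(ltW r2)// indicE.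
- by apply: emeasurable_funM => //; apply/measurable_EFinP; exact: measurable_indic.
- by apply/measurable_EFinP; exact: measurable_funX.
move=> w _; rewrite -EFinM lee_fin indicE; have [wA|wA] := boolP (w \in A).
  rewrite mulr1 lerXn2r ?nnegrE ?(ltW r0)//.
  by move: wA; rewrite inE => /ltW.
by rewrite mulr0 sqr_ge0.
Qed.

End convergence.

(** * Maximal inequality for processes with independent increments *)

Section maximal.
Variables (R : realType) (d : nat) (disp : measure_display).
Variables (Omega : measurableType disp) (P : probability Omega R).
Local Notation V := 'rV[R]_d.
Variable Z : R -> Omega -> V.

Definition centered_increments (k : R) :=
  forall s t (mI : measurable_fun setT (increment Z s t)),
  0 <= s -> s <= t -> centered (k * (t - s)) (law P mI).

Hypothesis mZ : measurable_process Z.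
Hypothesis iZ : independent_increments P Z.

Lemma measurable_increment s t : 0 <= s -> s <= t ->
  measurable_fun setT (increment Z s t).
Proof.
move=> s0 st; apply: measurable_rowB; apply: mZ => //; exact: le_trans st.
Qed.

Lemma indep_increments (t : nat -> R) n : 0 <= t 0%N -> (forall i, t i <= t i.+1) ->
  indep_seq P (fun k => increment Z (t k) (t k.+1)) n.
Proof. by move=> t0 tS A mA; exact: iZ. Qed.

Variable k : R.
Hypothesis k0 : 0 <= k.
Hypothesis cZ : centered_increments k.
Hypothesis rZ : {ae P, forall w, forall t, 0 <= t -> Z s w @[s --> t^'+] --> Z t w}.

Section discrete.
Variables (t : nat -> R) (r : R).
Hypotheses (t0 : 0 <= t 0%N) (tS : forall i, t i <= t i.+1) (r0 : 0 < r).

Let t_ge0 i : 0 <= t i.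
Proof. by elim: i => // i IH; exact: le_trans (tS i). Qed.

Let S i w : V := Z (t i) w - Z (t 0%N) w.

Let bad n : set Omega := [set w | exists2 i, (i <= n)%N & r < enorm (S i w)].

(** The walk is frozen from the first time it is outside the ball of radius [r]. *)
Let Phi (_ : nat) (y z : V) : V := y + (\1_[set y : V | enorm y <= r] y) *: z.

Let mPhi i : measurable_fun setT (fun p : V * V => Phi i p.1 p.2).
Proof.
have mb : measurable [set y : V | enorm y <= r].
  rewrite (_ : [set y : V | _] = @enorm R d @^-1` (`]-oo, r]%classic : set R)); last first.
    by apply/seteqP; split => w /=; rewrite in_itv/=.
  by apply: measurable_preimage => //; exact: measurable_enorm.
apply: measurable_fun_rV => j.
rewrite (_ : (fun _ => _) = (fun p : V * V => p.1 0 j + \1_[set y : V | enorm y <= r] p.1 * p.2 0 j)); last first.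
  by apply/funext => p; rewrite !mxE.
have m1 : measurable_fun setT (fun p : V * V => p.1 0 j).
  by apply: (measurableT_comp (@measurable_coord R d j)); exact: measurable_fst.
apply: measurable_funD => //; apply: measurable_funM.
  apply: (measurableT_comp (measurable_indic mb)); exact: measurable_fst.
by apply: (measurableT_comp (@measurable_coord R d j)); exact: measurable_snd.
Qed.

Let zeta i := increment Z (t i) (t i.+1).

Let mzeta i : measurable_fun setT (zeta i).
Proof. exact: measurable_increment. Qed.

Let y := chain zeta Phi 0.

Let stopped n w : (forall i, (i <= n)%N -> enorm (S i w) <= r) /\ y n w = S n w \/
  r < enorm (y n w).
Proof.
elim: n => [|n [[Hn yn]|yn]].
- left; rewrite /y/= /S subrr; split => // i; rewrite leqn0 => /eqP ->.
  by rewrite subrr enorm0 ltW.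
- have yS : y n.+1 w = S n.+1 w.
    rewrite /y /= -/y yn /Phi indicE mem_set ?scale1r; last exact: Hn.
    by rewrite /S /zeta /increment addrC addrA subrK.
  have [H|H] := leP (enorm (S n.+1 w)) r; last by right; rewrite yS.
  left; split => // i; rewrite leq_eqVlt => /orP[/eqP ->//|]; exact: Hn.
- right; rewrite /y /= -/y /Phi indicE memNset ?scale0r ?addr0//.
  by apply/negP; rewrite -ltNge.
Qed.

Let bad_sub n : bad n `<=` [set w | r < enorm (y n w)].
Proof.
move=> w [i iN Hi]; have [[H _]|//] := stopped n w.
by have := H i iN; rewrite leNgt Hi.
Qed.

Lemma measurable_exceed n : measurable
  [set w | exists2 i, (i <= n)%N & r < enorm (Z (t i) w - Z (t 0%N) w)].
Proof.
rewrite (_ : [set w | _] = \bigcup_(i < n.+1) [set w | r < enorm (S i w)]); last first.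
  by apply/seteqP; split => w [i iN Hi]; exists i.
apply: bigcup_measurable => i _.
rewrite (_ : [set w | _] = (fun w => enorm (S i w)) @^-1` (`]r, +oo[%classic : set R)); last first.
  by apply/seteqP; split => w /=; rewrite in_itv/= andbT.
apply: measurable_preimage => //.
by apply: (measurableT_comp (@measurable_enorm R d)); apply: measurable_rowB; exact: mZ.
Qed.

(** Freezing keeps the walk a chain driven by independent noise, so each step adds at most the
    second moment of its increment. A walk that has left the ball ends, once frozen, outside it, and
    Markov's inequality concludes. *)
Lemma kolmogorov n :
  (P [set w | exists2 i, (i <= n)%N & (r < enorm (Z (t i) w - Z (t 0%N) w))%R]
    <= (k * (t n - t 0%N) / r ^+ 2)%:E)%E.
Proof.
have my i : measurable_fun setT (y i) by exact: measurable_chain.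
have HM : (\int[P]_w (enorm (y n w) ^+ 2)%:E <= (k * (t n - t 0%N))%:E)%E.
  apply: (@chain_second_moment _ _ _ _ P zeta mzeta Phi 0 mPhi n (fun=> 1)
    (fun i => k * (t i.+1 - t i)) (indep_increments n t0 tS) _ _ _
    (fun i => k * (t i - t 0%N))) => //.
  - by move=> i; rewrite mulr_ge0// subr_ge0.
  - move=> i x _; rewrite mul1r.
    have [xr|xr] := leP (enorm x) r; last first.
      rewrite (eq_integral (fun=> (enorm x ^+ 2)%:E)); last first.
        move=> w _; rewrite /Phi indicE memNset ?scale0r ?addr0//.
        by apply/negP; rewrite -ltNge.
      rewrite integral_cst//= probability_setT mule1 lee_fin lerDl.
      by rewrite mulr_ge0// subr_ge0.
    have <- : (\int[law P (mzeta i)]_z (enorm (x + z) ^+ 2)%:E =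
      \int[P]_w (enorm (Phi i x (zeta i w)) ^+ 2)%:E)%E.
      have mx : measurable_fun setT (fun z : V => (enorm (x + z) ^+ 2)%:E : \bar R).
        apply/measurable_EFinP; apply: measurable_funX.
        by apply: (measurableT_comp (@measurable_enorm R d)); apply: measurable_rowD.
      rewrite (ge0_integral_law P (mzeta i) mx); last by move=> z; rewrite lee_fin sqr_ge0.
      by apply: eq_integral => w _; rewrite /Phi indicE mem_set// scale1r.
    by apply: centered_shift; exact: cZ.
  - by rewrite enorm0 subrr mulr0 expr0n.
  - by move=> i _; rewrite mul1r -mulrDr addrC addrA subrK.
have [mA HA] := markov_enorm (my n) r0 HM.
apply: le_trans HA; apply: le_measure => //; rewrite ?inE//.
- exact: measurable_exceed.
- exact: bad_sub.
Qed.

End discrete.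

(** The dyadic grids of [[a, b]] are nested, so the exceptional events of [kolmogorov] increase and
    their union obeys the same bound; right-continuity carries the estimate from grid points to all
    times. *)
Lemma maximal a b r : 0 <= a -> a <= b -> 0 < r ->
  exists G : set Omega, [/\ measurable G,
    (P (~` G) <= (k * (b - a) / r ^+ 2)%:E)%E &
    forall w, G w -> forall s, a <= s <= b -> enorm (Z s w - Z a w) <= r].
Proof.
move=> a0 ab r0.
pose t n i : R := a + (b - a) * i%:R / 2 ^+ n.
have p2 n : 0 < 2 ^+ n :> R by rewrite exprn_gt0.
have ba0 : 0 <= b - a by rewrite subr_ge0.
have t0 n : t n 0%N = a by rewrite /t mulr0 mul0r addr0.
have tS n i : t n i <= t n i.+1.
  by rewrite lerD2l ler_pM2r ?invr_gt0// ler_wpM2l// ler_nat.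
have tN n : t n (2 ^ n)%N = b.
  by rewrite /t natrX mulfK ?gt_eqF// addrC subrK.
have t2 n i : t n.+1 (2 * i)%N = t n i.
  rewrite /t natrM exprS; congr (_ + _).
  by field; rewrite gt_eqF.
pose E n := [set w | exists2 i, (i <= 2 ^ n)%N & r < enorm (Z (t n i) w - Z (t n 0%N) w)].
have mE n : measurable (E n) by apply: measurable_exceed => //; rewrite t0.
have PE n : (P (E n) <= (k * (b - a) / r ^+ 2)%:E)%E.
  have tn0 : 0 <= t n 0%N by rewrite t0.
  by apply: le_trans (@kolmogorov (t n) r tn0 (tS n) r0 (2 ^ n)%N) _; rewrite tN t0.
have mUE : measurable (\bigcup_n E n) by exact: bigcup_measurable.
have ndE : {homo E : n m / (n <= m)%N >-> (n <= m)%O}.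
  apply: homo_leq => //; [by move=> A B C AB BC; exact: le_trans AB BC|].
  move=> n; apply/subsetPset => w [i iN Hi]; exists (2 * i)%N.
    by rewrite expnS leq_mul2l iN orbT.
  by rewrite t2 !t0 in Hi *.
have PUE : (P (\bigcup_n E n) <= (k * (b - a) / r ^+ 2)%:E)%E.
  have H := nondecreasing_cvg_mu mE mUE ndE (mu := P).
  rewrite -(cvg_lim _ H)//; apply: lime_le; first by apply/cvg_ex; exists (P (\bigcup_n E n)).
  by apply: nearW => n; exact: PE.
have [N [mN PN HN]] := rZ.
exists (~` (\bigcup_n E n) `&` ~` N); split.
- by apply: measurableI; apply: measurableC.
- rewrite setCI !setCK; apply: (le_trans (measureU2 _ _ _)) => //.
  by rewrite [X in (_ + X)%E]PN adde0.
move=> w [wE wN] s /andP[as_ sb].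
have rw : forall t, 0 <= t -> Z s w @[s --> t^'+] --> Z t w.
  by apply: contrapT => H; exact/wN/HN.
have Ht n i : (i <= 2 ^ n)%N -> enorm (Z (t n i) w - Z a w) <= r.
  move=> iN; rewrite leNgt; apply/negP => Hr; apply: wE; exists n => //.
  by exists i => //; rewrite t0.
have [->|sb'] := eqVneq s b; first by rewrite -(tN 0%N); exact: Ht.
have {sb'}sb : s < b by rewrite lt_neqAle sb' sb.
rewrite leNgt; apply/negP => Hr.
pose e := enorm (Z s w - Z a w) - r.
have e0 : 0 < e by rewrite subr_gt0.
have s0 : 0 <= s by exact: le_trans as_.
have : \forall s1 \near s^'+, enorm (Z s1 w - Z s w) < e by exact: cvg_enorm_lt (rw s s0) e0.
move=> /nbhs_ballP[del /= del0 Hd].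
pose del' := Num.min del (b - s).
have del'0 : 0 < del' by rewrite lt_min del0 subr_gt0.
have ba : 0 < b - a by rewrite subr_gt0 (le_lt_trans as_).
have [n Hn] : exists n : nat, (b - a) / del' < 2 ^+ n.
  exists (Num.truncn ((b - a) / del')).+1; rewrite (lt_trans (truncnS_gt _))//.
  by rewrite -natrX ltr_nat ltn_expl.
have step_lt : (b - a) / 2 ^+ n < del'.
  by rewrite ltr_pdivrMr// mulrC -ltr_pdivrMr.
pose x := (s - a) * 2 ^+ n / (b - a).
have x0 : 0 <= x by rewrite divr_ge0 ?(ltW ba)// mulr_ge0 ?subr_ge0// ltW.
have /andP[x1 x2] := truncn_itv x0.
(* The first grid point strictly after [s]; it does not pass [b] because [del' <= b - s]. *)
pose i := (Num.truncn x).+1.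
have ts : s < t n i.
  rewrite /t -ltrBlDl mulrAC -ltr_pdivrMl ?divr_gt0//.
  by have -> : ((b - a) / 2 ^+ n)^-1 * (s - a) = x by rewrite /x; field; rewrite !gt_eqF.
have td : t n i - s < del'.
  apply: le_lt_trans step_lt; rewrite /t /i -natr1.
  rewrite (_ : a + _ - s = (b - a) / 2 ^+ n * ((Num.truncn x)%:R - x + 1)); last first.
    by rewrite /x; field; rewrite !gt_eqF.
  by rewrite ger_pMr ?divr_gt0//; lra.
have iN : (i <= 2 ^ n)%N.
  have : t n i < b by move: td; rewrite /del' lt_min => /andP[_]; rewrite ltrD2r.
  rewrite -(tN n) /t ltrD2l ltr_pM2r ?invr_gt0// ltr_pM2l// ltr_nat; exact: ltnW.
have := Hd (t n i); rewrite /ball/= distrC gtr0_norm ?subr_gt0//.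
have tdel : t n i - s < del by apply: lt_le_trans td _; rewrite ge_min lexx.
move=> /(_ tdel ts); rewrite /e => H.
have := ler_enormD (Z s w - Z (t n i) w) (Z (t n i) w - Z a w).
rewrite addrA subrK enormBC => H2.
have := Ht n i iN; lra.
Qed.

End maximal.

(** * Cadlag paths and differential inequalities *)

Section right_continuity.
Variable R : realType.

Let measurable_grid (F : nat -> R) (c T : R) : 0 < c ->
  measurable_fun (`[0, T]%classic : set R) (fun s => F (Num.truncn (c * s))).
Proof.
move=> c0 _ Y mY.
rewrite (_ : _ `&` _ = \bigcup_(k in [set k | Y (F k)])
    ((`[0, T]%classic : set R) `&` (`[k%:R / c, k.+1%:R / c[%classic : set R))); last first.
  apply/seteqP; split => [s [/= s0T Ys]|s [k Yk [/= s0T]]].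
    exists (Num.truncn (c * s)) => //; split => //=.
    have cs0 : 0 <= c * s by move: s0T; rewrite in_itv/= => /andP[s0 _]; rewrite mulr_ge0 ?(ltW c0).
    have /andP[H1 H2] := truncn_itv cs0.
    by rewrite in_itv/= ler_pdivrMr// ltr_pdivlMr// [s * c]mulrC H1.
  rewrite in_itv/= ler_pdivrMr// ltr_pdivlMr// [s * c]mulrC => /andP[H1 H2].
  by split => //=; rewrite (truncn_def (n := k)) ?H1.
by apply: bigcup_measurable => k _; exact: measurableI.
Qed.

(** Pointwise limit of step functions whose value at [s] is that of [g] at a grid point strictly to
    the right of [s]. *)
Lemma right_continuous_measurable (g : R -> R) (T : R) :
  (forall t, 0 <= t -> g s @[s --> t^'+] --> g t) ->
  measurable_fun (`[0, T]%classic : set R) g.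
Proof.
move=> gc; pose h n (s : R) := g ((Num.truncn (n.+1%:R * s)).+1%:R / n.+1%:R).
apply: (@measurable_fun_cvg _ _ _ _ h).
  by move=> n; exact: (measurable_grid (fun k => g (k.+1%:R / n.+1%:R))).
move=> s /=; rewrite in_itv/= => /andP[s0 sT].
have p n : s < (Num.truncn (n.+1%:R * s)).+1%:R / n.+1%:R <= s + n.+1%:R^-1.
  have cs0 : 0 <= n.+1%:R * s by rewrite mulr_ge0.
  have /andP[H1 H2] := truncn_itv cs0.
  have n0 : 0 < n.+1%:R :> R by [].
  rewrite ltr_pdivlMr// [s * _]mulrC H2/= ler_pdivrMr// mulrDl mulVf ?gt_eqF//.
  by rewrite -natr1 lerD2r [s * _]mulrC.
apply/cvgrPdist_lt => e e0.
have /cvgrPdist_lt/(_ e e0) := gc s s0.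
move=> /nbhs_ballP[del /= del0 Hd].
near=> n; apply: Hd; last by have /andP[] := p n.
have /andP[p1 p2] := p n.
rewrite /ball/= distrC gtr0_norm ?subr_gt0// ltrBlDl; apply: le_lt_trans p2 _.
rewrite ltrD2l; near: n; exact: near_infty_natSinv_lt (PosNum del0).
Unshelve. all: by end_near.
Qed.

(* If [phi] has nonpositive upper right derivative while it is above [A],
   it stays below [max A (phi s)]. *)
Lemma right_decrease (phi : R -> R) (A s t : R) : s <= t ->
  (forall r e : R, s <= r <= t -> 0 < e -> exists2 del, 0 < del &
    forall r', s <= r' <= t -> `|r' - r| < del -> `|phi r' - phi r| < e) ->
  (forall r e : R, s <= r < t -> A <= phi r -> 0 < e -> exists2 del, 0 < del &
    forall r', r < r' < r + del -> r' <= t -> phi r' <= phi r + e * (r' - r)) ->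
  phi t <= Num.max A (phi s).
Proof.
move=> st phic phid; set K := Num.max A (phi s).
apply/ler_addgt0Pr => e0 e00.
pose e := e0 / (1 + (t - s)).
have ts0 : 0 <= t - s by rewrite subr_ge0.
have e_gt0 : 0 < e by rewrite divr_gt0// ltr_pwDl.
suff H : phi t <= K + e * (t - s).
  apply: le_trans H _; rewrite lerD2l /e mulrAC ler_pdivrMr ?ltr_pwDl//.
  by rewrite ler_pM2l// lerDr.
(* Continuous induction: [tau] is the supremum of the times up to which [phi] stays below the line
   of slope [e]. Continuity puts [tau] itself in [S], and the bound on the right of [tau] would push
   beyond it if [tau < t]. *)
pose S := [set r | s <= r <= t /\ forall u, s <= u <= r -> phi u <= K + e * (u - s)].
have Ss : S s.
  split; first by rewrite lexx st.
  move=> u /andP[us su]; have -> : u = s by apply/eqP; rewrite eq_le us su.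
  by rewrite subrr mulr0 addr0 /K le_max lexx orbT.
have Sub : ubound S t by move=> r [/andP[]].
have hS : has_sup S by split; [exists s|exists t].
pose tau := sup S.
have tau_s : s <= tau by apply: (ub_le_sup _ Ss); exists t.
have tau_t : tau <= t by apply: ge_sup => //; exists s.
have Stau0 u : s <= u -> u < tau -> phi u <= K + e * (u - s).
  move=> su ut; have ut0 : 0 < tau - u by rewrite subr_gt0.
  have [r Sr ur] := sup_adherent ut0 hS.
  case: Sr => _ Hr; apply: Hr; rewrite su/= ltW//.
  by move: ur; rewrite -/tau opprB addrC subrK.
have Ptau : phi tau <= K + e * (tau - s).
  have [->|tne] := eqVneq tau s; first by apply: Ss.2; rewrite lexx.
  have {tne}stau : s < tau by rewrite lt_neqAle eq_sym tne tau_s.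
  apply/ler_addgt0Pr => e1 e10.
  have [|del del0 Hd] := phic tau e1 _ e10; first by rewrite tau_s tau_t.
  pose u := Num.max s (tau - del / 2).
  have d2 : 0 < del / 2 by rewrite divr_gt0.
  have su : s <= u by rewrite le_max lexx.
  have ut : u < tau by rewrite gt_max stau/= ltrBlDr ltrDl.
  have ud : `|u - tau| < del.
    rewrite distrC gtr0_norm ?subr_gt0// ltrBlDl -ltrBlDr lt_max; apply/orP; right.
    by rewrite ltrD2l ltrN2 ltr_pdivrMr// ltr_pMr// ltr1n.
  have := Hd u _ ud; rewrite su (le_trans (ltW ut) tau_t) => /(_ isT).
  have := Stau0 u su ut.
  have : e * (u - s) <= e * (tau - s) by rewrite ler_pM2l// lerD2r ltW.
  by rewrite ltr_norml => H1 H2 /andP[H3 H4]; lra.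
have Stau : S tau.
  split; first by rewrite tau_s tau_t.
  move=> u /andP[su]; rewrite le_eqVlt => /orP[/eqP ->//|]; exact: Stau0.
have [<-//|tn] := eqVneq tau t.
have {tn}tt : tau < t by rewrite lt_neqAle tn tau_t.
suff [del del0 Hd] : exists2 del, 0 < del & forall r', tau < r' < tau + del -> r' <= t ->
    phi r' <= K + e * (r' - s).
  pose r' := Num.min t (tau + del / 2).
  have tr : tau < r' by rewrite lt_min tt/= ltrDl divr_gt0.
  have Sr : S r'.
    split; first by rewrite (le_trans tau_s (ltW tr)) ge_min lexx.
    move=> u /andP[su ur]; have [ut|ut] := leP u tau; first by apply: Stau.2; rewrite su.
    apply: Hd; last by rewrite (le_trans ur)// ge_min lexx.
    rewrite ut/= (le_lt_trans ur)// gt_min; apply/orP; right.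
    by rewrite ltrD2l ltr_pdivrMr// ltr_pMr// ltr1n.
  have : r' <= tau by apply: (ub_le_sup _ Sr); exists t.
  by rewrite leNgt tr.
have [At|At] := leP A (phi tau).
  have [|del del0 Hd] := phid tau e _ At e_gt0; first by rewrite tau_s tt.
  exists del => // r' H1 H2; apply: le_trans (Hd _ H1 H2) _.
  by have := Ptau; rewrite -subr_ge0 => H; rewrite -subr_ge0; apply: le_trans H _;
    apply: le_of_eq; ring.
have e10 : 0 < A - phi tau by rewrite subr_gt0.
have [|del del0 Hd] := phic tau _ _ e10; first by rewrite tau_s tau_t.
exists del => // r' /andP[H1 H2] H3.
have sr' : s <= r' by rewrite (le_trans tau_s)// ltW.
have := Hd r'; rewrite sr' H3 gtr0_norm ?subr_gt0// ltrBlDl => /(_ isT H2).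
rewrite ltr_norml => /andP[_]; rewrite ltrD2r => /ltW H.
have ers : 0 <= e * (r' - s) by apply: mulr_ge0; [exact: ltW|rewrite subr_ge0].
have AK : A <= K by rewrite /K le_max lexx.
lra.
Qed.

(** [E] is an integrating factor for the growth rate [kappa], specified by an inequality instead of
    a differential equation; [right_decrease] is applied to the product [phi E]. *)
Lemma right_growth (phi E kappa : R -> R) (A Em s t : R) : s <= t -> 0 <= A ->
  (forall r, s <= r <= t -> 0 <= phi r) ->
  (forall r e : R, s <= r <= t -> 0 < e -> exists2 del, 0 < del &
    forall r', s <= r' <= t -> `|r' - r| < del -> `|phi r' - phi r| < e) ->
  (forall r e : R, s <= r <= t -> 0 < e -> exists2 del, 0 < del &
    forall r', s <= r' <= t -> `|r' - r| < del -> `|E r' - E r| < e) ->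
  (forall r, s <= r <= t -> 0 < E r <= Em) ->
  (forall r, s <= r < t -> exists2 del, 0 < del &
    forall r', r < r' < r + del -> r' <= t -> (1 + (r' - r) * kappa r) * E r' <= E r) ->
  (forall r e : R, s <= r < t -> A <= phi r -> 0 < e -> exists2 del, 0 < del &
    forall r', r < r' < r + del -> r' <= t ->
      phi r' <= (1 + (r' - r) * kappa r) * phi r + e * (r' - r)) ->
  phi t * E t <= Num.max (A * Em) (phi s * E s).
Proof.
move=> st A0 phi0 phic Ec E0 Ek phid.
have sst : s <= s <= t by rewrite lexx st.
have Em0 : 0 < Em by have /andP[/lt_le_trans] := E0 s sst; apply.
apply: (@right_decrease (fun r => phi r * E r)) => //.
- move=> r e rst e0.
  have p0 := phi0 r rst.
  pose e1 := e / (2 * (Em + phi r + 1)).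
  have D0 : 0 < 2 * (Em + phi r + 1) by rewrite mulr_gt0// ltr_wpDl// addr_ge0// ltW.
  have e10 : 0 < e1 by rewrite divr_gt0.
  have [d1 d10 H1] := phic r e1 rst e10.
  have [d2 d20 H2] := Ec r e1 rst e10.
  exists (Num.min d1 d2); first by rewrite lt_min d10.
  move=> r' r'st; rewrite lt_min => /andP[/(H1 _ r'st) {}H1 /(H2 _ r'st) {}H2].
  have /andP[Er'0 Er'] := E0 r' r'st.
  have -> : phi r' * E r' - phi r * E r = (phi r' - phi r) * E r' + phi r * (E r' - E r) by ring.
  apply: le_lt_trans (ler_normD _ _) _; rewrite !normrM (gtr0_norm Er'0) (ger0_norm p0).
  have eE : e = e1 * (2 * (Em + phi r + 1)) by rewrite /e1 divfK// gt_eqF.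
  have : `|phi r' - phi r| * E r' <= e1 * Em by apply: ler_pM => //; exact: ltW.
  have : phi r * `|E r' - E r| <= phi r * e1 by rewrite ler_wpM2l// ltW.
  by rewrite eE; nra.
- move=> r e rst Ar e0.
  have rst' : s <= r <= t by case/andP: rst => -> /ltW ->.
  have /andP[Er0 Er] := E0 r rst'.
  have p0 := phi0 r rst'.
  have AP : A <= phi r.
    rewrite leNgt; apply/negP => H; move: Ar; rewrite leNgt; apply/negP; rewrite negbK.
    apply: (@le_lt_trans _ _ (phi r * Em)); first by rewrite ler_wpM2l.
    by rewrite ltr_pM2r.
  have e10 : 0 < e / Em by rewrite divr_gt0.
  have [d1 d10 H1] := phid r _ rst AP e10.
  have [d2 d20 H2] := Ek r rst.
  exists (Num.min d1 d2); first by rewrite lt_min d10.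
  move=> r' /andP[rr' r'd] r't.
  have r'1 : r < r' < r + d1 by rewrite rr' (lt_le_trans r'd)// lerD2l ge_min lexx.
  have r'2 : r < r' < r + d2 by rewrite rr' (lt_le_trans r'd)// lerD2l ge_min lexx orbT.
  have {}H1 := H1 r' r'1 r't; have {}H2 := H2 r' r'2 r't.
  have r'st : s <= r' <= t by rewrite r't andbT (le_trans _ (ltW rr'))//; case/andP: rst.
  have /andP[Er'0 Er'] := E0 r' r'st.
  have h0 : 0 < r' - r by rewrite subr_gt0.
  apply: le_trans (ler_wpM2r (ltW Er'0) H1) _.
  rewrite mulrDl mulrAC; apply: lerD; first by rewrite mulrC ler_wpM2l.
  rewrite mulrAC ler_pM2r// mulrC -ler_pdivlMr//.
  by rewrite invf_div mulrA [e * _]mulrC mulfK ?gt_eqF.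
Qed.

End right_continuity.

(** * Pathwise estimates for equations with additive noise *)

Section paths.
Variables (R : realType) (d : nat).
Local Notation V := 'rV[R]_d.
Implicit Types (x z : R -> V) (b : R -> V -> V).

(** Near each time the path is controlled on the left by its left limit and on the right by its
    value; compactness of [[0, T]] does the rest. *)
Lemma cadlag_bounded x T : cadlag x -> exists M : R, forall t : R, 0 <= t <= T -> enorm (x t) <= M.
Proof.
move=> [xr xl].
have /compact_near_coveringP/(_ R (pinfty_nbhs R)
  (fun M t => 0 <= t <= T -> enorm (x t) <= M)) := @segment_compact R 0 T.
move=> []; last first.
- move=> M [_ HM]; exists (M + 1) => t tT.
  by apply: (HM (M + 1)) => //; rewrite ?ltrDl//= in_itv.
- move=> t /=; rewrite in_itv/= => /andP[t0 tT].
  have [C1 [e1 e10 H1]] : exists C1, exists2 e1, 0 < e1 &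
      forall s, t - e1 < s < t -> 0 <= s -> enorm (x s) <= C1.
    move: t0; rewrite le_eqVlt => /orP[/eqP <-|t0].
      exists 0; exists 1 => // s /andP[_ s0] s0'.
      by move: s0'; rewrite leNgt s0.
    have : \forall s \near t^'-, enorm (x s - lim (x s @[s --> t^'-])) < 1.
      by apply: cvg_enorm_lt => //; exact: xl.
    move=> /nbhs_ballP[del /= del0 Hd].
    exists (1 + enorm (lim (x s @[s --> t^'-]))); exists del => // s /andP[sd st] _.
    have := Hd s; rewrite /ball/= gtr0_norm ?subr_gt0// ltrBlDl -ltrBlDr => /(_ sd st).
    have := ler_enorm_sub (x s) (lim (x s @[s --> t^'-])); lra.
  have [e2 e20 H2] : exists2 e2, 0 < e2 &
      forall s, t < s < t + e2 -> enorm (x s) <= 1 + enorm (x t).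
    have : \forall s \near t^'+, enorm (x s - x t) < 1.
      by apply: cvg_enorm_lt => //; exact: xr.
    move=> /nbhs_ballP[del /= del0 Hd]; exists del => // s /andP[ts sd].
    have := Hd s; rewrite /ball/= distrC gtr0_norm ?subr_gt0// ltrBlDl => /(_ sd ts).
    have := ler_enorm_sub (x s) (x t); lra.
  pose C := Num.max C1 (1 + enorm (x t)).
  exists ((ball t (Num.min e1 e2)), [set M | C < M]) => /=.
    split; first by apply: nbhsx_ballx; rewrite lt_min e10.
    by exists C; split => //; exact: num_real.
  move=> [s M] [/= ts CM] /andP[s0 sT]; apply: le_trans (ltW CM).
  move: ts; rewrite /ball/= lt_min => /andP[ts1 ts2].
  rewrite /C le_max; have [st|st] := ltP s t.
    apply/orP; left; apply: H1 => //; rewrite st andbT.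
    by move: ts1; rewrite gtr0_norm ?subr_gt0// ltrBlDl -ltrBlDr.
  apply/orP; right; move: st; rewrite le_eqVlt => /orP[/eqP <-|st]; first by rewrite lerDr.
  apply: H2; rewrite st/=.
  by move: ts2; rewrite distrC gtr0_norm ?subr_gt0// ltrBlDl.
Qed.

Definition jointly_continuous b := forall (t : R) (x : V) (e : R), 0 <= t -> 0 < e ->
  exists2 del : R, 0 < del & forall (s : R) (y : V), 0 <= s -> `|s - t| < del ->
    enorm (y - x) < del -> enorm (b s y - b t x) < e.

Lemma cadlag_drift b x : jointly_continuous b -> cadlag x -> cadlag (fun t => b t (x t)).
Proof.
move=> bc [xr xl]; split => [t t0|t t0].
  apply: enorm_lt_cvg => e e0.
  have [del del0 H] := bc t (x t) e t0 e0.
  have : \forall s \near t^'+, enorm (x s - x t) < del by apply: cvg_enorm_lt => //; exact: xr.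
  move=> /nbhs_ballP[d1 /= d10 Hd]; apply/nbhs_ballP; exists (Num.min d1 del).
    by rewrite /= lt_min d10.
  move=> s /=; rewrite /ball/= lt_min => /andP[s1 s2] ts.
  apply: H => //; [by rewrite (le_trans t0)// ltW|by rewrite distrC|exact: Hd].
apply/cvg_ex; exists (b t (lim (x s @[s --> t^'-]))).
apply: enorm_lt_cvg => e e0.
have [del del0 H] := bc t (lim (x s @[s --> t^'-])) e (ltW t0) e0.
have : \forall s \near t^'-, enorm (x s - lim (x s @[s --> t^'-])) < del.
  by apply: cvg_enorm_lt => //; exact: xl.
move=> /nbhs_ballP[d1 /= d10 Hd]; apply/nbhs_ballP; exists (Num.min t (Num.min d1 del)).
  by rewrite /= !lt_min d10 t0.
move=> s /=; rewrite /ball/= !lt_min => /and3P[s0 s1 s2] st.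
apply: H => //; [|by rewrite distrC|exact: Hd].
by move: s0; rewrite gtr0_norm ?subr_gt0// ltrBlDl -ltrBlDr subrr => /ltW.
Qed.

(* All that is used of the integral equation x = x(0) + \int b(s, x_s) ds + z. *)
Definition drift_path b x z := forall (s t : R) (beta : V) (e : R), 0 <= s -> s <= t ->
  (forall r, s <= r <= t -> enorm (b r (x r) - beta) <= e) ->
  enorm (x t - x s - (z t - z s) - (t - s) *: beta) <= d%:R * ((t - s) * e).

(** Subtracting the equations at [s] and [t] leaves the integral of [b - beta] over []s, t]],
    estimated coordinate by coordinate; hence the factor [d]. *)
Lemma integral_equation_drift_path b x z : jointly_continuous b -> cadlag x ->
  (forall t, 0 <= t -> forall i, x t 0 i = x 0 0 i +
     \int[@lebesgue_measure R]_(s in `[0, t]) b s (x s) 0 i + z t 0 i) ->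
  drift_path b x z.
Proof.
move=> bc cx Hx s t beta e s0 st Hb.
have cbx := cadlag_drift bc cx.
have [M HM] := cadlag_bounded t cbx.
have t0 : 0 <= t by exact: le_trans st.
apply: le_trans (enorm_le_sum _) _.
rewrite -[d in leRHS](card_ord d) mulr_natl -sumr_const; apply: ler_sum => i _.
pose g r := b r (x r) 0 i.
have mg T : measurable_fun (`[0, T]%classic : set R) g.
  apply: right_continuous_measurable => r r0.
  apply/cvgrPdist_lt => e1 e10.
  have : \forall s \near r^'+, enorm (b s (x s) - b r (x r)) < e1.
    by apply: cvg_enorm_lt => //; exact: cbx.1.
  apply: filterS => u; rewrite enormBC; apply: le_lt_trans.
  by have := coord_enorm (b r (x r) - b u (x u)) i; rewrite !mxE.
have ig : (@lebesgue_measure R).-integrable `[0, t] (EFin \o g).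
  apply: (@measurable_bounded_integrable _ _ _ lebesgue_measure) => //.
  - have /= -> := @lebesgue_measure_itv R `[0%R, t].
    by case: ifP => //= _; rewrite -EFinB ltry.
  - exact: mg.
  - exists M; split; first exact: num_real.
    move=> M' MM' r /=; rewrite in_itv/= => rt; apply: le_trans (ltW MM').
    by apply: le_trans (HM r rt); exact: coord_enorm.
have Hint : \int[@lebesgue_measure R]_(r in `[0, t]) g r - \int[@lebesgue_measure R]_(r in `[0, s]) g r
    = \int[@lebesgue_measure R]_(r in `]s, t]) g r.
  by apply: Rintegral_itvB => //; rewrite /= ?bnd_simp.
have ig' : (@lebesgue_measure R).-integrable `]s, t] (EFin \o g).
  apply: (integrableS _ _ _ ig) => // r /=; rewrite !in_itv/= => /andP[sr ->].
  by rewrite (le_trans s0 (ltW sr)).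
have icst (a : R) : (@lebesgue_measure R).-integrable `]s, t] (EFin \o cst a).
  apply: (@measurable_bounded_integrable _ _ _ lebesgue_measure) => //.
  - have /= -> := @lebesgue_measure_itv R `]s, t].
    by case: ifP => //= _; rewrite -EFinB ltry.
  - by exists `|a|; split; [exact: num_real|move=> M' MM' r _ /=; exact: ltW].
have cstE (a : R) : \int[@lebesgue_measure R]_(r in `]s, t]) a = a * (t - s).
  rewrite Rintegral_cst//; congr (_ * _).
  have /= -> := @lebesgue_measure_itv R `]s, t].
  move: st; rewrite le_eqVlt => /orP[/eqP ->|st]; first by rewrite lte_fin ltxx/= subrr.
  by rewrite lte_fin st.
rewrite ![in leLHS]mxE (Hx t t0 i) (Hx s s0 i).
have -> : x 0 0 i + \int[lebesgue_measure]_(r in `[0, t]) b r (x r) 0 i + z t 0 i -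
   (x 0 0 i + \int[lebesgue_measure]_(r in `[0, s]) b r (x r) 0 i + z s 0 i) -
   (z t 0 i - z s 0 i) - (t - s) * beta 0 i = \int[lebesgue_measure]_(r in `]s, t]) (g r - beta 0 i).
  rewrite RintegralB//; last exact: icst.
  rewrite (cstE (beta 0 i)) -Hint /g; ring.
apply: le_trans (le_normr_Rintegral _ _) _ => //.
  exact: (integrableB _ ig' (icst _)).
rewrite [leRHS]mulrC -cstE; apply: le_Rintegral => //.
  exact: (integrable_abse (integrableB _ ig' (icst _))).
  exact: icst.
move=> r /=; rewrite in_itv/= => /andP[sr rt].
have := Hb r; rewrite (ltW sr) rt => /(_ isT); apply: le_trans.
by have := coord_enorm (b r (x r) - beta) i; rewrite !mxE.
Qed.

Section drift_bounds.
Variables (b : R -> V -> V) (x z : R -> V).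
Hypothesis bc : jointly_continuous b.
Hypothesis cx : cadlag x.
Hypothesis xz : drift_path b x z.

Lemma drift_path_lipschitz T : exists2 B : R, 0 <= B &
  forall r r', 0 <= r -> r <= r' -> r' <= T ->
    enorm (x r' - x r - (z r' - z r)) <= B * (r' - r).
Proof.
have [M HM] := cadlag_bounded T (cadlag_drift bc cx).
exists (d%:R * Num.max 0 M); first by rewrite mulr_ge0// le_max lexx.
move=> r r' r0 rr' r'T.
have := @xz r r' 0 (Num.max 0 M) r0 rr'; rewrite scaler0 subr0 mulrA mulrAC => H.
apply: H => u /andP[ru ur']; rewrite subr0 le_max HM ?orbT//.
by rewrite (le_trans r0 ru) (le_trans ur' r'T).
Qed.

Lemma drift_path_right_derivative (r e : R) : 0 <= r -> 0 < e ->
  exists2 del : R, 0 < del & forall r', r < r' < r + del ->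
    enorm (x r' - x r - (z r' - z r) - (r' - r) *: b r (x r)) <= e * (r' - r).
Proof.
move=> r0 e0; have e10 : 0 < e / d.+1%:R by rewrite divr_gt0.
have : \forall s \near r^'+, enorm (b s (x s) - b r (x r)) < e / d.+1%:R.
  by apply: cvg_enorm_lt => //; exact: (cadlag_drift bc cx).1.
move=> /nbhs_ballP[del /= del0 Hd]; exists del => // r' /andP[rr' r'd].
apply: le_trans (@xz r r' (b r (x r)) (e / d.+1%:R) r0 (ltW rr') _) _.
  move=> u /andP[ru ur']; move: ru; rewrite le_eqVlt => /orP[/eqP <-|ru].
    by rewrite subrr enorm0 ltW.
  apply: ltW; apply: Hd => //; rewrite /ball/= distrC gtr0_norm ?subr_gt0// ltrBlDl.
  exact: le_lt_trans r'd.
rewrite mulrCA mulrC ler_pM2r ?subr_gt0// mulrCA ger_pMr//.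
by rewrite ler_pdivrMr// mul1r ler_nat.
Qed.

(** The path [x] may jump, but [x - z] is locally Lipschitz with right derivative [b r (x r)], so
    [right_growth] applies to its norm. Adding [M0] lets a bound on the noise enter a homogeneous
    growth condition. *)
Lemma drift_growth (v0 : V) (s t M0 A Em : R) (kappa E : R -> R) : 0 <= s -> s <= t ->
  0 <= A -> 0 <= M0 ->
  (forall r e : R, s <= r <= t -> 0 < e -> exists2 del, 0 < del &
    forall r', s <= r' <= t -> `|r' - r| < del -> `|E r' - E r| < e) ->
  (forall r, s <= r <= t -> 0 < E r <= Em) ->
  (forall r, s <= r < t -> exists2 del, 0 < del &
    forall r', r < r' < r + del -> r' <= t -> (1 + (r' - r) * kappa r) * E r' <= E r) ->
  (forall r, s <= r < t -> A <= enorm (x r - (z r - v0)) + M0 -> exists2 del, 0 < del &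
    forall h, 0 < h < del -> enorm (x r - (z r - v0) + h *: b r (x r)) + M0 <=
      (1 + h * kappa r) * (enorm (x r - (z r - v0)) + M0)) ->
  (enorm (x t - (z t - v0)) + M0) * E t <= Num.max (A * Em) ((enorm (x s - (z s - v0)) + M0) * E s).
Proof.
move=> s0 st A0 M00 Ec E0 Ek Hb.
apply: (@right_growth _ (fun r => enorm (x r - (z r - v0)) + M0) E kappa) => //.
- by move=> r _; rewrite addr_ge0.
- move=> r e rst e0; have [B B0 HB] := drift_path_lipschitz t.
  have B10 : 0 < B + 1 by rewrite ltr_wpDl.
  exists (e / (B + 1)); first by rewrite divr_gt0.
  have key u v : s <= u -> u <= v -> v <= t -> v - u < e / (B + 1) ->
      `|enorm (x v - (z v - v0)) + M0 - (enorm (x u - (z u - v0)) + M0)| < e.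
    move=> su uv vt vue.
    rewrite [in X in `|X|](_ : _ - _ = enorm (x v - (z v - v0)) - enorm (x u - (z u - v0))); last by ring.
    apply: le_lt_trans (ler_dist_enorm _ _) _.
    have -> : x v - (z v - v0) - (x u - (z u - v0)) = x v - x u - (z v - z u).
      by apply/rowP => i; rewrite !mxE; ring.
    apply: le_lt_trans (HB u v (le_trans s0 su) uv vt) _.
    apply: (@le_lt_trans _ _ ((B + 1) * (v - u))).
      by rewrite ler_wpM2r ?subr_ge0// lerDl.
    by rewrite mulrC -ltr_pdivlMr.
  move=> r' /andP[sr' r't]; case/andP: rst => sr rt; have [rr'|/ltW rr'] := leP r r'.
    by rewrite ger0_norm ?subr_ge0//; exact: key.
  by rewrite [in X in X -> _]distrC ger0_norm ?subr_ge0// => H; rewrite distrC; exact: key.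
- move=> r e rst Ar e0; have [d1 d10 H1] := Hb r rst Ar.
  have /andP[sr rt] := rst.
  have [d2 d20 H2] := drift_path_right_derivative (le_trans s0 sr) e0.
  exists (Num.min d1 d2); first by rewrite lt_min d10.
  move=> r' /andP[rr' r'd] r't.
  have h1 : 0 < r' - r < d1.
    by rewrite subr_gt0 rr' ltrBlDl (lt_le_trans r'd)// lerD2l ge_min lexx.
  have h2 : r < r' < r + d2.
    by rewrite rr' (lt_le_trans r'd)// lerD2l ge_min lexx orbT.
  have := H1 _ h1; have := H2 _ h2.
  set w := x r - (z r - v0) => G1 G2.
  have -> : x r' - (z r' - v0) = (w + (r' - r) *: b r (x r)) +
      (x r' - x r - (z r' - z r) - (r' - r) *: b r (x r)).
    by rewrite /w; apply/rowP => i; rewrite !mxE; ring.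
  have := ler_enormD (w + (r' - r) *: b r (x r))
    (x r' - x r - (z r' - z r) - (r' - r) *: b r (x r)).
  by lra.
Qed.

Section dissipative.
Variable rho : R -> V -> R.
Hypothesis bE : forall r y, b r y = - rho r y *: y.
Hypothesis rho0 : forall r y, 0 <= r -> 0 <= rho r y.
Variables (s t M : R).
Hypotheses (s0 : 0 <= s) (st : s <= t) (M0 : 0 <= M).
Hypothesis zM : forall r, s <= r <= t -> enorm (z r - z s) <= M.

(** The damping acts on [x], not on [w = x - (z r - z s)]. When [|w| >= 2 M] the noise undoes at
    most half of it, whence the rate [c / 2]. *)
Let decay_step (c A r : R) : s <= r < t -> 2 * M <= A -> A <= enorm (x r - (z r - z s)) ->
  0 <= c <= rho r (x r) -> exists2 del, 0 < del &
    forall h, 0 < h < del -> enorm (x r - (z r - z s) + h *: b r (x r)) <=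
      (1 + h * (- (c / 2))) * enorm (x r - (z r - z s)).
Proof.
move=> /andP[sr rt] MA Ar /andP[c0 cr].
set w := x r - (z r - z s) in Ar *; set p := rho r (x r) in cr *.
have p0 : 0 <= p by apply: le_trans cr.
exists (p + 1)^-1; first by rewrite invr_gt0 ltr_wpDl.
move=> h /andP[h0 hp].
have hp1 : h * p <= 1.
  have : h * (p + 1) < 1 by rewrite -ltr_pdivlMr ?ltr_wpDl// mul1r.
  by rewrite mulrDr; lra.
have -> : w + h *: b r (x r) = (1 - h * p) *: w - (h * p) *: (z r - z s).
  by rewrite bE -/p /w; apply/rowP => i; rewrite !mxE; ring.
apply: le_trans (ler_enormB _ _) _; rewrite !enormZ (ger0_norm (_ : 0 <= 1 - h * p)) ?subr_ge0//.
have hp0 : 0 <= h * p by rewrite mulr_ge0// ltW.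
rewrite (ger0_norm hp0).
have zr : enorm (z r - z s) <= M by apply: zM; rewrite sr ltW.
have : h * c <= h * p by rewrite ler_pM2l.
have := enorm_ge0 w; have := enorm_ge0 (z r - z s).
move: (enorm w) (enorm (z r - z s)) Ar zr => a m Ar zr m0 a0 hc.
have h1 : (h * p) * m <= (h * p) * (a / 2) by rewrite ler_wpM2l//; lra.
have h2 : (h * c) * (a / 2) <= (h * p) * (a / 2) by rewrite ler_wpM2r//; lra.
by rewrite (_ : (1 + h * - (c / 2)) * a = a - (h * c) * (a / 2)); [lra|field].
Qed.

Lemma drift_stable A : 2 * M <= A -> enorm (x t - (z t - z s)) <= Num.max A (enorm (x s)).
Proof.
move=> MA; have A0 : 0 <= A by apply: le_trans MA; rewrite mulr_ge0.
have := @drift_growth (z s) s t 0 A 1 (fun=> 0) (fun=> 1) s0 st A0 (lexx 0).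
rewrite !addr0 !mulr1 (subrr (z s)) subr0; apply.
- by move=> r e _ e0; exists 1 => // *; rewrite subrr normr0.
- by move=> r _; rewrite ltr01 lexx.
- by move=> r _; exists 1 => // *; rewrite mulr0 addr0 mulr1.
- move=> r rst; rewrite addr0 => Ar.
  have [|del del0 H] := decay_step rst MA Ar (c := 0).
    by rewrite lexx rho0//; case/andP: rst => /(le_trans s0).
  exists del => // h /H; rewrite mul0r oppr0 mulr0 addr0 => {}H.
  by rewrite ?mulr0 !addr0.
Qed.

(** Either [x - (z - z s)] enters the ball of radius [A] at some time, and the damping keeps it
    there, or the lower bound [c] holds throughout and an exponential integrating factor applies. *)
Lemma drift_decay A c : 2 * M <= A -> 0 <= c ->
  (forall r, s <= r < t -> A <= enorm (x r - (z r - z s)) -> c <= rho r (x r)) ->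
  enorm (x t - (z t - z s)) <= Num.max A (expR (- (c / 2 * (t - s))) * enorm (x s)).
Proof.
move=> MA c0 Hc; have A0 : 0 <= A by apply: le_trans MA; rewrite mulr_ge0.
have [[r0 rst r0A]|Hn] := pselect (exists2 r, s <= r <= t & enorm (x r - (z r - z s)) <= A).
  have /andP[sr rt] := rst.
  rewrite le_max; apply/orP; left.
  have := @drift_growth (z s) r0 t 0 A 1 (fun=> 0) (fun=> 1) (le_trans s0 sr) rt A0 (lexx 0).
  rewrite !addr0 !mulr1 => H.
  apply: (@le_trans _ _ (Num.max A (enorm (x r0 - (z r0 - z s))))); last by rewrite ge_max lexx.
  apply: H.
  - by move=> r e _ e0; exists 1 => // *; rewrite subrr normr0.
  - by move=> r _; rewrite ltr01 lexx.
  - by move=> r _; exists 1 => // *; rewrite mulr0 addr0 mulr1.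
  - move=> r /andP[rr0 rt']; rewrite addr0 => Ar.
    have rst' : s <= r < t by rewrite rt' andbT (le_trans sr).
    have [|del del0 H] := decay_step rst' MA Ar (c := 0).
      by rewrite lexx rho0// (le_trans s0)// (le_trans sr).
    exists del => // h /H; rewrite mul0r oppr0 mulr0 addr0 => {}H.
    by rewrite ?mulr0 !addr0.
pose E r := expR (c / 2 * (r - s)).
have := @drift_growth (z s) s t 0 0 (expR (c / 2 * (t - s))) (fun=> - (c / 2)) E s0 st (lexx 0) (lexx 0).
rewrite /E (subrr (z s)) subr0 (subrr s) mulr0 expR0 mulr1 mul0r !addr0 => H.
rewrite le_max; apply/orP; right.
rewrite expRN mulrC ler_pdivlMr ?expR_gt0// -[leRHS](elimT max_idPr (enorm_ge0 (x s))).
apply: H.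
- move=> r e rst e0.
  have : {for r, continuous (fun r => expR (c / 2 * (r - s)))}.
    apply: continuous_comp; last exact: continuous_expR.
    by apply: cvgM; [exact: cvg_cst|apply: cvgB; [exact: cvg_id|exact: cvg_cst]].
  move=> /cvgrPdist_lt/(_ e e0)/nbhs_ballP[del /= del0 Hd].
  by exists del => // r' _ rr'; rewrite distrC; apply: Hd; rewrite /ball/= distrC.
- move=> r /andP[sr rt]; rewrite expR_gt0/= ler_expR ler_wpM2l ?divr_ge0//.
  by rewrite lerD2r.
- move=> r rst; exists 1 => // r' /andP[rr' _] _.
  have -> : c / 2 * (r' - s) = c / 2 * (r' - r) + c / 2 * (r - s) by ring.
  rewrite expRD mulrA ger_pMl ?expR_gt0//.
  have := expR_ge1Dx (- (c / 2 * (r' - r))); rewrite expRN => H1.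
  rewrite -ler_pdivlMr ?expR_gt0// div1r; apply: le_trans H1.
  by rewrite mulrN mulrC.
- move=> r rst _; have rst' : s <= r <= t by case/andP: rst => -> /ltW ->.
  have Ar : A <= enorm (x r - (z r - z s)).
    by rewrite leNgt; apply/negP => /ltW H1; apply: Hn; exists r.
  have [|del del0 H1] := decay_step rst MA Ar (c := c); first by rewrite c0 Hc.
  by exists del => // h /H1; rewrite !addr0.
Qed.

End dissipative.
End drift_bounds.
End paths.

Lemma prob_ae_eq (R : realType) (d1 : measure_display) (T1 : measurableType d1)
    (m : probability T1 R) (A B : set T1) : measurable A -> measurable B ->
  {ae m, forall w, A w <-> B w} -> m A = m B.
Proof.
move=> mA mB [N [mN N0 HN]].
have key (C D : set T1) : measurable C -> measurable D ->
    (forall w, ~ N w -> C w -> D w) -> (m C <= m D)%E.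
  move=> mC mD CD; apply: (@le_trans _ _ (m (D `|` N))%E).
    apply: le_measure; rewrite ?inE//; first exact: measurableU.
    by move=> w Cw; have [Nw|Nw] := pselect (N w); [right|left; exact: CD].
  apply: le_trans (measureU2 _ mD mN) _.
  by rewrite [X in (_ + X)%E]N0 adde0.
have AB w : ~ N w -> (A w <-> B w).
  by move=> Nw; apply: contrapT => H; exact/Nw/HN.
apply/eqP; rewrite eq_le; apply/andP; split; apply: key => // w Nw;
  have [H1 H2] := AB w Nw; (exact: H1 || exact: H2).
Qed.

Section law_lemmas.
Variables (R : realType) (d1 d2 : measure_display).
Variables (T1 : measurableType d1) (T2 : measurableType d2).
Variable m : probability T1 R.

Lemma expect_law (X : T1 -> T2) (mX : measurable_fun setT X) (f : T2 -> R) (M : R) :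
  measurable_fun setT f -> (forall y, `|f y| <= M) ->
  \int[law m mX]_y f y = \int[m]_w f (X w).
Proof.
move=> mf fM; rewrite /Rintegral; congr fine.
have H := @integral_pushforward _ _ _ _ _ _ mX m setT (EFin \o f).
rewrite preimage_setT in H; apply: H => //.
- exact/measurable_EFinP.
- apply: (@bounded_integrable _ _ _ m (fun w => f (X w)) M) => //.
  exact: measurableT_comp mf mX.
Qed.

End law_lemmas.

(** * Driving noises: Brownian motion and the Levy process *)

Section noise.
Variables (R : realType) (d : nat) (disp : measure_display).
Variables (Omega : measurableType disp) (P : probability Omega R).
Local Notation V := 'rV[R]_d.

(** The common ground of the two driving processes; the maximal inequality and the scheme estimates
    are proved once for it and used on both sides of the comparison. *)
Definition noise (psi : V -> R) (Z : R -> Omega -> V) :=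
  [/\ measurable_process Z,
      {ae P, forall w, Z 0 w = 0},
      independent_increments P Z,
      (forall s t (mI : measurable_fun setT (increment Z s t)), 0 <= s -> s <= t ->
         symmetric_charfun (fun xi => (t - s) * psi xi) (law P mI)) &
      {ae P, forall w, forall t, 0 <= t -> Z s w @[s --> t^'+] --> Z t w}].

Let cosM (y : V) (xi : V) : `|cos (inner xi y)| <= 1.
Proof. exact: cos_max. Qed.
Let sinM (y : V) (xi : V) : `|sin (inner xi y)| <= 1.
Proof. exact: sin_max. Qed.

Let symmetric_charfun_of (X : Omega -> V) (mX : measurable_fun setT X) (A : V -> R) :
  (forall xi, charfun P X xi = Complex (expR (- A xi)) 0) -> symmetric_charfun A (law P mX).
Proof.
move=> H xi; have := H xi; rewrite charfunE => -[Hc Hs].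
split.
  by rewrite (expect_law P mX (measurable_cosl xi) (fun y => cosM y xi)).
by rewrite (expect_law P mX (measurable_sinl xi) (fun y => sinM y xi)).
Qed.

Let realM (a c s : R) : (a%:C * (c +i* s))%C = Complex (a * c) (a * s).
Proof.
apply/eqP; rewrite eq_complex /=; apply/andP; split; apply/eqP; ring.
Qed.

Lemma brownian_noise (s2 : R) B : is_brownian P (s2%:M : 'M[R]_d) B ->
  noise (fun xi => s2 / 2 * enorm xi ^+ 2) B.
Proof.
move=> [mB B0 iB gB cB]; split => //.
- move=> s t mI s0 st; apply: symmetric_charfun_of => xi.
  rewrite (gB s t s0 st xi) inner0r /cexp/=.
  rewrite !(subr0, add0r) cos0 sin0 realM.
  rewrite -scalemxAr mul_mx_scalar !innerZl -enorm_sqr mulr1 mulr0.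
  by congr (Complex (expR _) _); field.
- apply: filterS cB => w Hw t t0.
  have /continuous_within_itvcyP[Hc Hr] := Hw.
  move: t0; rewrite le_eqVlt => /orP[/eqP <-//|t0].
  apply: cvg_at_right_filter; apply: Hc.
  by rewrite in_itv/= andbT.
Qed.

Lemma levy_noise nu L : is_pure_jump_levy P nu L ->
  (forall xi, complex.Im (levy_symbol nu xi) = 0) ->
  noise (fun xi => complex.Re (levy_symbol nu xi)) L.
Proof.
move=> [[mL L0 iL sL cL] HL] Im0; split => //.
- move=> s t mI s0 st.
  have ts0 : 0 <= t - s by rewrite subr_ge0.
  have mL0 := mL _ ts0.
  have H : symmetric_charfun (fun xi => (t - s) * complex.Re (levy_symbol nu xi)) (law P mL0).
    apply: symmetric_charfun_of => xi; rewrite HL// /cexp.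
    have := Im0 xi; case: (levy_symbol nu xi) => a b /= ->.
    rewrite !(mulr0, mul0r, subr0, add0r, addr0, oppr0) cos0 sin0.
    by rewrite realM mulr1 mulr0.
  have E (A : set V) : measurable A -> law P mI A = law P mL0 A.
    move=> mA; rewrite -[LHS]/(P (increment L s t @^-1` A)) -[RHS]/(P (L (t - s) @^-1` A)) sL//.
    apply: prob_ae_eq.
    - by apply: (@measurable_preimage _ Omega _ V) => //; apply: measurable_rowB; exact: mL.
    - by apply: (@measurable_preimage _ Omega _ V).
    - by apply: filterS L0 => w Hw; rewrite /preimage/= /increment Hw subr0.
  move=> xi; have [H1 H2] := H xi; split; [rewrite -H1|rewrite -H2];
    by rewrite /Rintegral; congr fine; apply: eq_measure_integral => A mA _; exact: E.
- by apply: filterS cL => w [].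
Qed.

Lemma noise_centered psi (s2 : R) Z : noise psi Z ->
  (forall xi, psi xi <= s2 / 2 * enorm xi ^+ 2) -> centered_increments P Z (d%:R * s2).
Proof.
move=> [mZ Z0 iZ cZ rZ] Hpsi s t mI s0 st.
rewrite -mulrA; apply: (symmetric_charfun_centered (cZ s t mI s0 st)) => u i.
have ts0 : 0 <= t - s by rewrite subr_ge0.
apply: le_trans (ler_wpM2l ts0 (Hpsi _)) _.
rewrite enormZ enorm_delta mulr1 real_normK ?num_real//.
apply: le_of_eq; ring.
Qed.

End noise.

(** * Solutions driven by continuous paths *)

Section continuous_paths.
Variables (R : realType) (d : nat).
Local Notation V := 'rV[R]_d.

Definition path_continuous (w : R -> V) := forall t e : R, 0 <= t -> 0 < e ->
  exists2 del : R, 0 < del & forall s, 0 <= s -> `|s - t| < del -> enorm (w s - w t) < e.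

Lemma path_uniformly_continuous (w : R -> V) (T e : R) : path_continuous w -> 0 < e ->
  exists2 del : R, 0 < del & forall s t, 0 <= s <= T -> 0 <= t <= T -> `|s - t| < del ->
    enorm (w s - w t) < e.
Proof.
move=> wc e0; have e20 : 0 < e / 2 by rewrite divr_gt0.
have /compact_near_coveringP/(_ R (0^'+)
  (fun del t => forall s, 0 <= s <= T -> 0 <= t <= T -> `|s - t| < del -> enorm (w s - w t) < e)) :=
  @segment_compact R 0 T.
move=> []; last first.
- move=> del /= del0 Hd; exists (del / 2); first by rewrite divr_gt0.
  move=> s t sT tT st; apply: (Hd (del / 2)) st => //=.
  + rewrite /ball/= sub0r normrN gtr0_norm ?divr_gt0//.
    by rewrite ltr_pdivrMr// ltr_pMr// ltr1n.
  + by rewrite divr_gt0.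
- move=> t /=; rewrite in_itv/= => /andP[t0 tT].
  have [del del0 Hd] := wc t (e / 2) t0 e20.
  have d20 : 0 < del / 2 by rewrite divr_gt0.
  exists ((ball t (del / 2)), [set u | 0 < u < del / 2]) => /=.
    split; first exact: nbhsx_ballx.
    exists (del / 2) => //= u; rewrite /ball/= sub0r normrN => H u0.
    by rewrite u0 (le_lt_trans (ler_norm u)).
  move=> [r u] /= [tr /andP[u0 ud]] s /andP[s0 sT] /andP[r0 rT] sr.
  apply: le_lt_trans (enorm_triangle (w t) _ _) _.
  rewrite [ltRHS](splitr e) ltrD//.
    apply: Hd => //; apply: le_lt_trans (ler_distD r _ _) _.
    rewrite [ltRHS](splitr del) ltrD//; first exact: lt_trans sr ud.
    by rewrite distrC.
  rewrite enormBC; apply: Hd => //; rewrite distrC; apply: lt_trans tr _.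
  by rewrite ltr_pdivrMr// ltr_pMr// ltr1n.
Qed.

Lemma path_continuous_cadlag (w : R -> V) : path_continuous w -> cadlag w.
Proof.
move=> wc; split => [t t0|t t0].
  apply: enorm_lt_cvg => e e0; have [del del0 Hd] := wc t e t0 e0.
  apply/nbhs_ballP; exists del => // s; rewrite /ball/= distrC => st ts.
  by apply: Hd => //; rewrite (le_trans t0)// ltW.
apply/cvg_ex; exists (w t).
apply: enorm_lt_cvg => e e0; have [del del0 Hd] := wc t e (ltW t0) e0.
apply/nbhs_ballP; exists (Num.min t del); first by rewrite /= lt_min t0.
move=> s; rewrite /ball/= lt_min => /andP[s1 s2] st.
apply: Hd; last by rewrite distrC.
by move: s1; rewrite gtr0_norm ?subr_gt0// ltrBlDl -ltrBlDr subrr => /ltW.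
Qed.

Variables (kap ell q : R).
Hypotheses (kap0 : 0 <= kap) (ell0 : 0 <= ell) (q0 : 0 < q).
Local Notation b := (@bbar R d kap ell q).

(* Y solves dY = b(Y) dt + dw. *)
Definition implicit_solution (w Y : R -> V) := forall T e : R, 0 < e ->
  exists2 del : R, 0 < del & forall s t, 0 <= s -> s <= t -> t <= T -> t - s < del ->
    enorm (Y t - Y s - (w t - w s) - (t - s) *: b (Y t)) <= (t - s) * e.

Lemma bbar_jointly_continuous : jointly_continuous (fun _ : R => b).
Proof.
move=> t x e t0 e0; pose K := enorm x + 1.
have K0 : 0 < K by rewrite ltr_wpDl.
pose L := kap + ell * K `^ q * (q + 2).
have L0 : 0 <= L by rewrite addr_ge0// !mulr_ge0 ?powR_ge0// addr_ge0// ltW.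
exists (Num.min 1 (e / (L + 1))); first by rewrite lt_min ltr01 divr_gt0// ltr_wpDl.
move=> s y _ _; rewrite lt_min => /andP[y1 y2].
have xK : enorm x <= K by rewrite lerDl.
have yK : enorm y <= K.
  by have := ler_enorm_sub y x; rewrite /K; lra.
apply: le_lt_trans (bbar_lip kap0 ell0 q0 yK xK) _; rewrite -/L.
apply: (@le_lt_trans _ _ ((L + 1) * enorm (y - x))).
  by rewrite ler_wpM2r// lerDl.
by rewrite mulrC -ltr_pdivlMr// ltr_wpDl.
Qed.

Lemma drift_path_implicit (w Y : R -> V) : path_continuous Y ->
  drift_path (fun=> b) Y w -> implicit_solution w Y.
Proof.
move=> Yc HY T e e0.
have [K HK] := cadlag_bounded T (path_continuous_cadlag Yc).
pose L := kap + ell * (Num.max 0 K) `^ q * (q + 2).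
have L0 : 0 <= L by rewrite addr_ge0// !mulr_ge0 ?powR_ge0// addr_ge0// ltW.
have D0 : 0 < (L + 1) * d.+1%:R by rewrite mulr_gt0// ltr_wpDl.
have e10 : 0 < e / ((L + 1) * d.+1%:R) by rewrite divr_gt0.
have [del del0 Hd] := path_uniformly_continuous T Yc e10.
exists del => // s t s0 st tT tsd.
have t0 : 0 <= t by exact: le_trans st.
have dK r : 0 <= r <= T -> enorm (Y r) <= Num.max 0 K by move=> /HK; rewrite le_max => ->; rewrite orbT.
apply: le_trans (HY s t (b (Y t)) ((L + 1) * (e / ((L + 1) * d.+1%:R))) s0 st _) _.
  move=> r /andP[sr rt].
  have rT : 0 <= r <= T by rewrite (le_trans s0 sr) (le_trans rt tT).
  have tT' : 0 <= t <= T by rewrite t0 tT.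
  apply: le_trans (bbar_lip kap0 ell0 q0 (dK _ rT) (dK _ tT')) _; rewrite -/L.
  rewrite ler_pM// ?lerDl// ltW//; apply: Hd => //.
  by rewrite distrC ger0_norm ?subr_ge0// (le_lt_trans _ tsd)// lerD2l lerN2.
rewrite mulrCA ler_wpM2l ?subr_ge0//.
have L10 : L + 1 != 0 by rewrite gt_eqF// ltr_wpDl.
rewrite (_ : d%:R * _ = e * (d%:R / d.+1%:R)); last by field; rewrite L10 addrC natr1 pnatr_eq0.
by rewrite ger_pMr// ler_pdivrMr// mul1r ler_nat.
Qed.

Definition grid_euler (w : R -> V) (x : V) (del : R) (k : nat) : V :=
  euler kap ell q (fun=> del) (fun k => w (k.+1%:R * del) - w (k%:R * del)) x k.

(** Sampled on a fine grid, [Y] satisfies the implicit scheme up to a defect [e] per unit of time,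
    so the schemes converge to it. As they depend only on [w] and [Y 0], uniqueness follows. *)
Lemma implicit_solution_euler (w Y : R -> V) (t : R) : 0 <= t -> implicit_solution w Y ->
  forall e : R, 0 < e -> exists N, forall n, (N <= n)%N ->
    enorm (Y t - grid_euler w (Y 0) (t / 2 ^+ n) (2 ^ n)) < e.
Proof.
move=> t0 HY e e0; have e10 : 0 < e / (t + 1) by rewrite divr_gt0// ltr_wpDl.
have [del del0 Hd] := HY t _ e10.
exists (Num.truncn (t / del)).+1 => n Nn.
have p2 : 0 < 2 ^+ n :> R by rewrite exprn_gt0.
have h0 : 0 <= t / 2 ^+ n by rewrite divr_ge0// ltW.
have hd : t / 2 ^+ n < del.
  rewrite ltr_pdivrMr// mulrC -ltr_pdivrMr//.
  apply: lt_le_trans (truncnS_gt _) _.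
  by rewrite -natrX ler_nat (leq_trans Nn)// ltnW// ltn_expl.
have E := @euler_perturbed R d kap ell q kap0 ell0 q0 (fun=> t / 2 ^+ n)
   (fun k => w (k.+1%:R * (t / 2 ^+ n)) - w (k%:R * (t / 2 ^+ n)))
   (fun k => Y (k%:R * (t / 2 ^+ n))) (fun=> t / 2 ^+ n * (e / (t + 1))) (2 ^ n) (fun=> h0).
have tE : (2 ^ n)%:R * (t / 2 ^+ n) = t :> R.
  by rewrite natrX mulrC divfK// gt_eqF.
rewrite tE mul0r in E.
apply: le_lt_trans (E _) _.
  move=> k kn.
  have dE : k.+1%:R * (t / 2 ^+ n) - k%:R * (t / 2 ^+ n) = t / 2 ^+ n.
    by rewrite -mulrBl -natr1 addrAC subrr add0r mul1r.
  have := Hd (k%:R * (t / 2 ^+ n)) (k.+1%:R * (t / 2 ^+ n)); rewrite dE; apply => //.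
  - by rewrite mulr_ge0.
  - by rewrite ler_wpM2r// ler_nat.
  - by rewrite -[leRHS]tE ler_wpM2r// ler_nat.
rewrite sumr_const card_ord -[X in X < _]mulr_natl mulrA tE.
by rewrite mulrCA gtr_pMr// ltr_pdivrMr ?ltr_wpDl// mul1r ltrDl.
Qed.

Lemma implicit_solution_unique (w Y Y' : R -> V) (t : R) : 0 <= t ->
  implicit_solution w Y -> implicit_solution w Y' -> Y 0 = Y' 0 -> Y t = Y' t.
Proof.
move=> t0 HY HY' Y00; apply/eqP; rewrite -subr_eq0 -enorm_eq0 -[_ == _]/(_ == _).
rewrite -normr_le0 ger0_norm//; apply/ler_addgt0Pr => e e0; rewrite add0r.
have e20 : 0 < e / 2 by rewrite divr_gt0.
have [N HN] := implicit_solution_euler t0 HY e20.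
have [N' HN'] := implicit_solution_euler t0 HY' e20.
have := HN _ (leq_maxl N N'); have := HN' _ (leq_maxr N N').
rewrite Y00; set g := grid_euler _ _ _ _ => H1 H2.
apply: le_trans (enorm_triangle g _ _) _.
by rewrite (enormBC g) ltW// [ltRHS](splitr e) ltrD.
Qed.

(** Although [Y] and [w] need not be differentiable, [Y - w] is, with derivative [b (Y)]; the
    fundamental theorem of calculus then applies. *)
Lemma implicit_solution_integral (w Y : R -> V) (t : R) i : 0 <= t -> path_continuous Y ->
  path_continuous w -> implicit_solution w Y ->
  Y t 0 i = Y 0 0 i + \int[@lebesgue_measure R]_(s in `[0, t]) b (Y s) 0 i + (w t 0 i - w 0 0 i).
Proof.
move=> t0 Yc wc HY.
move: t0; rewrite le_eqVlt => /orP[/eqP <-|t0].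
  rewrite (_ : `[0, 0]%classic = [set 0]); last exact: set_itv1.
  by rewrite Rintegral_set1 addr0 subrr addr0.
pose F (s : R) : R := Y s 0 i - w s 0 i.
pose f (s : R) : R := b (Y s) 0 i.
have bYc : path_continuous (fun s => b (Y s)).
  move=> s e s0 e0; have [d1 d10 H1] := bbar_jointly_continuous (Y s) s0 e0.
  have [d2 d20 H2] := Yc s d1 s0 d10.
  exists d2 => // r r0 rs; apply: (H1 s) => //; last exact: H2.
  by rewrite subrr normr0.
have coord_le (x : V) : `|x 0 i| <= enorm x by exact: coord_enorm.
have cont_of (p : R -> V) (s : R) : path_continuous p -> 0 < s -> p r 0 i @[r --> s] --> p s 0 i.
  move=> pc s0; apply/cvgrPdist_lt => e e0; have [del del0 Hd] := pc s e (ltW s0) e0.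
  apply/nbhs_ballP; exists (Num.min s del); first by rewrite /= lt_min s0.
  move=> r; rewrite /ball/= lt_min => /andP[r1 r2].
  apply: le_lt_trans (Hd r _ _); last by rewrite distrC.
    by rewrite enormBC; have := coord_le (p s - p r); rewrite !mxE.
  by move: r1; rewrite ltr_norml => /andP[_]; rewrite ltrBlDl -ltrBlDr subrr => /ltW.
have cont0 (p : R -> V) : path_continuous p -> p r 0 i @[r --> 0^'+] --> p 0 0 i.
  move=> pc; apply/cvgrPdist_lt => e e0; have [del del0 Hd] := pc 0 e (lexx 0) e0.
  apply/nbhs_ballP; exists del => // r; rewrite /ball/= => r1 r0.
  apply: le_lt_trans (Hd r (ltW r0) _); last by rewrite distrC.
  by rewrite enormBC; have := coord_le (p 0 - p r); rewrite !mxE.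
have contF (s : R) : 0 < s -> F r @[r --> s] --> F s by move=> s0; apply: cvgB; exact: cont_of.
have derF (s : R) : 0 < s -> s < t -> h^-1 *: (F (h + s) - F s) @[h --> 0^'] --> f s.
  move=> s0 st; apply/cvgrPdist_lt => e e0; have e20 : 0 < e / 2 by rewrite divr_gt0.
  have [d1 d10 H1] := HY t _ e20.
  have [d2 d20 H2] := bYc s _ (ltW s0) e20.
  apply/nbhs_ballP; exists (Num.min (Num.min d1 d2) (Num.min s (t - s))).
    by rewrite /= !lt_min d10 d20 s0 subr_gt0.
  move=> h; rewrite /ball/= sub0r normrN !lt_min => /andP[/andP[h1 h2] /andP[h3 h4]] hn0.
  have hs0 : 0 <= h + s by move: h3; rewrite ltr_norml => /andP[]; lra.
  have hst : h + s <= t by move: h4; rewrite ltr_norml => /andP[]; lra.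
  have F_est u v : 0 <= u -> u <= v -> v <= t -> v - u < d1 ->
      `|F v - F u - (v - u) * f v| <= (v - u) * (e / 2).
    move=> u0 uv vt uvd; apply: le_trans (H1 u v u0 uv vt uvd).
    have := coord_le (Y v - Y u - (w v - w u) - (v - u) *: b (Y v)).
    rewrite /F /f; move: (b (Y v)) => bv.
    by rewrite !mxE; congr (`|_| <= _); ring.
  have fhs : `|f (h + s) - f s| < e / 2.
    apply: le_lt_trans (H2 (h + s) hs0 _); last by rewrite addrK.
    have := coord_le (b (Y (h + s)) - b (Y s)).
    by rewrite /f; move: (b (Y (h + s))) (b (Y s)) => b1 b2; rewrite !mxE.
  have hn : 0 < `|h| by rewrite normr_gt0.
  rewrite -(ltr_pM2l hn) -normrM mulrBr.
  rewrite -[h * (h^-1 *: _)]/(h * (h^-1 * _)) mulrA mulfV// mul1r.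
  have [hp|hp|h0] := ltgtP 0 h; last by rewrite h0 eqxx in hn0.
  - have := F_est s (h + s) (ltW s0) _ hst.
    rewrite addrK (ger0_norm (ltW hp)) in h1 *; rewrite lerDr (ltW hp) => /(_ isT h1).
    rewrite !ler_norml !ltr_norml => /andP[A1 A2].
    move: fhs; rewrite ltr_norml => /andP[B1 B2].
    have C1 : h * (- (e / 2)) < h * (f (h + s) - f s) by rewrite ltr_pM2l.
    have C2 : h * (f (h + s) - f s) < h * (e / 2) by rewrite ltr_pM2l.
    by apply/andP; split; lra.
  - have := F_est (h + s) s hs0 _ (ltW st).
    rewrite (ltr0_norm hp) in h1 *.
    rewrite opprD addrCA subrr addr0 gerDr (ltW hp) => /(_ isT h1).
    rewrite !ler_norml !ltr_norml => /andP[A1 A2].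
    have : 0 < (- h) * e by rewrite mulr_gt0// oppr_gt0.
    by move=> C; apply/andP; split; lra.
have FTC : (\int[@lebesgue_measure R]_(s in `[0%R, t]) (f s)%:E = (F t)%:E - (F 0%R)%:E)%E.
  apply: continuous_FTC2 => //.
  - apply/continuous_within_itvP => //; split.
    + by move=> s /[!in_itv]/= /andP[s0 st]; exact: cont_of.
    + exact: cont0.
    + by apply: cvg_at_left_filter; exact: cont_of.
  - split.
    + move=> s /[!in_itv]/= /andP[s0 st]; apply/cvg_ex; exists (f s).
      have := derF s s0 st; apply: cvg_trans; apply: near_eq_cvg; near=> h.
      by rewrite /= /GRing.scale/= mulr1.
    + by apply: cvgB; exact: cont0.
    + by apply: cvg_at_left_filter; exact: contF.
  - move=> s /[!in_itv]/= /andP[s0 st]; rewrite /derive1; apply: cvg_lim => //.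
    exact: derF.
rewrite /Rintegral -/f FTC /= /F; ring.
Unshelve. all: by end_near.
Qed.

Lemma ler_enorm_big (I : Type) (r : seq I) (p : pred I) (F : I -> V) :
  enorm (\sum_(i <- r | p i) F i) <= \sum_(i <- r | p i) enorm (F i).
Proof.
elim/big_ind2 : _ => // [|x1 x2 y1 y2 H1 H2]; first by rewrite enorm0.
by apply: le_trans (ler_enormD _ _) _; exact: lerD.
Qed.

Section existence.
Variables (w : R -> V) (x : V).
Hypothesis wc : path_continuous w.

Let E n k := grid_euler w x (2 ^- n) k.

Let p2 n : 0 < 2 ^- n :> R. Proof. by rewrite invr_gt0 exprn_gt0. Qed.

Let growth C := (kap + ell * C `^ q) * C.

Let growth_ge0 C : 0 <= C -> 0 <= growth C.
Proof. by move=> C0; rewrite mulr_ge0// addr_ge0// mulr_ge0// powR_ge0. Qed.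

(** The driving path itself is a perturbed scheme, with defect [- h b(w)], bounded on [[0, T]]. So
    the scheme started at [w 0] stays near [w], and the one started at [x] stays within [|w 0 - x|]
    of it. *)
Let E_bound (T : R) : exists2 C : R, 0 <= C & forall n k, k%:R * 2 ^- n <= T -> enorm (E n k) <= C.
Proof.
have [W HW] := cadlag_bounded T (path_continuous_cadlag wc).
pose W' := Num.max 0 W.
have W'0 : 0 <= W' by rewrite le_max lexx.
have HW' t : 0 <= t <= T -> enorm (w t) <= W' by move=> /HW; rewrite le_max orbC => ->.
exists (W' + (enorm (w 0 - x) + Num.max 0 T * growth W')).
  by rewrite !addr_ge0// mulr_ge0 ?growth_ge0// le_max lexx.
move=> n k kT.
have kT' j : (j <= k)%N -> (0 : R) <= (j%:R * 2 ^- n : R) <= T.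
  move=> jk; rewrite mulr_ge0 ?(ltW (p2 n))//= (le_trans _ kT)//.
  by rewrite ler_wpM2r ?(ltW (p2 n))// ler_nat.
have H := @euler_perturbed R d kap ell q kap0 ell0 q0 (fun=> 2 ^- n)
  (fun k => w (k.+1%:R * 2 ^- n) - w (k%:R * 2 ^- n)) (fun k => w (k%:R * 2 ^- n))
  (fun=> 2 ^- n * growth W') k (fun=> ltW (p2 n)).
have := @euler_contract_exp R d kap ell q kap0 ell0 q0 (2 ^- n)
  (fun k => w (k.+1%:R * 2 ^- n) - w (k%:R * 2 ^- n)) (w 0) x k (ltW (p2 n)).
rewrite mul0r in H.
move: H; rewrite -[euler _ _ _ _ _ x k]/(E n k).
set E' := euler _ _ _ _ _ _ _ => H1 H2.
have {}H2 : enorm (E' - E n k) <= enorm (w 0 - x).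
  by apply: le_trans H2; rewrite ler_peMr// exprn_ege1// lerDl mulr_ge0// ltW.
have {}H1 : enorm (w (k%:R * 2 ^- n) - E') <= Num.max 0 T * growth W'.
  apply: le_trans (H1 _) _.
    move=> j jk; rewrite subrr add0r enormN enormZ (gtr0_norm (p2 n)) ler_wpM2l ?(ltW (p2 n))//.
    by apply: bbar_bound => //; apply: HW'; exact: kT'.
  rewrite sumr_const card_ord -[X in X <= _]mulr_natl mulrA ler_wpM2r ?growth_ge0//.
  by rewrite le_max kT orbT.
have H3 := HW' _ (kT' k (leqnn k)).
have := ler_enorm_sub (E n k) (w (k%:R * 2 ^- n)).
have := enorm_triangle E' (E n k) (w (k%:R * 2 ^- n)).
rewrite (enormBC (E n k) E') (enormBC E' (w _)); lra.
Qed.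

Let E_incr n i j : (i <= j)%N ->
  E n j - E n i - (w (j%:R * 2 ^- n) - w (i%:R * 2 ^- n)) =
  2 ^- n *: \sum_(i <= l < j) b (E n l.+1).
Proof.
elim: j => [|j IH]; first by rewrite leqn0 => /eqP ->; rewrite !subrr big_geq ?scaler0.
rewrite leq_eqVlt => /orP[/eqP ->|ij]; first by rewrite !subrr big_geq ?scaler0.
rewrite big_nat_recr//= scalerDr -IH//.
have := @resolventP R d kap ell q kap0 ell0 q0 (2 ^- n)
   (E n j + (w (j.+1%:R * 2 ^- n) - w (j%:R * 2 ^- n))) (ltW (p2 n)).
rewrite -[resolvent _ _ _ _ _]/(E n j.+1).
have key (B0 e0 e1 e2 w1 w2 w3 : V) : e0 - B0 = e1 + (w1 - w2) ->
    e0 - e2 - (w1 - w3) = e1 - e2 - (w2 - w3) + B0.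
  move=> H; have -> : e0 = B0 + (e1 + (w1 - w2)) by rewrite -H addrC subrK.
  by apply/rowP => l; rewrite !mxE; ring.
exact: key.
Qed.

Let E_osc (T e : R) : 0 < e -> exists2 del : R, 0 < del & forall n i j l,
  (i <= l)%N -> (l <= j)%N -> j%:R * 2 ^- n <= T -> j%:R * 2 ^- n - i%:R * 2 ^- n < del ->
  enorm (E n l - E n j) <= e /\ enorm (b (E n l) - b (E n j)) <= e.
Proof.
move=> e0; have [C C0 HC] := E_bound T.
pose L := kap + ell * C `^ q * (q + 2).
have L0 : 0 <= L by rewrite addr_ge0// !mulr_ge0 ?powR_ge0// addr_ge0// ltW.
have L10 : 0 < L + 1 by rewrite ltr_wpDl.
pose e1 := e / (L + 1) / 2.
have e10 : 0 < e1 by rewrite !divr_gt0.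
have [d1 d10 Hd1] := path_uniformly_continuous T wc e10.
have G0 := growth_ge0 C0.
exists (Num.min d1 (e1 / (growth C + 1))).
  by rewrite lt_min d10 divr_gt0// ltr_wpDl.
move=> n i j l il lj jT; rewrite lt_min => /andP[jd1 jd2].
have kT k : (k <= j)%N -> k%:R * 2 ^- n <= T.
  by move=> kj; rewrite (le_trans _ jT)// ler_wpM2r ?(ltW (p2 n))// ler_nat.
have HCk k : (k <= j)%N -> enorm (E n k) <= C by move=> /kT /HC.
suff HE : enorm (E n l - E n j) <= e1 + e1.
  have eE : (L + 1) * (e1 + e1) = e by rewrite -splitr mulrC divfK// gt_eqF.
  split.
    rewrite (le_trans HE)// -[leRHS]eE ler_peMl ?lerDr// addr_ge0 ?ltW//.
  apply: le_trans (bbar_lip kap0 ell0 q0 (HCk l lj) (HCk j (leqnn j))) _.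
  by rewrite -/L -eE ler_pM// lerDl.
rewrite enormBC.
have jl : ((j - l)%N%:R : R) * 2 ^- n <= j%:R * 2 ^- n - i%:R * 2 ^- n.
  by rewrite -mulrBl ler_wpM2r ?(ltW (p2 n))// natrB// lerD2l lerN2 ler_nat.
have := E_incr n lj; set z := w _ - w _; set u := _ *: _ => H.
have -> : E n j - E n l = z + u by rewrite -H addrCA subrr addr0.
apply: le_trans (ler_enormD _ _) _; apply: lerD; last first.
  rewrite /u enormZ (gtr0_norm (p2 n)).
  apply: (@le_trans _ _ (2 ^- n * \sum_(l <= k < j) growth C)).
    rewrite ler_wpM2l ?(ltW (p2 n))//.
    rewrite big_nat [in leRHS]big_nat.
    apply: le_trans (ler_enorm_big _ _ _) _; apply: ler_sum => k /andP[lk kj].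
    by apply: bbar_bound => //; exact: HCk.
  rewrite sumr_const_nat -[growth C *+ _]mulr_natl mulrA [2 ^- n * _]mulrC.
  apply: (@le_trans _ _ (e1 / (growth C + 1) * growth C)).
    by rewrite ler_wpM2r// (le_trans jl)// ltW.
  rewrite mulrAC ler_pdivrMr ?ltr_wpDl//.
  by rewrite ler_pM2l// lerDl.
apply: ltW; rewrite /z; apply: Hd1.
- by rewrite mulr_ge0 ?(ltW (p2 n))// kT.
- by rewrite mulr_ge0 ?(ltW (p2 n))// kT.
- rewrite -mulrBl -natrB// ger0_norm ?mulr_ge0 ?(ltW (p2 n))//.
  exact: le_lt_trans jl jd1.
Qed.

(** Sampled on the coarse grid, the fine scheme is a perturbed coarse scheme: its defect is the
    oscillation of the drift within one coarse step. *)
Let E_cauchy (T e : R) : 0 < e -> exists N, forall n p k, (N <= n)%N -> k%:R * 2 ^- n <= T ->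
  enorm (E (n + p) (2 ^ p * k) - E n k) <= e.
Proof.
move=> e0; have e10 : 0 < e / (Num.max 0 T + 1) by rewrite divr_gt0// ltr_wpDl// le_max lexx.
have [del del0 Hd] := E_osc T e10.
exists (Num.truncn del^-1).+1 => n p k Nn kT.
have nd : 2 ^- n < del.
  rewrite -[ltRHS]invrK ltf_pV2 ?posrE ?invr_gt0 ?exprn_gt0//.
  apply: lt_le_trans (truncnS_gt _) _.
  by rewrite -natrX ler_nat (leq_trans Nn)// ltnW// ltn_expl.
have npE j : (2 ^ p * j)%N%:R * 2 ^- (n + p) = j%:R * 2 ^- n :> R.
  rewrite natrM natrX exprD invfM; field.
  by rewrite !expf_neq0.
have H := @euler_perturbed R d kap ell q kap0 ell0 q0 (fun=> 2 ^- n)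
  (fun k => w (k.+1%:R * 2 ^- n) - w (k%:R * 2 ^- n)) (fun k => E (n + p) (2 ^ p * k))
  (fun=> 2 ^- n * (e / (Num.max 0 T + 1))) k (fun=> ltW (p2 n)).
have E0 : E (n + p) (2 ^ p * 0) = x by rewrite muln0.
rewrite E0 in H; apply: le_trans (H _) _.
  move=> j jk; have jj : (2 ^ p * j <= 2 ^ p * j.+1)%N by rewrite leq_mul2l leqnSn orbT.
  have := E_incr (n + p) jj; rewrite !npE => ->.
  have hE : 2 ^- n *: b (E (n + p) (2 ^ p * j.+1)) =
      2 ^- (n + p) *: \sum_(2 ^ p * j <= l < 2 ^ p * j.+1) b (E (n + p) (2 ^ p * j.+1)).
    rewrite sumr_const_nat -mulnBr subSnn muln1 -[X in _ = _ *: X]scaler_nat [RHS]scalerA natrX.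
    congr (_ *: _); rewrite exprD; field.
    by rewrite !expf_neq0.
  rewrite hE -scalerBr -sumrB enormZ (gtr0_norm (p2 _)).
  apply: (@le_trans _ _ (2 ^- (n + p) *
      \sum_(2 ^ p * j <= l < 2 ^ p * j.+1) (e / (Num.max 0 T + 1)))).
    rewrite ler_wpM2l ?(ltW (p2 _))// big_nat [in leRHS]big_nat.
    apply: le_trans (ler_enorm_big _ _ _) _; apply: ler_sum => l /andP[l1 l2].
    apply: (Hd _ (2 ^ p * j)%N (2 ^ p * j.+1)%N l.+1 _ _ _ _).2 => //.
    - exact: leqW.
    - by rewrite npE (le_trans _ kT)// ler_wpM2r ?(ltW (p2 _))// ler_nat.
    - by rewrite !npE -mulrBl -natr1 addrAC subrr add0r mul1r.
  rewrite sumr_const_nat -mulnBr subSnn muln1 -[X in _ * X <= _]mulr_natl [leLHS]mulrA natrX.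
  rewrite ler_wpM2r ?(ltW e10)// exprD invfM -mulrA mulVf ?mulr1//.
rewrite sumr_const card_ord -[X in X <= _]mulr_natl mulrA.
apply: (@le_trans _ _ (Num.max 0 T * (e / (Num.max 0 T + 1)))).
  by rewrite ler_wpM2r ?(ltW e10)// le_max kT orbT.
rewrite mulrA ler_pdivrMr ?ltr_wpDl ?le_max ?lexx// mulrC.
by rewrite ler_pM2l// lerDl.
Qed.

Let kk n (t : R) := Num.truncn (t * 2 ^+ n).
Let tt n (t : R) : R := (kk n t)%:R * 2 ^- n.

Let tt_itv n t : 0 <= t -> t - 2 ^- n <= tt n t <= t.
Proof.
move=> t0; have p0 : 0 < 2 ^+ n :> R by rewrite exprn_gt0.
have /andP[H1 H2] : (kk n t)%:R <= t * 2 ^+ n < (kk n t).+1%:R.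
  by apply: truncn_itv; rewrite mulr_ge0// ltW.
rewrite /tt ler_pdivrMr// H1 andbT lerBlDr -[X in _ + X]mul1r -mulrDl ler_pdivlMr//.
by rewrite natr1 ltW.
Qed.

Let Y_ n t := E n (kk n t).

Let kk_ndecr n s t : 0 <= s -> s <= t -> (kk n s <= kk n t)%N.
Proof.
move=> s0 st; apply: le_truncn; rewrite ler_wpM2r// ltW// exprn_gt0//.
Qed.

Let Y_cauchy (t e : R) : 0 <= t -> 0 < e -> exists N, forall n m, (N <= n)%N -> (n <= m)%N ->
  enorm (Y_ n t - Y_ m t) <= e.
Proof.
move=> t0 e0; have e20 : 0 < e / 2 by rewrite divr_gt0.
have [N1 H1] := E_cauchy t e20.
have [del del0 H2] := E_osc t e20.
exists (maxn N1 (Num.truncn del^-1).+1) => n m; rewrite geq_max => /andP[Nn N2n] nm.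
have nd : 2 ^- n < del.
  rewrite -[ltRHS]invrK ltf_pV2 ?posrE ?invr_gt0 ?exprn_gt0//.
  apply: lt_le_trans (truncnS_gt _) _.
  by rewrite -natrX ler_nat (leq_trans N2n)// ltnW// ltn_expl.
have /andP[t1 t2] := tt_itv n t0; have /andP[t3 t4] := tt_itv m t0.
pose p := (m - n)%N; have mE : m = (n + p)%N by rewrite /p subnKC.
have npE j : (2 ^ p * j)%N%:R * 2 ^- m = j%:R * 2 ^- n :> R.
  rewrite mE natrM natrX exprD invfM; field.
  by rewrite !expf_neq0.
have kle : (2 ^ p * kk n t <= kk m t)%N.
  have : ((2 ^ p * kk n t)%N%:R : R) <= t * 2 ^+ m.
    rewrite -[leLHS](divfK (expf_neq0 m (_ : (2 : R) != 0)))// npE.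
    by rewrite ler_wpM2r// exprn_ge0.
  by rewrite /kk => H; rewrite -(@natrK R (_ * _)); apply: le_truncn.
apply: le_trans (enorm_triangle (E m (2 ^ p * kk n t)) _ _) _.
rewrite [leRHS](splitr e); apply: lerD.
  by rewrite enormBC mE; apply: H1.
apply: (H2 m (2 ^ p * kk n t)%N (kk m t) (2 ^ p * kk n t)%N _ _ _ _).1 => //.
rewrite npE -/(tt n t) -/(tt m t) (le_lt_trans _ nd)//; lra.
Qed.

Lemma row_cauchy (u : nat -> V) :
  (forall e : R, 0 < e -> exists N, forall n m, (N <= n)%N -> (n <= m)%N -> enorm (u n - u m) <= e) ->
  exists l : V, u n @[n --> \oo] --> l.
Proof.
move=> H; have /cauchy_cvg/cvg_ex[l Hl] : cauchy (u n @[n --> \oo]); last by exists l.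
apply: cauchy_exP => e e0; have e20 : 0 < e / 2 by rewrite divr_gt0.
have [N HN] := H _ e20; exists (u N).
exists N => // n /= Nn; split => // i j; rewrite (ord1 i) /ball/=.
have := coord_enorm (u N - u n) j; rewrite !mxE => H1.
apply: le_lt_trans H1 _; apply: le_lt_trans (HN N n (leqnn N) Nn) _.
by rewrite ltr_pdivrMr// ltr_pMr// ltr1n.
Qed.

Let pow2_small (e : R) : 0 < e -> \forall n \near \oo, (2 ^- n : R) < e.
Proof.
move=> e0; have := near_infty_natSinv_expn_lt (PosNum e0).
by apply: filterS => n; rewrite div1r.
Qed.

Lemma implicit_solution_exists : exists2 Y : R -> V, path_continuous Y &
  Y 0 = x /\ implicit_solution w Y.
Proof.
have [Y HY] : exists Y : R -> V, forall t, 0 <= t -> Y_ n t @[n --> \oo] --> Y t.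
  have H : forall t : R, exists l : V, 0 <= t -> Y_ n t @[n --> \oo] --> l.
    move=> t; have [t0|t0] := leP 0 t; last by exists 0 => t1; exfalso; lra.
    have [l Hl] := row_cauchy (fun e e0 => Y_cauchy t0 e0).
    by exists l.
  exists (fun t => projT1 (cid (H t))) => t; exact: (projT2 (cid (H t))).
have ttcvg t : 0 <= t -> tt n t @[n --> \oo] --> t.
  move=> t0; apply/cvgrPdist_lt => e e0; near=> n.
  have /andP[H1 H2] := tt_itv n t0.
  rewrite ger0_norm ?subr_ge0//.
  have : (2 ^- n : R) < e.
    by near: n; exact: pow2_small.
  lra.
have wcvg t : 0 <= t -> w (tt n t) @[n --> \oo] --> w t.
  move=> t0; apply: enorm_lt_cvg => e e0; have [del del0 Hd] := wc t0 e0.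
  have /cvgrPdist_lt/(_ _ del0) := ttcvg t t0.
  apply: filterS => n; rewrite distrC => Hn; apply: Hd => //.
  by rewrite /tt mulr_ge0// ltW.
have bY t : 0 <= t -> b (Y_ n t) @[n --> \oo] --> b (Y t).
  move=> t0; apply: enorm_lt_cvg => e e0.
  have [del del0 Hd] := bbar_jointly_continuous (Y t) t0 e0.
  have : \forall n \near \oo, enorm (Y_ n t - Y t) < del by apply: cvg_enorm_lt => //; exact: HY.
  by apply: filterS => n Hn; apply: (Hd t) => //; rewrite subrr normr0.
have HI : implicit_solution w Y.
  move=> T e e0; have [del del0 Hd] := E_osc T e0.
  exists del => // s t s0 st tT tsd.
  have t0 : 0 <= t by exact: le_trans st.
  pose F n := Y_ n t - Y_ n s - (w (tt n t) - w (tt n s)) - (tt n t - tt n s) *: b (Y_ n t).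
  have HF : F n @[n --> \oo] --> Y t - Y s - (w t - w s) - (t - s) *: b (Y t).
    apply: cvgB; last by apply: cvgZ; [apply: cvgB; exact: ttcvg|exact: bY].
    by apply: cvgB; [apply: cvgB; exact: HY|apply: cvgB; exact: wcvg].
  apply/ler_addgt0Pr => e1 e10.
  have e20 : 0 < e1 / 2 by rewrite divr_gt0.
  have e30 : 0 < e1 / 2 / e by rewrite divr_gt0.
  near \oo => n.
  have nFlt : enorm (F n - (Y t - Y s - (w t - w s) - (t - s) *: b (Y t))) < e1 / 2.
    near: n; exact: cvg_enorm_lt HF e20.
  have Hn2 : (2 ^- n : R) < del - (t - s).
    near: n; have d0 : 0 < del - (t - s) by rewrite subr_gt0.
    exact: pow2_small.
  have Hn3 : (2 ^- n : R) < e1 / 2 / e.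
    by near: n; exact: pow2_small.
  have /andP[t1 t2] := tt_itv n t0; have /andP[s1 s2] := tt_itv n s0.
  have kst := kk_ndecr n s0 st.
  have Fn : enorm (F n) <= (tt n t - tt n s) * e.
    rewrite /F /Y_ E_incr//.
    have -> : (tt n t - tt n s) *: b (E n (kk n t)) =
        2 ^- n *: \sum_(kk n s <= l < kk n t) b (E n (kk n t)).
      rewrite sumr_const_nat -[X in _ = _ *: X]scaler_nat scalerA natrB// mulrC.
      by rewrite /tt -mulrBl.
    rewrite -scalerBr -sumrB enormZ (gtr0_norm (p2 n)).
    apply: (@le_trans _ _ (2 ^- n * \sum_(kk n s <= l < kk n t) e)).
      rewrite ler_wpM2l ?(ltW (p2 n))// big_nat [in leRHS]big_nat.
      apply: le_trans (ler_enorm_big _ _ _) _; apply: ler_sum => l /andP[l1 l2].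
      apply: (Hd n (kk n s) (kk n t) l.+1 _ _ _ _).2 => //.
      - exact: leqW.
      - by rewrite (le_trans t2).
      - by move: t2 s1; rewrite /tt; lra.
    by rewrite sumr_const_nat -[X in _ * X <= _]mulr_natl natrB// [leLHS]mulrA [_ * (_ - _)]mulrC /tt -mulrBl.
  have := ler_enorm_sub (Y t - Y s - (w t - w s) - (t - s) *: b (Y t)) (F n).
  rewrite (enormBC _ (F n)) => G1.
  have : (tt n t - tt n s) * e <= (t - s) * e + 2 ^- n * e.
    by rewrite -mulrDl ler_wpM2r ?(ltW e0)//; lra.
  have : 2 ^- n * e <= e1 / 2 by rewrite -ler_pdivlMr// ltW.
  by move: Fn nFlt G1; lra.
have Y0 : Y 0 = x.
  apply: (cvg_unique (@norm_hausdorff _ _) (HY 0 (lexx 0))).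
  rewrite (_ : (fun n => Y_ n 0) = fun=> x); first exact: cvg_cst.
  by apply/funext => n; rewrite /Y_ /kk mul0r truncn0.
exists Y => //.
move=> t e t0 e0.
have [C C0 HC] := E_bound (t + 1).
have YC s : 0 <= s <= t + 1 -> enorm (Y s) <= C + 1.
  move=> /andP[s0 st]; near \oo => n.
  have : enorm (Y_ n s - Y s) < 1 by near: n; apply: cvg_enorm_lt => //; exact: HY.
  have : enorm (Y_ n s) <= C.
    by apply: HC; rewrite (le_trans _ st)//; have /andP[] := tt_itv n s0.
  have := ler_enorm_sub (Y s) (Y_ n s); rewrite (enormBC (Y s)); lra.
have C10 : 0 <= C + 1 by rewrite addr_ge0.
pose B0 := growth (C + 1) + 1.
have B00 : 0 < B0 by rewrite ltr_wpDl// growth_ge0.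
have e20 : 0 < e / 2 by rewrite divr_gt0.
have [d1 d10 H1] := HI (t + 1) 1 ltr01.
have [d2 d20 H2] := wc t0 e20.
exists (Num.min (Num.min d1 d2) (Num.min 1 (e / 2 / B0))).
  by rewrite !lt_min d10 d20 ltr01 divr_gt0.
have key u v : 0 <= u -> u <= v -> v <= t + 1 -> v - u < d1 -> v - u < e / 2 / B0 ->
    enorm (w v - w u) < e / 2 -> enorm (Y v - Y u) < e.
  move=> u0 uv vt vu1 vu2 wuv.
  have := H1 u v u0 uv vt vu1; rewrite mulr1.
  have v0 : 0 <= v by exact: le_trans uv.
  have : enorm ((v - u) *: b (Y v)) <= (v - u) * growth (C + 1).
    rewrite enormZ ger0_norm ?subr_ge0// ler_wpM2l ?subr_ge0//.
    by apply: bbar_bound => //; apply: YC; rewrite v0.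
  have : (v - u) * B0 < e / 2 by rewrite -ltr_pdivlMr.
  rewrite /B0 mulrDr mulr1 => A1 A2 A3.
  have := ler_enormD (Y v - Y u - (w v - w u) - (v - u) *: b (Y v)) ((w v - w u) + (v - u) *: b (Y v)).
  have := ler_enormD (w v - w u) ((v - u) *: b (Y v)).
  have -> : Y v - Y u - (w v - w u) - (v - u) *: b (Y v) + (w v - w u + (v - u) *: b (Y v)) = Y v - Y u.
    by move: ((v - u) *: b (Y v)) => B1; apply/rowP => l; rewrite !mxE; ring.
  by move: wuv A1 A2 A3; lra.
move=> s s0; rewrite !lt_min => /andP[/andP[h1 h2] /andP[h3 h4]].
have wst := H2 s s0 h2.
have [ts|/ltW st] := leP t s.
  rewrite ger0_norm ?subr_ge0// in h1 h3 h4.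
  by apply: key => //; lra.
rewrite distrC ger0_norm ?subr_ge0// in h1 h3 h4.
rewrite enormBC; apply: (key s t) => //; [by rewrite lerDl|by rewrite enormBC].
Unshelve. all: by end_near.
Qed.

End existence.

End continuous_paths.

(** Setting [B] to 0 on a null set makes every path continuous and issued from 0, so the equation
    can be solved for every [w] and the solution is measurable without exceptions. *)
Lemma brownian_version (R : realType) (d : nat) (disp : measure_display)
    (Omega : measurableType disp) (P : probability Omega R) (s2 : R)
    (B : R -> Omega -> 'rV[R]_d) :
  is_brownian P (s2%:M : 'M[R]_d) B ->
  exists W : R -> Omega -> 'rV[R]_d, exists N : set Omega,
    [/\ noise P (fun xi => s2 / 2 * enorm xi ^+ 2) W,
        forall w, path_continuous (W ^~ w), forall w, W 0 w = 0,
        measurable N /\ P N = 0%E & forall w t, ~ N w -> W t w = B t w].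
Proof.
move=> Bb; have [mB B0 iB cB rB] := brownian_noise Bb.
have [_ _ _ _ cpB] := Bb.
have [N [mN PN HN]] : {ae P, forall w, B 0 w = 0 /\ {within `[0, +oo[, continuous (B ^~ w)}}.
  by apply: filterS2 B0 cpB.
pose W t w := (1 - \1_N w : R) *: B t w.
have WB w t : ~ N w -> W t w = B t w.
  by move=> Nw; rewrite /W indicE memNset// subr0 scale1r.
have W0 w t : N w -> W t w = 0.
  by move=> Nw; rewrite /W indicE mem_set// subrr scale0r.
have mW : measurable_process W.
  move=> t t0; apply: measurable_fun_rV => i.
  rewrite (_ : (fun _ => _) = (fun w => (1 - \1_N w) * B t w 0 i)); last first.
    by apply/funext => w; rewrite mxE.
  apply: measurable_funM; first by apply: measurable_funB => //; exact: measurable_indic.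
  by apply: (measurableT_comp (@measurable_coord R d i)); exact: mB.
have aeW (Q : Omega -> Prop) : (forall w, ~ N w -> Q w) -> {ae P, forall w, Q w}.
  by move=> H; exists N; split => // w Qw; apply: contrapT => Nw; exact/Qw/H.
have Wincr s t w : ~ N w -> increment W s t w = increment B s t w.
  by move=> Nw; rewrite /increment !WB.
have mI s t : 0 <= s -> s <= t -> measurable_fun setT (increment W s t).
  by move=> s0 st; apply: measurable_rowB; apply: mW => //; exact: le_trans st.
have mIB s t : 0 <= s -> s <= t -> measurable_fun setT (increment B s t).
  by move=> s0 st; apply: measurable_rowB; apply: mB => //; exact: le_trans st.
have good w : ~ N w -> B 0 w = 0 /\ path_continuous (B ^~ w).
  move=> Nw; have [B0w /continuous_within_itvcyP[Hc Hr]] :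
      B 0 w = 0 /\ {within `[0, +oo[, continuous (B ^~ w)}.
    by apply: contrapT => H; exact/Nw/HN.
  split => // t e t0 e0; move: t0; rewrite le_eqVlt => /orP[/eqP <-|t0].
    have : \forall s \near 0^'+, enorm (B s w - B 0 w) < e by exact: cvg_enorm_lt Hr e0.
    move=> /nbhs_ballP[del /= del0 Hd]; exists del => // s s0; rewrite subr0 => sd.
    move: s0; rewrite le_eqVlt => /orP[/eqP <-|s0]; first by rewrite subrr enorm0.
    by apply: Hd => //; rewrite /ball/= sub0r normrN.
  have Hct : B s w @[s --> t] --> B t w by apply: Hc; rewrite in_itv/= t0.
  have : \forall s \near t, enorm (B s w - B t w) < e by exact: cvg_enorm_lt Hct e0.
  move=> /nbhs_ballP[del /= del0 Hd]; exists del => // s s0 st.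
  by apply: Hd; rewrite /ball/= distrC.
have Wc w : path_continuous (W ^~ w).
  have [Nw|Nw] := pselect (N w).
    by move=> t e _ e0; exists 1 => // s _ _; rewrite !W0// subrr enorm0.
  by rewrite (_ : W ^~ w = B ^~ w); [exact: (good w Nw).2|apply/funext => t; exact: WB].
exists W, N; split => //; last first.
  move=> w; have [Nw|Nw] := pselect (N w); first exact: W0.
  by rewrite WB//; exact: (good w Nw).1.
split => //.
- by apply: aeW => w Nw; rewrite WB//; exact: (good w Nw).1.
- move=> n t A t0 tS mA.
  have ti0 i : 0 <= t i by elim: i => // i IH; exact: le_trans (tS i).
  have mcap (Z : R -> Omega -> 'rV[R]_d) : (forall s t, 0 <= s -> s <= t -> measurable_fun setT (increment Z s t)) ->
      measurable (\bigcap_(i < n) increment Z (t i) (t i.+1) @^-1` A i).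
    move=> mZ; apply: bigcap_measurableType => i _.
    rewrite -[X in measurable X]setTI; apply: mZ => //.
  have E : P (\bigcap_(i < n) increment W (t i) (t i.+1) @^-1` A i) =
           P (\bigcap_(i < n) increment B (t i) (t i.+1) @^-1` A i).
    apply: prob_ae_eq; [exact: mcap|exact: mcap|].
    apply: aeW => w Nw; split => H i iN; have := H i iN; rewrite /preimage/= Wincr//.
  rewrite [LHS]E iB//; apply: eq_bigr => i _.
  apply: prob_ae_eq.
  - by rewrite -[X in measurable X]setTI; apply: mIB.
  - by rewrite -[X in measurable X]setTI; apply: mI.
  - by apply: aeW => w Nw; rewrite /preimage/= Wincr.
- move=> s t mIW s0 st xi; have [H1 H2] := cB s t (mIB s t s0 st) s0 st xi.
  have E (A : set 'rV[R]_d) : measurable A -> law P mIW A = law P (mIB s t s0 st) A.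
    move=> mA; rewrite -[LHS]/(P (increment W s t @^-1` A)) -[RHS]/(P (increment B s t @^-1` A)).
    apply: prob_ae_eq.
    - exact: (measurable_preimage (mI s t s0 st) mA).
    - exact: (measurable_preimage (mIB s t s0 st) mA).
    - by apply: aeW => w Nw; rewrite /preimage/= Wincr.
  split; [rewrite -H1|rewrite -H2];
    by rewrite /Rintegral; congr fine; apply: eq_measure_integral => A mA _; exact: E.
- apply: aeW => w _; exact: (path_continuous_cadlag (Wc w)).1.
Qed.

(** * The solution map of the limit equation *)

Section ode_sol.
Variables (R : realType) (d : nat) (kap ell q : R).
Hypotheses (kap0 : 0 <= kap) (ell0 : 0 <= ell) (q0 : 0 < q).
Local Notation V := 'rV[R]_d.
Local Notation b := (@bbar R d kap ell q).
Local Notation impl := (@implicit_solution R d kap ell q).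

Definition ode_sol (w : R -> V) (x : V) : R -> V :=
  xget (fun=> x) [set Y | [/\ path_continuous Y, Y 0 = x & impl w Y]].

Lemma ode_solP w x : path_continuous w ->
  [/\ path_continuous (ode_sol w x), ode_sol w x 0 = x & impl w (ode_sol w x)].
Proof.
move=> wc; have [Y Yc [Y0 HY]] := implicit_solution_exists kap0 ell0 q0 x wc.
by rewrite /ode_sol; case: xgetP => [y _ []|/(_ Y)[]].
Qed.

Lemma ode_sol_unique w x (Y : R -> V) t : path_continuous w -> 0 <= t -> Y 0 = x ->
  impl w Y -> ode_sol w x t = Y t.
Proof.
move=> wc t0 Y0 HY; have [_ S0 HS] := ode_solP x wc.
by apply: (implicit_solution_unique kap0 ell0 q0 t0 HS HY); rewrite S0 Y0.
Qed.

Lemma implicit_solution_shift w Y s : 0 <= s -> impl w Y ->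
  impl (fun u => w (s + u) - w s) (fun u => Y (s + u)).
Proof.
move=> s0 HY T e e0; have [del del0 Hd] := HY (s + T) e e0.
exists del => // u v u0 uv vT vu.
have := Hd (s + u) (s + v).
rewrite addr_ge0// lerD2l lerD2l opprD addrACA subrr add0r => /(_ isT uv vT vu).
have -> : w (s + v) - w s - (w (s + u) - w s) = w (s + v) - w (s + u); last by [].
by rewrite opprB addrA subrK.
Qed.

Lemma ode_sol_flow w x s t : path_continuous w -> 0 <= s -> 0 <= t ->
  ode_sol w x (s + t) = ode_sol (fun u => w (s + u) - w s) (ode_sol w x s) t.
Proof.
move=> wc s0 t0; have [Sc S0 HS] := ode_solP x wc.
have wc' : path_continuous (fun u => w (s + u) - w s).
  move=> u e u0 e0; have [del del0 Hd] := wc (s + u) e (addr_ge0 s0 u0) e0.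
  exists del => // r r0 ru; rewrite opprB addrA subrK; apply: Hd.
    exact: addr_ge0.
  by rewrite opprD addrACA subrr add0r.
symmetry; apply: (@ode_sol_unique _ _ (fun u => ode_sol w x (s + u))) => //.
  by rewrite addr0.
exact: implicit_solution_shift.
Qed.

(** The schemes up to time [t] read the path only on [[0, t]], hence so does their limit; this is
    what makes the solution adapted. *)
Lemma implicit_solution_local w w' Y T : impl w Y ->
  (forall u, 0 <= u <= T -> w u = w' u) -> path_continuous w' -> forall t, 0 <= t <= T ->
  Y t = ode_sol w' (Y 0) t.
Proof.
move=> HY ww' wc' t /andP[t0 tT].
have [Sc S0 HS] := ode_solP (Y 0) wc'.
apply/eqP; rewrite -subr_eq0 -enorm_eq0 -normr_le0 ger0_norm//.
apply/ler_addgt0Pr => e e0; rewrite add0r.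
have e20 : 0 < e / 2 by rewrite divr_gt0.
have [N HN] := implicit_solution_euler kap0 ell0 q0 t0 HY e20.
have [N' HN'] := implicit_solution_euler kap0 ell0 q0 t0 HS e20.
have := HN _ (leq_maxl N N'); have := HN' _ (leq_maxr N N').
set n := maxn N N'; rewrite S0.
have -> : grid_euler kap ell q w' (Y 0) (t / 2 ^+ n) (2 ^ n) =
    grid_euler kap ell q w (Y 0) (t / 2 ^+ n) (2 ^ n).
  rewrite /grid_euler.
  have p0 : 0 < 2 ^+ n :> R by rewrite exprn_gt0.
  suff H k : (k <= 2 ^ n)%N ->
    euler kap ell q (fun=> t / 2 ^+ n) (fun k => w' (k.+1%:R * (t / 2 ^+ n)) - w' (k%:R * (t / 2 ^+ n))) (Y 0) k =
    euler kap ell q (fun=> t / 2 ^+ n) (fun k => w (k.+1%:R * (t / 2 ^+ n)) - w (k%:R * (t / 2 ^+ n))) (Y 0) k.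
    exact: H.
  have kT j : (j <= 2 ^ n)%N -> w (j%:R * (t / 2 ^+ n)) = w' (j%:R * (t / 2 ^+ n)).
    move=> jn; apply: ww'; rewrite mulr_ge0 ?divr_ge0 ?(ltW p0)//=.
    apply: le_trans tT; rewrite mulrA ler_pdivrMr// mulrC ler_wpM2l// -natrX.
    by rewrite ler_nat.
  elim: k => // k IH kn; rewrite !eulerS (IH (ltnW kn)) kT// kT//.
  exact: ltnW.
set g := grid_euler _ _ _ _ _ _ _ => H1 H2.
apply: le_trans (enorm_triangle g _ _) _.
by rewrite (enormBC g) ltW// [ltRHS](splitr e) ltrD.
Qed.

(** Variable meshes are allowed so that the grid can contain a prescribed intermediate time, as the
    semigroup property requires. *)
Lemma implicit_solution_partition w Y (T e : R) : impl w Y -> 0 < e ->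
  exists2 del : R, 0 < del & forall (tau : nat -> R) N, tau 0%N = 0 ->
    (forall k, tau k <= tau k.+1) -> (forall k, tau k.+1 - tau k < del) -> tau N <= T ->
    enorm (Y (tau N) - euler kap ell q (fun k => tau k.+1 - tau k)
      (fun k => w (tau k.+1) - w (tau k)) (Y 0) N) <= tau N * e.
Proof.
move=> HY e0; have [del del0 Hd] := HY T e e0; exists del => // tau N tau0 tauS taud tauT.
have tau_mono i j : (i <= j)%N -> tau i <= tau j.
  by move=> ij; apply: (homo_leq (@lexx _ _) (@le_trans _ _)) ij => k; exact: tauS.
have tau_ge0 i : 0 <= tau i by rewrite -tau0; exact: tau_mono.
have hS k : 0 <= tau k.+1 - tau k by rewrite subr_ge0.
have := @euler_perturbed R d kap ell q kap0 ell0 q0 (fun k => tau k.+1 - tau k)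
  (fun k => w (tau k.+1) - w (tau k)) (fun k => Y (tau k)) (fun k => (tau k.+1 - tau k) * e) N hS.
rewrite tau0 => H; apply: le_trans (H _) _.
  move=> k kN; apply: Hd => //.
  by rewrite (le_trans _ tauT)// tau_mono.
rewrite -mulr_suml ler_wpM2r ?(ltW e0)//.
rewrite -(big_mkord xpredT (fun k => tau k.+1 - tau k)) telescope_sumr// tau0 subr0.
exact: lexx.
Qed.

(** The rate in [resolvent_contract] at distance [a]. *)
Definition contraction_rate (a : R) := kap + ell * (2^-1 * (2^-1 * a) `^ q).

Lemma contraction_rate_ge0 a : 0 <= contraction_rate a.
Proof. by rewrite addr_ge0// !mulr_ge0// ?powR_ge0. Qed.

(** The dichotomy of [euler_contract_max] carried to the limit of the schemes. *)
Lemma ode_sol_contract w x y t a : path_continuous w -> 0 <= t -> 0 <= a ->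
  enorm (ode_sol w x t - ode_sol w y t) <=
  Num.max a (enorm (x - y) / (1 + t * contraction_rate a)).
Proof.
move=> wc t0 a0; have [_ X0 HX] := ode_solP x wc; have [_ Y0 HY] := ode_solP y wc.
apply/ler_addgt0Pr => e e0; have e20 : 0 < e / 2 by rewrite divr_gt0.
have [N HN] := implicit_solution_euler kap0 ell0 q0 t0 HX e20.
have [N' HN'] := implicit_solution_euler kap0 ell0 q0 t0 HY e20.
have := HN _ (leq_maxl N N'); have := HN' _ (leq_maxr N N').
set n := maxn N N'; rewrite X0 Y0.
have h0 : 0 <= t / 2 ^+ n by rewrite divr_ge0// exprn_ge0.
have := @euler_contract_max R d kap ell q kap0 ell0 q0 (fun=> t / 2 ^+ n)
  (fun k => w (k.+1%:R * (t / 2 ^+ n)) - w (k%:R * (t / 2 ^+ n))) x y (2 ^ n) a (fun=> h0) a0.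
rewrite -!/(grid_euler kap ell q w _ _ _).
set gx := grid_euler _ _ _ _ x _ _; set gy := grid_euler _ _ _ _ y _ _.
have -> : \sum_(k < 2 ^ n) t / 2 ^+ n = t.
  by rewrite sumr_const card_ord -[LHS]mulr_natl natrX mulrC divfK// expf_neq0.
rewrite -/(contraction_rate a) => H H1 H2.
have c0 : 0 < 1 + t * contraction_rate a by rewrite ltr_pwDl// mulr_ge0// contraction_rate_ge0.
have {}H : enorm (gx - gy) <= Num.max a (enorm (x - y) / (1 + t * contraction_rate a)).
  rewrite le_max; case: H => [->//|H]; apply/orP; right.
  by rewrite ler_pdivlMr.
have := enorm_triangle gx (ode_sol w x t) (ode_sol w y t).
have := enorm_triangle gy gx (ode_sol w y t).
rewrite (enormBC gy); lra.
Qed.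

Lemma ode_sol_lip w x y t : path_continuous w -> 0 <= t ->
  enorm (ode_sol w x t - ode_sol w y t) <= enorm (x - y).
Proof.
move=> wc t0; apply: le_trans (ode_sol_contract x y wc t0 (enorm_ge0 (x - y))) _.
rewrite ge_max lexx/= ler_pdivrMr; last first.
  by rewrite ltr_pwDl// mulr_ge0// contraction_rate_ge0.
by rewrite ler_peMr// lerDl mulr_ge0// contraction_rate_ge0.
Qed.

Section measurability.
Variables (disp : measure_display) (Omega : measurableType disp).
Variable Z : R -> Omega -> V.
Hypothesis mZ : measurable_process Z.
Hypothesis cZ : forall w, path_continuous (Z ^~ w).

Lemma measurable_grid_euler h k : 0 <= h ->
  measurable_fun setT (fun p : V * Omega => grid_euler kap ell q (Z ^~ p.2) p.1 h k).
Proof.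
move=> h0; rewrite /grid_euler; elim: k => [|k IH] /=; first exact: measurable_fst.
apply: (measurableT_comp (measurable_resolvent kap0 ell0 q0 h0)).
apply: measurable_rowD => //; apply: measurable_rowB.
  by apply: (measurableT_comp (mZ _)); [rewrite mulr_ge0|exact: measurable_snd].
by apply: (measurableT_comp (mZ _)); [rewrite mulr_ge0|exact: measurable_snd].
Qed.

Lemma measurable_ode_sol t : 0 <= t ->
  measurable_fun setT (fun p : V * Omega => ode_sol (Z ^~ p.2) p.1 t).
Proof.
move=> t0; apply: measurable_fun_rV => i.
apply: (@measurable_fun_cvg _ _ _ _
  (fun n (p : V * Omega) => grid_euler kap ell q (Z ^~ p.2) p.1 (t / 2 ^+ n) (2 ^ n) 0 i)).
  move=> n; apply: (measurableT_comp (@measurable_coord R d i)).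
  by apply: measurable_grid_euler; rewrite divr_ge0// exprn_ge0.
move=> [x w] _ /=; apply/cvgrPdist_lt => e e0.
have [_ X0 HX] := ode_solP x (cZ w).
have [N HN] := implicit_solution_euler kap0 ell0 q0 t0 HX e0.
exists N => // n /= /HN; rewrite X0; apply: le_lt_trans.
have := coord_enorm (ode_sol (Z ^~ w) x t - grid_euler kap ell q (Z ^~ w) x (t / 2 ^+ n) (2 ^ n)) i.
by rewrite !mxE.
Qed.

Lemma measurable_ode_sol1 x t : 0 <= t ->
  measurable_fun setT (fun w : Omega => ode_sol (Z ^~ w) x t).
Proof.
move=> t0; have := measurable_ode_sol t0.
move/measurableT_comp/(_ (measurable_fun_pair (measurable_cst x) (@measurable_id _ Omega setT))).
exact.
Qed.

End measurability.

End ode_sol.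

Section limits.
Variables (R : realType) (d : nat).
Local Notation V := 'rV[R]_d.

Lemma cvg_enorm (T : Type) (F : set_system T) {FF : Filter F} (x : T -> V) (l : V) :
  x @ F --> l -> enorm (x s) @[s --> F] --> enorm l.
Proof.
move=> xl; apply/cvgrPdist_lt => e e0.
near=> s; have : enorm (x s - l) < e by near: s; exact: cvg_enorm_lt xl e0.
by apply: le_lt_trans; rewrite distrC; exact: ler_dist_enorm.
Unshelve. all: by end_near.
Qed.

Lemma lip_cvg (T : Type) (F : set_system T) {FF : Filter F} (C : R) (f : V -> R)
    (x : T -> V) (l : V) : 0 <= C -> lip C f ->
  x @ F --> l -> f (x s) @[s --> F] --> f l.
Proof.
move=> C0 fC xl; apply/cvgrPdist_lt => e e0.
have e1 : 0 < e / (C + 1) by rewrite divr_gt0// ltr_wpDl.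
near=> s; have Hs : enorm (x s - l) < e / (C + 1) by near: s; exact: cvg_enorm_lt xl e1.
rewrite distrC; apply: le_lt_trans (fC _ _) _.
apply: (@le_lt_trans _ _ ((C + 1) * enorm (x s - l))); first by rewrite ler_wpM2r// lerDl.
by rewrite mulrC -ltr_pdivlMr// ltr_wpDl.
Unshelve. all: by end_near.
Qed.

Variables (disp : measure_display) (Omega : measurableType disp).
Variable P : probability Omega R.

Lemma expect_cvg (X : nat -> Omega -> V) (Y : Omega -> V) C f : 0 <= C -> blip C f ->
  (forall n, measurable_fun setT (X n)) -> measurable_fun setT Y ->
  (forall w, X n w @[n --> \oo] --> Y w) ->
  \int[P]_w f (X n w) @[n --> \oo] --> \int[P]_w f (Y w).
Proof.
move=> C0 fC mX mY XY; have mf := blip_measurable fC; have [f1 fL] := fC.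
apply: (@expect_dominated _ _ _ P (fun n w => f (X n w)) (fun w => f (Y w)) 1).
- by move=> n; exact: measurableT_comp mf (mX n).
- exact: measurableT_comp mf mY.
- by move=> n w; exact: f1.
- by move=> w; exact: lip_cvg C0 fL (XY w).
Qed.

Lemma second_moment_lim (X : nat -> Omega -> V) (Y : Omega -> V) (M : R) :
  (forall n, measurable_fun setT (X n)) -> (forall w, X n w @[n --> \oo] --> Y w) ->
  (forall n, \int[P]_w (enorm (X n w) ^+ 2)%:E <= M%:E)%E ->
  (\int[P]_w (enorm (Y w) ^+ 2)%:E <= M%:E)%E.
Proof.
move=> mX XY HM.
have me n : measurable_fun setT (fun w => (enorm (X n w) ^+ 2)%:E).
  apply/measurable_EFinP; apply: measurable_funX.
  exact: (measurableT_comp (@measurable_enorm R d) (mX n)).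
apply: (@le_trans _ _ (\int[P]_x limn_einf (fun n => (enorm (X n x) ^+ 2)%:E))%E).
  apply: le_of_eq; apply: eq_integral => w _.
  symmetry; apply: (cvg_limn_einf_sup _).1.
  apply: cvg_EFin; first exact: nearW.
  rewrite (_ : _ \o _ = fun n => enorm (X n w) * enorm (X n w))//.
  by rewrite expr2; apply: cvgM; exact: cvg_enorm (XY w).
apply: le_trans (fatou P measurableT me _) _.
  by move=> n w _; rewrite lee_fin sqr_ge0.
rewrite limn_einf_lim; apply: lime_le; first exact: is_cvg_einfs.
apply: nearW => n; apply: le_trans (HM n).
by apply: ereal_inf_lbound; exists n => //=.
Qed.

End limits.

(** * Time reversal of the noise *)

Section noise_upto.
Variables (R : realType) (d : nat).
Local Notation V := 'rV[R]_d.
Variable psi : V -> R.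
Variables (disp : measure_display) (Omega : measurableType disp).
Variable P : probability Omega R.

(** Restricted to [[0, T]] because a process reversed at [T] has the right increments only there. *)
Definition noise_upto (T : R) (Z : R -> Omega -> V) :=
  [/\ measurable_process Z,
      (forall (tau : nat -> R) N, 0 <= tau 0%N -> (forall k, tau k <= tau k.+1) -> tau N <= T ->
         indep_seq P (fun k => increment Z (tau k) (tau k.+1)) N) &
      (forall s t (mI : measurable_fun setT (increment Z s t)), 0 <= s -> s <= t -> t <= T ->
         symmetric_charfun (fun xi => (t - s) * psi xi) (law P mI))].

Lemma noise_noise_upto (T : R) Z : noise P psi Z -> noise_upto T Z.
Proof.
move=> [mZ Z0 iZ cZ rZ]; split => //.
- by move=> tau N tau0 tauS _ A mA; exact: iZ.
- by move=> s t mI s0 st _; exact: cZ.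
Qed.

Lemma noise_upto_le (T T' : R) Z : T' <= T -> noise_upto T Z -> noise_upto T' Z.
Proof.
move=> TT [mZ iZ cZ]; split => //.
- by move=> tau N tau0 tauS tauN; apply: iZ => //; exact: le_trans TT.
- by move=> s t mI s0 st tT; apply: cZ => //; exact: le_trans TT.
Qed.

(** The maximum freezes the path after time [T], so that it is continuous on the whole half-line. *)
Definition reverse (T : R) (Z : R -> Omega -> V) (u : R) (w : Omega) : V :=
  Z T w - Z (Num.max (T - u) 0) w.

Lemma reverse_continuous (T : R) Z w : 0 <= T -> path_continuous (Z ^~ w) ->
  path_continuous ((reverse T Z) ^~ w).
Proof.
move=> T0 Zc t e t0 e0.
have m0 : 0 <= Num.max (T - t) 0 by rewrite le_max lexx orbT.
have [del del0 Hd] := Zc _ e m0 e0; exists del => // s s0 st.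
rewrite /reverse opprB addrC addrA subrK enormBC; apply: Hd.
  by rewrite le_max lexx orbT.
apply: le_lt_trans st; rewrite !maxEle.
by case: (leP (T - s) 0); case: (leP (T - t) 0) => h1 h2; rewrite ler_norml;
  have := ler_norm (s - t); have := ler_norm (t - s); rewrite (distrC t s) => *;
  apply/andP; split; lra.
Qed.

Lemma noise_upto_reverse (T : R) Z : 0 <= T -> noise P psi Z -> noise_upto T (reverse T Z).
Proof.
move=> T0 [mZ Z0 iZ cZ rZ].
have mR : measurable_process (reverse T Z).
  move=> t t0; apply: measurable_rowB; first exact: mZ.
  by apply: mZ; rewrite le_max lexx orbT.
have incrE s t w : s <= t -> t <= T -> increment (reverse T Z) s t w = increment Z (T - t) (T - s) w.
  move=> st tT; rewrite /increment /reverse.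
  rewrite (elimT max_idPl); last by rewrite subr_ge0.
  rewrite (elimT max_idPl); last by rewrite subr_ge0 (le_trans st).
  by rewrite opprB addrC addrA subrK.
split => //.
- move=> tau N tau0 tauS tauN A mA.
  have tau_mono i j : (i <= j)%N -> tau i <= tau j.
    by move=> ij; apply: (homo_leq (@lexx _ _) (@le_trans _ _)) ij => k; exact: tauS.
  (* The reversed mesh: increment [k] of the reversed process is increment [N - k - 1] of [Z] along
     [sig]. *)
  pose sig j := T - tau (N - j)%N.
  have sig0 : 0 <= sig 0%N by rewrite /sig subn0 subr_ge0.
  have sigS j : sig j <= sig j.+1 by rewrite /sig lerD2l lerN2 tau_mono// leq_sub2l.
  have rE k w : (k < N)%N -> increment (reverse T Z) (tau k) (tau k.+1) w =
      increment Z (sig (N - k.+1)%N) (sig (N - k.+1).+1) w.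
    move=> kN; rewrite incrE//; last by rewrite (le_trans _ tauN)// tau_mono.
    by rewrite /sig subKn// subnSK// subKn// ltnW.
  have := iZ N sig (fun j => A (N - j.+1)%N) sig0 sigS (fun j => mA _).
  rewrite (_ : \bigcap_(i < N) _ = \bigcap_(i < N) increment (reverse T Z) (tau i) (tau i.+1) @^-1` A i); last first.
    have kk k : (k < N)%N -> (N - (N - k.+1).+1)%N = k by lia.
    apply/seteqP; split => w H k kN.
      have kN0 : (k < N)%N := kN.
      have kN' : (N - k.+1 < N)%N by lia.
      by have := H (N - k.+1)%N kN'; rewrite /preimage/= rE// kk.
    have kN0 : (k < N)%N := kN.
    have kN' : (N - k.+1 < N)%N by lia.
    by have := H (N - k.+1)%N kN'; rewrite /preimage/= rE// kk.
  move=> ->; rewrite [LHS](reindex_inj rev_ord_inj)/=; apply: eq_bigr => k _.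
  have kN := ltn_ord k.
  congr (P _); apply/seteqP; split => w; rewrite /preimage/= rE//.
    by rewrite (_ : (N - (N - k.+1).+1)%N = k)//; lia.
  by rewrite (_ : (N - (N - k.+1).+1)%N = k)//; lia.
- move=> s t mI s0 st tT xi.
  have Ts0 : 0 <= T - t by rewrite subr_ge0.
  have TT : T - t <= T - s by rewrite lerD2l lerN2.
  have mI' : measurable_fun setT (increment Z (T - t) (T - s)).
    by apply: measurable_rowB; apply: mZ => //; exact: le_trans TT.
  have := cZ _ _ mI' Ts0 TT xi; rewrite (_ : T - s - (T - t) = t - s); last by ring.
  rewrite (expect_law P mI' (measurable_cosl xi) (fun y => cos_max _)).
  rewrite (expect_law P mI' (measurable_sinl xi) (fun y => sin_max _)).
  rewrite (expect_law P mI (measurable_cosl xi) (fun y => cos_max _)).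
  rewrite (expect_law P mI (measurable_sinl xi) (fun y => sin_max _)).
  by under [in X in X -> _]eq_Rintegral do rewrite -incrE//;
     under [X in _ /\ X = _ -> _]eq_Rintegral do rewrite -incrE//.
Qed.

End noise_upto.

Section euler_laws.
Variables (R : realType) (d : nat) (kap ell q : R).
Hypotheses (kap0 : 0 <= kap) (ell0 : 0 <= ell) (q0 : 0 < q).
Local Notation V := 'rV[R]_d.
Variables (psi : V -> R) (s2 : R).
Hypotheses (psi0 : forall xi, 0 <= psi xi) (s20 : 0 <= s2).
Hypothesis psi2 : forall xi, psi xi <= s2 / 2 * enorm xi ^+ 2.

Lemma symmetric_centered (mu : probability V R) (t : R) : 0 <= t ->
  symmetric_charfun (fun xi => t * psi xi) mu -> centered (d%:R * s2 * t) mu.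
Proof.
move=> t0 H; rewrite -mulrA; apply: (symmetric_charfun_centered H) => u i.
apply: le_trans (ler_wpM2l t0 (psi2 _)) _.
rewrite enormZ enorm_delta mulr1 real_normK ?num_real//.
apply: le_of_eq; ring.
Qed.

Section two_chains.
Variables (d1 d2 : measure_display) (O1 : measurableType d1) (O2 : measurableType d2).
Variables (P1 : probability O1 R) (P2 : probability O2 R).
Variables (z1 : nat -> O1 -> V) (z2 : nat -> O2 -> V).
Hypotheses (mz1 : forall k, measurable_fun setT (z1 k)).
Hypotheses (mz2 : forall k, measurable_fun setT (z2 k)).
Variables (h t : nat -> R) (N : nat).
Hypotheses (h0 : forall k, 0 <= h k) (t0 : forall k, 0 <= t k).
Hypotheses (i1 : indep_seq P1 z1 N) (i2 : indep_seq P2 z2 N).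
Hypothesis c1 : forall k, (k < N)%N -> symmetric_charfun (fun xi => t k * psi xi) (law P1 (mz1 k)).
Hypothesis c2 : forall k, (k < N)%N -> symmetric_charfun (fun xi => t k * psi xi) (law P2 (mz2 k)).

(** Lindeberg's replacement at no cost: by [charfun_unique] the one-step laws agree on every
    function in [blip C]. *)
Lemma euler_law_unique C f x : 0 <= C -> blip C f ->
  \int[P1]_w f (euler kap ell q h (z1 ^~ w) x N) =
  \int[P2]_w f (euler kap ell q h (z2 ^~ w) x N).
Proof.
move=> C0 fC.
rewrite (expect_iter_step kap0 ell0 q0 C0 mz1 h0 (mu := fun k => law P1 (mz1 k)) x i1 (leqnn N) _ fC)//.
rewrite (expect_iter_step kap0 ell0 q0 C0 mz2 h0 (mu := fun k => law P2 (mz2 k)) x i2 (leqnn N) _ fC)//.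
apply/eqP; rewrite -subr_eq0 -normr_le0.
apply: le_trans (iter_step_close kap0 ell0 q0 C0 (mu := fun k => law P1 (mz1 k))
  (mu' := fun k => law P2 (mz2 k)) (eps := fun=> 0) h0 _ fC x) _; last by rewrite big1.
move=> k g kN gC.
have s1 := symmetric_centered (t0 k) (c1 kN); have s2' := symmetric_centered (t0 k) (c2 kN).
rewrite (charfun_unique C0 gC (c1 kN) (c2 kN) s1 s2') ?subrr ?normr0//.
by move=> xi; rewrite mulr_ge0.
Qed.

End two_chains.

Lemma iter_step_add (h : nat -> R) (mu : nat -> probability V R) m n f :
  iter_step kap ell q h mu (m + n) f =
  iter_step kap ell q h mu m (iter_step kap ell q (fun k => h (m + k)%N) (fun k => mu (m + k)%N) n f).
Proof.
by elim: n f => [|n IH] f; [rewrite addn0|rewrite addnS /= IH].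
Qed.

Local Notation sol := (@ode_sol R d kap ell q).

Section noise_laws.
Variables (disp : measure_display) (Omega : measurableType disp).
Variable P : probability Omega R.
Variables (T : R) (Z : R -> Omega -> V).
Hypothesis T0 : 0 <= T.
Hypothesis nZ : noise_upto psi P T Z.
Hypothesis cZ : forall w, path_continuous (Z ^~ w).

Let h n : R := T / 2 ^+ n.
Let z n k := increment Z (k%:R * h n) (k.+1%:R * h n).

Let h0 n : 0 <= h n.
Proof. by rewrite divr_ge0// exprn_ge0. Qed.

Let mz n k : measurable_fun setT (z n k).
Proof. by case: nZ => mZ _ _; apply: measurable_rowB; apply: mZ; rewrite mulr_ge0. Qed.

Let hS n k : k%:R * h n <= k.+1%:R * h n.
Proof. by rewrite ler_wpM2r// ler_nat. Qed.

Let hN n : (2 ^ n)%:R * h n = T.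
Proof. by rewrite /h natrX mulrC divfK// expf_neq0. Qed.

Let hB n k : k.+1%:R * h n - k%:R * h n = h n.
Proof. by rewrite -mulrBl -natr1 addrAC subrr add0r mul1r. Qed.

Lemma grid_indep n : indep_seq P (z n) (2 ^ n).
Proof.
case: nZ => _ iZ _; apply: (iZ (fun k => k%:R * h n)) => //; first by rewrite mul0r.
by rewrite hN.
Qed.

Lemma grid_charfun n k : (k < 2 ^ n)%N -> symmetric_charfun (fun xi => h n * psi xi) (law P (mz n k)).
Proof.
move=> kn; case: nZ => _ _ cZ'; have := cZ' (k%:R * h n) (k.+1%:R * h n) (mz n k).
rewrite hB; apply => //; first by rewrite mulr_ge0.
by rewrite -[leRHS](hN n) ler_wpM2r// ler_nat.
Qed.

Lemma grid_cvg x w : grid_euler kap ell q (Z ^~ w) x (h n) (2 ^ n) @[n --> \oo] --> sol (Z ^~ w) x T.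
Proof.
apply: enorm_lt_cvg => e e0; have [_ S0 HS] := ode_solP kap0 ell0 q0 x (cZ w).
have [N HN] := implicit_solution_euler kap0 ell0 q0 T0 HS e0.
by exists N => // n /= /HN; rewrite S0 enormBC.
Qed.

Let mgrid x n : measurable_fun setT (fun w => grid_euler kap ell q (Z ^~ w) x (h n) (2 ^ n)).
Proof.
case: nZ => mZ _ _.
exact: (measurableT_comp (measurable_grid_euler kap0 ell0 q0 mZ (2 ^ n) (h0 n))
  (measurable_fun_pair (measurable_cst x) (@measurable_id _ Omega setT))).
Qed.

Lemma grid_expect_cvg x C f : 0 <= C -> blip C f ->
  \int[P]_w f (grid_euler kap ell q (Z ^~ w) x (h n) (2 ^ n)) @[n --> \oo] -->
  \int[P]_w f (sol (Z ^~ w) x T).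
Proof.
move=> C0 fC; apply: (@expect_cvg R d _ Omega P
  (fun n w => grid_euler kap ell q (Z ^~ w) x (h n) (2 ^ n)) (fun w => sol (Z ^~ w) x T) C f C0 fC).
- exact: mgrid.
- by case: nZ => mZ _ _; exact: measurable_ode_sol1.
- by move=> w; exact: grid_cvg.
Qed.

Lemma ode_sol_second_moment (M : R) : 0 < kap + ell -> d%:R * s2 / (kap + ell) + 1 <= M ->
  (\int[P]_w (enorm (sol (Z ^~ w) 0 T) ^+ 2)%:E <= M%:E)%E.
Proof.
case: (nZ) => mZ _ _ c0 HM.
have s0 : 0 <= d%:R * s2 by rewrite mulr_ge0.
apply: (@second_moment_lim _ _ _ _ P
   (fun n w => grid_euler kap ell q (Z ^~ w) 0 (h n) (2 ^ n))).
- exact: mgrid.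
- by move=> w; exact: grid_cvg.
move=> n; apply: (euler_second_moment kap0 ell0 q0 (mz n) (h := fun=> h n) (fun=> h0 n)
  (mu := fun k => law P (mz n k)) (grid_indep n) s0) => //.
- by move=> k kn; apply: symmetric_centered => //; exact: grid_charfun.
- by rewrite enorm0 expr0n/= (le_trans _ HM)// addr_ge0// divr_ge0// ltW.
Qed.

End noise_laws.

(** Weak uniqueness: both sides are limits of expectations of schemes on the same grid, which agree
    by [euler_law_unique]. *)
Lemma ode_sol_law_unique (d1 d2 : measure_display) (O1 : measurableType d1) (O2 : measurableType d2)
    (P1 : probability O1 R) (P2 : probability O2 R) (T : R)
    (Z1 : R -> O1 -> V) (Z2 : R -> O2 -> V) C f x : 0 <= T ->
  noise_upto psi P1 T Z1 -> noise_upto psi P2 T Z2 ->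
  (forall w, path_continuous (Z1 ^~ w)) -> (forall w, path_continuous (Z2 ^~ w)) ->
  0 <= C -> blip C f ->
  \int[P1]_w f (sol (Z1 ^~ w) x T) = \int[P2]_w f (sol (Z2 ^~ w) x T).
Proof.
move=> T0 n1 n2 c1 c2 C0 fC.
have H1 := @grid_expect_cvg _ _ _ _ _ T0 n1 c1 x C f C0 fC.
have H2 := @grid_expect_cvg _ _ _ _ _ T0 n2 c2 x C f C0 fC.
apply: (cvg_unique (@norm_hausdorff _ _) H1).
rewrite (_ : (fun n => \int[P1]_w _) = (fun n => \int[P2]_w f (grid_euler kap ell q (Z2 ^~ w) x (T / 2 ^+ n) (2 ^ n))))//.
apply/funext => n.
have h0 : 0 <= T / 2 ^+ n by rewrite divr_ge0// exprn_ge0.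
have mz (d' : measure_display) (O : measurableType d') (Z : R -> O -> V) k :
    measurable_process Z -> measurable_fun setT (increment Z (k%:R * (T / 2 ^+ n)) (k.+1%:R * (T / 2 ^+ n))).
  by move=> mZ; apply: measurable_rowB; apply: mZ; rewrite mulr_ge0.
case: (n1) => m1 _ _; case: (n2) => m2 _ _.
apply: (euler_law_unique (mz1 := fun k => mz _ _ Z1 k m1) (mz2 := fun k => mz _ _ Z2 k m2)
  (t := fun=> T / 2 ^+ n) (N := (2 ^ n)%N) (fun=> h0) (fun=> h0) _ _ _ _ _ C0 fC).
- exact: grid_indep.
- exact: grid_indep.
- by move=> k kn; exact: grid_charfun.
- by move=> k kn; exact: grid_charfun.
Qed.

(** * Markov semigroup of the limit equation *)

Section semigroup.
Variables (disp : measure_display) (Omega : measurableType disp).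
Variable P : probability Omega R.
Variable W : R -> Omega -> V.
Hypothesis nW : noise P psi W.
Hypothesis cW : forall w, path_continuous (W ^~ w).

Definition semigroup (t : R) (f : V -> R) (x : V) : R := \int[P]_w f (sol (W ^~ w) x t).

Let mW : measurable_process W. Proof. by case: nW. Qed.

Lemma semigroup_blip C t f : 0 <= C -> 0 <= t -> blip C f -> blip C (semigroup t f).
Proof.
move=> C0 t0 fC; have mf := blip_measurable fC; have [f1 fL] := fC.
have ms x : measurable_fun setT (fun w => f (sol (W ^~ w) x t)).
  by apply: (measurableT_comp mf); exact: measurable_ode_sol1.
split; first by move=> x; apply: expect_abs_le.
move=> x y; rewrite /semigroup -(expectB _ (M := 1))//.
apply: expect_abs_le; first exact: measurable_funB.
move=> w; apply: le_trans (fL _ _) _; rewrite ler_wpM2l//.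
exact: ode_sol_lip.
Qed.

(* The two phases of the scheme meet at time s; the first phase sees only the
   noise before s and the second only the noise after s. *)
Lemma semigroupD C s t f x : 0 <= C -> 0 <= s -> 0 <= t -> blip C f ->
  semigroup (s + t) f x = semigroup s (semigroup t f) x.
Proof.
move=> C0 s0 t0 fC; have [f1 fL] := fC.
have p2 n : 0 < 2 ^+ n :> R by rewrite exprn_gt0.
(* The mesh makes [2^n] steps of length [s / 2^n], then steps of length [t / 2^n]; the time [s] is
   grid point [2^n] for every [n]. *)
pose tau n k : R := (minn k (2 ^ n))%:R * (s / 2 ^+ n) + (k - 2 ^ n)%N%:R * (t / 2 ^+ n).
have sn n : 0 <= s / 2 ^+ n by rewrite divr_ge0// ltW.
have tn n : 0 <= t / 2 ^+ n by rewrite divr_ge0// ltW.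
have tau0 n : tau n 0%N = 0 by rewrite /tau min0n sub0n !mul0r addr0.
have tau1 n k : (k < 2 ^ n)%N -> tau n k.+1 - tau n k = s / 2 ^+ n.
  move=> kn; rewrite /tau (minn_idPl kn) (minn_idPl (ltnW kn)).
  rewrite (_ : (k.+1 - 2 ^ n)%N = 0%N); last by lia.
  rewrite (_ : (k - 2 ^ n)%N = 0%N); last by lia.
  by rewrite !mul0r !addr0 -mulrBl -natr1 addrAC subrr add0r mul1r.
have tau2 n k : tau n (2 ^ n + k)%N = s + k%:R * (t / 2 ^+ n).
  by rewrite /tau (minn_idPr (leq_addr _ _)) addKn natrX [2 ^+ n * _]mulrC divfK// gt_eqF.
have tau3 n k : tau n (2 ^ n + k).+1 - tau n (2 ^ n + k)%N = t / 2 ^+ n.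
  by rewrite -addnS !tau2 opprD addrACA subrr add0r -mulrBl -natr1 addrAC subrr add0r mul1r.
have tauS n k : tau n k <= tau n k.+1.
  rewrite -subr_ge0; have [kn|kn] := ltnP k (2 ^ n); first by rewrite tau1.
  by rewrite -(subnKC kn) tau3.
have tau_ge0 n k : 0 <= tau n k by elim: k => [|k IH]; [rewrite tau0|exact: le_trans (tauS n k)].
have taud n k e : s / 2 ^+ n < e -> t / 2 ^+ n < e -> tau n k.+1 - tau n k < e.
  move=> se te; have [kn|kn] := ltnP k (2 ^ n); first by rewrite tau1.
  by rewrite -(subnKC kn) tau3.
pose h n k := tau n k.+1 - tau n k.
have h0 n k : 0 <= h n k by rewrite subr_ge0.
pose z n k := increment W (tau n k) (tau n k.+1).
have mz n k : measurable_fun setT (z n k) by apply: measurable_rowB; apply: mW.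
pose Y n N w := euler kap ell q (h n) (z n ^~ w) x N.
have mY n N : measurable_fun setT (Y n N) by exact: measurable_euler.
have iz n N : indep_seq P (z n) N by case: nW => _ _ iW _ _; move=> A mA; apply: iW => //; rewrite tau0.
have cz n k : symmetric_charfun (fun xi => h n k * psi xi) (law P (mz n k)).
  by case: nW => _ _ _ + _; apply.
have small (u e : R) : 0 < e -> \forall n \near \oo, u / 2 ^+ n < e.
  move=> e0; have e1 : 0 < e / (`|u| + 1) by rewrite divr_gt0// ltr_wpDl.
  have := near_infty_natSinv_expn_lt (PosNum e1); apply: filterS => n /=.
  rewrite div1r ltr_pdivlMr ?ltr_wpDl// => H; apply: le_lt_trans H.
  by rewrite mulrC ler_wpM2l ?invr_ge0 ?(ltW (p2 n))// ler_wpDr// ler_norm.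
have Ycvg (v : nat -> nat) (r : R) : (forall n, tau n (v n) = r) -> r <= s + t ->
    forall w, Y n (v n) w @[n --> \oo] --> sol (W ^~ w) x r.
  move=> vr rst w; have r0 : 0 <= r by rewrite -(vr 0%N).
  have [_ S0 HS] := ode_solP kap0 ell0 q0 x (cW w).
  apply: enorm_lt_cvg => e e0; have e1 : 0 < e / (r + 1) by rewrite divr_gt0// ltr_wpDl.
  have [del del0 Hd] := implicit_solution_partition kap0 ell0 q0 (s + t) HS e1.
  near=> n; rewrite enormBC.
  have := Hd (tau n) (v n) (tau0 n) (tauS n); rewrite vr S0 => H.
  apply: le_lt_trans (H _ rst) _.
    by move=> k; apply: taud; near: n; exact: small.
  by rewrite mulrCA gtr_pMr// ltr_pdivrMr ?ltr_wpDl// mul1r ltrDl.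
have tauN n : tau n (2 ^ n)%N = s by have := tau2 n 0%N; rewrite addn0 mul0r addr0.
have tauNN n : tau n (2 ^ n + 2 ^ n)%N = s + t.
  by rewrite tau2 natrX [2 ^+ n * _]mulrC divfK// gt_eqF.
pose g n := iter_step kap ell q (fun k => h n (2 ^ n + k)%N) (fun k => law P (mz n (2 ^ n + k)%N)) (2 ^ n) f.
have gC n : blip C (g n) by apply: iter_step_blip.
have lawE n k A : measurable A -> P (z n k @^-1` A) = law P (mz n k) A by [].
have E1 n : \int[P]_w f (Y n (2 ^ n + 2 ^ n)%N w) = \int[P]_w g n (Y n (2 ^ n)%N w).
  rewrite (expect_iter_step kap0 ell0 q0 C0 (mz n) (h0 n) (mu := fun k => law P (mz n k)) x (iz n (2 ^ n + 2 ^ n)%N) (leqnn _) (fun k A _ => lawE n k A) fC).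
  rewrite (expect_iter_step kap0 ell0 q0 C0 (mz n) (h0 n) (mu := fun k => law P (mz n k)) x (iz n (2 ^ n)%N) (leqnn _) (fun k A _ => lawE n k A) (gC n)).
  by rewrite iter_step_add.
have gE n y : g n y = \int[P]_w f (grid_euler kap ell q (W ^~ w) y (t / 2 ^+ n) (2 ^ n)).
  have mz' k : measurable_fun setT (increment W (k%:R * (t / 2 ^+ n)) (k.+1%:R * (t / 2 ^+ n))).
    by apply: measurable_rowB; apply: mW; rewrite mulr_ge0.
  have izs : indep_seq P (fun k => z n (2 ^ n + k)%N) (2 ^ n).
    move=> A mA; case: nW => _ _ iW _ _.
    have t1 k : tau n (2 ^ n + k)%N <= tau n (2 ^ n + k.+1)%N by rewrite addnS.
    have := iW (2 ^ n)%N (fun k => tau n (2 ^ n + k)%N) A (tau_ge0 n _) t1 mA.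
    have zE k : z n (2 ^ n + k)%N = increment W (tau n (2 ^ n + k)%N) (tau n (2 ^ n + k.+1)%N).
      by rewrite /z addnS.
    by under eq_bigcapr do rewrite -zE; under [in X in _ = X -> _]eq_bigr do rewrite -zE.
  have := expect_iter_step kap0 ell0 q0 C0 (z := fun k => z n (2 ^ n + k)%N) (fun k => mz n (2 ^ n + k)%N)
     (h := fun k => h n (2 ^ n + k)%N) (fun k => h0 n (2 ^ n + k)%N) (N := (2 ^ n)%N)
     (mu := fun k => law P (mz n (2 ^ n + k)%N)) y izs (leqnn _) (fun k A _ => lawE n (2 ^ n + k)%N A) fC.
  rewrite -/(g n) => <-.
  have -> : (fun k => h n (2 ^ n + k)%N) = fun=> t / 2 ^+ n.
    by apply/funext => k; rewrite /h tau3.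
  apply: (euler_law_unique (mz1 := fun k => mz n (2 ^ n + k)%N) (mz2 := mz') (t := fun=> t / 2 ^+ n)
     (fun=> tn n) (fun=> tn n) izs _ _ _ y C0 fC).
  - have := grid_indep t0 (noise_noise_upto t nW) n.
    exact.
  - by move=> k _; have := cz n (2 ^ n + k)%N; rewrite /h tau3.
  - by move=> k kn; exact: (grid_charfun t0 (noise_noise_upto t nW) kn).
have L1 : \int[P]_w f (Y n (2 ^ n + 2 ^ n)%N w) @[n --> \oo] --> semigroup (s + t) f x.
  apply: (@expect_cvg R d _ Omega P (fun n w => Y n (2 ^ n + 2 ^ n)%N w) (fun w => sol (W ^~ w) x (s + t)) C f C0 fC).
  - by move=> n; exact: mY.
  - by apply: measurable_ode_sol1 => //; exact: addr_ge0.
  - by move=> w; apply: (Ycvg (fun n => (2 ^ n + 2 ^ n)%N)).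
have L2 : \int[P]_w g n (Y n (2 ^ n)%N w) @[n --> \oo] --> semigroup s (semigroup t f) x.
  have sC := semigroup_blip C0 t0 fC.
  have ms : measurable_fun setT (fun w => sol (W ^~ w) x s) by exact: measurable_ode_sol1.
  apply: (@expect_dominated _ _ _ P (fun n w => g n (Y n (2 ^ n)%N w)) (fun w => semigroup t f (sol (W ^~ w) x s)) 1).
  - by move=> n; exact: measurableT_comp (blip_measurable (gC n)) (mY _ _).
  - exact: measurableT_comp (blip_measurable sC) ms.
  - by move=> n w; exact: (gC n).1.
  - move=> w; have Yw := Ycvg (fun n => (2 ^ n)%N) s tauN _ w.
    have gl : g n (sol (W ^~ w) x s) @[n --> \oo] --> semigroup t f (sol (W ^~ w) x s).
      rewrite (_ : (fun n => _) = fun n => \int[P]_v f (grid_euler kap ell q (W ^~ v)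
          (sol (W ^~ w) x s) (t / 2 ^+ n) (2 ^ n))); last by apply/funext => n; rewrite gE.
      exact: (@grid_expect_cvg _ _ _ _ _ t0 (noise_noise_upto t nW) cW _ C f C0 fC).
    (* The functions [g n] share the Lipschitz constant [C], so their argument may move with [n]. *)
    have gd : g n (Y n (2 ^ n)%N w) - g n (sol (W ^~ w) x s) @[n --> \oo] --> (0 : R).
      apply/cvgr0Pnorm_lt => e e0; have e1 : 0 < e / (C + 1) by rewrite divr_gt0// ltr_wpDl.
      near=> n; apply: le_lt_trans ((gC n).2 _ _) _.
      have Hn : enorm (Y n (2 ^ n)%N w - sol (W ^~ w) x s) < e / (C + 1).
        by near: n; apply: (cvg_enorm_lt (Yw _) e1); rewrite lerDl.
      apply: (@le_lt_trans _ _ ((C + 1) * enorm (Y n (2 ^ n)%N w - sol (W ^~ w) x s))).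
        by rewrite ler_wpM2r// lerDl.
      by rewrite mulrC -ltr_pdivlMr// ltr_wpDl.
    have := cvgD gd gl; rewrite add0r (_ : _ + _ = fun n => g n (Y n (2 ^ n)%N w)); last first.
      by apply/funext => n; rewrite !fctE subrK.
    exact.
apply: (cvg_unique (@norm_hausdorff _ _) L1).
by rewrite (_ : (fun n => _) = fun n => \int[P]_w g n (Y n (2 ^ n)%N w)); last exact/funext.
Unshelve. all: by end_near.
Qed.

End semigroup.
End euler_laws.

(** * The invariant law *)

Lemma expect_ae_eq (R : realType) (disp : measure_display) (T : measurableType disp)
    (P : probability T R) (f g : T -> R) (M : R) (N : set T) :
  measurable_fun setT f -> measurable_fun setT g ->
  (forall x, `|f x| <= M) -> (forall x, `|g x| <= M) ->
  measurable N -> P N = 0%E -> (forall x, ~ N x -> f x = g x) ->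
  \int[P]_x f x = \int[P]_x g x.
Proof.
move=> mf mg fM gM mN N0 fg; apply/eqP; rewrite -subr_eq0 -normr_le0.
have := @expect_near R disp T P f g M 1 0 (fun=> M + M) (fun=> N) mf mg fM gM (fun=> mN).
rewrite !big_ord1 N0/= mulr0 addr0; apply=> x; rewrite big_ord1 add0r indicE.
case: (boolP (x \in N)) => [xN|]; last by rewrite notin_setE => /fg ->; rewrite subrr normr0 mulr0.
by rewrite mulr1; apply: le_trans (ler_normB _ _) _; exact: lerD.
Qed.

Section product.
Variables (R : realType) (d1 d2 : measure_display).
Variables (T1 : measurableType d1) (T2 : measurableType d2).
Variables (m1 : probability T1 R) (m2 : probability T2 R).

(** Under the product probability the two projections are independent, so this is [expect_indep]. *)
Lemma expect_prod (H : T1 * T2 -> R) (M : R) : measurable_fun setT H -> (forall p, `|H p| <= M) ->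
  \int[(m1 \x m2)%E]_p H p = \int[m1]_x \int[m2]_y H (x, y).
Proof.
move=> mH HM; pose Q : probability _ R := (m1 \x m2)%E.
have Q1 A : measurable A -> Q (fst @^-1` A) = m1 A.
  move=> mA; rewrite (_ : fst @^-1` A = A `*` setT); last by apply/seteqP; split => -[x y]//= [].
  rewrite [LHS](product_measure1E m1 m2 mA measurableT).
  by transitivity (m1 A * 1)%E; [congr (_ * _)%E; exact: probability_setT|exact: mule1].
have Q2 A : measurable A -> Q (snd @^-1` A) = m2 A.
  move=> mA; rewrite (_ : snd @^-1` A = setT `*` A); last by apply/seteqP; split => -[x y]//= [].
  rewrite [LHS](product_measure1E m1 m2 measurableT mA).
  by transitivity (1 * m2 A)%E; [congr (_ * _)%E; exact: probability_setT|exact: mul1e].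
have HM' p : -M <= H p <= M by rewrite -ler_norml.
have M0 : 0 <= M by exact: le_trans (normr_ge0 _) (HM point).
pose G (p : T1 * T2) := (H p + M)%:E.
have G0 p : (0 <= G p)%E.
  by rewrite lee_fin -lerBlDr sub0r; have /andP[] := HM' p.
have mG : measurable_fun setT G.
  by apply/measurable_EFinP; apply: measurable_funD.
have mHx x : measurable_fun setT (fun y => H (x, y)) by exact: measurable_fun_pair2.
have inner x : (\int[m2]_y G (x, y) = (\int[m2]_y H (x, y) + M)%:E)%E.
  rewrite (@Rintegral_EFin _ _ _ _ _ (M + M))//; last first.
  - by move=> y; rewrite (le_trans (ler_normD _ _))// (ger0_norm M0) lerD2r.
  - exact: measurable_funD.
  by rewrite (@expectD _ _ _ _ _ _ M) ?expect_cst// => y; rewrite ger0_norm.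
have mi : measurable_fun setT (fun x => \int[m2]_y H (x, y)).
  have mF := @measurable_fun_fubini_tonelli_F _ _ _ _ R m2 G mG G0.
  have : measurable_fun setT (fun x => fubini_F m2 G x - M%:E)%E by exact: emeasurable_funB.
  rewrite (_ : (fun _ => _) = EFin \o (fun x => \int[m2]_y H (x, y))).
    by move/measurable_EFinP.
  by apply/funext => x /=; rewrite /fubini_F inner -EFinB addrK.
have ind A B : measurable A -> measurable B ->
    Q (fst @^-1` A `&` snd @^-1` B) = (Q (fst @^-1` A) * Q (snd @^-1` B))%E.
  move=> mA mB; rewrite Q1// Q2// (_ : _ `&` _ = A `*` B); last by apply/seteqP; split => -[].
  exact: (product_measure1E m1 m2 mA mB).
have := @expect_indep R _ _ _ _ T1 T2 Q fst snd measurable_fst measurable_snd ind H M mH HM.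
rewrite (_ : (fun w => H (w.1, w.2)) = H); last by apply/funext => -[].
move=> ->.
have E2 x : \int[Q]_p H (x, p.2) = \int[m2]_y H (x, y).
  rewrite -(expect_law Q measurable_snd (mHx x) (M := M))//.
  by rewrite /Rintegral; congr fine; apply: eq_measure_integral => A mA _; exact: Q2.
under eq_Rintegral do rewrite E2.
rewrite -(expect_law Q measurable_fst mi (M := M)).
  by rewrite /Rintegral; congr fine; apply: eq_measure_integral => A mA _; exact: Q1.
by move=> x; exact: expect_abs_le.
Qed.

End product.

Section invariant_law.
Variables (R : realType) (d : nat) (kap ell q : R).
Hypotheses (kap0 : 0 <= kap) (ell0 : 0 <= ell) (q0 : 0 < q) (c0 : 0 < kap + ell).
Local Notation V := 'rV[R]_d.
Local Notation sol := (@ode_sol R d kap ell q).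
Variables (psi : V -> R) (s2 : R).
Hypotheses (psi0 : forall xi, 0 <= psi xi) (s20 : 0 <= s2).
Hypothesis psi2 : forall xi, psi xi <= s2 / 2 * enorm xi ^+ 2.

Lemma contraction_rate_gt0 a : 0 < a -> 0 < contraction_rate kap ell q a.
Proof.
move=> a0; rewrite /contraction_rate; have [k0|k0] := ltP 0 kap.
  by rewrite ltr_pwDl// !mulr_ge0// ?powR_ge0.
have kE : kap = 0 by apply/eqP; rewrite eq_le k0.
by move: c0; rewrite kE !add0r => e0; rewrite !mulr_gt0// ?powR_gt0 ?mulr_gt0.
Qed.

(** Chosen nondecreasing in [m] and so that the time multiplied by the rate at distance [2^-m] is at
    least [4^m]: two solutions at distance at most [2^m] are then brought within [2^-m]. *)
Definition mixing_time (m : nat) : R :=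
  \sum_(k < m.+1) 4 ^+ k / contraction_rate kap ell q (2 ^- k).

Let term_gt0 k : 0 < 4 ^+ k / contraction_rate kap ell q (2 ^- k) :> R.
Proof. by rewrite divr_gt0 ?exprn_gt0// contraction_rate_gt0// invr_gt0 exprn_gt0. Qed.

Lemma mixing_time_ge0 m : 0 <= mixing_time m.
Proof. by apply: sumr_ge0 => k _; exact: ltW. Qed.

Lemma mixing_timeS m : mixing_time m <= mixing_time m.+1.
Proof. by rewrite /mixing_time [leRHS]big_ord_recr/= lerDl ltW. Qed.

Lemma mixing_time_rate m : 4 ^+ m <= mixing_time m * contraction_rate kap ell q (2 ^- m).
Proof.
rewrite -ler_pdivrMr; last by rewrite contraction_rate_gt0// invr_gt0 exprn_gt0.
by rewrite /mixing_time big_ord_recr/= lerDr; apply: sumr_ge0 => k _; exact: ltW.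
Qed.

Lemma ode_sol_mixing w x y m : path_continuous w ->
  enorm (sol w x (mixing_time m) - sol w y (mixing_time m)) <=
  Num.max (2 ^- m) (enorm (x - y) / 4 ^+ m).
Proof.
move=> wc; have p0 : 0 < 4 ^+ m :> R by rewrite exprn_gt0.
have a0 : 0 <= 2 ^- m :> R by rewrite invr_ge0 exprn_ge0.
apply: le_trans (ode_sol_contract kap0 ell0 q0 x y wc (mixing_time_ge0 m) a0) _.
rewrite ge_max !le_max lexx/=; apply/orP; right.
have r0 : 0 <= mixing_time m * contraction_rate kap ell q (2 ^- m).
  by rewrite mulr_ge0 ?mixing_time_ge0 ?contraction_rate_ge0.
rewrite ler_wpM2l// lef_pV2 ?posrE//; last by rewrite ltr_pwDl.
by apply: le_trans (mixing_time_rate m) _; rewrite lerDr.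
Qed.

Variables (disp : measure_display) (Omega : measurableType disp).
Variable P : probability Omega R.
Variable W : R -> Omega -> V.
Hypothesis nW : noise P psi W.
Hypothesis cW : forall w, path_continuous (W ^~ w).
Local Notation semigroup := (semigroup kap ell q P W).
Local Notation T := mixing_time.

Lemma ode_sol_reverse (Z : R -> Omega -> V) (x : V) w (a b : R) :
  (forall w, path_continuous (Z ^~ w)) -> 0 <= a -> a <= b ->
  sol ((reverse b Z) ^~ w) x b =
  sol ((reverse a Z) ^~ w) (sol ((reverse b Z) ^~ w) x (b - a)) a.
Proof.
move=> cZ a0 ab; have ba0 : 0 <= b - a by rewrite subr_ge0.
have cR : path_continuous ((reverse b Z) ^~ w).
  by apply: reverse_continuous => //; exact: le_trans ab.
have := ode_sol_flow kap0 ell0 q0 x cR ba0 a0; rewrite subrK => ->.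
suff -> : (fun u => reverse b Z (b - a + u) w - reverse b Z (b - a) w) = (reverse a Z) ^~ w by [].
apply/funext => u; rewrite /reverse opprD addrA subKr (elimT (@max_idPl _ _ a 0))//.
by rewrite opprB [LHS]addrC addrA subrK.
Qed.

(* The solution started at 0 at time -T m and observed at time 0. *)
Let pull_back m w := sol ((reverse (T m) W) ^~ w) 0 (T m).

Let cR m w : path_continuous ((reverse (T m) W) ^~ w).
Proof. by apply: reverse_continuous => //; exact: mixing_time_ge0. Qed.

Let nR m : noise_upto psi P (T m) (reverse (T m) W).
Proof. exact: (noise_upto_reverse (mixing_time_ge0 m) nW). Qed.

Let mpull m : measurable_fun setT (pull_back m).
Proof. by case: (nR m) => mR _ _; apply: measurable_ode_sol1 => //; exact: mixing_time_ge0. Qed.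

(** The position, at time [- T m], of the solution started at 0 at time [- T m.+1]. From there on
    both pull-backs are driven by the same noise. *)
Let start m w := sol ((reverse (T m.+1) W) ^~ w) 0 (T m.+1 - T m).

Let pull_backS m w : pull_back m.+1 w = sol ((reverse (T m) W) ^~ w) (start m w) (T m).
Proof.
have D0 : 0 <= T m.+1 - T m by rewrite subr_ge0 mixing_timeS.
exact: (ode_sol_reverse 0 w cW (mixing_time_ge0 m) (mixing_timeS m)).
Qed.

Let M : R := d%:R * s2 / (kap + ell) + 1.
Let M0 : 0 <= M.
Proof. by rewrite addr_ge0// divr_ge0 ?mulr_ge0// ltW. Qed.

Let bad m := [set w | 2 ^+ m < enorm (start m w)].

(** The second moment of [start m] is bounded uniformly in [m], so these probabilities are summable
    and Borel-Cantelli applies. Off the bad event, [2^m / 4^m = 2^-m] bounds the distance of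
    successive pull-backs. *)
Let bad_prob m : measurable (bad m) /\ (P (bad m) <= (M / 4 ^+ m)%:E)%E.
Proof.
have D0 : 0 <= T m.+1 - T m by rewrite subr_ge0 mixing_timeS.
have DT : T m.+1 - T m <= T m.+1 by rewrite gerBl mixing_time_ge0.
have nD := noise_upto_le DT (nR m.+1).
have ms : measurable_fun setT (start m).
  by case: nD => mR _ _; exact: measurable_ode_sol1.
have p2 : 0 < 2 ^+ m :> R by rewrite exprn_gt0.
have := @markov_enorm R d _ _ P (start m) M (2 ^+ m) ms p2.
rewrite -exprM mulnC exprM (_ : 2 ^+ 2 = 4 :> R); last by ring.
apply.
have := ode_sol_second_moment kap0 ell0 q0 s20 psi2 D0 nD (cR m.+1) c0 (lexx M).
exact.
Qed.

Let close m w : ~ bad m w -> enorm (pull_back m.+1 w - pull_back m w) <= 2 ^- m.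
Proof.
move=> /negP; rewrite -leNgt => sw; rewrite pull_backS.
apply: le_trans (ode_sol_mixing _ _ _ (cR m w)) _; rewrite subr0 ge_max lexx/=.
rewrite ler_pdivrMr ?exprn_gt0//; apply: le_trans sw _.
by rewrite (_ : 4 = 2 * 2 :> R) ?exprMn ?mulKf ?expf_neq0//; ring.
Qed.

Let N := lim_sup_set bad.

Let mN : measurable N.
Proof.
apply: bigcapT_measurable => n; apply: bigcup_measurable => k _.
exact: (bad_prob k).1.
Qed.

Let N0 : P N = 0%E.
Proof.
apply: lim_sup_set_cvg0; first by move=> k; exact: (bad_prob k).1.
apply: (@le_lt_trans _ _ (4 * M)%:E); last exact: ltry.
apply: lime_le; first exact: is_cvg_nneseries.
(* Partial sums of [M / 4^k] are bounded by [4 M - 2 M / 2^n], a form that carries the induction. *)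
apply: nearW => n; apply: (@le_trans _ _ (4 * M - 2 * (M * 2 ^- n))%:E); last first.
  by rewrite lee_fin gerBl !mulr_ge0// invr_ge0 exprn_ge0.
elim: n => [|n IH].
  by rewrite big_nil expr0 invr1 mulr1 lee_fin; move: M0; lra.
rewrite big_nat_recr//=; apply: le_trans (leeD IH (bad_prob n).2) _.
rewrite -EFinD lee_fin exprS (_ : 4 ^+ n = 2 ^+ n * 2 ^+ n :> R); last first.
  by rewrite -exprMn; congr (_ ^+ _); ring.
have p : 0 < 2 ^- n :> R by rewrite invr_gt0 exprn_gt0.
have p1 : 2 ^- n <= 1 :> R by rewrite invf_le1 ?exprn_gt0// exprn_ege1// ler1n.
rewrite !invfM; move: p p1; set x := 2 ^- n => p p1.
have : M * (x * x) <= M * x by rewrite ler_wpM2l// ger_pMr.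
have -> : M * (2^-1 * x) = 2^-1 * (M * x) by ring.
lra.
Qed.

Let xi m w : V := (1 - \1_N w : R) *: pull_back m w.

Let mxi m : measurable_fun setT (xi m).
Proof.
apply: measurable_fun_rV => i.
rewrite (_ : (fun _ => _) = (fun w => (1 - \1_N w) * pull_back m w 0 i)); last first.
  by apply/funext => w; rewrite mxE.
apply: measurable_funM; first by apply: measurable_funB => //; exact: measurable_indic.
exact: (measurableT_comp (@measurable_coord R d i)).
Qed.

Let xiE m w : ~ N w -> xi m w = pull_back m w.
Proof. by move=> Nw; rewrite /xi indicE memNset// subr0 scale1r. Qed.

Let xi_cvg w : exists l : V, xi m w @[m --> \oo] --> l.
Proof.
have [Nw|Nw] := pselect (N w).
  exists 0; rewrite (_ : (fun m => xi m w) = fun=> 0); first exact: cvg_cst.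
  by apply/funext => m; rewrite /xi indicE mem_set// subrr scale0r.
have [n0 Hn0] : exists n0, forall m, (n0 <= m)%N -> ~ bad m w.
  apply: contrapT => /forallNP H; apply: Nw => n _; apply: contrapT => Hn.
  by apply: (H n) => m nm bm; apply: Hn; exists m.
have step n k : (n0 <= n)%N -> enorm (xi n w - xi (n + k)%N w) <= 2 * 2 ^- n - 2 * 2 ^- (n + k).
  move=> nn; elim: k => [|k IH]; first by rewrite addn0 !subrr enorm0.
  apply: le_trans (enorm_triangle (xi (n + k)%N w) _ _) _.
  have cl : enorm (xi (n + k)%N w - xi (n + k.+1)%N w) <= 2 ^- (n + k).
    rewrite enormBC !xiE// addnS; apply: close; apply: Hn0.
    exact: (leq_trans nn (leq_addr _ _)).
  apply: le_trans (lerD IH cl) _.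
  rewrite addnS exprS invfM; set y := 2 ^- (n + k).
  by rewrite mulrA divff// mul1r; lra.
apply: row_cauchy => e e0.
have [n1 _ Hn1] : \forall n \near \oo, 2 * 2 ^- n < e :> R.
  have := near_infty_natSinv_expn_lt (PosNum (divr_gt0 e0 (ltr0n R 2))).
  by apply: filterS => n /=; rewrite div1r => H; rewrite mulrC -ltr_pdivlMr.
exists (maxn n0 n1) => n m; rewrite geq_max => /andP[nn0 nn1] nm.
rewrite -(subnKC nm); apply: le_trans (step _ _ nn0) _.
apply: (@le_trans _ _ (2 * 2 ^- n)); first by rewrite gerBl mulr_ge0// invr_ge0 exprn_ge0.
exact/ltW/Hn1.
Qed.

Let xi_lim w := projT1 (cid (xi_cvg w)).
Let xi_limP w : xi m w @[m --> \oo] --> xi_lim w.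
Proof. exact: projT2 (cid (xi_cvg w)). Qed.

Let mlim : measurable_fun setT xi_lim.
Proof.
apply: measurable_fun_rV => i.
apply: (@measurable_fun_cvg _ _ _ _ (fun m w => xi m w 0 i)).
  by move=> m; apply: (measurableT_comp (@measurable_coord R d i)).
move=> w _; apply/cvgrPdist_lt => e e0; near=> m.
have H : enorm (xi m w - xi_lim w) < e by near: m; exact: (cvg_enorm_lt (@xi_limP w) e0).
by rewrite distrC; apply: le_lt_trans H; have := coord_enorm (xi m w - xi_lim w) i; rewrite !mxE.
Unshelve. all: by end_near.
Qed.

Definition invariant_law : probability V R := law P mlim.

(** The reversed noise has the law of the noise on [[0, T m]], so the pull-back has the law of the
    forward solution from 0 at time [T m]. The forward solution converges only in law, the pull-back
    almost surely. *)
Lemma invariant_law_lim (C : R) f : 0 <= C -> blip C f ->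
  semigroup (T m) f 0 @[m --> \oo] --> \int[invariant_law]_x f x.
Proof.
move=> C0 fC; have mf := blip_measurable fC.
rewrite (expect_law P mlim mf fC.1).
rewrite (_ : (fun m => semigroup (T m) f 0) = fun m => \int[P]_w f (xi m w)).
  exact: (expect_cvg C0 fC mxi mlim xi_limP).
apply/funext => m.
rewrite /semigroup (ode_sol_law_unique kap0 ell0 q0 psi0 psi2 0 (mixing_time_ge0 m) (noise_noise_upto (T m) nW) (nR m) cW (cR m) C0 fC).
symmetry; apply: (@expect_ae_eq _ _ _ P _ _ 1 N).
- exact: measurableT_comp.
- exact: measurableT_comp mf (mpull m).
- by move=> w; exact: fC.1.
- by move=> w; exact: fC.1.
- exact: mN.
- exact: N0.
- by move=> w Nw; rewrite xiE.
Qed.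

Lemma invariant_law_moment : (\int[invariant_law]_x (enorm x ^+ 2)%:E <= M%:E)%E.
Proof.
rewrite ge0_integral_law//; last 2 first.
- exact: measurable_enorm_sqr.
- by move=> x; rewrite lee_fin sqr_ge0.
apply: (second_moment_lim mxi xi_limP) => m.
apply: le_trans (ode_sol_second_moment kap0 ell0 q0 s20 psi2 (mixing_time_ge0 m) (nR m) (cR m) c0 (lexx M)).
apply: ge0_le_integral => //.
- by move=> w _; rewrite lee_fin sqr_ge0.
- by apply/measurable_EFinP; apply: measurable_funX; exact: measurableT_comp (@measurable_enorm R d) (mxi m).
- by apply/measurable_EFinP; apply: measurable_funX; exact: measurableT_comp (@measurable_enorm R d) (mpull m).
move=> w _; rewrite lee_fin -/(pull_back m w) /xi enormZ exprMn ler_piMl ?sqr_ge0//.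
rewrite indicE; case: (_ \in _); rewrite ?subrr ?subr0 ?normr0 ?normr1 ?expr1n ?expr0n//.
Qed.

Lemma semigroup_forget (C : R) f x y : 0 <= C -> blip C f ->
  semigroup (T m) f x - semigroup (T m) f y @[m --> \oo] --> (0 : R).
Proof.
move=> C0 fC; apply/cvgr0Pnorm_lt => e e0.
pose K := C * (1 + enorm (x - y)) + 1.
have K0 : 0 < K by rewrite ltr_wpDl// mulr_ge0// addr_ge0.
near=> m.
have p0 : 0 <= 2 ^- m :> R by rewrite invr_ge0 exprn_ge0.
apply: (@le_lt_trans _ _ (K * 2 ^- m)); last first.
  rewrite mulrC -ltr_pdivlMr// -div1r; near: m.
  exact: (near_infty_natSinv_expn_lt (PosNum (divr_gt0 e0 K0))).
rewrite -(expectB _ (M := 1)); last 4 first.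
- by apply: (measurableT_comp (blip_measurable fC)); case: nW => mW _ _ _ _; apply: measurable_ode_sol1 => //; exact: mixing_time_ge0.
- by apply: (measurableT_comp (blip_measurable fC)); case: nW => mW _ _ _ _; apply: measurable_ode_sol1 => //; exact: mixing_time_ge0.
- by move=> w; exact: fC.1.
- by move=> w; exact: fC.1.
apply: expect_abs_le.
  by apply: measurable_funB; apply: (measurableT_comp (blip_measurable fC)); case: nW => mW _ _ _ _; apply: measurable_ode_sol1 => //; exact: mixing_time_ge0.
move=> w; apply: le_trans (fC.2 _ _) _.
apply: le_trans (ler_wpM2l C0 (ode_sol_mixing x y m (cW w))) _.
apply: (@le_trans _ _ (C * ((1 + enorm (x - y)) * 2 ^- m))); last first.
  by rewrite mulrA ler_wpM2r// lerDl.
rewrite ler_wpM2l// ge_max ler_peMl ?lerDl//= mulrDl mul1r ler_wpDl// ler_wpM2l//.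
by rewrite lef_pV2 ?posrE ?exprn_gt0// lerXn2r ?nnegrE ?ler_nat.
Unshelve. all: by end_near.
Qed.

Lemma semigroup_expect_lim (C : R) f (rho : probability V R) : 0 <= C -> blip C f ->
  \int[rho]_x semigroup (T m) f x @[m --> \oo] --> \int[invariant_law]_x f x.
Proof.
move=> C0 fC; have sC m := semigroup_blip kap0 ell0 q0 nW cW C0 (mixing_time_ge0 m) fC.
have H : \int[rho]_x (semigroup (T m) f x - semigroup (T m) f 0) @[m --> \oo] --> \int[rho]_x (0 : R).
  apply: (@expect_dominated _ _ _ rho (fun m x => semigroup (T m) f x - semigroup (T m) f 0) (fun=> 0) 2).
  - by move=> m; apply: measurable_funB => //; exact: blip_measurable (sC m).
  - exact: measurable_cst.
  - by move=> m x; apply: le_trans (ler_normB _ _) _; rewrite [2](_ : _ = 1 + 1)// lerD//; exact: (sC m).1.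
  - by move=> x; exact: semigroup_forget C0 fC.
have := cvgD H (invariant_law_lim C0 fC); rewrite expect_cst add0r.
rewrite (_ : _ + _ = fun m => \int[rho]_x semigroup (T m) f x); first exact.
apply/funext => m; rewrite fctE (@expectB _ _ _ _ _ _ 1)// ?expect_cst ?subrK//.
- exact: blip_measurable (sC m).
- exact: (sC m).1.
- by move=> x; exact: (sC m).1.
Qed.

(** Apply [semigroup_expect_lim] to the law of the solution from 0 at time [t]. Since the semigroups
    commute, one and the same sequence tends to both integrals. *)
Lemma invariant_law_semigroup (C : R) f t : 0 <= C -> 0 <= t -> blip C f ->
  \int[invariant_law]_x semigroup t f x = \int[invariant_law]_x f x.
Proof.
move=> C0 t0 fC; have sC := semigroup_blip kap0 ell0 q0 nW cW C0 t0 fC.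
have L1 := invariant_law_lim C0 sC.
have mS : measurable_fun setT (fun w => sol (W ^~ w) 0 t).
  by case: nW => mW _ _ _ _; exact: measurable_ode_sol1.
have := @semigroup_expect_lim C f (law P mS) C0 fC.
rewrite (_ : (fun m => _) = (fun m => semigroup (T m) (semigroup t f) 0)); last first.
  apply/funext => m.
  have sT := semigroup_blip kap0 ell0 q0 nW cW C0 (mixing_time_ge0 m) fC.
  rewrite (expect_law P mS (blip_measurable sT) sT.1).
  rewrite -[LHS]/(semigroup t (semigroup (T m) f) 0).
  rewrite -(semigroupD kap0 ell0 q0 psi0 s20 psi2 nW cW 0 C0 t0 (mixing_time_ge0 m) fC).
  by rewrite addrC (semigroupD kap0 ell0 q0 psi0 s20 psi2 nW cW 0 C0 (mixing_time_ge0 m) t0 fC).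
exact: (cvg_unique (@norm_hausdorff _ _) L1).
Qed.

(** For an invariant [rho] the sequence in [semigroup_expect_lim] is constant. *)
Lemma invariant_law_unique (rho : probability V R) :
  (forall (C : R) f t, 0 <= C -> 0 <= t -> blip C f -> \int[rho]_x semigroup t f x = \int[rho]_x f x) ->
  forall A, measurable A -> rho A = invariant_law A.
Proof.
move=> H; apply: measure_eq_blip => C f C0 fC.
have L := semigroup_expect_lim rho C0 fC.
apply/esym; apply: (cvg_unique (@norm_hausdorff _ _) L).
rewrite (_ : (fun m => _) = fun=> \int[rho]_x f x); first exact: cvg_cst.
by apply/funext => m; apply: (H C) => //; exact: mixing_time_ge0.
Qed.

End invariant_law.

Section brownian_invariant.
Variables (R : realType) (d : nat) (kap ell q : R).
Hypotheses (kap0 : 0 <= kap) (ell0 : 0 <= ell) (q0 : 0 < q) (c0 : 0 < kap + ell).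
Local Notation V := 'rV[R]_d.
Local Notation sol := (@ode_sol R d kap ell q).
Variables (s2 : R) (disp : measure_display) (Omega : measurableType disp).
Variable P : probability Omega R.
Variables (B W : R -> Omega -> V) (N : set Omega).
Hypothesis s20 : 0 <= s2.
Hypothesis nW : noise P (fun xi => s2 / 2 * enorm xi ^+ 2) W.
Hypothesis cW : forall w, path_continuous (W ^~ w).
Hypothesis W0 : forall w, W 0 w = 0.
Hypotheses (mN : measurable N) (N0 : P N = 0%E).
Hypothesis WB : forall w t, ~ N w -> W t w = B t w.

Let mW : measurable_process W. Proof. by case: nW. Qed.

Let aeN (Q : Omega -> Prop) : (forall w, ~ N w -> Q w) -> {ae P, forall w, Q w}.
Proof.
by move=> H; exists N; split => // w Qw; apply: contrapT => Nw; exact/Qw/H.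
Qed.

(* The truncated Euler schemes driven by B only read B before time t, and they
   converge to the solution off the null set on which B is not continuous. *)
Lemma ode_sol_adapted x : completed_adapted P (fun w => sol (W ^~ w) x 0) B
  (fun t w => sol (W ^~ w) x t).
Proof.
move=> t A t0 mA.
pose G := [set E | (exists2 A, measurable A & E = (fun w => sol (W ^~ w) x 0) @^-1` A) \/
   (exists s (A : set V), [/\ 0 <= s, s <= t, measurable A & E = B s @^-1` A])] : set (set Omega).
(* The sample space with the history up to time [t] as sigma-algebra: measurability of a map on [O']
   is adaptedness. *)
pose O' := g_sigma_algebraType G.
pose Z (u : R) (w : O') := B (Num.min u t) w.
have mZ : measurable_process Z.
  move=> u u0 _ A' mA'; rewrite setTI; apply: sub_sigma_algebra; right.
  exists (Num.min u t), A'; split => //; first by rewrite le_min u0.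
  by rewrite ge_min lexx orbT.
pose g n (w : O') := grid_euler kap ell q (Z ^~ w) x (t / 2 ^+ n) (2 ^ n).
have mg n : measurable_fun setT (g n).
  have h0 : 0 <= t / 2 ^+ n by rewrite divr_ge0// exprn_ge0.
  exact: (measurableT_comp (measurable_grid_euler kap0 ell0 q0 mZ (2 ^ n) h0)
    (measurable_fun_pair (measurable_cst x) (@measurable_id _ O' setT))).
(* An upper limit is measurable even where the schemes diverge; off [N] it is the solution. *)
pose phi (w : O') : V := \row_i fine (limn_esup (fun n => (g n w 0 i)%:E)).
have mphi : measurable_fun setT phi.
  apply: measurable_fun_rV => i.
  rewrite (_ : (fun _ => _) = fine \o (fun w => limn_esup (fun n => (g n w 0 i)%:E))); last first.
    by apply/funext => w; rewrite mxE.
  apply: measurableT_comp => //; apply: measurable_fun_limn_esup => n.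
  by apply/measurable_EFinP; apply: (measurableT_comp (@measurable_coord R d i)).
have phiE w : ~ N w -> phi w = sol (W ^~ w) x t.
  move=> Nw; pose w' u := W (Num.min u t) w.
  have w'c : path_continuous w'.
    move=> u e u0 e0; have m0 : 0 <= Num.min u t by rewrite le_min u0.
    have [del del0 Hd] := cW w m0 e0.
    exists del => // s s0 su; apply: Hd; first by rewrite le_min s0.
    apply: le_lt_trans su; rewrite !minEle; have := ler_norm (s - u); have := ler_norm (u - s).
    rewrite (distrC u s) => n1 n2.
    by case: ifPn; rewrite -?ltNge => h1; case: ifPn; rewrite -?ltNge => h2; rewrite ler_norml; apply/andP; split; lra.
  have E : sol (W ^~ w) x t = sol w' x t.
    have [_ S0 HS] := ode_solP kap0 ell0 q0 x (cW w).
    rewrite -{2}S0; apply: (implicit_solution_local kap0 ell0 q0 (T := t) HS) => //.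
      by move=> u /andP[_ ut]; rewrite /w' (min_idPl ut).
    by rewrite t0 lexx.
  have gE n : g n w = grid_euler kap ell q w' x (t / 2 ^+ n) (2 ^ n).
    by rewrite /g /Z /w'; congr (grid_euler _ _ _ _ _ _ _); apply/funext => u; rewrite WB.
  have [_ S0 HS] := ode_solP kap0 ell0 q0 x w'c.
  apply/rowP => i; rewrite mxE E.
  suff /cvg_limn_einf_sup[_ ->] : (g n w 0 i)%:E @[n --> \oo] --> (sol w' x t 0 i)%:E by [].
  apply: cvg_EFin; first exact: nearW.
  apply/cvgrPdist_lt => e e0.
  have [n0 Hn0] := implicit_solution_euler kap0 ell0 q0 t0 HS e0.
  exists n0; first by [].
  move=> n nn0; have := Hn0 n nn0; rewrite S0 -gE; apply: le_lt_trans.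
  by have := coord_enorm (sol w' x t - g n w) i; rewrite !mxE.
exists (phi @^-1` A).
  by have := mphi measurableT A mA; rewrite setTI.
exists N; split => // w; rewrite /setU/setD/preimage/=.
by move=> H; apply: contrapT => Nw; move: H; rewrite phiE// => -[[]|[]].
Qed.

Lemma ode_sol_strong_solution x :
  is_strong_solution P (fun=> bbar kap ell q) B (fun t w => sol (W ^~ w) x t).
Proof.
have S0 w : sol (W ^~ w) x 0 = x by have [] := ode_solP kap0 ell0 q0 x (cW w).
split.
- by move=> t t0; exact: measurable_ode_sol1.
- move=> n t A0 A t0 mA0 mA; have [xA|xA] := pselect (A0 x).
    rewrite (_ : _ @^-1` A0 = setT); last by apply/seteqP; split => // w _; rewrite /preimage/= S0.
    by rewrite setTI probability_setT mul1e.
  rewrite (_ : _ @^-1` A0 = set0); last by apply/seteqP; split => // w; rewrite /preimage/= S0.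
  by rewrite set0I measure0 mul0e.
- exact: ode_sol_adapted.
- apply: aeW => w; apply: path_continuous_cadlag.
  by have [] := ode_solP kap0 ell0 q0 x (cW w).
- apply: aeN => w Nw t t0 i; have [Sc _ HS] := ode_solP kap0 ell0 q0 x (cW w).
  rewrite (implicit_solution_integral kap0 ell0 q0 i t0 Sc (cW w) HS) W0 WB//.
  by rewrite mxE subr0.
Qed.

(** Off a null set, a strong solution driven by [B] is continuous and solves the pathwise equation
    along [W], where solutions are unique. *)
Lemma strong_solution_ode_sol x Y t : 0 <= t ->
  is_strong_solution P (fun=> bbar kap ell q) B Y -> {ae P, forall w, Y 0 w = x} ->
  {ae P, forall w, Y t w = sol (W ^~ w) x t}.
Proof.
move=> t0 [mY _ _ cY eY] Y0.
have aeG : {ae P, forall w, ~ N w} by exact: aeN.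
move: cY; apply: filterS3 eY (filterI Y0 aeG) => w eYw [Y0w Nw] cYw.
symmetry; apply: (ode_sol_unique kap0 ell0 q0 (Y := Y ^~ w)) => //.
have dY : drift_path (fun=> bbar kap ell q) (Y ^~ w) (W ^~ w).
  apply: integral_equation_drift_path => //; first exact: bbar_jointly_continuous.
  by move=> s s0 i; rewrite WB//; exact: eYw.
apply: drift_path_implicit => // s e s0 e0.
have [K K0 HK] := drift_path_lipschitz (bbar_jointly_continuous kap0 ell0 q0) cYw dY (s + 1).
have e20 : 0 < e / 2 by rewrite divr_gt0.
have [del del0 Hd] := cW w s0 e20.
have eK : 0 < e / 2 / (K + 1) by rewrite !divr_gt0// ltr_wpDl.
exists (Num.min 1 (Num.min del (e / 2 / (K + 1)))); first by rewrite !lt_min ltr01 del0.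
move=> r r0; rewrite !lt_min => /and3P[r1 rd rK].
have bound : enorm (Y r w - Y s w - (W r w - W s w)) <= K * `|r - s|.
  have [rs|sr] := leP r s.
    have -> : enorm (Y r w - Y s w - (W r w - W s w)) = enorm (Y s w - Y r w - (W s w - W r w)).
      by rewrite -enormN opprB !opprB addrC.
    rewrite distrC ger0_norm ?subr_ge0//.
    by apply: HK => //; rewrite lerDl.
  rewrite gtr0_norm ?subr_gt0//; apply: HK => //; first exact: ltW.
  by rewrite -lerBlDl; apply: le_trans (ltW r1); exact: ler_norm.
have -> : Y r w - Y s w = (Y r w - Y s w - (W r w - W s w)) + (W r w - W s w) by rewrite subrK.
apply: le_lt_trans (ler_enormD _ _) _; rewrite [ltRHS](splitr e) ler_ltD//.
  apply: le_trans bound _; apply: (@le_trans _ _ ((K + 1) * `|r - s|)).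
    by rewrite ler_wpM2r// lerDl.
  by rewrite mulrC -ler_pdivlMr ?ltr_wpDl// ltW.
exact: Hd.
Qed.

Lemma ode_sol_prod_law (rho : probability V R) t
    (mF : measurable_fun setT (fun p : V * Omega => sol (W ^~ p.2) p.1 t)) :
  (forall A, measurable A ->
     law (rho \x P)%E mF A = (\int[rho]_x P ((fun w => sol (W ^~ w) x t) @^-1` A))%E) /\
  (forall C f, 0 <= C -> blip C f ->
     \int[law (rho \x P)%E mF]_y f y = \int[rho]_x semigroup kap ell q P W t f x).
Proof.
split.
  move=> A mA; apply: eq_integral => x _; rewrite /=; congr (P _).
  by apply/seteqP; split => w; rewrite /xsection/preimage/= inE.
move=> C f C0 fC; have mf := blip_measurable fC.
rewrite (expect_law _ mF mf fC.1).
rewrite (@expect_prod _ _ _ _ _ rho P (fun p => f (sol (W ^~ p.2) p.1 t)) 1)//.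
  exact: measurableT_comp mf mF.
by move=> p; exact: fC.1.
Qed.

Let psi0 (xi : V) : 0 <= s2 / 2 * enorm xi ^+ 2.
Proof. by rewrite mulr_ge0 ?sqr_ge0// divr_ge0. Qed.

Lemma brownian_unique_invariant :
  is_unique_invariant P (bbar kap ell q) B
    (invariant_law kap0 ell0 q0 c0 s20 (fun xi => lexx (s2 / 2 * enorm xi ^+ 2)) nW cW).
Proof.
set pi := invariant_law _ _ _ _ _ _ _ _.
split.
  exists (fun x t w => sol (W ^~ w) x t); split.
    move=> x; split; first exact: ode_sol_strong_solution.
    by apply: aeW => w; have [] := ode_solP kap0 ell0 q0 x (cW w).
  move=> t A t0 mA; have mF := measurable_ode_sol kap0 ell0 q0 mW cW t0.
  have [H1 H2] := ode_sol_prod_law pi mF.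
  rewrite -(H1 A mA); apply: measure_eq_blip => // C f C0 fC; rewrite (H2 C f C0 fC).
  exact: (invariant_law_semigroup kap0 ell0 q0 c0 psi0 s20 _ nW cW C0 t0 fC).
move=> rho [Y [HY invY]]; apply: invariant_law_unique => // C f t C0 t0 fC.
have mF := measurable_ode_sol kap0 ell0 q0 mW cW t0.
have [H1 H2] := ode_sol_prod_law rho mF.
rewrite -(H2 C f C0 fC) /Rintegral; congr fine; apply: eq_measure_integral => A mA _.
transitivity (\int[rho]_x P ((fun w => sol (W ^~ w) x t) @^-1` A))%E; first exact: H1.
apply: etrans (invY t A t0 mA); apply: eq_integral => x _.
have [YS Y0] := HY x.
apply: prob_ae_eq.
- by apply: measurable_preimage => //; exact: measurable_ode_sol1.
- by apply: measurable_preimage => //; case: YS => mY _ _ _ _; exact: mY.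
by have := strong_solution_ode_sol t0 YS Y0; apply: filterS => w; rewrite /preimage/= => ->.
Qed.

End brownian_invariant.

Lemma brownian_invariant (R : realType) (d : nat) (kap ell q s2 : R) (disp : measure_display)
    (Omega : measurableType disp) (P : probability Omega R) (B : R -> Omega -> 'rV[R]_d) :
  0 <= kap -> 0 <= ell -> 0 < q -> 0 < kap + ell -> 0 <= s2 ->
  is_brownian P (s2%:M : 'M[R]_d) B ->
  exists pi : probability 'rV[R]_d R, exists W : R -> Omega -> 'rV[R]_d,
    [/\ is_unique_invariant P (bbar kap ell q) B pi,
        (\int[pi]_x (enorm x ^+ 2)%:E <= (d%:R * s2 / (kap + ell) + 1)%:E)%E,
        noise P (fun xi => s2 / 2 * enorm xi ^+ 2) W,
        forall w, path_continuous (W ^~ w) &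
        forall (C : R) f t, 0 <= C -> 0 <= t -> blip C f ->
          \int[pi]_x semigroup kap ell q P W t f x = \int[pi]_x f x].
Proof.
move=> kap0 ell0 q0 c0 s20 Bb; have [W [N [nW cW W0 [mN N0] WB]]] := brownian_version Bb.
exists (invariant_law kap0 ell0 q0 c0 s20 (fun xi => lexx (s2 / 2 * enorm xi ^+ 2)) nW cW), W.
split => //.
- exact: (brownian_unique_invariant kap0 ell0 q0 c0 s20 nW cW W0 mN N0 WB).
- exact: invariant_law_moment.
- move=> C f t C0 t0 fC; apply: (invariant_law_semigroup kap0 ell0 q0 c0 _ s20 _ nW cW C0 t0 fC).
  by move=> xi; rewrite mulr_ge0 ?sqr_ge0// divr_ge0.
Qed.

(** * Comparison of the rescaled process with the scheme *)

Section drift_step.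
Variables (R : realType) (d : nat).
Local Notation V := 'rV[R]_d.
Variables (b : R -> V -> V) (b2 : V -> V) (x z : R -> V).
Variables (s t r r' h kap1 Lam Gam e1 : R).
Hypothesis xz : drift_path b x z.
Hypotheses (s0 : 0 <= s) (st : s <= t) (r0 : 0 < r) (r'0 : 0 < r').
Hypotheses (tsE : t - s = h * r ^+ 2) (h0 : 0 <= h).
Hypothesis rr' : `|r' / r - 1 - kap1 * h| <= h ^+ 2.
Hypotheses (Lam0 : 0 <= Lam) (Gam0 : 0 <= Gam) (kap10 : 0 <= kap1).
Hypothesis xLam : forall u, s <= u <= t -> enorm (x u) <= Lam * r.
Hypothesis xtLam : enorm (x t) <= Lam * r'.
Hypothesis b20 : b2 0 = 0.
Hypothesis bb2 : forall u y y', s <= u <= t -> enorm y <= Lam -> enorm y' <= Lam ->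
  enorm (r *: b u (r *: y) - b2 y') <= e1 + Gam * enorm (y - y').

Let y' := r'^-1 *: x t.
(** Defect of the rescaled path in one implicit step. The term in [kap1] comes from the change of
    scale from [r] to [r'], whose ratio is [1 + kap1 h] up to [h^2]. *)
Let err := y' - r^-1 *: x s - r^-1 *: (z t - z s) - h *: (b2 y' - kap1 *: y').

Let xrLam u : s <= u <= t -> enorm (r^-1 *: x u) <= Lam.
Proof.
move=> /xLam H; rewrite enormZ gtr0_norm ?invr_gt0//.
by rewrite mulrC ler_pdivrMr.
Qed.

Let y'Lam : enorm y' <= Lam.
Proof. by rewrite enormZ gtr0_norm ?invr_gt0// mulrC ler_pdivrMr. Qed.

Lemma drift_step_osc (eps : R) :
  (forall u, s <= u <= t -> enorm (r^-1 *: x u - y') <= eps) ->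
  enorm err <= h * (d%:R * (e1 + Gam * eps) + h * Lam).
Proof.
move=> Heps.
have rn : r != 0 by rewrite gt_eqF.
have r'n : r' != 0 by rewrite gt_eqF.
have H u : s <= u <= t -> enorm (b u (x u) - r^-1 *: b2 y') <= r^-1 * (e1 + Gam * eps).
  move=> su; have -> : b u (x u) - r^-1 *: b2 y' = r^-1 *: (r *: b u (r *: (r^-1 *: x u)) - b2 y').
    by rewrite scalerBr !scalerA mulVf// mulfV// !scale1r.
  rewrite enormZ gtr0_norm ?invr_gt0// ler_wpM2l ?invr_ge0 ?(ltW r0)//.
  apply: le_trans (bb2 su (xrLam su) y'Lam) _.
  by rewrite lerD2l ler_wpM2l// Heps.
have := xz s0 st H; set q := x t - x s - _ - _ => Hq.
have -> : err = r^-1 *: q - (r' / r - 1 - kap1 * h) *: y'.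
  rewrite /q /err tsE; move: (b2 y') => b2y; rewrite /y'; apply/rowP => i; rewrite !mxE; field.
  by rewrite rn r'n.
apply: le_trans (ler_enormB _ _) _; rewrite !enormZ gtr0_norm ?invr_gt0// mulrDr lerD//.
  apply: le_trans (ler_wpM2l _ Hq) _; first by rewrite invr_ge0 ltW.
  rewrite tsE; apply: le_of_eq; field.
  by rewrite rn.
by rewrite [leRHS]mulrA -expr2 ler_pM// -enormZ.
Qed.

(** Crude version for steps on which the noise oscillates too much: the oscillation of the path is
    bounded by the diameter of its ball. *)
Lemma drift_step_bad : enorm err <= h * (d%:R * (e1 + Gam * (2 * Lam)) + h * Lam).
Proof.
apply: drift_step_osc => u /xrLam H; apply: le_trans (ler_enormB _ _) _.
by rewrite mulr_natl mulr2n lerD.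
Qed.

(** When the noise moves by at most [a r], the path moves little too; its drift contribution is
    bounded by comparison with [b2 0 = 0]. *)
Lemma drift_step_good (a : R) : (forall u, s <= u <= t -> enorm (z u - z s) <= a * r) ->
  enorm err <= h * (d%:R * (e1 + Gam * (2 * a + d%:R * h * (e1 + Gam * Lam) + (kap1 + h) * h * Lam)) + h * Lam).
Proof.
move=> za; apply: drift_step_osc => u /andP[su ut].
have rn : r != 0 by rewrite gt_eqF.
have r'n : r' != 0 by rewrite gt_eqF.
have su0 : s <= u <= t by rewrite su.
have H v : u <= v <= t -> enorm (b v (x v) - 0) <= r^-1 * (e1 + Gam * Lam).
  move=> /andP[uv vt]; have sv : s <= v <= t by rewrite vt (le_trans su).
  have -> : b v (x v) - 0 = r^-1 *: (r *: b v (r *: (r^-1 *: x v)) - b2 0).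
    by rewrite b20 !subr0 !scalerA mulVf// mulfV// !scale1r.
  rewrite enormZ gtr0_norm ?invr_gt0// ler_wpM2l ?invr_ge0 ?(ltW r0)//.
  have e00 : enorm (0 : V) <= Lam by rewrite enorm0.
  apply: le_trans (bb2 sv (xrLam sv) e00) _.
  by rewrite lerD2l ler_wpM2l// subr0 xrLam.
have := xz (le_trans s0 su) ut H; rewrite scaler0 subr0; set q := x t - x u - _ => Hq.
have -> : r^-1 *: x u - y' = (r' / r - 1 - kap1 * h + kap1 * h) *: y' - r^-1 *: q
    + r^-1 *: (z u - z s) - r^-1 *: (z t - z s).
  by rewrite /q /y'; apply/rowP => i; rewrite !mxE; field; rewrite rn r'n.
have H1 : enorm ((r' / r - 1 - kap1 * h + kap1 * h) *: y') <= (kap1 + h) * h * Lam.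
  rewrite enormZ ler_pM//; apply: le_trans (ler_normD _ _) _.
  rewrite (ger0_norm (mulr_ge0 kap10 h0)) mulrDl -expr2 addrC lerD2l//.
have H2 : enorm (r^-1 *: q) <= d%:R * h * (e1 + Gam * Lam).
  rewrite enormZ gtr0_norm ?invr_gt0//; apply: le_trans (ler_wpM2l _ Hq) _.
    by rewrite invr_ge0 ltW.
  have E0 : 0 <= e1 + Gam * Lam.
    have tt : u <= t <= t by rewrite ut lexx.
    by have := le_trans (enorm_ge0 _) (H t tt); rewrite pmulr_rge0 ?invr_gt0.
  have -> : r^-1 * (d%:R * ((t - u) * (r^-1 * (e1 + Gam * Lam)))) =
     d%:R * ((t - u) / r ^+ 2) * (e1 + Gam * Lam) by field.
  rewrite ler_wpM2r// ler_wpM2l// ler_pdivrMr ?exprn_gt0// -tsE.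
  by rewrite lerD2l lerN2.
have zz v : s <= v <= t -> enorm (r^-1 *: (z v - z s)) <= a.
  move=> /za Hv; rewrite enormZ gtr0_norm ?invr_gt0// mulrC ler_pdivrMr//.
have tt : s <= t <= t by rewrite st lexx.
apply: le_trans (ler_enormB _ _) _; apply: le_trans (lerD (ler_enormD _ _) (zz _ tt)) _.
apply: le_trans (lerD (lerD (ler_enormB _ _) (zz _ su0)) (lexx a)) _.
lra.
Qed.

End drift_step.

Section chain_compare.
Variables (R : realType) (d : nat) (kap ell q : R).
Hypotheses (kap0 : 0 <= kap) (ell0 : 0 <= ell) (q0 : 0 < q).
Local Notation V := 'rV[R]_d.
Variables (disp : measure_display) (Omega : measurableType disp).
Variable P : probability Omega R.

(** A bad step [O k] only adds [h E] to the error, so all of them cost [K h E p1]. Excluding them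
    from [G] would cost [K p1], which is not small: [p1] will be of order [h / a^2], and [K h] is
    the long horizon. *)
Lemma chain_compare (C h e E D R0 p0 p1 : R) K (z y : nat -> Omega -> V) (G : set Omega)
    (O : nat -> set Omega) (f : V -> R) :
  0 <= C -> blip C f -> 0 <= h -> 0 <= E ->
  (forall k, measurable_fun setT (z k)) ->
  (forall k, (k <= K)%N -> measurable_fun setT (y k)) ->
  measurable G -> fine (P (~` G)) <= p0 ->
  (forall k, (k < K)%N -> measurable (O k)) ->
  (forall k, (k < K)%N -> fine (P (O k)) <= p1) ->
  (forall w, G w -> enorm (y 0%N w) <= R0) ->
  (forall w k, G w -> (k < K)%N ->
    enorm (y k.+1 w - y k w - z k w - h *: bbar kap ell q (y k.+1 w)) <=
      h * (e + E * \1_(O k) w)) ->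
  (forall (zz : nat -> V) (x : V), enorm x <= R0 ->
    enorm (euler kap ell q (fun=> h) zz x K - euler kap ell q (fun=> h) zz 0 K) <= D) ->
  0 <= D -> 0 <= e ->
  `|\int[P]_w f (y K w) - \int[P]_w f (euler kap ell q (fun=> h) (z ^~ w) 0 K)| <=
    C * (D + K%:R * h * (e + E * p1)) + 2 * p0.
Proof.
move=> C0 fC h0 E0 mz my mG PG mO PO y0 Hy HD D0 e0; have [f1 fL] := fC.
have mf := blip_measurable fC.
have c2 (i : 'I_K.+1) : measurable (if unlift ord0 i is Some j then O j else ~` G).
  by case: (unliftP ord0 i) => [j|] _; [exact: mO|exact: measurableC].
have := @expect_near R disp Omega P (fun w => f (y K w)) (fun w => f (euler kap ell q (fun=> h) (z ^~ w) 0 K))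
  1 K.+1 (C * (D + K%:R * h * e)) (fun i => if unlift ord0 i is Some j then C * (h * E) else 2)
  (fun i => if unlift ord0 i is Some j then O j else ~` G).
rewrite big_ord_recl unlift_none; under eq_bigr do rewrite liftK.
move=> H; apply: le_trans (H _ _ _ _ c2 _) _.
- exact: measurableT_comp mf (my K (leqnn K)).
- by apply: (measurableT_comp mf); exact: measurable_euler.
- by move=> w; exact: f1.
- by move=> w; exact: f1.
- move=> w; rewrite big_ord_recl unlift_none; under eq_bigr do rewrite liftK.
  have s0 : 0 <= \sum_(i < K) C * (h * E) * \1_(O i) w.
    by apply: sumr_ge0 => i _; rewrite !mulr_ge0// indicE.
  have [Gw|Gw] := pselect (G w); last first.
    rewrite indicE mem_set// mulr1; apply: (@le_trans _ _ 2).
      apply: le_trans (ler_normB _ _) _; rewrite [2](_ : _ = 1 + 1)// lerD//.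
    by rewrite ler_wpDl ?lerDl// mulr_ge0// addr_ge0// !mulr_ge0.
  rewrite indicE memNset; last by move=> /(_ Gw).
  rewrite mulr0 add0r; apply: le_trans (fL _ _) _.
  have Hp := @euler_perturbed R d kap ell q kap0 ell0 q0 (fun=> h) (z ^~ w) (y ^~ w)
     (fun k => h * (e + E * \1_(O k) w)) K (fun=> h0) (fun k kK => Hy w k Gw kK).
  apply: le_trans (ler_wpM2l C0 (enorm_triangle (euler kap ell q (fun=> h) (z ^~ w) (y 0%N w) K) _ _)) _.
  apply: le_trans (ler_wpM2l C0 (lerD Hp (HD _ _ (y0 w Gw)))) _.
  rewrite -mulr_sumr big_split/= sumr_const card_ord -mulr_sumr -(mulr_natl e).
  rewrite -mulr_sumr; set S := \sum_(i < K) _.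
  by apply: le_of_eq; ring.
rewrite [leRHS](_ : _ = C * (D + K%:R * h * e) + (2 * p0 + K%:R * (C * (h * E) * p1))); last by ring.
rewrite lerD2l lerD//; first by rewrite ler_wpM2l.
rewrite mulr_natl -[X in _ *+ X]card_ord -sumr_const ler_sum// => i _.
by rewrite ler_wpM2l ?PO// !mulr_ge0.
Qed.

End chain_compare.

Section scaled_increments.
Variables (R : realType) (d : nat).
Local Notation V := 'rV[R]_d.
Variables (disp : measure_display) (Omega : measurableType disp).
Variable P : probability Omega R.
Variables (psi : V -> R) (s2 : R) (Z : R -> Omega -> V).
Hypothesis nZ : noise P psi Z.
Variables (t r : nat -> R) (h : R).
Hypotheses (t0 : 0 <= t 0%N) (h0 : 0 <= h) (r0 : forall k, 0 < r k).
Hypothesis tS : forall k, t k.+1 - t k = h * r k ^+ 2.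

Definition scaled_increments k w : V := (r k)^-1 *: increment Z (t k) (t k.+1) w.

Lemma time_leS k : t k <= t k.+1.
Proof. by rewrite -subr_ge0 tS mulr_ge0// sqr_ge0. Qed.

Lemma time_ge0 k : 0 <= t k.
Proof. by elim: k => // k IH; exact: le_trans (time_leS k). Qed.

Let mincr k : measurable_fun setT (increment Z (t k) (t k.+1)).
Proof. by case: nZ => mZ _ _ _ _; apply: measurable_rowB; apply: mZ; exact: time_ge0. Qed.

Lemma measurable_scaled_increments k : measurable_fun setT (scaled_increments k).
Proof. exact: measurable_rowZ. Qed.

Lemma scaled_increments_indep n : indep_seq P scaled_increments n.
Proof.
move=> A mA; case: nZ => _ _ iZ _ _.
have mS k : measurable ((fun x : V => (r k)^-1 *: x) @^-1` A k).
  by apply: measurable_preimage => //; exact: measurable_rowZ.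
exact: (iZ n t (fun k => (fun x : V => (r k)^-1 *: x) @^-1` A k) t0 time_leS mS).
Qed.

Lemma scaled_increments_charfun k :
  symmetric_charfun (fun xi => h * r k ^+ 2 * psi ((r k)^-1 *: xi)) (law P (measurable_scaled_increments k)).
Proof.
case: nZ => _ _ _ cZ _ xi.
have := cZ (t k) (t k.+1) (mincr k) (time_ge0 k) (time_leS k) ((r k)^-1 *: xi).
rewrite tS.
rewrite (expect_law P (mincr k) (measurable_cosl _) (fun y => cos_max _)).
rewrite (expect_law P (mincr k) (measurable_sinl _) (fun y => sin_max _)).
rewrite (expect_law P (measurable_scaled_increments k) (measurable_cosl xi) (fun y => cos_max _)).
rewrite (expect_law P (measurable_scaled_increments k) (measurable_sinl xi) (fun y => sin_max _)).
by under eq_Rintegral do rewrite innerZl -innerZr; under [X in _ /\ X = _ -> _]eq_Rintegral do rewrite innerZl -innerZr.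
Qed.

Hypothesis psi2 : forall xi, psi xi <= s2 / 2 * enorm xi ^+ 2.

Lemma scaled_increments_centered k :
  centered (d%:R * s2 * h) (law P (measurable_scaled_increments k)).
Proof.
rewrite -mulrA; apply: (symmetric_charfun_centered (scaled_increments_charfun k)) => u i.
apply: le_trans (ler_wpM2l _ (psi2 _)) _; first by rewrite mulr_ge0// sqr_ge0.
rewrite !enormZ enorm_delta mulr1 gtr0_norm ?invr_gt0//.
rewrite exprMn real_normK ?num_real//; apply: le_of_eq; field.
by rewrite gt_eqF.
Qed.

End scaled_increments.

Section clt_compare.
Variables (R : realType) (d : nat) (kap ell q : R).
Hypotheses (kap0 : 0 <= kap) (ell0 : 0 <= ell) (q0 : 0 < q).
Local Notation V := 'rV[R]_d.
Variables (d1 d2 : measure_display) (O1 : measurableType d1) (O2 : measurableType d2).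
Variables (P1 : probability O1 R) (P2 : probability O2 R).
Variables (z1 : nat -> O1 -> V) (z2 : nat -> O2 -> V).
Hypotheses (mz1 : forall k, measurable_fun setT (z1 k)).
Hypotheses (mz2 : forall k, measurable_fun setT (z2 k)).
Variables (h s : R) (K : nat) (A1 A2 : nat -> V -> R).
Hypothesis h0 : 0 <= h.
Hypotheses (i1 : indep_seq P1 z1 K) (i2 : indep_seq P2 z2 K).
Hypothesis c1 : forall k, symmetric_charfun (A1 k) (law P1 (mz1 k)).
Hypothesis c2 : forall k, symmetric_charfun (A2 k) (law P2 (mz2 k)).
Hypothesis s1 : forall k, centered s (law P1 (mz1 k)).
Hypothesis s2 : forall k, centered s (law P2 (mz2 k)).
Hypotheses (A10 : forall k xi, 0 <= A1 k xi) (A20 : forall k xi, 0 <= A2 k xi).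

Lemma clt_compare (C L eps : R) n f : 0 <= C -> blip C f -> (0 < n)%N -> 0 < L ->
  (forall k (xi : V), (k < K)%N -> (forall i, `|xi 0 i| <= (n ^ 2)%:R / L) -> `|A1 k xi - A2 k xi| <= eps) ->
  `|\int[P1]_w f (euler kap ell q (fun=> h) (z1 ^~ w) 0 K) -
    \int[P2]_w f (euler kap ell q (fun=> h) (z2 ^~ w) 0 K)| <=
  K%:R * (2 * C * s / L + 5 * C * L * d%:R / n%:R + n%:R ^+ (2 * d) * eps).
Proof.
move=> C0 fC n0 L0 He; have hh (k : nat) : 0 <= h by [].
rewrite (expect_iter_step kap0 ell0 q0 C0 mz1 hh (mu := fun k => law P1 (mz1 k)) 0 i1 (leqnn K) _ fC)//.
rewrite (expect_iter_step kap0 ell0 q0 C0 mz2 hh (mu := fun k => law P2 (mz2 k)) 0 i2 (leqnn K) _ fC)//.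
apply: le_trans (iter_step_close kap0 ell0 q0 C0 (mu := fun k => law P1 (mz1 k))
  (mu' := fun k => law P2 (mz2 k))
  (eps := fun=> 2 * C * s / L + 5 * C * L * d%:R / n%:R + n%:R ^+ (2 * d) * eps) hh _ fC 0) _; last first.
  by rewrite sumr_const card_ord -[X in X <= _]mulr_natl; exact: lexx.
move=> k g kK gC.
exact: (charfun_expect_close n0 L0 C0 gC (c1 k) (c2 k) (s1 k) (s2 k) (A10 k) (A20 k)
  (fun xi Hxi => He k xi kK Hxi)).
Qed.

End clt_compare.

Section process_compare.
Variables (R : realType) (d : nat) (kap ell q : R).
Hypotheses (kap0 : 0 <= kap) (ell0 : 0 <= ell) (q0 : 0 < q).
Local Notation V := 'rV[R]_d.
Variables (disp : measure_display) (Omega : measurableType disp).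
Variable P : probability Omega R.
Variables (psi : V -> R) (s2 : R) (Z X : R -> Omega -> V).
Hypothesis s20 : 0 <= s2.
Hypothesis nZ : noise P psi Z.
Hypothesis psi2 : forall xi, psi xi <= s2 / 2 * enorm xi ^+ 2.
Hypothesis mX : measurable_process X.
Variables (t r : nat -> R) (h : R) (K : nat).
Hypotheses (t0 : 0 <= t 0%N) (h0 : 0 < h) (r0 : forall k, 0 < r k).
Hypothesis tS : forall k, t k.+1 - t k = h * r k ^+ 2.
Variables (b : R -> V -> V) (b2 : V -> V) (kap1 Lam Gam e1 a R0 D p0 : R) (G : set Omega).
Hypotheses (Lam0 : 0 <= Lam) (Gam0 : 0 <= Gam) (e10 : 0 <= e1) (kap10 : 0 <= kap1) (a0 : 0 < a) (D0 : 0 <= D).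
Hypothesis rS : forall k, `|r k.+1 / r k - 1 - kap1 * h| <= h ^+ 2.
Hypothesis b2E : forall y, bbar kap ell q y = b2 y - kap1 *: y.
Hypotheses (mG : measurable G) (PG : fine (P (~` G)) <= p0).
Hypothesis GX : forall w, G w -> drift_path b (X ^~ w) (Z ^~ w).
Hypothesis GXLam : forall w k u, G w -> (k < K)%N -> t k <= u <= t k.+1 ->
  enorm (X u w) <= Lam * r k.
Hypothesis GXtLam : forall w k, G w -> (k < K)%N -> enorm (X (t k.+1) w) <= Lam * r k.+1.
Hypothesis GX0 : forall w, G w -> enorm (X (t 0%N) w) <= R0 * r 0%N.
Hypothesis bb2 : forall k u y y', (k < K)%N -> t k <= u <= t k.+1 ->
  enorm y <= Lam -> enorm y' <= Lam ->
  enorm (r k *: b u (r k *: y) - b2 y') <= e1 + Gam * enorm (y - y').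
Hypothesis HD : forall (zz : nat -> V) (x : V), enorm x <= R0 ->
  enorm (euler kap ell q (fun=> h) zz x K - euler kap ell q (fun=> h) zz 0 K) <= D.

(** The parameter [a] is the oscillation of the noise, relative to [r k], above which step [k] is
    bad; the maximal inequality on one step gives the probability [d s2 h / a^2] in the last
    product. *)
Lemma process_compare C f : 0 <= C -> blip C f ->
  `|\int[P]_w f ((r K)^-1 *: X (t K) w) -
    \int[P]_w f (euler kap ell q (fun=> h) ((scaled_increments Z t r) ^~ w) 0 K)| <=
  C * (D + K%:R * h * ((d%:R * (e1 + Gam * (2 * a + d%:R * h * (e1 + Gam * Lam) + (kap1 + h) * h * Lam)) + h * Lam)
     + d%:R * (Gam * (2 * Lam)) * (d%:R * s2 * h / a ^+ 2))) + 2 * p0.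
Proof.
move=> C0 fC; have h0' := ltW h0.
have [mZ Z0 iZ _ rZ] := nZ; have cZ := noise_centered nZ psi2.
have tle k : t k <= t k.+1 by exact: (time_leS h0' tS).
have tge k : 0 <= t k by exact: (time_ge0 t0 h0' tS).
have ar0 k : 0 < a * r k by rewrite mulr_gt0.
have k0 : 0 <= d%:R * s2 by rewrite mulr_ge0.
have Omax k : exists O : set Omega, [/\ measurable O, fine (P O) <= d%:R * s2 * h / a ^+ 2 &
    forall w, ~ O w -> forall u, t k <= u <= t k.+1 -> enorm (Z u w - Z (t k) w) <= a * r k].
  have [U [mU PU HU]] := maximal mZ iZ k0 cZ rZ (tge k) (tle k) (ar0 k).
  exists (~` U); split; first exact: measurableC.
    rewrite -lee_fin fineK ?fin_num_prob//; last exact: measurableC.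
    apply: le_trans PU _; rewrite lee_fin tS exprMn; apply: le_of_eq; field.
    by rewrite !gt_eqF.
  by move=> w Ow u tu; apply: HU => //; exact: contrapT.
pose O k := projT1 (cid (Omax k)).
have HO k := projT2 (cid (Omax k)).
set e := d%:R * _ + _; set E := d%:R * (Gam * (2 * Lam)).
have E0 : 0 <= E by rewrite !mulr_ge0.
have e0 : 0 <= e.
  by rewrite addr_ge0 ?mulr_ge0// !(addr_ge0, mulr_ge0)// ltW.
apply: (chain_compare kap0 ell0 q0 (y := fun k w => (r k)^-1 *: X (t k) w) (R0 := R0) C0 fC h0' E0 _ _ mG PG (O := O)) => //.
- by move=> k; exact: (measurable_scaled_increments nZ t0 h0' tS).
- move=> k _; have mXk := mX (tge k).
  by apply: (measurable_rowZ (a := fun=> (r k)^-1)).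
- by move=> k _; have [] := HO k.
- by move=> k _; have [] := HO k.
- move=> w Gw; rewrite enormZ gtr0_norm ?invr_gt0// mulrC ler_pdivrMr//.
  exact: GX0.
- move=> w k Gw kK; rewrite b2E.
  have b20 : b2 0 = 0.
    by have := b2E 0; rewrite scaler0 subr0 /bbar scaler0.
  have Hbad := drift_step_bad (GX Gw) (tge k) (tle k) (r0 k) (r0 k.+1) (tS k) (rS k)
    Gam0 (fun u => GXLam Gw kK) (GXtLam Gw kK) (fun u y y' => bb2 kK).
  have Hgood := drift_step_good (GX Gw) (tge k) (tle k) (r0 k) (r0 k.+1) (tS k) h0' (rS k)
    Lam0 Gam0 kap10 (fun u => GXLam Gw kK) (GXtLam Gw kK) b20 (fun u y y' => bb2 kK).
  have [Ow|Ow] := pselect (O k w).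
    rewrite indicE mem_set// mulr1; apply: le_trans Hbad _.
    have : 0 <= d%:R * (Gam * (2 * a + d%:R * h * (e1 + Gam * Lam) + (kap1 + h) * h * Lam)).
      by rewrite !(addr_ge0, mulr_ge0)// ltW.
    move=> J0; rewrite ler_wpM2l// /e /E !(mulrDr d%:R e1); lra.
  rewrite indicE memNset// mulr0 addr0; apply: Hgood.
  by have [_ _] := HO k; apply.
Qed.

End process_compare.

Definition fluctuation_const (R : realType) (d : nat) (s2 c : R) : R :=
  5 * d%:R * c + 2 * d%:R ^+ 2 * c ^+ 2 + c + 2 * d%:R ^+ 2 * s2 * c.

(** Here [T] is the horizon, [U] bounds the constants of the drift and [1 / B] is the oscillation
    threshold. Expanded, the left side consists of seven products, each small through one of the
    hypotheses on [T h], [T e1] and [T U / B]. *)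
Lemma fluctuation_bound (R : realType) (d : nat) (s2 c0 u U B T h e1 Gam Lam kap1 : R) :
  0 <= s2 -> 0 <= c0 -> 0 < u -> 1 <= U -> 1 <= B -> 0 <= T -> 0 <= h -> h <= 1 ->
  T * h <= u^-1 / (U ^+ 2 * B ^+ 2) -> T * e1 <= c0 / u -> T * (U / B) <= u^-1 ->
  0 <= e1 <= c0 -> 0 <= Gam <= c0 * U -> 0 <= Lam <= c0 * U -> Gam * Lam <= c0 * U ->
  0 <= kap1 <= 1 ->
  T * ((d%:R * (e1 + Gam * (2 * B^-1 + d%:R * h * (e1 + Gam * Lam) + (kap1 + h) * h * Lam)) + h * Lam)
     + d%:R * (Gam * (2 * Lam)) * (d%:R * s2 * h / B^-1 ^+ 2)) <=
  fluctuation_const d s2 c0 / u.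
Proof.
rewrite /fluctuation_const.
move=> s20 c00 u0 U1 B1 T0 h0 h1 Th Te TB /andP[e10 e1c] /andP[G0 GU] /andP[L0 LU] GL /andP[k0 k1].
have U0 : 0 < U by apply: lt_le_trans U1.
have B0 : 0 < B by apply: lt_le_trans B1.
have d0 : 0 <= d%:R :> R by [].
have v0 : 0 < u^-1 by rewrite invr_gt0.
set v := u^-1 in Th TB v0 *; rewrite -/v in Te.
have Th0 : 0 <= T * h by rewrite mulr_ge0.
have UB : T * h * (U ^+ 2 * B ^+ 2) <= v by rewrite -ler_pdivlMr ?mulr_gt0 ?exprn_gt0.
have B21 : 1 <= B ^+ 2 by rewrite exprn_ege1.
have U21 : 1 <= U ^+ 2 by rewrite exprn_ege1.
have UU : U <= U ^+ 2 by rewrite expr2 ler_peMr// ltW.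
have ThU2 : T * h * U ^+ 2 <= v.
  by apply: le_trans UB; rewrite mulrA ler_peMr// mulr_ge0// sqr_ge0.
have ThU : T * h * U <= v by apply: le_trans ThU2; rewrite ler_wpM2l.
have ThUB : T * h * U * B ^+ 2 <= v.
  by apply: le_trans UB; rewrite mulrA ler_wpM2r ?sqr_ge0// ler_wpM2l.
have GL0 : 0 <= Gam * Lam by rewrite mulr_ge0.
have t2 : T * (Gam * B^-1) <= c0 * v.
  apply: (@le_trans _ _ (c0 * (T * (U / B)))); last by rewrite ler_wpM2l.
  rewrite (_ : c0 * _ = T * (c0 * U / B)); last by ring.
  by rewrite ler_wpM2l// ler_wpM2r// invr_ge0 ltW.
have t3 : T * h * (Gam * e1) <= c0 ^+ 2 * v.
  apply: (@le_trans _ _ (c0 ^+ 2 * (T * h * U))); last by rewrite ler_wpM2l ?sqr_ge0.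
  rewrite (_ : c0 ^+ 2 * _ = T * h * (c0 * U * c0)); last by ring.
  by rewrite ler_wpM2l// ler_pM.
have t4 : T * h * (Gam * (Gam * Lam)) <= c0 ^+ 2 * v.
  apply: (@le_trans _ _ (c0 ^+ 2 * (T * h * U ^+ 2))); last by rewrite ler_wpM2l ?sqr_ge0.
  rewrite (_ : c0 ^+ 2 * _ = T * h * (c0 * U * (c0 * U))); last by ring.
  by rewrite ler_wpM2l// ler_pM.
have t5 : T * h * (Gam * Lam) <= c0 * v.
  apply: (@le_trans _ _ (c0 * (T * h * U))); last by rewrite ler_wpM2l.
  rewrite (_ : c0 * _ = T * h * (c0 * U)); last by ring.
  by rewrite ler_wpM2l.
have t6 : T * h * Lam <= c0 * v.
  apply: (@le_trans _ _ (c0 * (T * h * U))); last by rewrite ler_wpM2l.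
  rewrite (_ : c0 * _ = T * h * (c0 * U)); last by ring.
  by rewrite ler_wpM2l.
have t7 : T * h * (Gam * Lam) * B ^+ 2 <= c0 * v.
  apply: (@le_trans _ _ (c0 * (T * h * U * B ^+ 2))); last by rewrite ler_wpM2l.
  rewrite (_ : c0 * _ = T * h * (c0 * U) * B ^+ 2); last by ring.
  by rewrite ler_wpM2r ?sqr_ge0// ler_wpM2l.
have t5' : (kap1 + h) * (T * h * (Gam * Lam)) <= 2 * (c0 * v).
  rewrite ler_pM ?addr_ge0//; last by rewrite [2](_ : _ = 1 + 1)// lerD.
  by rewrite mulr_ge0.
have d20 : 0 <= d%:R ^+ 2 :> R by rewrite sqr_ge0.
have := ler_wpM2l d0 Te; have := ler_wpM2l d0 t2; have := ler_wpM2l d20 t3.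
have := ler_wpM2l d20 t4; have := ler_wpM2l d0 t5'.
have := ler_wpM2l (mulr_ge0 d20 s20) t7.
rewrite exprVn invrK.
move=> *.
have -> : T * (d%:R * (e1 + Gam * (2 * B^-1 + d%:R * h * (e1 + Gam * Lam) + (kap1 + h) * h * Lam)) + h * Lam
     + d%:R * (Gam * (2 * Lam)) * (d%:R * s2 * h * B ^+ 2)) =
  d%:R * (T * e1) + 2 * (d%:R * (T * (Gam * B^-1))) + d%:R ^+ 2 * (T * h * (Gam * e1))
  + d%:R ^+ 2 * (T * h * (Gam * (Gam * Lam))) + d%:R * ((kap1 + h) * (T * h * (Gam * Lam)))
  + T * h * Lam + 2 * (d%:R ^+ 2 * s2 * (T * h * (Gam * Lam) * B ^+ 2)) by ring.
lra.
Qed.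

(** * Choice of exponents and comparison with the invariant law *)

Section chain_rates.
Variables (R : realType) (d : nat) (kap ell q : R) (p : nat).
Hypotheses (kap0 : 0 <= kap) (ell0 : 0 <= ell) (q0 : 0 < q) (qp : q <= p%:R) (p0 : (0 < p)%N).
Local Notation V := 'rV[R]_d.
Local Notation sol := (@ode_sol R d kap ell q).

(* With [u = m%:R]: time horizon [u ^ tau_exp], radius of the process
   [u ^ rho_exp], Lipschitz constant of the drift [u ^ gam_exp], oscillation on a
   good step [u ^ - osc_exp], [m ^ step_exp] steps. *)
Definition tau_exp := (2 * p + 5)%N.
Definition rho_exp := (p + 4)%N.
Definition gam_exp := (rho_exp * p.+1)%N.
Definition osc_exp := (gam_exp + tau_exp + 1)%N.
Definition step_exp := (2 * tau_exp + 2 * gam_exp + 2 * osc_exp + 1)%N.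
(** [m ^ freq_exp] is the [n] of [charfun_expect_close]: with [L = u^(tau_exp + 1)], the smoothing
    errors [L / n] of all [m ^ step_exp] steps sum to [1 / u]. *)
Definition freq_exp := (step_exp + tau_exp + 2)%N.

Lemma lip_growth (Lam : R) : 1 <= Lam ->
  (kap + ell * Lam `^ q * (q + 2)) * Lam <= Lam ^+ p.+1 * (1 + kap + ell * (q + 2)) /\
  Lam <= Lam ^+ p.+1 * (1 + kap + ell * (q + 2)).
Proof.
move=> L1; have Lq : Lam `^ q <= Lam ^+ p.
  by rewrite -powR_mulrn ?(le_trans _ L1)//; apply: ler_powR.
have Lp : 1 <= Lam ^+ p by rewrite exprn_ege1.
have A0 : 0 <= ell * (q + 2) by rewrite mulr_ge0// addr_ge0// ltW.
have L0 : 0 <= Lam by exact: le_trans L1.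
rewrite exprS; move: (Lam `^ q) (Lam ^+ p) (powR_ge0 Lam q) Lq Lp => Q S Q0 QS S1.
have LS : Lam <= Lam * S by rewrite ler_peMr.
have h1 : kap * Lam <= kap * (Lam * S) by rewrite ler_wpM2l.
have h2 : ell * (q + 2) * (Lam * Q) <= ell * (q + 2) * (Lam * S) by rewrite !ler_wpM2l.
have h3 : 0 <= kap * (Lam * S) by rewrite !mulr_ge0// (le_trans _ S1).
have h4 : 0 <= ell * (q + 2) * (Lam * S) by rewrite mulr_ge0// mulr_ge0// (le_trans _ S1).
have -> : Lam * S * (1 + kap + ell * (q + 2)) = Lam * S + kap * (Lam * S) + ell * (q + 2) * (Lam * S).
  by ring.
have -> : (kap + ell * Q * (q + 2)) * Lam = kap * Lam + ell * (q + 2) * (Lam * Q) by ring.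
by split; lra.
Qed.

Lemma ode_sol_drift_path w x : path_continuous w ->
  drift_path (fun=> bbar kap ell q) (sol w x) w.
Proof.
move=> wc; have [Sc S0 HS] := ode_solP kap0 ell0 q0 x wc.
have H : drift_path (fun=> bbar kap ell q) (sol w x) (fun t => w t - w 0).
  apply: integral_equation_drift_path.
  - exact: bbar_jointly_continuous.
  - exact: path_continuous_cadlag.
  - by move=> t t0 i; rewrite (implicit_solution_integral kap0 ell0 q0 i t0 Sc wc HS) !mxE.
move=> s t beta e s0 st Hb; have := H s t beta e s0 st Hb.
have -> : w t - w 0 - (w s - w 0) = w t - w s by rewrite opprB addrA subrK.
exact.
Qed.

Section brownian_side.
Variables (disp : measure_display) (Omega : measurableType disp).
Variable P : probability Omega R.
Variables (s2 : R) (W : R -> Omega -> V).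
Hypothesis s20 : 0 <= s2.
Hypothesis nW : noise P (fun xi => s2 / 2 * enorm xi ^+ 2) W.
Hypothesis cW : forall w, path_continuous (W ^~ w).
Variables (m : nat) (h c0 : R).
Local Notation u := (m%:R : R).
Local Notation K := (m ^ step_exp)%N.
Hypotheses (m0 : (0 < m)%N) (h0 : 0 < h) (Kh : K%:R * h <= u ^+ tau_exp).
Hypothesis c00 : 0 <= c0.
Hypothesis HD : forall (zz : nat -> V) (x : V), enorm x <= u ->
  enorm (euler kap ell q (fun=> h) zz x K - euler kap ell q (fun=> h) zz 0 K) <= c0 / u.

Definition brownian_const : R :=
  fluctuation_const d s2 (3 ^+ p.+1 * (1 + kap + ell * (q + 2))).

Lemma step_small B : B = u ^+ osc_exp ->
  [/\ h <= 1, K%:R * h * h <= u^-1 / ((u ^+ gam_exp) ^+ 2 * B ^+ 2) &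
      K%:R * h * (u ^+ gam_exp / B) <= u^-1].
Proof.
move=> ->.
have u0 : 0 < u by rewrite ltr0n.
have u1 : 1 <= u by rewrite ler1n.
have ug k : 0 < u ^+ k by rewrite exprn_gt0.
have hK : h <= u ^+ tau_exp / u ^+ step_exp.
  by rewrite ler_pdivlMr// mulrC -natrX.
have E : u ^+ step_exp = (u ^+ tau_exp) ^+ 2 * (u ^+ gam_exp) ^+ 2 * (u ^+ osc_exp) ^+ 2 * u.
  rewrite /step_exp; move: tau_exp gam_exp osc_exp => i j l.
  by rewrite !(mulnC 2%N) !exprD expr1 !exprM.
have E' : u ^+ osc_exp = u ^+ gam_exp * u ^+ tau_exp * u.
  by rewrite /osc_exp; move: tau_exp gam_exp => i j; rewrite !exprD expr1.
split.
- apply: le_trans hK _; rewrite ler_pdivrMr// mul1r ler_weXn2l//.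
  by rewrite /step_exp; move: tau_exp gam_exp osc_exp => i j l; clear; lia.
- apply: (@le_trans _ _ (u ^+ tau_exp * (u ^+ tau_exp / u ^+ step_exp))).
    by apply: ler_pM; rewrite ?mulr_ge0// ltW.
  move: (ug gam_exp) (ug tau_exp) (ug osc_exp); rewrite E.
  set a := u ^+ gam_exp; set b := u ^+ tau_exp; set c := u ^+ osc_exp => a0 b0 cc0.
  by apply: le_of_eq; field; rewrite !gt_eqF.
- rewrite mulrA ler_pdivrMr//; apply: le_trans (ler_wpM2r _ Kh) _; first by rewrite ltW.
  rewrite E'; apply: le_of_eq; field.
  by rewrite gt_eqF.
Qed.

(** The solution of the limit equation is itself treated by [process_compare], at the constant scale
    [r = 1], with no rescaling term and [e1 = 0]. *)
Lemma semigroup_chain (C : R) f x : 0 <= C -> blip C f -> enorm x <= u ->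
  `|semigroup kap ell q P W (K%:R * h) f x -
    \int[P]_w f (euler kap ell q (fun=> h) ((scaled_increments W (fun k => k%:R * h) (fun=> 1)) ^~ w) 0 K)|
  <= (C * (c0 + brownian_const) + 2 * (d%:R * s2)) / u.
Proof.
move=> C0 fC xu.
have u0 : 0 < u by rewrite ltr0n.
have u1 : 1 <= u by rewrite ler1n.
have ug k : 0 < u ^+ k by rewrite exprn_gt0.
have T0 : 0 <= K%:R * h by rewrite mulr_ge0// ltW.
have [mW W0 iW _ rW] := nW.
have cen := noise_centered nW (fun xi => lexx _).
have k0 : 0 <= d%:R * s2 by rewrite mulr_ge0.
have [G [mG PG HG]] := maximal mW iW k0 cen rW (lexx 0) T0 (ug rho_exp).
rewrite subr0 in PG.
have bc := @bbar_jointly_continuous R d kap ell q kap0 ell0 q0.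
have bE (r : R) (y : V) : bbar kap ell q y = - (kap + ell * enorm y `^ q) *: y by [].
have rho0 (r : R) (y : V) : 0 <= r -> 0 <= kap + ell * enorm y `^ q.
  by move=> _; rewrite addr_ge0// mulr_ge0// powR_ge0.
have urho : u <= u ^+ rho_exp by rewrite -[leLHS]expr1 ler_weXn2l// /rho_exp addn4.
have Lam0 : 0 <= 3 * u ^+ rho_exp by rewrite mulr_ge0// ltW.
have GLam w s : G w -> 0 <= s <= K%:R * h -> enorm (sol (W ^~ w) x s) <= 3 * u ^+ rho_exp.
  move=> Gw /andP[s0 sT]; have [Sc S0 HS] := ode_solP kap0 ell0 q0 x (cW w).
  have bs r : 0 <= r <= s -> enorm (W r w - W 0 w) <= u ^+ rho_exp.
    by move=> /andP[r0 rs]; apply: HG => //; rewrite r0 (le_trans rs).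
  have r0 : 0 <= u ^+ rho_exp by rewrite ltW.
  have := drift_stable bc (path_continuous_cadlag Sc)
    (ode_sol_drift_path (x := x) (cW w)) (rho := fun _ y => kap + ell * enorm y `^ q) bE rho0 (lexx 0) s0 r0 bs (lexx (2 * u ^+ rho_exp)).
  rewrite S0 (elimT max_idPl); last by apply: le_trans xu _; lra.
  have := bs s; rewrite s0 lexx => /(_ isT).
  have := ler_enorm_sub (sol (W ^~ w) x s) (W s w - W 0 w); lra.
set Lam := 3 * u ^+ rho_exp in Lam0 GLam.
pose Gam := kap + ell * Lam `^ q * (q + 2).
have Gam0 : 0 <= Gam by rewrite addr_ge0// !mulr_ge0 ?powR_ge0// addr_ge0// ltW.
pose c : R := 3 ^+ p.+1 * (1 + kap + ell * (q + 2)).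
have c0' : 0 <= c by rewrite mulr_ge0 ?exprn_ge0// !addr_ge0// mulr_ge0// addr_ge0// ltW.
have Lam1 : 1 <= Lam by rewrite /Lam; have := le_trans u1 urho; lra.
have LamE : Lam ^+ p.+1 = 3 ^+ p.+1 * u ^+ gam_exp by rewrite /Lam exprMn -exprM.
have [GL LamU] := lip_growth Lam1.
have cE : c * u ^+ gam_exp = Lam ^+ p.+1 * (1 + kap + ell * (q + 2)) by rewrite LamE /c mulrAC.
rewrite -cE -/Gam in GL LamU.
have GamU : Gam <= c * u ^+ gam_exp by apply: le_trans GL; rewrite ler_peMr.
have [h1 Th1 Th2] := step_small erefl.
have FB : K%:R * h * ((d%:R * (0 + Gam * (2 * (u ^+ osc_exp)^-1 + d%:R * h * (0 + Gam * Lam) + (0 + h) * h * Lam)) + h * Lam)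
     + d%:R * (Gam * (2 * Lam)) * (d%:R * s2 * h / (u ^+ osc_exp)^-1 ^+ 2)) <= brownian_const / u.
  apply: (@fluctuation_bound R d s2 c u (u ^+ gam_exp) (u ^+ osc_exp)) => //.
  - by rewrite exprn_ege1.
  - by rewrite exprn_ege1.
  - exact: ltW.
  - by rewrite mulr0 divr_ge0// ltW.
  - by rewrite lexx.
  - by rewrite Gam0.
  - by rewrite Lam0.
  - by rewrite lexx ler01.
have mX : measurable_process (fun t w => sol (W ^~ w) x t) by move=> t t0; exact: measurable_ode_sol1.
have kK k : (k <= K)%N -> k%:R * h <= K%:R * h by move=> kK; rewrite ler_pM2r// ler_nat.
have kh0 k : 0 <= k%:R * h by rewrite mulr_ge0// ltW.
have PC : `|\int[P]_w f (1^-1 *: sol (W ^~ w) x (K%:R * h)) -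
    \int[P]_w f (euler kap ell q (fun=> h) ((scaled_increments W (fun k => k%:R * h) (fun=> 1)) ^~ w) 0 K)|
    <= _ := @process_compare R d kap ell q kap0 ell0 q0 disp Omega P _ s2 W (fun t w => sol (W ^~ w) x t) s20 nW
  (fun xi => lexx _) mX (fun k => k%:R * h) (fun=> 1) h K (kh0 0%N) h0 (fun=> ltr01) _ (fun=> bbar kap ell q)
  (bbar kap ell q) 0 Lam Gam 0
  (u ^+ osc_exp)^-1 u (c0 / u) (d%:R * s2 / u) G Lam0 Gam0 (lexx 0) (lexx 0) _ _ _ _ mG _ _ _ _ _ _ HD C f C0 fC.
have -> : semigroup kap ell q P W (K%:R * h) f x = \int[P]_w f (1^-1 *: sol (W ^~ w) x (K%:R * h)).
  by rewrite /semigroup; under [RHS]eq_Rintegral do rewrite invr1 scale1r.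
apply: le_trans (PC _ _ _ _ _ _ _ _ _ _ _) _.
- by move=> k; rewrite -mulrBl -natr1 addrAC subrr add0r expr1n mulr1 mul1r.
- by rewrite invr_gt0.
- by rewrite divr_ge0// ltW.
- by move=> k; rewrite divr1 subrr mul0r subrr normr0 sqr_ge0.
- by move=> y; rewrite scale0r subr0.
- rewrite -lee_fin fineK ?fin_num_prob//; last exact: measurableC.
  apply: le_trans PG _; rewrite lee_fin -mulrA ler_wpM2l// ler_pdivrMr ?exprn_gt0//.
  apply: le_trans Kh _; rewrite mulrC ler_pdivlMr// -exprSr -exprM ler_weXn2l//.
  by rewrite /tau_exp /rho_exp; clear; lia.
- by move=> w _; exact: ode_sol_drift_path.
- move=> w k s Gw kltK /andP[ks sk]; rewrite mulr1; apply: GLam => //.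
  by rewrite (le_trans (kh0 k) ks) (le_trans sk)// kK.
- by move=> w k Gw kltK; rewrite mulr1; apply: GLam; rewrite // kh0 kK.
- move=> w _; have [_ S0 _] := ode_solP kap0 ell0 q0 x (cW w).
  by rewrite mul0r S0 mulr1.
- move=> k s y y' _ _ yL y'L; rewrite add0r !scale1r.
  exact: bbar_lip.
rewrite [leRHS](_ : _ = C * (c0 / u + brownian_const / u) + 2 * (d%:R * s2 / u)); last by ring.
by rewrite lerD2r ler_wpM2l// lerD2l.
Qed.

Variables (pi : probability V R) (M : R).
Hypothesis M0 : 0 <= M.
Hypothesis pi_moment : (\int[pi]_x (enorm x ^+ 2)%:E <= M%:E)%E.
Hypothesis pi_invariant : forall (C : R) f t, 0 <= C -> 0 <= t -> blip C f ->
  \int[pi]_x semigroup kap ell q P W t f x = \int[pi]_x f x.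

(** By invariance the solution may start from [pi]; starting points of norm above [u], outside the
    scope of [semigroup_chain], have mass at most [M / u^2]. *)
Lemma invariant_chain (C : R) f : 0 <= C -> blip C f ->
  `|\int[pi]_x f x -
    \int[P]_w f (euler kap ell q (fun=> h) ((scaled_increments W (fun k => k%:R * h) (fun=> 1)) ^~ w) 0 K)|
  <= (C * (c0 + brownian_const) + 2 * (d%:R * s2) + 2 * M) / u.
Proof.
move=> C0 fC; have u0 : 0 < u by rewrite ltr0n.
have u1 : 1 <= u by rewrite ler1n.
have T0 : 0 <= K%:R * h by rewrite mulr_ge0// ltW.
rewrite -(pi_invariant C0 T0 fC).
pose e := \int[P]_w f (euler kap ell q (fun=> h) ((scaled_increments W (fun k => k%:R * h) (fun=> 1)) ^~ w) 0 K).
rewrite -/e.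
have sC := semigroup_blip kap0 ell0 q0 nW cW C0 T0 fC.
have e1 : `|e| <= 1.
  apply: expect_abs_le; last by move=> w; exact: fC.1.
  apply: (measurableT_comp (blip_measurable fC)); apply: measurable_euler => // k; last exact: ltW.
  apply: (measurable_scaled_increments nW (t := fun k => k%:R * h) (r := fun=> 1) (h := h)).
  - by rewrite mul0r.
  - exact: ltW.
  - by move=> i; rewrite -mulrBl -natr1 addrAC subrr add0r expr1n mulr1 mul1r.
have [mA PA] := markov_enorm (@measurable_id _ V setT) u0 pi_moment.
set c := C * _ + _.
have cu0 : 0 <= c / u.
  have x0 : enorm (0 : V) <= u by rewrite enorm0 ltW.
  exact: le_trans (normr_ge0 _) (semigroup_chain C0 fC x0).
have := @expect_near R _ _ pi (semigroup kap ell q P W (K%:R * h) f) (fun=> e) 1 1 (c / u) (fun=> 2)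
  (fun=> [set x | u < enorm x]) (blip_measurable sC) (measurable_cst e) sC.1 (fun=> e1) (fun=> mA).
rewrite big_ord1 expect_cst => H; apply: le_trans (H _) _.
  move=> x; rewrite big_ord1; have [xu|ux] := leP (enorm x) u.
    rewrite indicE memNset/=; last by rewrite ltNge xu.
    by rewrite mulr0 addr0; exact: semigroup_chain.
  rewrite indicE mem_set//= mulr1 ler_wpDl//.
  by apply: le_trans (ler_normB _ _) _; rewrite [2](_ : _ = 1 + 1)// lerD//; exact: sC.1.
rewrite [leRHS]mulrDl lerD2l -mulrA ler_wpM2l//.
rewrite -lee_fin fineK ?fin_num_prob//; apply: le_trans PA _.
by rewrite lee_fin ler_wpM2l// lef_pV2 ?posrE ?exprn_gt0// expr2 ler_peMr// ltW.
Qed.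

Definition decay_exp := (tau_exp + freq_exp * (2 * d + 6) + 1)%N.

Section levy_side.
Variables (disp' : measure_display) (Omega' : measurableType disp').
Variable P' : probability Omega' R.
Variables (psi : V -> R) (Z : R -> Omega' -> V) (del mm : R).
Hypothesis nZ : noise P' psi Z.
Hypothesis psi0 : forall xi, 0 <= psi xi.
Hypothesis psi2 : forall xi, psi xi <= s2 / 2 * enorm xi ^+ 2.
Hypotheses (del0 : 0 < del) (del1 : del <= 1) (mm0 : 0 <= mm).
Hypothesis psi_est : forall xi, `|psi xi - s2 / 2 * enorm xi ^+ 2| <= mm * enorm xi `^ (2 + del).
Variables t r : nat -> R.
Hypotheses (t0 : 0 <= t 0%N) (r0 : forall k, 0 < r k).
Hypothesis tS : forall k, t k.+1 - t k = h * r k ^+ 2.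
Hypothesis r_large : forall k, (k < K)%N -> u ^+ decay_exp <= r k `^ del.

(** The three terms of [charfun_expect_close], summed over the steps: one decides the choice of [L],
    the next that of [n], and the last the size demanded of [r k]. *)
Lemma clt_rate (C : R) f : 0 <= C -> blip C f ->
  `|\int[P']_w f (euler kap ell q (fun=> h) ((scaled_increments Z t r) ^~ w) 0 K) -
    \int[P]_w f (euler kap ell q (fun=> h) ((scaled_increments W (fun k => k%:R * h) (fun=> 1)) ^~ w) 0 K)|
  <= (2 * C * (d%:R * s2) + 5 * C * d%:R + mm * d.+1%:R ^+ 3) / u.
Proof.
move=> C0 fC; have u0 : 0 < u by rewrite ltr0n.
have u1 : 1 <= u by rewrite ler1n.
have ug k : 0 < u ^+ k by rewrite exprn_gt0.
have h0' := ltW h0.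
have tW0 : 0 <= 0%:R * h by rewrite mul0r.
have tWS (k : nat) : k.+1%:R * h - k%:R * h = h * 1 ^+ 2.
  by rewrite -mulrBl -natr1 addrAC subrr add0r expr1n mulr1 mul1r.
pose n := (m ^ freq_exp)%N; pose L := u ^+ tau_exp.+1.
have n0 : (0 < n)%N by rewrite expn_gt0 m0.
have L0 : 0 < L by exact: ug.
(* At scale [r k] the symbol deviates from its quadratic part by [|xi|^(2 + del) / r k^del] times
   [h mm]; frequencies are at most of order [u^(2 freq_exp)], and [2 + del <= 3]. *)
pose eps := h * (mm * ((d.+1%:R * u ^+ (freq_exp * 2)) ^+ 3 / u ^+ decay_exp)).
have CC := @clt_compare R d kap ell q kap0 ell0 q0 _ _ Omega' Omega P' P
  (scaled_increments Z t r) (scaled_increments W (fun k => k%:R * h) (fun=> 1))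
  (measurable_scaled_increments nZ t0 h0' tS) (measurable_scaled_increments nW tW0 h0' tWS)
  h (d%:R * s2 * h) K (fun k xi => h * r k ^+ 2 * psi ((r k)^-1 *: xi))
  (fun k xi => h * 1 ^+ 2 * (s2 / 2 * enorm (1^-1 *: xi) ^+ 2)) h0'
  (scaled_increments_indep nZ t0 h0' tS K) (scaled_increments_indep nW tW0 h0' tWS K)
  (scaled_increments_charfun nZ t0 h0' tS) (scaled_increments_charfun nW tW0 h0' tWS)
  (scaled_increments_centered nZ t0 h0' r0 tS psi2) (scaled_increments_centered nW tW0 h0' (fun=> ltr01) tWS (fun xi => lexx _))
  _ _ C L eps n f C0 fC n0 L0.
apply: le_trans (CC _ _ _) _.
- by move=> k xi; apply: mulr_ge0 => //; apply: mulr_ge0 => //; exact: sqr_ge0.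
- by move=> k xi; rewrite !mulr_ge0// ?sqr_ge0// invr_ge0.
- move=> k xi kK xin; rewrite invr1 scale1r expr1n mulr1.
  have rk := r0 k.
  have -> : h * r k ^+ 2 * psi ((r k)^-1 *: xi) - h * (s2 / 2 * enorm xi ^+ 2) =
      h * (r k ^+ 2 * (psi ((r k)^-1 *: xi) - s2 / 2 * enorm ((r k)^-1 *: xi) ^+ 2)).
    by rewrite enormZ exprMn real_normK ?num_real//; field; rewrite gt_eqF.
  rewrite normrM (ger0_norm h0') /eps ler_wpM2l// normrM ger0_norm ?sqr_ge0//.
  apply: le_trans (ler_wpM2l (sqr_ge0 _) (psi_est _)) _.
  rewrite mulrCA ler_wpM2l// enormZ gtr0_norm ?invr_gt0// powRM ?invr_ge0 ?(ltW rk)//.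
  have xd : enorm xi <= d.+1%:R * u ^+ (freq_exp * 2).
    apply: le_trans (le_enorm_coord xin) _.
    have nL : (n ^ 2)%:R / L <= u ^+ (freq_exp * 2).
      rewrite ler_pdivrMr// /n -expnM natrX ler_peMr ?(ltW (ug _))//.
      by rewrite exprn_ege1.
    by rewrite ler_pM// ?ler_nat// divr_ge0// ltW.
  have b1 : 1 <= d.+1%:R * u ^+ (freq_exp * 2).
    by rewrite -[leLHS]mulr1 ler_pM// ?ler1n// exprn_ege1.
  have x3 : enorm xi `^ (2 + del) <= (d.+1%:R * u ^+ (freq_exp * 2)) ^+ 3.
    apply: (@le_trans _ _ ((d.+1%:R * u ^+ (freq_exp * 2)) `^ (2 + del))).
      by apply: powR_mono => //; rewrite addr_ge0// ltW.
    move: b1; set y := d.+1%:R * _ => b1.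
    rewrite -powR_mulrn ?(le_trans _ b1)//; apply: ler_powR => //.
    by rewrite (_ : 3%:R = 2 + 1 :> R) ?lerD2l// -natr1.
  have -> : r k ^+ 2 * ((r k)^-1 `^ (2 + del) * enorm xi `^ (2 + del)) = enorm xi `^ (2 + del) / r k `^ del.
    rewrite -[X in X `^ (2 + del)](powR_inv1 (ltW rk)) -powRrM mulN1r powRN powRD; last by rewrite (gt_eqF rk) implybT.
    rewrite -(powR_mulrn 2 (ltW rk)) invfM.
    have := powR_gt0 2 rk; have := powR_gt0 del rk; move: (r k `^ 2) (r k `^ del) => x y y0 x0.
    by field; rewrite !gt_eqF.
  rewrite ler_pM ?powR_ge0// ?invr_ge0 ?powR_ge0//.
  rewrite lef_pV2 ?posrE ?powR_gt0//; exact: r_large.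
rewrite (_ : K%:R * _ = K%:R * (2 * C * (d%:R * s2 * h) / L) + K%:R * (5 * C * L * d%:R / n%:R) +
  K%:R * (n%:R ^+ (2 * d) * eps)); last by ring.
rewrite [leRHS](_ : _ = 2 * C * (d%:R * s2) / u + 5 * C * d%:R / u + mm * d.+1%:R ^+ 3 / u); last by ring.
rewrite lerD//; first apply: lerD.
- have -> : K%:R * (2 * C * (d%:R * s2 * h) / L) = 2 * C * (d%:R * s2) * (K%:R * h / L) by ring.
  rewrite ler_wpM2l ?mulr_ge0// ler_pdivrMr//; apply: le_trans Kh _.
  by rewrite /L exprS mulKf// gt_eqF.
- apply: le_of_eq.
  rewrite /n /L !natrX; have -> : u ^+ freq_exp = u ^+ step_exp * u ^+ tau_exp * u ^+ 2.
    by rewrite /freq_exp; move: step_exp tau_exp => i j; rewrite !exprD.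
  move: (ug step_exp) (ug tau_exp); rewrite exprS; move: (u ^+ step_exp) (u ^+ tau_exp) => x y x0 y0.
  by field; rewrite !gt_eqF.
- have -> : K%:R * (n%:R ^+ (2 * d) * eps) =
    mm * d.+1%:R ^+ 3 * (K%:R * h * (n%:R ^+ (2 * d) * (u ^+ (freq_exp * 2)) ^+ 3 / u ^+ decay_exp)).
    by rewrite /eps exprMn; ring.
  rewrite ler_wpM2l ?mulr_ge0 ?exprn_ge0//.
  have -> : n%:R = u ^+ freq_exp by rewrite natrX.
  have -> : u ^+ decay_exp = u ^+ tau_exp * ((u ^+ freq_exp) ^+ (2 * d) * (u ^+ (freq_exp * 2)) ^+ 3) * u.
    rewrite /decay_exp; move: tau_exp freq_exp => i j.
    by rewrite -!exprM -!exprD -exprSr; congr (_ ^+ _); clear; lia.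
  move: (ug tau_exp) (ug freq_exp) (ug (freq_exp * 2)%N) Kh => x0 y0 z0 Kh'.
  have w0 : 0 < (u ^+ freq_exp) ^+ (2 * d) * (u ^+ (freq_exp * 2)) ^+ 3.
    by rewrite mulr_gt0// exprn_gt0.
  move: w0; set w := _ * (u ^+ (freq_exp * 2)) ^+ 3 => w0.
  apply: (@le_trans _ _ (u ^+ tau_exp * (w / (u ^+ tau_exp * w * u)))).
    by rewrite ler_wpM2r// divr_ge0 ?mulr_ge0// ltW.
  apply: le_of_eq.
  by field; rewrite !gt_eqF.
Qed.

Variables (X : R -> Omega' -> V) (b : R -> V -> V) (b2 : V -> V) (kap1 Lam Gam e1 R0 p1 : R) (G : set Omega').
Hypothesis mX : measurable_process X.
Hypotheses (Lam0 : 0 <= Lam) (Gam0 : 0 <= Gam) (e10 : 0 <= e1) (kap10 : 0 <= kap1 <= 1).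
Hypothesis rS : forall k, `|r k.+1 / r k - 1 - kap1 * h| <= h ^+ 2.
Hypothesis b2E : forall y, bbar kap ell q y = b2 y - kap1 *: y.
Hypotheses (mG : measurable G) (PG : fine (P' (~` G)) <= p1).
Hypothesis GX : forall w, G w -> drift_path b (X ^~ w) (Z ^~ w).
Hypothesis GXLam : forall w k v, G w -> (k < K)%N -> t k <= v <= t k.+1 ->
  enorm (X v w) <= Lam * r k.
Hypothesis GXtLam : forall w k, G w -> (k < K)%N -> enorm (X (t k.+1) w) <= Lam * r k.+1.
Hypothesis GX0 : forall w, G w -> enorm (X (t 0%N) w) <= R0 * r 0%N.
Hypothesis bb2 : forall k v y y', (k < K)%N -> t k <= v <= t k.+1 ->
  enorm y <= Lam -> enorm y' <= Lam ->
  enorm (r k *: b v (r k *: y) - b2 y') <= e1 + Gam * enorm (y - y').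
Hypothesis HD0 : forall (zz : nat -> V) (x : V), enorm x <= R0 ->
  enorm (euler kap ell q (fun=> h) zz x K - euler kap ell q (fun=> h) zz 0 K) <= c0 / u.
Hypotheses (LamU : Lam <= c0 * u ^+ gam_exp) (GamU : Gam <= c0 * u ^+ gam_exp).
Hypotheses (GLU : Gam * Lam <= c0 * u ^+ gam_exp) (e1U : u ^+ tau_exp.+1 * e1 <= c0).

Lemma process_invariant (C : R) f : 0 <= C -> blip C f ->
  `|\int[P']_w f ((r K)^-1 *: X (t K) w) - \int[pi]_x f x| <=
  (C * (2 * c0 + fluctuation_const d s2 c0 + brownian_const) +
     2 * C * (d%:R * s2) + 5 * C * d%:R + mm * d.+1%:R ^+ 3 + 2 * (d%:R * s2) + 2 * M) / u + 2 * p1.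
Proof.
move=> C0 fC; have u0 : 0 < u by rewrite ltr0n.
have u1 : 1 <= u by rewrite ler1n.
have T0 : 0 <= K%:R * h by rewrite mulr_ge0// ltW.
have [k10 k11] := andP kap10.
have c0u : 0 <= c0 / u by rewrite divr_ge0// ltW.
have a0 : 0 < (u ^+ osc_exp)^-1 by rewrite invr_gt0 exprn_gt0.
have PC := process_compare kap0 ell0 q0 s20 nZ psi2 mX t0 h0 r0 tS Lam0 Gam0 e10 k10 a0 c0u rS b2E
  mG PG GX GXLam GXtLam GX0 bb2 HD0 C0 fC.
have [h1 Th1 Th2] := step_small erefl.
have FB := @fluctuation_bound R d s2 c0 u (u ^+ gam_exp) (u ^+ osc_exp) (K%:R * h) h e1 Gam Lam kap1
  s20 c00 u0 (exprn_ege1 _ u1) (exprn_ege1 _ u1) T0 (ltW h0) h1 Th1.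
have {}FB := FB _ Th2 _ _ _ GLU kap10.
have := invariant_chain C0 fC; rewrite distrC => I1.
have I2 := clt_rate C0 fC.
apply: le_trans (ler_distD (\int[P']_w f (euler kap ell q (fun=> h) ((scaled_increments Z t r) ^~ w) 0 K)) _ _) _.
apply: le_trans (lerD PC (ler_distD (\int[P]_w f (euler kap ell q (fun=> h)
  ((scaled_increments W (fun k => k%:R * h) (fun=> 1)) ^~ w) 0 K)) _ _)) _.
apply: le_trans (lerD (lexx _) (lerD I2 I1)) _.
apply: (@le_trans _ _ (C * (c0 / u + fluctuation_const d s2 c0 / u) + 2 * p1 +
  ((2 * C * (d%:R * s2) + 5 * C * d%:R + mm * d.+1%:R ^+ 3) / u +
   (C * (c0 + brownian_const) + 2 * (d%:R * s2) + 2 * M) / u))).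
  rewrite !lerD2r ler_wpM2l// lerD2l; apply: FB.
  - rewrite ler_pdivlMr//; apply: le_trans e1U.
    by rewrite mulrAC exprSr ler_wpM2r// ler_wpM2r// ltW.
  - rewrite e10/=; apply: le_trans e1U; rewrite ler_peMl//.
    by rewrite exprn_ege1.
  - by rewrite Gam0.
  - by rewrite Lam0.
by apply: le_of_eq; field; rewrite gt_eqF.
Qed.

End levy_side.
End brownian_side.
End chain_rates.

Section powR_estimates.
Variable R : realType.

Lemma expR_near0 (z : R) : `|expR z - 1| <= `|z| * expR `|z|.
Proof.
have [z0|z0] := leP 0 z.
  rewrite !ger0_norm// ?subr_ge0 -?[X in X <= _]expR0 ?ler_expR//.
  have := expR_ge1Dx (- z); rewrite expRN => H.
  have : (1 - z) * expR z <= 1 by rewrite -ler_pdivlMr ?expR_gt0// div1r.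
  by rewrite mulrBl; lra.
rewrite ltr0_norm; last by rewrite subr_lt0 -[X in _ < X]expR0 ltr_expR.
rewrite (ltr0_norm z0); have := expR_ge1Dx z.
have : 1 <= expR (- z) by rewrite -[X in X <= _]expR0 ler_expR oppr_ge0 ltW.
move=> H1 H2; apply: (@le_trans _ _ (- z)); first lra.
by rewrite ler_peMr// oppr_ge0 ltW.
Qed.

Lemma ln_le_sub1 (y : R) : 0 < y -> ln y <= y - 1.
Proof.
move=> y0; have := @le_ln1Dx R (y - 1); rewrite (_ : 1 + (y - 1) = y); last by ring.
by apply; lra.
Qed.

(** On this interval [|ln y|] is at most both [2 |y - 1|] and 2; the first bound gives the linear
    factor, the second the constant. *)
Lemma powR_near1 (y p : R) : 2^-1 <= y <= 3 ->
  `|y `^ p - 1| <= 2 * `|p| * expR (2 * `|p|) * `|y - 1|.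
Proof.
move=> /andP[y1 y3]; have y0 : 0 < y by apply: lt_le_trans y1.
have lny : `|ln y| <= 2 * `|y - 1|.
  rewrite ler_norml; apply/andP; split.
    have yV0 : 0 < y^-1 by rewrite invr_gt0.
    have H := ln_le_sub1 yV0; rewrite lnV ?posrE// in H.
    rewrite lerNl; apply: le_trans H _.
    rewrite (_ : y^-1 - 1 = y^-1 * (1 - y)); last by rewrite mulrBr mulr1 mulVf// gt_eqF.
    apply: (@le_trans _ _ (y^-1 * `|y - 1|)).
      by rewrite ler_wpM2l ?invr_ge0 ?(ltW y0)// distrC ler_norm.
    by rewrite ler_wpM2r// -[leRHS]invrK lef_pV2 ?posrE// invr_gt0.
  apply: le_trans (ln_le_sub1 y0) _.
  by apply: le_trans (ler_norm _) _; rewrite ler_peMl// ler1n.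
have lny2 : `|ln y| <= 2.
  have [y1'|y1'] := leP 1 y.
    rewrite ger0_norm ?ln_ge0//; apply: le_trans (ln_le_sub1 y0) _; lra.
  apply: le_trans lny _; rewrite -[leRHS]mulr1 ler_wpM2l// ltr0_norm; lra.
rewrite /powR gt_eqF//; apply: le_trans (expR_near0 _) _; rewrite normrM.
rewrite (_ : 2 * `|p| * _ * _ = `|p| * (2 * `|y - 1|) * expR (2 * `|p|)); last by ring.
rewrite ler_pM ?mulr_ge0 ?expR_ge0//; first by rewrite ler_wpM2l.
by rewrite ler_expR mulrC ler_wpM2r.
Qed.

Lemma powR_continuous_at (x p e : R) : 0 < x -> 0 < e -> exists2 del : R, 0 < del &
  forall y, `|y - x| < del -> `|y `^ p - x `^ p| < e.
Proof.
move=> x0 e0; pose C := x `^ p * (2 * `|p| * expR (2 * `|p|)).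
have C0 : 0 <= C by rewrite !mulr_ge0 ?powR_ge0 ?expR_ge0.
exists (Num.min (x / 2) (x * (e / (C + 1)))).
  by rewrite lt_min divr_gt0//= mulr_gt0// divr_gt0// ltr_wpDl.
move=> y; rewrite lt_min => /andP[y1 y2].
have /andP[y3 y4] : x - x / 2 <= y <= x + x / 2.
  move: y1; rewrite ltr_norml => /andP[? ?]; apply/andP; split; lra.
have yx : 2^-1 <= y / x <= 3.
  by rewrite ler_pdivlMr// ler_pdivrMr//; apply/andP; split; lra.
have y0 : 0 < y by lra.
have -> : y `^ p - x `^ p = x `^ p * ((y / x) `^ p - 1).
  by rewrite mulrBr mulr1 -powRM ?ltW// ?divr_gt0// mulrCA divff ?gt_eqF// mulr1.
rewrite normrM ger0_norm ?powR_ge0//.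
apply: le_lt_trans (ler_wpM2l (powR_ge0 _ _) (powR_near1 p yx)) _.
rewrite mulrA -/C (_ : y / x - 1 = (y - x) / x); last by rewrite mulrBl divff// gt_eqF.
rewrite normrM (gtr0_norm (_ : 0 < x^-1)) ?invr_gt0//.
have : `|y - x| / x < e / (C + 1) by rewrite ltr_pdivrMr// mulrC.
move=> H; apply: (@le_lt_trans _ _ ((C + 1) * (`|y - x| / x))).
  by rewrite ler_wpM2r ?divr_ge0 ?(ltW x0)// lerDl.
by rewrite mulrC -ltr_pdivlMr// ltr_wpDl.
Qed.

Lemma exp_decay_bound (c : R) (k : nat) : 0 < c -> exists2 C : R, 0 < C &
  forall x, 0 <= x -> x ^+ k * expR (- (c * x)) <= C.
Proof.
move=> c0; exists ((k.+1)`!%:R / c ^+ k.+1 + 1).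
  by rewrite ltr_wpDl// divr_ge0// exprn_ge0// ltW.
move=> x x0; have [x1|x1] := leP x 1.
  apply: (@le_trans _ _ 1); last by rewrite lerDr divr_ge0// exprn_ge0// ltW.
  rewrite -[1]mulr1 ler_pM ?exprn_ge0 ?expR_ge0//; first by rewrite exprn_ile1.
  by rewrite -expR0 ler_expR oppr_le0 mulr_ge0// ltW.
have cx : 0 <= c * x by rewrite mulr_ge0// ltW.
have x0' : 0 < x by apply: lt_trans x1.
rewrite expRN ler_pdivrMr ?expR_gt0//.
have := @expR_ge1Dxn R (c * x) k cx; set F := (k.+1)`!%:R.
have F0 : 0 < F by rewrite ltr0n fact_gt0.
have ck : 0 < c ^+ k.+1 by rewrite exprn_gt0.
rewrite exprMn => H.
have : c ^+ k.+1 * x ^+ k.+1 / F <= expR (c * x) by lra.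
rewrite ler_pdivrMr// => {}H.
rewrite mulrDl mul1r; apply: ler_wpDr; first exact: expR_ge0.
rewrite mulrAC ler_pdivlMr// mulrC [leRHS]mulrC; apply: le_trans H.
by rewrite ler_wpM2l ?(ltW ck)// exprS ler_peMl ?exprn_ge0// ltW.
Qed.

End powR_estimates.

Lemma three_quarters_lt (R : realFieldType) (e : R) : 0 < e -> e / 4 + e / 4 + e / 4 < e.
Proof. by move=> *; lra. Qed.

(** * The rescaled drift and its limit *)

Section drift.
Variables (R : realType) (d : nat) (beta gamma lambda : R).
Local Notation V := 'rV[R]_d.
Local Notation F := (@drift R d beta gamma lambda).

Lemma one_plus_ge1 (x : V) : 1 <= 1 + enorm x ^+ 2.
Proof. by rewrite lerDl sqr_ge0. Qed.

Lemma drift_jointly_continuous : jointly_continuous F.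
Proof.
move=> t x e t0 e0; pose p : R := 2^-1 * (gamma - 1).
pose g (s : R) := (1 + s) `^ (- beta) * lambda; pose k (y : V) := (1 + enorm y ^+ 2) `^ p.
have FE s y : F s y = (g s * k y) *: y by [].
have x1 : 0 < 1 + enorm x ^+ 2 by apply: lt_le_trans (one_plus_ge1 x).
pose S := `|g t| + 1; pose Q := k x + 1; pose Y := enorm x + 1.
have S1 : 1 <= S by rewrite lerDr.
have Q1 : 1 <= Q by rewrite lerDr powR_ge0.
have Y1 : 1 <= Y by rewrite lerDr.
pose e1 := e / (4 * S * Q * Y).
have SQ0 : 0 < 4 * S * Q * Y by rewrite !mulr_gt0// (lt_le_trans ltr01).
have e10 : 0 < e1 by rewrite divr_gt0.
have el : 0 < Num.min 1 (e1 / (`|lambda| + 1)).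
  by rewrite lt_min ltr01 divr_gt0// ltr_wpDl.
have [d1 d10 H1] := @powR_continuous_at R (1 + t) (- beta) _ (ltr_pwDl ltr01 t0) el.
have me1 : 0 < Num.min 1 e1 by rewrite lt_min ltr01.
have [d2 d20 H2] := @powR_continuous_at R _ p _ x1 me1.
have [d3 [d30 d3E]] : exists d3 : R, 0 < d3 /\ d3 = d2 / (2 * Y).
  by exists (d2 / (2 * Y)); rewrite divr_gt0// mulr_gt0// (lt_le_trans ltr01).
exists (Num.min d1 (Num.min d3 (Num.min 1 e1))); first by rewrite !lt_min d10 d30 ltr01.
move=> s y s0; rewrite !lt_min => /andP[sd1 _] /and4P[_ yd3 y1 ye1].
have {}H1 : `|g s - g t| < e1 /\ `|g s - g t| <= `|lambda|.
  have := H1 (1 + s); rewrite opprD addrACA subrr add0r => /(_ sd1).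
  rewrite lt_min => /andP[h1 h2]; rewrite /g -mulrBl normrM; split.
    apply: (@le_lt_trans _ _ (`|(1 + s) `^ (- beta) - (1 + t) `^ (- beta)| * (`|lambda| + 1))).
      by rewrite ler_wpM2l// lerDl.
    by rewrite -ltr_pdivlMr// ltr_wpDl.
  by rewrite -[leRHS]mul1r ler_wpM2r// ltW.
have {}H2 : `|k y - k x| < e1 /\ `|k y - k x| < 1.
  have := H2 (1 + enorm y ^+ 2); rewrite lt_min => H; apply/andP; rewrite andbC; apply: H.
  rewrite opprD addrACA subrr add0r subr_sqr normrM.
  have yx := ler_dist_enorm y x.
  have yY : enorm y <= Y by have := ler_enorm_sub y x; rewrite /Y; lra.
  have xY : enorm x <= Y by rewrite lerDl.
  rewrite (ger0_norm (addr_ge0 (enorm_ge0 y) (enorm_ge0 x))).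
  apply: (@le_lt_trans _ _ (enorm (y - x) * (2 * Y))).
    by rewrite ler_pM ?addr_ge0//; lra.
  rewrite -ltr_pdivlMr ?mulr_gt0// ?(lt_le_trans ltr01)//.
  by rewrite -d3E.
have [h1 h1'] := H1; have [h2 h2'] := H2.
rewrite !FE (_ : (g s * k y) *: y - (g t * k x) *: x =
   ((g s - g t) * k y) *: y + (g t * (k y - k x)) *: y + (g t * k x) *: (y - x)); last first.
  by rewrite mulrBl mulrBr !scalerBl scalerBr !addrA !subrK.
have ky : `|k y| <= Q.
  have kk : k y - k x <= `|k y - k x| by exact: ler_norm.
  by rewrite ger0_norm ?powR_ge0// /Q; lra.
have yY : enorm y <= Y by have := ler_enorm_sub y x; rewrite /Y; lra.
have S0 : 0 <= S by rewrite (le_trans ler01).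
have Q0 : 0 <= Q by rewrite (le_trans ler01).
have gS : `|g t| <= S by rewrite lerDl.
have kQ : `|k x| <= Q by rewrite ger0_norm ?powR_ge0// lerDl.
have t1 : enorm (((g s - g t) * k y) *: y) <= e1 * (S * Q * Y).
  rewrite enormZ normrM (_ : e1 * (S * Q * Y) = e1 * (S * Q) * Y); last by ring.
  apply: ler_pM => //; apply: ler_pM => //; first exact: ltW.
  by apply: le_trans ky _; rewrite ler_peMl.
have t2 : enorm ((g t * (k y - k x)) *: y) <= e1 * (S * Q * Y).
  rewrite enormZ normrM (_ : e1 * (S * Q * Y) = S * (e1 * Q) * Y); last by ring.
  apply: ler_pM => //; apply: ler_pM => //; apply: le_trans (ltW h2) _.
  by rewrite ler_peMr// ltW.
have t3 : enorm ((g t * k x) *: (y - x)) <= e1 * (S * Q * Y).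
  rewrite enormZ normrM (_ : e1 * (S * Q * Y) = (S * Q * Y) * e1); last by ring.
  apply: ler_pM => //; last exact: ltW.
  apply: (@le_trans _ _ (S * Q)); first exact: ler_pM.
  by rewrite ler_peMr// mulr_ge0.
apply: le_lt_trans (ler_enormD _ _) _.
apply: le_lt_trans (lerD (ler_enormD _ _) t3) _.
apply: le_lt_trans (lerD (lerD t1 t2) (lexx _)) _.
have -> : e1 * (S * Q * Y) = e / 4.
  by rewrite /e1; field; rewrite !gt_eqF// (lt_le_trans ltr01).
exact: three_quarters_lt.
Qed.

(* Rescaling by r turns the drift into [lambda omega A^(gamma - 1) y] with
   [A^2 = r^-2 + |y|^2] and [omega = r^(1 + gamma) (1 + v)^-beta]. *)
Lemma drift_scaled (r v : R) (y : V) : 0 < r ->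
  r *: F v (r *: y) =
  (lambda * (r `^ (1 + gamma) * (1 + v) `^ (- beta)) * Num.sqrt (r ^- 2 + enorm y ^+ 2) `^ (gamma - 1)) *: y.
Proof.
move=> r0; rewrite /drift !scalerA; congr (_ *: _).
have r20 : 0 < r ^+ 2 by rewrite exprn_gt0.
have A0 : 0 < r ^- 2 + enorm y ^+ 2 by rewrite ltr_wpDr ?sqr_ge0// invr_gt0.
have -> : 1 + enorm (r *: y) ^+ 2 = r ^+ 2 * (r ^- 2 + enorm y ^+ 2).
  by rewrite enormZ exprMn real_normK ?num_real// mulrDr divff// gt_eqF.
rewrite powRM ?(ltW A0) ?(ltW r20)// -powR12_sqrt ?(ltW A0)// -powRrM.
have -> : (r ^+ 2) `^ (2^-1 * (gamma - 1)) = r `^ (gamma - 1).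
  by rewrite -(powR_mulrn 2 (ltW r0)) -powRrM; congr (_ `^ _); field.
have -> : r `^ (1 + gamma) = r * r `^ (gamma - 1) * r.
  rewrite (_ : 1 + gamma = 1 + (gamma - 1) + 1); last by ring.
  by rewrite powRD ?powRD ?(gt_eqF r0) ?implybT// powRr1// ltW.
ring.
Qed.

Lemma drift_scaled_power (r v Lam eps : R) (y y' : V) : 1 < gamma -> lambda <= 0 -> 1 <= r -> 0 <= eps ->
  `|r `^ (1 + gamma) * (1 + v) `^ (- beta) - 1| <= eps ->
  enorm y <= Lam -> enorm y' <= Lam ->
  enorm (r *: F v (r *: y) - bbar 0 (- lambda) (gamma - 1) y') <=
  - lambda * (Lam + 1) `^ (gamma - 1) * (eps * Lam + gamma / r)
  + - lambda * (Lam + 1) `^ (gamma - 1) * (gamma + 1) * enorm (y - y').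
Proof.
move=> g1 l0 r1 e0 om yL y'L; have r0 : 0 < r by apply: lt_le_trans r1.
have l0' : 0 <= - lambda by rewrite oppr_ge0.
have g0 : 0 < gamma - 1 by rewrite subr_gt0.
rewrite drift_scaled//; set w := r `^ _ * _ in om *; set A := Num.sqrt _.
have rV0 : 0 < r^-1 by rewrite invr_gt0.
have A1 : enorm y <= A.
  by rewrite -[leLHS]ger0_norm// -sqrtr_sqr ler_wsqrtr// lerDr invr_ge0 sqr_ge0.
have A2 : A <= enorm y + r^-1.
  have e1 : 0 <= enorm y + r^-1 by rewrite addr_ge0// ltW.
  rewrite -[leRHS]ger0_norm// -sqrtr_sqr ler_wsqrtr//.
  by rewrite sqrrD -exprVn [leLHS]addrC lerD2r lerDl mulrn_wge0// mulr_ge0// ltW.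
have A0 : 0 <= A by exact: sqrtr_ge0.
have rV1 : r^-1 <= 1 by rewrite invf_le1.
have AL : A <= Lam + 1 by lra.
have L0 : 0 <= Lam by apply: le_trans yL.
have y'L1 : enorm y' <= Lam + 1 by lra.
have PF := power_field_lip g0 A1 AL (lexx (enorm y')) y'L1.
have -> : (lambda * w * A `^ (gamma - 1)) *: y - bbar 0 (- lambda) (gamma - 1) y' =
  (lambda * (w - 1) * A `^ (gamma - 1)) *: y + lambda *: (A `^ (gamma - 1) *: y - enorm y' `^ (gamma - 1) *: y').
  by rewrite /bbar; apply/rowP => i; rewrite !mxE; ring.
apply: le_trans (ler_enormD _ _) _; rewrite !enormZ !normrM (ler0_norm l0).
have pA : A `^ (gamma - 1) <= (Lam + 1) `^ (gamma - 1) by apply: powR_mono => //; exact: ltW.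
rewrite (ger0_norm (powR_ge0 _ _)).
have H1 : - lambda * `|w - 1| * A `^ (gamma - 1) * enorm y <= - lambda * (Lam + 1) `^ (gamma - 1) * (eps * Lam).
  rewrite (_ : - lambda * (Lam + 1) `^ (gamma - 1) * (eps * Lam) = - lambda * eps * (Lam + 1) `^ (gamma - 1) * Lam); last by ring.
  by rewrite ler_pM ?mulr_ge0 ?powR_ge0// ler_pM ?mulr_ge0 ?powR_ge0// ler_wpM2l.
have AA : `|A - enorm y'| <= r^-1 + enorm (y - y').
  apply: le_trans (ler_distD (enorm y) _ _) _; apply: lerD; last exact: ler_dist_enorm.
  by rewrite ger0_norm ?subr_ge0// lerBlDl.
have {}PF : enorm (A `^ (gamma - 1) *: y - enorm y' `^ (gamma - 1) *: y') <=
    (Lam + 1) `^ (gamma - 1) * (gamma / r + (gamma + 1) * enorm (y - y')).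
  apply: le_trans PF _; rewrite ler_wpM2l ?powR_ge0//.
  have : (gamma - 1 + 1) * `|A - enorm y'| <= (gamma - 1 + 1) * (r^-1 + enorm (y - y')).
    by rewrite ler_wpM2l// subrK; lra.
  by rewrite subrK mulrDr => H; rewrite mulrDl mul1r; lra.
have := ler_wpM2l l0' PF; move: H1; rewrite !mulrDr !mulrA; lra.
Qed.

(** The exponent [1 + gamma - 2 beta] is negative exactly in case (a), where the drift disappears in
    the limit. *)
Lemma drift_small (r v Lam : R) (y : V) : 0 <= beta -> 0 < gamma -> 1 <= r -> r ^+ 2 <= v -> enorm y <= Lam ->
  enorm (r *: F v (r *: y)) <= `|lambda| * (1 + Lam) `^ gamma * r `^ (1 + gamma - 2 * beta).
Proof.
move=> b0 g0 r1 rv yL; have r0 : 0 < r by apply: lt_le_trans r1.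
have L0 : 0 <= Lam by apply: le_trans yL.
rewrite drift_scaled// enormZ; set A := Num.sqrt _.
have rV1 : r ^- 2 <= 1 by rewrite invf_le1 ?exprn_ege1// exprn_gt0.
have A1 : enorm y <= A.
  by rewrite -[leLHS]ger0_norm// -sqrtr_sqr ler_wsqrtr// lerDr invr_ge0 sqr_ge0.
have A00 : 0 < A by rewrite sqrtr_gt0 ltr_wpDr ?sqr_ge0// invr_gt0 exprn_gt0.
have A2 : A <= 1 + Lam.
  have e1 : 0 <= 1 + Lam by rewrite addr_ge0.
  rewrite -[leRHS]ger0_norm// -sqrtr_sqr ler_wsqrtr//.
  have : enorm y ^+ 2 <= Lam ^+ 2 by rewrite ler_sqr ?nnegrE.
  by rewrite sqrrD expr1n; lra.
have Ay : A `^ (gamma - 1) * enorm y <= (1 + Lam) `^ gamma.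
  apply: (@le_trans _ _ (A `^ (gamma - 1) * A)); first by rewrite ler_wpM2l ?powR_ge0.
  rewrite -[X in _ * X]powRr1 ?(ltW A00)// -powRD ?subrK; last by rewrite gt_eqF// implybT.
  by apply: powR_mono => //; exact: ltW.
have v0 : 0 <= v by apply: le_trans rv; exact: sqr_ge0.
have vb : (1 + v) `^ (- beta) <= r `^ (- (2 * beta)).
  rewrite !powRN lef_pV2 ?posrE ?powR_gt0//; last by rewrite ltr_pwDl.
  rewrite powRrM powR_mulrn ?(ltW r0)//; apply: powR_mono => //; last by lra.
  by rewrite sqr_ge0.
set w := r `^ _ * _; have w0 : 0 <= w by rewrite mulr_ge0 ?powR_ge0.
have wr : w <= r `^ (1 + gamma - 2 * beta).
  rewrite powRD; last by rewrite (gt_eqF r0) implybT.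
  by rewrite /w ler_wpM2l ?powR_ge0.
rewrite normrM normrM (ger0_norm w0) (ger0_norm (powR_ge0 A _)).
move: w w0 wr => w w0 wr.
rewrite -!mulrA ler_wpM2l// [leLHS](_ : _ = A `^ (gamma - 1) * enorm y * w); last by ring.
by apply: ler_pM => //; rewrite ?mulr_ge0 ?powR_ge0.
Qed.

End drift.

(** * Test functions, initial laws, and the passage from [m] to [t] *)

Section smooth_functions.
Variables (R : realType) (d : nat).
Local Notation V := 'rV[R]_d.

Lemma partials_le_nabla_sup k (s : k.-tuple 'I_d) (f : V -> R) x :
  (`|partials s f x|%:E <= nabla_sup k f)%E.
Proof.
apply: (@le_trans _ _ (nabla_norm k f x)%:E); last by apply: ereal_sup_ubound; exists x.
rewrite lee_fin -sqrtr_sqr ler_wsqrtr// (bigD1 s)//= lerDl.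
by apply: sumr_ge0 => *; exact: sqr_ge0.
Qed.

Lemma nabla_sup_ge0 k (f : V -> R) : (0 <= nabla_sup k f)%E.
Proof.
apply: (@le_trans _ _ (nabla_norm k f 0)%:E); first by rewrite lee_fin sqrtr_ge0.
by apply: ereal_sup_ubound; exists 0.
Qed.

Lemma Fc_partials (f : V -> R) : Fc f ->
  (forall x, `|f x| <= 1) /\ (forall i x, `|'D_(delta_mx 0 i) f x| <= 1).
Proof.
move=> [_ _]; rewrite !big_ord_recl big_ord0 adde0 => H.
have n0 := nabla_sup_ge0 0 f; have n1 := nabla_sup_ge0 1 f.
have n2 := nabla_sup_ge0 2 f; have n3 := nabla_sup_ge0 3 f.
have H0 : (nabla_sup 0 f <= 1)%E.
  by apply: le_trans H; rewrite leeDl// !adde_ge0.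
have H1 : (nabla_sup 1 f <= 1)%E.
  by apply: le_trans H; apply: le_trans (leeDr _ n0); rewrite leeDl// !adde_ge0.
split=> [x|i x]; rewrite -lee_fin.
  exact: le_trans (partials_le_nabla_sup [tuple] f x) H0.
exact: le_trans (partials_le_nabla_sup [tuple i] f x) H1.
Qed.

Lemma coordinate_lip (f : V -> R) (x : V) (i : 'I_d) (a : R) :
  (forall x, derivable f x (delta_mx 0 i)) -> (forall x, `|'D_(delta_mx 0 i) f x| <= 1) ->
  `|f (x + a *: delta_mx 0 i) - f x| <= `|a|.
Proof.
move=> df Df; pose v : V := delta_mx 0 i.
pose g (t : R) := f (x + t *: v).
have gd (t : R) : is_derive t 1 g ('D_v f (x + t *: v)).
  have E : (fun h : R => h^-1 *: (g (h *: (1 : R) + t) - g t)) =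
           (fun h : R => h^-1 *: (f (h *: v + (x + t *: v)) - f (x + t *: v))).
    apply/funext => h; rewrite /g; congr (_ *: (f _ - _)).
    by rewrite scalerDl -[h *: (1 : R)]/(h * 1) mulr1 addrCA.
  apply: DeriveDef; first by rewrite /derivable E; exact: df.
  by rewrite /derive E.
have gc : continuous g.
  by move=> t; apply: differentiable_continuous; apply/derivable1_diffP; have [] := gd t.
have key (s t : R) : s <= t -> `|g t - g s| <= t - s.
  move=> st; have [c _ ->] := MVT_segment st (fun u _ => gd u) (continuous_subspaceT gc).
  by rewrite normrM (ger0_norm (_ : 0 <= t - s)) ?subr_ge0// ler_piMl ?subr_ge0.
have -> : f x = g 0 by rewrite /g scale0r addr0.
rewrite -/(g a); have [a0|a0] := leP 0 a.
  by apply: le_trans (key _ _ a0) _; rewrite subr0 ler_norm.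
rewrite distrC; apply: le_trans (key _ _ (ltW a0)) _.
by rewrite sub0r -normrN ler_norm.
Qed.

(** Go from [x] to [y] changing one coordinate at a time, since partial derivatives are what is
    given; each of the [d] moves costs at most the distance. *)
Lemma Fc_blip (f : V -> R) : Fc f -> blip d%:R f.
Proof.
move=> fF; have [f1 Df] := Fc_partials fF; have [sf _ _] := fF.
split=> // x y.
pose z k : V := \row_i (if (i < k)%N then y 0 i else x 0 i).
have zS (k : 'I_d) : z k.+1 = z k + (y 0 k - x 0 k) *: delta_mx 0 k.
  apply/rowP => j; rewrite !mxE eqxx/=; have [->|jk] := eqVneq j k.
    by rewrite ltnSn ltnn mulr1 addrC subrK.
  by rewrite mulr0 addr0 ltnS leq_eqVlt (inj_eq val_inj) (negbTE jk).
have step (k : 'I_d) : `|f (z k.+1) - f (z k)| <= `|y 0 k - x 0 k|.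
  rewrite zS; apply: coordinate_lip; last exact: Df.
  by move=> u; have [_ /(_ u k)] := sf [::].
have z0 : z 0%N = x by apply/rowP => j; rewrite mxE ltn0.
have zd : z d = y by apply/rowP => j; rewrite mxE ltn_ord.
have -> : f x - f y = - \sum_(k < d) (f (z k.+1) - f (z k)).
  by rewrite -(big_mkord xpredT (fun k => f (z k.+1) - f (z k))) telescope_sumr// z0 zd opprB.
rewrite normrN; apply: le_trans (ler_norm_sum _ _ _) _.
apply: (@le_trans _ _ (\sum_(k < d) enorm (x - y))).
  apply: ler_sum => k _; apply: le_trans (step k) _.
  by have := coord_enorm (x - y) k; rewrite !mxE distrC.
by rewrite sumr_const card_ord mulr_natl.
Qed.

End smooth_functions.

(** The constant [M] depends on [mu] alone, and not on the probability space, in accordance with the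
    order of quantifiers in [polynomial_convergence]. *)
Lemma moment_tail (R : realType) (d : nat) (gamma : R) (mu : probability 'rV[R]_d R) : 0 < gamma ->
  finite_moment gamma mu -> exists2 M : R, 0 <= M &
  forall (disp : measure_display) (Omega : measurableType disp) (P : probability Omega R)
    (X0 : Omega -> 'rV[R]_d), measurable_fun setT X0 ->
    (forall A, measurable A -> P (X0 @^-1` A) = mu A) ->
  forall r, 0 < r -> exists G : set Omega, [/\ measurable G, fine (P (~` G)) <= M / r `^ gamma &
    forall w, G w -> enorm (X0 w) <= r].
Proof.
move=> g0 fm; pose I := (\int[mu]_x (enorm x `^ gamma)%:E)%E.
have I0 : (0 <= I)%E by apply: integral_ge0 => x _; rewrite lee_fin powR_ge0.
have If : I \is a fin_num by rewrite ge0_fin_numE.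
exists (fine I); first exact: fine_ge0.
move=> disp Omega P X0 mX0 HX0 r r0.
have mE : measurable [set x : 'rV[R]_d | enorm x <= r].
  have := @measurable_enorm R d measurableT _ (measurable_itv `]-oo, r]).
  by rewrite setTI; congr measurable; apply/seteqP; split => x; rewrite /preimage/= in_itv.
exists (X0 @^-1` [set x | enorm x <= r]); split => //.
  exact: measurable_preimage.
rewrite preimage_setC HX0; last exact: measurableC.
have rg : 0 < r `^ gamma by exact: powR_gt0.
rewrite -lee_fin fineK ?fin_num_prob//; last exact: measurableC.
rewrite EFinM fineK// lee_pdivlMr//.
apply: (@le_trans _ _ (\int[mu]_(x in ~` [set x | (enorm x <= r)%R]) (enorm x `^ gamma)%:E)%E); last first.
  apply: ge0_subset_integral => //; first exact: measurableC.
  - apply/measurable_EFinP; exact: (measurableT_comp (measurable_powR _) (@measurable_enorm R d)).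
  - by move=> x _; rewrite lee_fin powR_ge0.
rewrite muleC -(integral_cst mu (measurableC mE) (r `^ gamma)%:E).
apply: ge0_le_integral.
- exact: measurableC.
- by move=> x _; rewrite lee_fin powR_ge0.
- exact: measurable_cst.
- apply/measurable_EFinP; apply: measurable_funTS.
  exact: (measurableT_comp (measurable_powR _) (@measurable_enorm R d)).
- move=> x /negP; rewrite -ltNge => rx; rewrite lee_fin.
  by apply: powR_mono; exact: ltW.
Qed.

Lemma solution_good_set (R : realType) (d : nat) (disp : measure_display) (Omega : measurableType disp)
    (P : probability Omega R) (b : R -> 'rV[R]_d -> 'rV[R]_d) (L X : R -> Omega -> 'rV[R]_d) :
  jointly_continuous b -> is_strong_solution P b L X ->
  exists N : set Omega, [/\ measurable N, P N = 0%E &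
    forall w, ~ N w -> cadlag (X ^~ w) /\ drift_path b (X ^~ w) (L ^~ w)].
Proof.
move=> bc [_ _ _ cX eX].
have [N [mN N0 HN]] : {ae P, forall w, cadlag (X ^~ w) /\ drift_path b (X ^~ w) (L ^~ w)}.
  by apply: filterS2 cX eX => w cXw eXw; split => //; exact: integral_equation_drift_path.
exists N; split => // w Nw; apply: contrapT => H; apply: Nw; exact: HN.
Qed.

(** Take [m] the integer part of [t^(1 / n)]: an error [C / m] is at most [2 C t^(- 1 / n)]. The
    exponent and the starting time come from [n] and [m0], chosen before [mu]. The upper bound
    [(2 m)^n] lets [t] be bounded polynomially in [m]. *)
Lemma polynomial_convergence_of (R : realType) (d : nat) (nu : {measure set 'rV[R]_d -> \bar R})
    (b : R -> 'rV[R]_d -> 'rV[R]_d) (gamma theta : R) (pi : probability 'rV[R]_d R) (n m0 : nat) :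
  (0 < n)%N -> (0 < m0)%N ->
  (forall mu : probability 'rV[R]_d R, finite_moment gamma mu -> exists2 C : R, 0 < C &
    forall (disp : measure_display) (Omega : measurableType disp) (P : probability Omega R)
      (L X : R -> Omega -> 'rV[R]_d), is_pure_jump_levy P nu L -> is_strong_solution P b L X ->
      (forall A, measurable A -> P (X 0 @^-1` A) = mu A) ->
    forall (m : nat) (t : R) f, (m0 <= m)%N -> m%:R ^+ n <= t <= (2 * m%:R) ^+ n -> blip d%:R f ->
    `|\int[P]_w f (t `^ (- theta) *: X t w) - \int[pi]_x f x| <= C / m%:R) ->
  polynomial_convergence nu b gamma theta pi.
Proof.
move=> n0 m00 H; have n0' : 0 < n%:R :> R by rewrite ltr0n.
exists n%:R^-1, (m0%:R ^+ n); split; [by rewrite invr_gt0|by rewrite exprn_gt0// ltr0n|].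
move=> mu fmu; have [C C0 HC] := H mu fmu; exists (2 * C); first by rewrite mulr_gt0.
move=> disp Omega P L X LL XS X0 t tm0.
have m01 : 1 <= m0%:R :> R by rewrite ler1n.
have t1 : 1 <= t by apply: le_trans tm0; rewrite exprn_ege1.
have t0 : 0 < t by apply: lt_le_trans t1.
pose y := t `^ n%:R^-1; have y0 : 0 < y by exact: powR_gt0.
have yn : y ^+ n = t by rewrite /y -powR_mulrn ?powR_ge0// -powRrM mulVf ?gt_eqF// powRr1// ltW.
have m0y : m0%:R <= y by rewrite -(ler_pXn2r n0) ?nnegrE ?ler0n ?(ltW y0)// yn.
pose m := Num.truncn y; have /andP[my ym] := truncn_itv (ltW y0).
have m0m : (m0 <= m)%N by rewrite truncn_ge_nat// ltW.
have mp : 0 < m%:R :> R by rewrite ltr0n (leq_trans m00).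
have y2m : y <= 2 * m%:R.
  apply: le_trans (ltW ym) _; rewrite -/m -natr1 mulr_natl mulr2n lerD2l ler1n.
  by rewrite -(ltr0n R).
have tm : m%:R ^+ n <= t <= (2 * m%:R) ^+ n.
  by rewrite -yn !ler_pXn2r ?nnegrE ?ler0n ?mulr_ge0 ?(ltW y0)// my.
have mY : measurable_fun setT (fun w => t `^ (- theta) *: X t w).
  by case: XS => mX _ _ _ _; apply: (measurable_rowZ (a := fun=> t `^ (- theta))) => //; exact: (mX _ (ltW t0)).
apply: ge_ereal_sup => _ [f fF <-]; have fC := Fc_blip fF; have mf := blip_measurable fC.
have E1 : (\int[pushforward P (fun w => t `^ (- theta) *: X t w)]_x (f x)%:E =
   (\int[P]_w f (t `^ (- theta) *: X t w))%:E)%E.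
  rewrite -(expect_law P mY mf fC.1) -[LHS]/(\int[law P mY]_x (f x)%:E)%E.
  exact: (Rintegral_EFin _ mf fC.1).
rewrite E1 (Rintegral_EFin pi mf fC.1) -EFinB lee_fin.
apply: le_trans (HC _ _ P L X LL XS X0 m t f m0m tm fC) _.
rewrite powRN -/y (mulrC 2) -mulrA ler_wpM2l ?(ltW C0)//.
by rewrite -[X in _ <= X]invrK invfM invrK lef_pV2 ?posrE// ?mulr_gt0 ?invr_gt0// mulrC ler_pdivrMr// mulrC.
Qed.

(** * Rates of convergence *)

Section power_drift.
Variables (R : realType) (d : nat) (beta gamma lambda : R) (p : nat).
Local Notation V := 'rV[R]_d.
Local Notation F := (@drift R d beta gamma lambda).
Hypotheses (gamma1 : 1 < gamma) (lambda0 : lambda < 0) (gp : gamma - 1 <= p%:R).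

(** A relative error [u^(- small_exp)] in the time factor, multiplied by a drift of size
    [u^gam_exp], remains [u^(- tau_exp - 1)], negligible over the horizon. *)
Definition small_exp := ((tau_exp p).+1 + gam_exp p)%N.

Lemma power_drift_bounds (Lam c ce u : R) : 1 <= u -> 0 <= Lam -> 0 <= ce -> 0 <= c ->
  Lam + 1 <= c * u ^+ rho_exp p ->
  exists e1 Gam : R, [/\ 0 <= e1, 0 <= Gam,
    u ^+ (tau_exp p).+1 * e1 <= - lambda * c ^+ p.+1 * (ce + gamma),
    Gam * (1 + Lam) <= - lambda * c ^+ p.+1 * (gamma + 1) * u ^+ gam_exp p &
    forall r v (y y' : V), u ^+ small_exp <= r ->
      `|r `^ (1 + gamma) * (1 + v) `^ (- beta) - 1| <= ce / u ^+ small_exp ->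
      enorm y <= Lam -> enorm y' <= Lam ->
      enorm (r *: F v (r *: y) - bbar 0 (- lambda) (gamma - 1) y') <= e1 + Gam * enorm (y - y')].
Proof.
move=> u1 L0 ce0 c0 Lc; have u0 : 0 < u by apply: lt_le_trans u1.
have un k : 0 < u ^+ k by rewrite exprn_gt0.
have l0 : 0 <= - lambda by rewrite oppr_ge0 ltW.
have g0 : 0 <= gamma by rewrite (le_trans ler01)// ltW.
pose Q := (Lam + 1) `^ (gamma - 1).
have Q0 : 0 <= Q by exact: powR_ge0.
have L1 : 1 <= Lam + 1 by rewrite lerDr.
have QL : Q * (Lam + 1) <= c ^+ p.+1 * u ^+ gam_exp p.
  have -> : c ^+ p.+1 * u ^+ gam_exp p = (c * u ^+ rho_exp p) ^+ p.+1.
    by rewrite exprMn -exprM.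
  apply: (@le_trans _ _ ((Lam + 1) ^+ p.+1)); last first.
    by rewrite lerXn2r// nnegrE ?(le_trans _ Lc)// addr_ge0.
  rewrite exprSr ler_wpM2r ?addr_ge0// -powR_mulrn ?addr_ge0//; exact: ler_powR.
pose S := u ^+ small_exp; have S0 : 0 < S by exact: un.
exists (- lambda * Q * (ce / S * Lam + gamma / S)), (- lambda * Q * (gamma + 1)).
have z1 : 0 <= ce / S * Lam + gamma / S.
  by apply: addr_ge0; [apply: mulr_ge0 => //|]; rewrite divr_ge0// ltW.
split.
- by rewrite !mulr_ge0.
- by rewrite !mulr_ge0// addr_ge0.
- have H : ce / S * Lam + gamma / S <= (ce + gamma) * (Lam + 1) / S.
    rewrite [ce / S * Lam]mulrAC -mulrDl ler_wpM2r ?invr_ge0 ?(ltW S0)//.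
    have : 0 <= gamma * Lam by rewrite mulr_ge0.
    by rewrite mulrDl !mulrDr !mulr1; lra.
  apply: (@le_trans _ _ (u ^+ (tau_exp p).+1 * (- lambda * Q * ((ce + gamma) * (Lam + 1) / S)))).
    by rewrite ler_wpM2l ?(ltW (un _))// ler_wpM2l// mulr_ge0.
  rewrite [leLHS](_ : _ = - lambda * (ce + gamma) * (u ^+ (tau_exp p).+1 / S) * (Q * (Lam + 1))); last by ring.
  apply: (@le_trans _ _ (- lambda * (ce + gamma) * (u ^+ (tau_exp p).+1 / S) * (c ^+ p.+1 * u ^+ gam_exp p))).
    by rewrite ler_wpM2l// !mulr_ge0 ?addr_ge0 ?invr_ge0 ?(ltW S0) ?(ltW (un _)).
  apply: le_of_eq; rewrite /S /small_exp exprD.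
  by have := un (tau_exp p).+1; have := un (gam_exp p); move=> a0 b0; field; rewrite !gt_eqF.
- rewrite [leLHS](_ : _ = - lambda * (gamma + 1) * (Q * (Lam + 1))); last by ring.
  rewrite [leRHS](_ : _ = - lambda * (gamma + 1) * (c ^+ p.+1 * u ^+ gam_exp p)); last by ring.
  by rewrite ler_wpM2l// mulr_ge0// addr_ge0.
- move=> r v y y' ru om yL y'L.
  have r1 : 1 <= r by apply: le_trans ru; rewrite exprn_ege1.
  have r0 : 0 < r by apply: lt_le_trans r1.
  have ceS : 0 <= ce / S by rewrite divr_ge0// ltW.
  apply: le_trans (drift_scaled_power gamma1 (ltW lambda0) r1 ceS om yL y'L) _.
  rewrite lerD2r ler_wpM2l ?mulr_ge0// lerD2l ler_wpM2l// lef_pV2 ?posrE//.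
Qed.

End power_drift.

Section subcritical_path.
Variables (R : realType) (d : nat) (beta gamma lambda : R).
Local Notation V := 'rV[R]_d.
Local Notation F := (@drift R d beta gamma lambda).
Hypotheses (beta0 : 0 < beta) (gamma1 : 1 < gamma) (lambda0 : lambda < 0).

Lemma drift_dissipative (v : R) (y : V) : F v y =
  - ((1 + v) `^ (- beta) * - lambda * (1 + enorm y ^+ 2) `^ (2^-1 * (gamma - 1))) *: y.
Proof. by rewrite /drift; congr (_ *: _); ring. Qed.

Let rho (v : R) (y : V) := (1 + v) `^ (- beta) * - lambda * (1 + enorm y ^+ 2) `^ (2^-1 * (gamma - 1)).

Lemma drift_rate_ge0 (v : R) (y : V) : 0 <= v -> 0 <= rho v y.
Proof. by move=> v0; rewrite !mulr_ge0 ?powR_ge0// oppr_ge0 ltW. Qed.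

Let bc : jointly_continuous F := @drift_jointly_continuous R d beta gamma lambda.

Lemma subcritical_stable (x z : R -> V) (s t M : R) : cadlag x -> drift_path F x z ->
  0 <= s -> s <= t -> 0 <= M -> (forall v, s <= v <= t -> enorm (z v - z s) <= M) ->
  enorm (x t) <= Num.max (2 * M) (enorm (x s)) + M.
Proof.
move=> cx dx s0 st M0 zM.
have H := drift_stable bc cx dx (rho := rho) drift_dissipative drift_rate_ge0 s0 st M0 zM (lexx (2 * M)).
have tt : s <= t <= t by rewrite st lexx.
have := ler_enorm_sub (x t) (z t - z s); have := zM t tt; lra.
Qed.

(** With [r^(1 + gamma) = t^beta], the damping rate beyond radius [r] and before time [t] is at
    least of order [r^-2]. A window of length [T r^2] thus forgets the initial position up to a
    factor exponentially small in [T]. *)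
Lemma subcritical_decay (x z : R -> V) (a T r t M : R) : cadlag x -> drift_path F x z ->
  1 <= r -> r `^ (1 + gamma) = t `^ beta -> 1 <= t -> 0 <= a -> 0 <= T -> a + T * r ^+ 2 <= t -> r <= M ->
  (forall v, a <= v <= a + T * r ^+ 2 -> enorm (z v - z a) <= M) ->
  enorm (x (a + T * r ^+ 2)) <=
    Num.max (2 * M) (expR (- (- lambda * 2 `^ (- beta) / 2 * T)) * enorm (x a)) + M.
Proof.
move=> cx dx r1 rt t1 a0 T0 at_ rM zM.
have r0 : 0 < r by apply: lt_le_trans r1.
have t0 : 0 < t by apply: lt_le_trans t1.
have M0 : 0 <= M by apply: le_trans rM; exact: ltW.
have aT : a <= a + T * r ^+ 2 by rewrite lerDl mulr_ge0// sqr_ge0.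
have l0 : 0 < - lambda by rewrite oppr_gt0.
(* This is [- lambda (2 t)^(- beta) r^(gamma - 1)], the damping at radius [r], with [1 + v] bounded
   by [2 t]. *)
pose c := - lambda * 2 `^ (- beta) * r ^- 2.
have c0 : 0 <= c by rewrite !mulr_ge0 ?powR_ge0 ?invr_ge0 ?sqr_ge0// ltW.
have Hc v : a <= v < a + T * r ^+ 2 -> 2 * M <= enorm (x v - (z v - z a)) -> c <= rho v (x v).
  move=> /andP[av vT] Mx.
  have v0 : 0 <= v by apply: le_trans av.
  have xr : r <= enorm (x v).
    have zv : enorm (z v - z a) <= M by apply: zM; rewrite av ltW.
    by have := ler_enormB (x v) (z v - z a); lra.
  have -> : c = (2 * t) `^ (- beta) * - lambda * (r ^+ 2) `^ (2^-1 * (gamma - 1)).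
    rewrite powRM ?(ltW t0)// /c -(powR_mulrn 2 (ltW r0)) -powRrM mulrA divff// mul1r.
    rewrite [t `^ - beta]powRN -rt (_ : 1 + gamma = (gamma - 1) + 2); last by ring.
    rewrite powRD; last by rewrite (gt_eqF r0) implybT.
    have := powR_gt0 2 r0; have := powR_gt0 (gamma - 1) r0.
    move: (r `^ 2) (r `^ (gamma - 1)) => A B A0 B0; field.
    by rewrite !gt_eqF.
  rewrite /rho ler_pM ?mulr_ge0 ?powR_ge0// ?(ltW l0)//.
    rewrite ler_wpM2r ?(ltW l0)// !powRN lef_pV2 ?posrE ?powR_gt0 ?mulr_gt0//; last by rewrite ltr_pwDl.
    by apply: powR_mono; [exact: ltW|rewrite addr_ge0|lra].
  apply: powR_mono; [|exact: sqr_ge0|].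
    by rewrite mulr_ge0// subr_ge0 ltW.
  by rewrite ler_wpDl// ler_sqr ?nnegrE// ltW.
have H := drift_decay bc cx dx (rho := rho) drift_dissipative drift_rate_ge0 a0 aT M0 zM (lexx (2 * M)) c0 Hc.
have E : c / 2 * (a + T * r ^+ 2 - a) = - lambda * 2 `^ (- beta) / 2 * T.
  by rewrite addrAC subrr add0r /c; field; rewrite gt_eqF.
rewrite E in H.
have tt : a <= a + T * r ^+ 2 <= a + T * r ^+ 2 by rewrite aT lexx.
have := ler_enorm_sub (x (a + T * r ^+ 2)) (z (a + T * r ^+ 2) - z a); have := zM _ tt; lra.
Qed.

End subcritical_path.

(** Along the geometric mesh the scale [sqrt t] is multiplied by [sqrt (1 + h) = 1 + h / 2 + O(h^2)]
    at each step: this is where the term [- y / 2] of the limit equation comes from. *)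
Lemma sqrt_step (R : realType) (h : R) : 0 <= h <= 1 -> `|Num.sqrt (1 + h) - 1 - 2^-1 * h| <= h ^+ 2.
Proof.
move=> /andP[h0 h1]; set x := Num.sqrt _.
have x0 : 0 <= x by exact: sqrtr_ge0.
have xx : x ^+ 2 = 1 + h by rewrite sqr_sqrtr// addr_ge0.
rewrite ler_norml; apply/andP; split.
  rewrite -subr_ge0 opprK; apply: contraT; rewrite -ltNge => H.
  have x1 : x < 1 + h / 2 - h ^+ 2 by lra.
  have : x ^+ 2 < (1 + h / 2 - h ^+ 2) ^+ 2 by rewrite ltr_sqr ?nnegrE// (le_trans x0)// ltW.
  rewrite xx; have h3 : 0 <= h ^+ 3 * (1 - h) by rewrite mulr_ge0 ?exprn_ge0// subr_ge0.
  have := sqr_ge0 h; rewrite !expr2 exprS expr2 in h3 *; nra.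
have : x <= 1 + h / 2.
  rewrite leNgt; apply/negP => H.
  have : (1 + h / 2) ^+ 2 < x ^+ 2 by rewrite ltr_sqr ?nnegrE// addr_ge0// divr_ge0.
  by rewrite xx; have := sqr_ge0 h; rewrite !expr2; nra.
by have := sqr_ge0 h; lra.
Qed.

Lemma bernoulli (R : realDomainType) (h : R) (n : nat) : 0 <= h -> 1 + n%:R * h <= (1 + h) ^+ n.
Proof.
move=> h0; elim: n => [|n IH]; first by rewrite mul0r addr0 expr0.
have n0 : 0 <= n%:R * h by rewrite mulr_ge0.
rewrite exprS; apply: (@le_trans _ _ ((1 + h) * (1 + n%:R * h))).
  rewrite -natr1 mulrDl mul1r mulrDl mul1r mulrDr mulr1.
  have : 0 <= h * (n%:R * h) by rewrite mulr_ge0.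
  lra.
by rewrite ler_wpM2l// addr_ge0.
Qed.

(** The ratio [u^4] of the last to the first time is chosen so that the linear contraction along the
    mesh, its square root [u^2], beats a starting spread of order [u]. *)
Lemma geometric_mesh (R : realType) (u : R) (K : nat) : 1 < u -> (0 < K)%N ->
  exists h : R, [/\ 0 < h, (1 + h) ^+ K = u ^+ 4 & K%:R * h <= u ^+ 4].
Proof.
move=> u1 K0; have u0 : 0 < u by exact: lt_trans u1.
have KR0 : 0 < K%:R :> R by rewrite ltr0n.
pose h : R := u `^ (4 / K%:R) - 1.
have hp : 0 <= 1 + h by rewrite /h addrC subrK powR_ge0.
have hE : (1 + h) ^+ K = u ^+ 4.
  rewrite /h addrC subrK -(powR_mulrn K (powR_ge0 _ _)) -powRrM divfK ?gt_eqF//.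
  by rewrite (powR_mulrn 4 (ltW u0)).
have h0 : 0 < h.
  rewrite ltNge; apply/negP => hle.
  have : (1 + h) ^+ K <= 1 by rewrite exprn_ile1//; lra.
  by rewrite hE leNgt exprn_egt1.
exists h; split => //; rewrite -hE; apply: le_trans (bernoulli K (ltW h0)).
by rewrite lerDr.
Qed.

(* The drift rescaled at the time [v ~ r ^+ 2] is close to its limit, with an
   error and a Lipschitz constant that the powers of the scale [m] used in
   [process_invariant] can absorb. *)
Definition drift_asymptotics (R : realType) (d : nat) (beta gamma lambda ell q A cb : R) (p N : nat) :=
  forall (m : nat) (h : R), (0 < m)%N -> 0 <= h -> h <= 1 ->
    h * m%:R ^+ step_exp p <= m%:R ^+ tau_exp p ->
    exists e1 Gam : R, [/\ 0 <= e1, 0 <= Gam, m%:R ^+ (tau_exp p).+1 * e1 <= cb,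
      Gam * (1 + 4 * A * m%:R ^+ 3) <= cb * m%:R ^+ gam_exp p &
      forall r v (y y' : 'rV[R]_d), m%:R ^+ N <= r -> r ^+ 2 <= v <= (1 + h) * r ^+ 2 ->
        enorm y <= 4 * A * m%:R ^+ 3 -> enorm y' <= 4 * A * m%:R ^+ 3 ->
        enorm (r *: drift beta gamma lambda v (r *: y) - bbar 0 ell q y') <= e1 + Gam * enorm (y - y')].

Lemma prob_setCI (R : realType) (disp : measure_display) (T : measurableType disp)
    (P : probability T R) (S U : set T) : measurable S -> measurable U ->
  fine (P (~` (S `&` U))) <= fine (P (~` S)) + fine (P (~` U)).
Proof.
move=> mS mU; have mSC := measurableC mS; have mUC := measurableC mU.
rewrite setCI -lee_fin EFinD !fineK ?fin_num_prob//; first exact: measureU2.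
exact: measurableU.
Qed.

Lemma prob_maximal (R : realType) (disp : measure_display) (T : measurableType disp)
    (P : probability T R) (G : set T) (k t u : R) : measurable G -> 0 <= k -> 0 < t -> 1 <= u ->
  (P (~` G) <= (k * (t - 0) / (u * Num.sqrt t) ^+ 2)%:E)%E -> fine (P (~` G)) <= k / u.
Proof.
move=> mG k0 t0 u1 PG; have u0 : 0 < u by apply: lt_le_trans u1.
rewrite -lee_fin fineK ?fin_num_prob//; last exact: measurableC.
apply: le_trans PG _; rewrite subr0 lee_fin exprMn sqr_sqrtr ?(ltW t0)//.
rewrite -mulrA ler_wpM2l// (_ : t / (u ^+ 2 * t) = u^-1 * u^-1).
  by rewrite ger_pMr ?invr_gt0// invf_le1.
by field; rewrite !gt_eqF.
Qed.

Section arithmetic.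
Variable R : realFieldType.

Lemma sum3_le4 (a b s x : R) : s <= x -> a <= 2 * s -> b <= s -> 0 <= x -> a + b + x <= 4 * x.
Proof. by move=> *; lra. Qed.

Lemma add1_le4 (t v : R) : 1 <= t -> v <= t -> 1 + v <= 2 ^+ 2 * t.
Proof. by rewrite expr2 => *; lra. Qed.

Lemma sqr_half_step (h : R) : 1 + h <= (1 + h * 2^-1) ^+ 2.
Proof. by have := sqr_ge0 (h * 2^-1); rewrite !expr2; lra. Qed.

Lemma sub_twice_ge0 (t x : R) : 0 <= t -> x <= t / 4 -> 0 <= t - 2 * x.
Proof. by move=> *; lra. Qed.

End arithmetic.

Lemma near_one_bounds (R : realFieldType) (y : R) : `|y - 1| <= 4^-1 -> 2^-1 <= y <= 3.
Proof. by rewrite ler_norml => /andP[? ?]; apply/andP; split; lra. Qed.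

Lemma sum5_bounds (R : realFieldType) (a b c e : R) : 0 <= a -> 0 <= b -> 0 <= c -> 0 <= e ->
  [/\ a <= a + b + c + e + 1, b <= a + b + c + e + 1, c <= a + b + c + e + 1 & e <= a + b + c + e + 1].
Proof. by move=> *; split; lra. Qed.

Lemma contraction_rate_identity (R : realFieldType) (A l u a b c : R) :
  0 < l -> 0 < u -> 0 < a -> 0 < b -> 0 < c ->
  A * a / (a * b * u * (l * (2^-1 * (c * b)^-1))) = A * (2 * c) / l / u.
Proof. by move=> *; field; rewrite !gt_eqF. Qed.

Section limits.
Variables (R : realType) (d : nat).
Local Notation V := 'rV[R]_d.
Variables (nu : {measure set V -> \bar R}) (s2 del mm : R).
Let psi (xi : V) : R := complex.Re (levy_symbol nu xi).
Hypothesis symbol_real : forall xi, complex.Im (levy_symbol nu xi) = 0.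
Hypothesis s20 : 0 <= s2.
Hypothesis psi0 : forall xi, 0 <= psi xi.
Hypothesis psi2 : forall xi, psi xi <= s2 / 2 * enorm xi ^+ 2.
Hypotheses (del0 : 0 < del) (del1 : del <= 1) (mm0 : 0 <= mm).
Hypothesis psi_est : forall xi, `|psi xi - s2 / 2 * enorm xi ^+ 2| <= mm * enorm xi `^ (2 + del).
Variables (beta gamma lambda : R).
Hypotheses (beta0 : 0 < beta) (gamma0 : 0 < gamma).
Local Notation F := (@drift R d beta gamma lambda).

Variables (kap ell q : R) (p : nat).
Hypotheses (kap0 : 0 <= kap) (ell0 : 0 <= ell) (q0 : 0 < q) (qp : q <= p%:R).
Variables (disp : measure_display) (Omega : measurableType disp) (P : probability Omega R).
Variable W : R -> Omega -> V.
Hypothesis nW : noise P (fun xi => s2 / 2 * enorm xi ^+ 2) W.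
Hypothesis cW : forall w, path_continuous (W ^~ w).
Variables (pi : probability V R) (M : R).
Hypothesis M0 : 0 <= M.
Hypothesis pi_moment : (\int[pi]_x (enorm x ^+ 2)%:E <= M%:E)%E.
Hypothesis pi_invariant : forall (C : R) f t, 0 <= C -> 0 <= t -> blip C f ->
  \int[pi]_x semigroup kap ell q P W t f x = \int[pi]_x f x.

(** A deterministic bound on the diffusive scale; with the maximal inequality for the noise it
    confines the rescaled process to a ball of polynomial radius. *)
Definition apriori_bound (A : R) := forall (x z : R -> V) (t M : R),
  cadlag x -> drift_path F x z -> 0 <= t -> 0 <= M ->
  (forall s, 0 <= s <= t -> enorm (z s - z 0) <= M) ->
  enorm (x t) <= A * (Num.sqrt (1 + t) + enorm (x 0) + M).

Lemma critical_case (A cb : R) (N : nat) : kap = 2^-1 -> 1 <= A -> apriori_bound A -> 0 <= cb ->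
  drift_asymptotics d beta gamma lambda ell q A cb p N ->
  polynomial_convergence nu F gamma 2^-1 pi.
Proof.
move=> kapE A1 HA cb0 HB.
(* Three demands on a scale [r >= u^N1]: validity of the drift asymptotics, [r^del >= u^decay_exp]
   for the central limit theorem, and [r^gamma >= u] for the tail of the initial law. *)
pose N1 := maxn N (maxn (Num.truncn ((decay_exp d p)%:R / del)).+1 (Num.truncn gamma^-1).+1).
have NN1 : (N <= N1)%N by exact: leq_maxl.
have N1del : (decay_exp d p)%:R <= N1%:R * del.
  rewrite -ler_pdivrMr//; apply: le_trans (ltW (truncnS_gt _)) _.
  by rewrite ler_nat /N1 leq_max leq_max leqnn orbT.
have N1gam : 1 <= N1%:R * gamma.
  rewrite -ler_pdivrMr// div1r; apply: le_trans (ltW (truncnS_gt _)) _.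
  by rewrite ler_nat /N1 leq_max leq_max leqnn !orbT.
have A0 : 0 <= A by exact: le_trans A1.
(* With [t >= u^(2 N1 + 4)] the scheme can start at [s0 = t / u^4], whose scale [sqrt s0] is still
   at least [u^N1]. *)
apply: (@polynomial_convergence_of R d nu F gamma 2^-1 pi (2 * N1 + 4) 2) => //; first by rewrite addn4.
move=> mu fmu; have [Mmu Mmu0 Htail] := moment_tail gamma0 fmu.
pose c0 := 4 * A + cb.
have c00 : 0 <= c0 by rewrite addr_ge0// mulr_ge0.
pose Cd : R := d%:R.
pose C1 := Cd * (2 * c0 + fluctuation_const d s2 c0 + brownian_const d kap ell q p s2) +
     2 * Cd * (d%:R * s2) + 5 * Cd * d%:R + mm * d.+1%:R ^+ 3 + 2 * (d%:R * s2) + 2 * M.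
pose C2 := `|C1| + 2 * (Mmu + 2 * (d%:R * s2)) + 1.
have C20 : 0 < C2 by rewrite ltr_wpDl// addr_ge0// mulr_ge0// addr_ge0// !mulr_ge0.
exists C2 => // disp' Omega' P' L X LL XS X0 m t f m2 /andP[tm _] fC.
have m0 : (0 < m)%N by exact: ltnW.
pose u : R := m%:R; rewrite -/u in tm *.
have u1 : 1 < u by rewrite ltr1n.
have u1' := ltW u1.
have u0 : 0 < u by exact: lt_trans u1.
have un k : 0 < u ^+ k by rewrite exprn_gt0.
have t0 : 0 < t by apply: lt_le_trans tm.
have LN := levy_noise LL symbol_real.
have [mL L0 iL cL rL] := LN; have cen := noise_centered LN psi2.
have k0 : 0 <= d%:R * s2 by rewrite mulr_ge0.
have mX : measurable_process X by case: XS.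
pose s0 := t / u ^+ 4.
have s0_gt0 : 0 < s0 by rewrite divr_gt0.
have s0E : s0 * u ^+ 4 = t by rewrite divfK// gt_eqF.
have s0t : s0 <= t by rewrite ler_pdivrMr// ler_peMr ?exprn_ege1// ltW.
have s0u : u ^+ (2 * N1) <= s0 by rewrite ler_pdivlMr// -exprD.
have s01 : 1 <= s0 by apply: le_trans s0u; rewrite exprn_ege1.
pose K := (m ^ step_exp p)%N.
have K0 : (0 < K)%N by rewrite expn_gt0 m0.
have KR0 : 0 < K%:R :> R by rewrite ltr0n.
have [h [h0 h1E Kh4]] := geometric_mesh u1 K0.
have Kh : K%:R * h <= u ^+ tau_exp p.
  by apply: le_trans Kh4 _; rewrite ler_weXn2l// /tau_exp addnC.
have h1 : h <= 1.
  by have [] := step_small m0 h0 Kh erefl.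
pose tk k : R := s0 * (1 + h) ^+ k; pose rk k := Num.sqrt (tk k).
have h1p : 0 < 1 + h by rewrite addr_gt0.
have tk0 k : 0 < tk k by rewrite mulr_gt0// exprn_gt0.
have rk0 k : 0 < rk k by rewrite sqrtr_gt0.
have rk2 k : rk k ^+ 2 = tk k by rewrite sqr_sqrtr// ltW.
have tkS k : tk k.+1 - tk k = h * rk k ^+ 2 by rewrite rk2 /tk exprS; ring.
have tkS' k : tk k.+1 = (1 + h) * rk k ^+ 2 by rewrite rk2 /tk exprS; ring.
have tk_s0 k : s0 <= tk k by rewrite /tk ler_peMr// ?exprn_ege1 ?lerDl// ltW.
have tkK : tk K = t by rewrite /tk h1E.
have rkK : (rk K)^-1 = t `^ (- 2^-1) by rewrite powRN powR12_sqrt ?ltW// -tkK.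
have tkt k : (k <= K)%N -> tk k <= t.
  by move=> kK; rewrite -tkK /tk ler_wpM2l ?(ltW s0_gt0)// ler_weXn2l// lerDl ltW.
have rkN1 k : u ^+ N1 <= rk k.
  rewrite -[leLHS]ger0_norm ?(ltW (un _))// -sqrtr_sqr ler_wsqrtr// -exprM mulnC.
  exact: le_trans (tk_s0 k).
have rk_s0 k : Num.sqrt s0 <= rk k by rewrite ler_wsqrtr.
have sq0 : 0 < Num.sqrt s0 by rewrite sqrtr_gt0.
have sqt0 : 0 < Num.sqrt t by rewrite sqrtr_gt0.
have sqt : Num.sqrt t = u ^+ 2 * Num.sqrt s0.
  rewrite -s0E sqrtrM ?(ltW s0_gt0)// mulrC (_ : u ^+ 4 = (u ^+ 2) ^+ 2); last by rewrite -exprM.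
  by rewrite sqrtr_sqr ger0_norm// ltW.
have rS k : `|rk k.+1 / rk k - 1 - 2^-1 * h| <= h ^+ 2.
  have -> : rk k.+1 / rk k = Num.sqrt (1 + h).
    rewrite /rk (_ : tk k.+1 = (1 + h) * tk k); last by rewrite /tk exprS; ring.
    by rewrite sqrtrM ?(ltW h1p)// mulfK// gt_eqF// sqrtr_gt0.
  by apply: sqrt_step; rewrite ltW.
have [N0 [mN0 PN0 HN0]] := solution_good_set (@drift_jointly_continuous R d beta gamma lambda) XS.
have [G1 [mG1 PG1 HG1]] := Htail _ _ _ _ (mX 0 (lexx 0)) X0 _ sq0.
have us0 : 0 < u * Num.sqrt s0 by rewrite mulr_gt0.
have ut0 : 0 < u * Num.sqrt t by rewrite mulr_gt0.
(* The event of [G3] on the shorter window [[0, s0]]: it bounds the starting point of the scheme by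
   [4 A u] at its own scale, whereas [G3] alone would give [4 A u^3], too much for the contraction
   by [u^2]. *)
have [G2 [mG2 PG2 HG2]] := maximal mL iL k0 cen rL (lexx 0) (ltW s0_gt0) us0.
have [G3 [mG3 PG3 HG3]] := maximal mL iL k0 cen rL (lexx 0) (ltW t0) ut0.
pose G := ~` N0 `&` (G1 `&` (G2 `&` G3)).
have mG : measurable G by apply: measurableI; [exact: measurableC|do 2!apply: measurableI => //].
have PG : fine (P' (~` G)) <= (Mmu + 2 * (d%:R * s2)) / u.
  have key := @prob_setCI R disp' Omega' P'.
  have P2 := prob_maximal mG2 k0 s0_gt0 u1' PG2.
  have P3 := prob_maximal mG3 k0 t0 u1' PG3.
  have P1 : fine (P' (~` G1)) <= Mmu / u.
    apply: le_trans PG1 _; rewrite ler_wpM2l// lef_pV2 ?posrE ?powR_gt0//.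
    apply: (@le_trans _ _ ((u ^+ N1) `^ gamma)); last first.
      apply: powR_mono; [exact: ltW|exact: ltW|].
      by have := rkN1 0%N; rewrite /rk /tk expr0 mulr1.
    rewrite -(powR_mulrn N1 (ltW u0)) -powRrM -[leLHS](powRr1 (ltW u0)).
    exact: ler_powR.
  apply: le_trans (key _ _ (measurableC mN0) _) _; first by do 2!apply: measurableI => //.
  rewrite setCK PN0 add0r.
  apply: le_trans (key _ _ mG1 _) _; first exact: measurableI.
  apply: le_trans (lerD P1 (key _ _ mG2 mG3)) _.
  apply: le_trans (lerD (lexx _) (lerD P2 P3)) _.
  by apply: le_of_eq; ring.
have X0s w : G w -> enorm (X 0 w) <= Num.sqrt s0 by move=> [_ [/HG1]].
have Gap w v : G w -> 0 <= v <= t -> enorm (X v w) <= 4 * A * u * Num.sqrt t.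
  move=> Gw /andP[v0 vt]; have [Nw [g1 [g2 g3]]] := Gw; have [cXw dXw] := HN0 w Nw.
  have := HA (X ^~ w) (L ^~ w) v (u * Num.sqrt t) cXw dXw v0 (ltW ut0).
  move=> H; apply: le_trans (H _) _.
    by move=> s /andP[s0' sv]; apply: HG3 => //; rewrite s0' (le_trans sv).
  have b1 : Num.sqrt (1 + v) <= 2 * Num.sqrt t.
    apply: (@le_trans _ _ (Num.sqrt (2 ^+ 2 * t))); last by rewrite sqrtrM// sqrtr_sqr ger0_norm.
    by rewrite ler_wsqrtr// add1_le4// (le_trans s01).
  have b2 : enorm (X 0 w) <= Num.sqrt t by apply: le_trans (X0s w Gw) _; rewrite ler_wsqrtr.
  have b3 : Num.sqrt t <= u * Num.sqrt t by rewrite ler_peMl// ltW.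
  by rewrite -mulrA [4 * A]mulrC -mulrA ler_wpM2l// (sum3_le4 b3 b1 b2)// ltW.
have Gs0 w : G w -> enorm (X s0 w) <= 4 * A * u * Num.sqrt s0.
  move=> Gw; have [Nw [g1 [g2 g3]]] := Gw; have [cXw dXw] := HN0 w Nw.
  have := HA (X ^~ w) (L ^~ w) s0 (u * Num.sqrt s0) cXw dXw (ltW s0_gt0) (ltW us0).
  move=> H; apply: le_trans (H _) _; first by move=> s ss; exact: HG2.
  have b1 : Num.sqrt (1 + s0) <= 2 * Num.sqrt s0.
    apply: (@le_trans _ _ (Num.sqrt (2 ^+ 2 * s0))); last by rewrite sqrtrM// sqrtr_sqr ger0_norm.
    by rewrite ler_wsqrtr// add1_le4.
  have b2 := X0s w Gw.
  have b3 : Num.sqrt s0 <= u * Num.sqrt s0 by rewrite ler_peMl// ltW.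
  by rewrite -mulrA [4 * A]mulrC -mulrA ler_wpM2l// (sum3_le4 b3 b1 b2)// ltW.
have Lam0 : 0 <= 4 * A * u ^+ 3 by rewrite !mulr_ge0// ltW.
have GLam w v k : G w -> 0 <= v <= t -> enorm (X v w) <= 4 * A * u ^+ 3 * rk k.
  move=> Gw vt; apply: le_trans (Gap w v Gw vt) _.
  rewrite sqt exprS -!mulrA !ler_wpM2l// ?(ltW u0)// ?(ltW (un _))//.
have rN k : u ^+ N <= rk k by apply: le_trans (rkN1 k); rewrite ler_weXn2l.
have hst : h * u ^+ step_exp p <= u ^+ tau_exp p by rewrite mulrC -natrX.
have [e1 [Gam [e10 Gam0 e1U GamU HBB]]] := HB m h m0 (ltW h0) h1 hst.
rewrite -/u in e1U GamU HBB.
have ug1 k : 1 <= u ^+ k by rewrite exprn_ege1.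
have cbc0 : cb <= c0 by rewrite lerDr mulr_ge0.
have AU : 4 * A * u ^+ 3 <= c0 * u ^+ gam_exp p.
  rewrite ler_pM ?mulr_ge0// ?(ltW (un _))// ?lerDl// ler_weXn2l// /gam_exp /rho_exp.
  by rewrite mulnS (leq_trans _ (leq_addr _ _))// addn4.
have GamU1 : Gam <= c0 * u ^+ gam_exp p.
  apply: (@le_trans _ _ (cb * u ^+ gam_exp p)); last by rewrite ler_wpM2r// ltW.
  by apply: le_trans GamU; rewrite ler_peMr// lerDl.
have GamU2 : Gam * (4 * A * u ^+ 3) <= c0 * u ^+ gam_exp p.
  apply: (@le_trans _ _ (cb * u ^+ gam_exp p)); last by rewrite ler_wpM2r// ltW.
  by apply: le_trans GamU; rewrite ler_wpM2l// lerDr.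
have HD0 (zz : nat -> V) (x : V) : enorm x <= 4 * A * u ->
    enorm (euler kap ell q (fun=> h) zz x K - euler kap ell q (fun=> h) zz 0 K) <= c0 / u.
  move=> xA; have := euler_contract_exp kap0 ell0 q0 zz x 0 K (ltW h0).
  rewrite subr0 kapE; set D := enorm _ => HD.
  (* As [(1 + h / 2)^2 >= 1 + h], the contraction factor over the mesh is at least the square root
     of the time ratio [u^4]. *)
  have hk : u ^+ 2 <= (1 + h * 2^-1) ^+ K.
    have h20 : 0 <= 1 + h * 2^-1 by rewrite addr_ge0// divr_ge0// ltW.
    rewrite -(@ler_pXn2r _ 2)// ?nnegrE ?exprn_ge0// ?(ltW u0)//.
    rewrite -exprM -h1E -exprM mulnC exprM lerXn2r ?nnegrE ?exprn_ge0// ?(ltW h1p)//.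
    exact: sqr_half_step.
  have : D * u ^+ 2 <= 4 * A * u.
    by apply: le_trans xA; apply: le_trans HD; rewrite ler_wpM2l// enorm_ge0.
  rewrite -ler_pdivlMr// => {}HD; apply: le_trans HD _.
  rewrite (_ : 4 * A * u / u ^+ 2 = 4 * A / u); last by field; rewrite gt_eqF.
  by rewrite ler_wpM2r ?invr_ge0 ?(ltW u0)// lerDl.
have HDu (zz : nat -> V) (x : V) : enorm x <= u ->
    enorm (euler kap ell q (fun=> h) zz x K - euler kap ell q (fun=> h) zz 0 K) <= c0 / u.
  by move=> xu; apply: HD0; apply: le_trans xu _; rewrite ler_peMl// ?(ltW u0)// (le_trans A1)// ler_peMl// ler1n.
have b2E (y : V) : bbar kap ell q y = bbar 0 ell q y - 2^-1 *: y.
  by rewrite /bbar kapE add0r; apply/rowP => i; rewrite !mxE; ring.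
have kap1 : (0 : R) <= (2^-1 : R) <= 1 by rewrite invr_ge0 ler0n invf_le1// ler1n.
have rdel k : (k < K)%N -> u ^+ decay_exp d p <= rk k `^ del.
  move=> _; apply: (@le_trans _ _ ((u ^+ N1) `^ del)); last first.
    by apply: powR_mono => //; exact: ltW.
  by rewrite -(powR_mulrn N1 (ltW u0)) -powRrM -(powR_mulrn _ (ltW u0)); apply: ler_powR.
have tk00 : 0 <= tk 0%N by exact: ltW.
have rngt k v : (k < K)%N -> tk k <= v <= tk k.+1 -> 0 <= v <= t.
  move=> kK /andP[v1 v2]; rewrite (le_trans (ltW (tk0 k)) v1)/=.
  by apply: le_trans v2 _; exact: tkt.
have := @process_invariant R d kap ell q p kap0 ell0 q0 qp disp Omega P s2 W s20 nW cW m h c0 m0 h0 Kh c00 HDu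
  pi M M0 pi_moment pi_invariant disp' Omega' P' psi L del mm LN psi0 psi2 del0 del1 mm0 psi_est tk rk tk00 rk0 tkS rdel
  X F (bbar 0 ell q) 2^-1 (4 * A * u ^+ 3) Gam e1 (4 * A * u) ((Mmu + 2 * (d%:R * s2)) / u) G
  mX Lam0 Gam0 e10 kap1 rS b2E mG PG.
move=> PI.
have {}PI := PI _ _ _ _ _ HD0 AU GamU1 GamU2 _ Cd f (ler0n _ _) fC.
rewrite tkK rkK in PI.
apply: le_trans (PI _ _ _ _ _ _) _.
- by move=> w [Nw _]; have [] := HN0 w Nw.
- by move=> w k v Gw kK vk; apply: GLam => //; exact: rngt vk.
- move=> w k Gw kK; apply: GLam => //; rewrite (ltW (tk0 _))/=; exact: tkt.
- by move=> w Gw; rewrite /rk /tk expr0 mulr1; exact: Gs0.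
- move=> k v y y' kK /andP[v1 v2] yL y'L; apply: (HBB _ _ _ _ (rN k)) => //.
  by rewrite rk2 v1 -rk2 -tkS'.
- by apply: le_trans e1U _; rewrite lerDr mulr_ge0.
rewrite -/C1 mulrA -mulrDl ler_wpM2r ?invr_ge0 ?(ltW u0)//.
by rewrite /C2 -[leRHS]addrA; apply: lerD (ler_norm _) _; rewrite lerDl.
Qed.

Hypotheses (gamma1 : 1 < gamma) (lambda0 : lambda < 0) (betac : beta < (1 + gamma) / 2).

Lemma subcritical_case : kap = 0 -> ell = - lambda -> q = gamma - 1 ->
  polynomial_convergence nu F gamma (beta / (1 + gamma)) pi.
Proof.
move=> kapE ellE qE.
have g10 : 0 < 1 + gamma by rewrite addr_gt0.
(* This makes [T / u^(2 rho_exp) <= 1 / u], so that over a time [2 T r^2] the noise stays below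
   [u^rho_exp r] with high probability. *)
have tau_rho : ((tau_exp p).+1 <= rho_exp p * 2)%N by rewrite /tau_exp /rho_exp; clear; lia.
pose th := beta / (1 + gamma); have th0 : 0 < th by rewrite divr_gt0.
(* Subcriticality: the relaxation time [r^2 = t^(2 th)] is short compared with [t], so the time
   factor of the drift can be frozen on the final window. *)
have th2 : 2 * th < 1 by rewrite /th mulrA ltr_pdivrMr// mul1r; move: betac; lra.
have thE : th * (1 + gamma) = beta by rewrite divfK// gt_eqF.
have th1 : th <= 1 by move: th2 th0; lra.
(* The horizon needed for the power contraction: bringing points at distance of order [u^rho_exp]
   within [1 / u], at a rate no smaller than order [u^(- p)], takes a time of order
   [u^(rho_exp + p + 1)]. *)
have tau_sum : (rho_exp p + p).+1 = tau_exp p by rewrite /tau_exp /rho_exp; clear; lia.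
pose E0 := (small_exp p + 2)%N.
(* The demands are, in order: [r >= u^E0]; [r^del >= u^decay_exp]; a window [T r^2] at most
   [t / u^E0]; and [n1 >= 2] for the tail of the initial law. *)
pose n1 := (maxn (maxn (Num.truncn (E0%:R / th)).+1 (Num.truncn ((decay_exp d p)%:R / del / th)).+1)
   (maxn (Num.truncn ((tau_exp p + E0)%:R / (1 - 2 * th))).+1 2))%N.
have th2' : 0 < 1 - 2 * th by rewrite subr_gt0.
have trunc_le (a : R) : (Num.truncn a < n1)%N -> a <= n1%:R.
  by move=> H; apply: le_trans (ltW (truncnS_gt _)) _; rewrite ler_nat.
have n1E : E0%:R <= n1%:R * th.
  by rewrite -ler_pdivrMr//; apply: trunc_le; rewrite /n1 !leq_max leqnn.
have n1del : (decay_exp d p)%:R <= n1%:R * th * del.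
  by rewrite -ler_pdivrMr// -ler_pdivrMr//; apply: trunc_le; rewrite /n1 !leq_max leqnn orbT.
have n1T : (tau_exp p + E0)%:R <= n1%:R * (1 - 2 * th).
  by rewrite -ler_pdivrMr//; apply: trunc_le; rewrite /n1 !leq_max leqnn !orbT.
have n12 : (2 <= n1)%N by rewrite /n1 !leq_max leqnn !orbT.
have l0 : 0 < - lambda by rewrite oppr_gt0.
pose cdec := - lambda * 2 `^ (- beta) / 2.
have cdec0 : 0 < cdec by rewrite divr_gt0// mulr_gt0// powR_gt0.
have [Cdec Cdec0 HCdec] := exp_decay_bound (n1 + 1) cdec0.
(* The 9 collects the noise bounds over the two windows, the other term what is left of the position
   at the start of the first one. *)
pose A : R := 9 + 3 * 2 ^+ n1 * Cdec.
have A1 : 1 <= A by rewrite ler_wpDr ?ler1n// !mulr_ge0 ?exprn_ge0// ltW.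
have A0 : 0 <= A by exact: le_trans A1.
pose ce : R := 2 * `|- beta| * expR (2 * `|- beta|) * 2.
have ce0 : 0 <= ce by rewrite !mulr_ge0 ?expR_ge0.
apply: (@polynomial_convergence_of R d nu F gamma th pi n1 2) => //; first exact: ltnW.
move=> mu fmu; have [Mmu Mmu0 Htail] := moment_tail gamma0 fmu.
pose cG := - lambda * (A + 1) ^+ p.+1 * (gamma + 1).
pose cE := - lambda * (A + 1) ^+ p.+1 * (ce + gamma).
have lA0 : 0 <= - lambda * (A + 1) ^+ p.+1.
  by apply: mulr_ge0; [exact: ltW|rewrite exprn_ge0// addr_ge0].
have cG0 : 0 <= cG by apply: mulr_ge0 => //; rewrite addr_ge0// ltW.
have cE0 : 0 <= cE by apply: mulr_ge0 => //; rewrite addr_ge0// ltW.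
pose cD := A * 2 ^+ p.+1 / - lambda.
have cD0 : 0 <= cD.
  by apply: divr_ge0; [rewrite mulr_ge0// exprn_ge0|exact: ltW].
pose c0 := A + cG + cE + cD + 1.
have c00 : 0 <= c0 by rewrite /c0; do 4![apply: addr_ge0 => //].
pose Cd : R := d%:R.
pose C1 := Cd * (2 * c0 + fluctuation_const d s2 c0 + brownian_const d kap ell q p s2) +
     2 * Cd * (d%:R * s2) + 5 * Cd * d%:R + mm * d.+1%:R ^+ 3 + 2 * (d%:R * s2) + 2 * M.
pose C2 := `|C1| + 2 * (Mmu + 3 * (d%:R * s2)) + 1.
have C20 : 0 < C2 by rewrite ltr_wpDl// addr_ge0// mulr_ge0// addr_ge0// !mulr_ge0.
exists C2 => // disp' Omega' P' L X LL XS X0 m t f m2 /andP[tm tm2] fC.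
have m0 : (0 < m)%N by exact: ltnW.
pose u : R := m%:R; rewrite -/u in tm tm2 *.
have u2 : 2 <= u by rewrite ler_nat.
have u1 : 1 < u by rewrite ltr1n.
have u1' := ltW u1.
have u0 : 0 < u by exact: lt_trans u1.
have un k : 0 < u ^+ k by rewrite exprn_gt0.
have ug1 k : 1 <= u ^+ k by rewrite exprn_ege1.
have t1 : 1 <= t by apply: le_trans tm.
have t0 : 0 < t by apply: lt_le_trans t1.
have LN := levy_noise LL symbol_real.
have [mL L0 iL cL rL] := LN; have cen := noise_centered LN psi2.
have k0 : 0 <= d%:R * s2 by rewrite mulr_ge0.
have mX : measurable_process X by case: XS.
have tpow (a : R) k : 0 <= a -> k%:R <= n1%:R * a -> u ^+ k <= t `^ a.
  move=> a0 ka; apply: (@le_trans _ _ ((u ^+ n1) `^ a)); last by apply: powR_mono => //; exact: ltW.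
  by rewrite -(powR_mulrn n1 (ltW u0)) -powRrM -(powR_mulrn k (ltW u0)); apply: ler_powR.
pose r := t `^ th; have r0 : 0 < r by exact: powR_gt0.
have rE0 : u ^+ E0 <= r by apply: tpow => //; exact: ltW.
have r1 : 1 <= r by apply: le_trans rE0.
have rS : u ^+ small_exp p <= r by apply: le_trans rE0; rewrite ler_weXn2l// leq_addr.
have rdel : u ^+ decay_exp d p <= r `^ del.
  by rewrite -powRrM; apply: tpow; [rewrite mulr_ge0// ltW|rewrite mulrA].
have rt : r `^ (1 + gamma) = t `^ beta by rewrite -powRrM thE.
pose T := u ^+ tau_exp p; have T0 : 0 < T by exact: un.
have r2E : r ^+ 2 = t / t `^ (1 - 2 * th).
  rewrite -(powR_mulrn 2 (ltW r0)) -powRrM -[X in X / _](powRr1 (ltW t0)) -powRB; last by rewrite (gt_eqF t0) implybT.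
  by congr (_ `^ _); rewrite mulrC; ring.
have TrS : T * r ^+ 2 <= t / u ^+ E0.
  rewrite r2E mulrCA ler_wpM2l ?(ltW t0)// ler_pdivrMr ?powR_gt0// mulrC ler_pdivlMr// /T -exprD.
  by apply: tpow => //; exact: ltW.
have E02 : 4 <= u ^+ E0.
  apply: (@le_trans _ _ (u ^+ 2)); last by rewrite ler_weXn2l// leq_addl.
  by rewrite (_ : 4 = 2 ^+ 2 :> R); [rewrite ler_sqr ?nnegrE// ltW|ring].
have Tr4 : T * r ^+ 2 <= t / 4.
  by apply: le_trans TrS _; rewrite ler_wpM2l ?(ltW t0)// lef_pV2 ?posrE.
have Tr0 : 0 < T * r ^+ 2 by rewrite mulr_gt0// exprn_gt0.
(* Two windows of length [T r^2]: on [[a0, a1]] the damping brings the process down to the scale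
   [r], up to powers of [u]; on [[a1, t]] it is compared with the scheme. *)
pose a0 := t - 2 * (T * r ^+ 2); pose a1 := t - T * r ^+ 2.
have a00 : 0 <= a0 by apply: sub_twice_ge0 => //; exact: ltW.
have a01 : a0 + T * r ^+ 2 = a1 by rewrite /a0 /a1; ring.
have a01' : a0 <= a1 by rewrite -a01 lerDl ltW.
have a1t : a1 <= t by rewrite /a1 gerBl ltW.
have a10 : 0 <= a1 by exact: le_trans a01'.
have a0t : a0 <= t by exact: le_trans a1t.
pose K := (m ^ step_exp p)%N.
have K0 : (0 < K)%N by rewrite expn_gt0 m0.
have KR0 : 0 < K%:R :> R by rewrite ltr0n.
pose h := T / K%:R; have h0 : 0 < h by rewrite divr_gt0.
have KhE : K%:R * h = T by rewrite mulrC divfK// gt_eqF.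
have Kh : K%:R * h <= u ^+ tau_exp p by rewrite KhE lexx.
pose tk k : R := a1 + k%:R * (h * r ^+ 2).
have tk0 : 0 <= tk 0%N by rewrite /tk mul0r addr0.
have tkS k : tk k.+1 - tk k = h * r ^+ 2 by rewrite /tk -natr1; ring.
have tkK : tk K = t by rewrite /tk mulrA KhE /a1 subrK.
have tka k : a1 <= tk k by rewrite lerDl !mulr_ge0 ?sqr_ge0// ltW.
have tkt k : (k <= K)%N -> tk k <= t.
  by move=> kK; rewrite -tkK /tk lerD2l ler_wpM2r ?ler_nat// mulr_ge0 ?sqr_ge0// ltW.
have rngt k v : (k < K)%N -> tk k <= v <= tk k.+1 -> a1 <= v <= t.
  move=> kK /andP[v1 v2]; rewrite (le_trans (tka k) v1)/=.
  by apply: le_trans v2 _; exact: tkt.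
have [N0 [mN0 PN0 HN0]] := solution_good_set (@drift_jointly_continuous R d beta gamma lambda) XS.
have sqt0 : 0 < Num.sqrt t by rewrite sqrtr_gt0.
have [G1 [mG1 PG1 HG1]] := Htail _ _ _ _ (mX 0 (lexx 0)) X0 _ sqt0.
have ut0 : 0 < u * Num.sqrt t by rewrite mulr_gt0.
have [G2 [mG2 PG2 HG2]] := maximal mL iL k0 cen rL (lexx 0) (ltW t0) ut0.
pose Mr := u ^+ rho_exp p * r; have Mr0 : 0 < Mr by rewrite mulr_gt0.
have [G3 [mG3 PG3 HG3]] := maximal mL iL k0 cen rL a00 a0t Mr0.
pose G := ~` N0 `&` (G1 `&` (G2 `&` G3)).
have mG : measurable G by apply: measurableI; [exact: measurableC|do 2!apply: measurableI => //].
have PG : fine (P' (~` G)) <= (Mmu + 3 * (d%:R * s2)) / u.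
  have key := @prob_setCI R disp' Omega' P'.
  have P2 := prob_maximal mG2 k0 t0 u1' PG2.
  have P3 : fine (P' (~` G3)) <= 2 * (d%:R * s2) / u.
    rewrite -lee_fin fineK ?fin_num_prob//; last exact: measurableC.
    apply: le_trans PG3 _; rewrite lee_fin.
    have -> : t - a0 = 2 * (T * r ^+ 2) by rewrite /a0 opprB addrC subrK.
    rewrite [leLHS](_ : _ = 2 * (d%:R * s2) * (T / (u ^+ rho_exp p) ^+ 2)); last first.
      by rewrite /Mr; have := un (rho_exp p); move=> x0; field; rewrite !gt_eqF.
    rewrite ler_wpM2l ?mulr_ge0// ler_pdivrMr ?exprn_gt0// mulrC ler_pdivlMr// /T -exprSr -exprM.
    by rewrite ler_weXn2l.
  have P1 : fine (P' (~` G1)) <= Mmu / u.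
    apply: le_trans PG1 _; rewrite ler_wpM2l// lef_pV2 ?posrE ?powR_gt0//.
    have -> : Num.sqrt t `^ gamma = t `^ (2^-1 * gamma) by rewrite powRrM powR12_sqrt// ltW.
    have g2 : 0 <= 2^-1 * gamma by rewrite mulr_ge0// ltW.
    have n12' : 2 <= n1%:R :> R by rewrite ler_nat.
    apply: (tpow _ 1%N g2).
    apply: (@le_trans _ _ (2 * (2^-1 * gamma))); first by rewrite mulrA divff// mul1r ltW.
    by rewrite ler_wpM2r.
  apply: le_trans (key _ _ (measurableC mN0) _) _; first by do 2!apply: measurableI => //.
  rewrite setCK PN0 add0r.
  apply: le_trans (key _ _ mG1 _) _; first exact: measurableI.
  apply: le_trans (lerD P1 (key _ _ mG2 mG3)) _.
  apply: le_trans (lerD (lexx _) (lerD P2 P3)) _.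
  by apply: le_of_eq; ring.
have X0s w : G w -> enorm (X 0 w) <= Num.sqrt t by move=> [_ [/HG1]].
have Xa0 w : G w -> enorm (X a0 w) <= 3 * (u * Num.sqrt t).
  move=> Gw; have [Nw [g1 [g2 g3]]] := Gw; have [cXw dXw] := HN0 w Nw.
  have b3 : Num.sqrt t <= u * Num.sqrt t by rewrite ler_peMl// ltW.
  have H := subcritical_stable lambda0 cXw dXw (lexx 0) a00 (ltW ut0) (M := u * Num.sqrt t).
  apply: le_trans (H _) _.
    by move=> v /andP[v0 va]; apply: HG2 => //; rewrite v0 (le_trans va).
  have b4 : Num.sqrt t <= 2 * (u * Num.sqrt t) by apply: le_trans b3 _; rewrite ler_peMl ?(ltW ut0)// ler1n.
  rewrite (elimT max_idPl); last by apply: le_trans (X0s w Gw) _.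
  by rewrite [3](natrD _ 2 1) [leRHS]mulrDl mul1r.
(* At [a0] only a bound polynomial in [u] is available, through [t <= (2 u)^n1]; the exponential in
   [T], a power of [u], absorbs it. *)
have decay : expR (- (cdec * T)) * (3 * (u * Num.sqrt t)) <= 3 * 2 ^+ n1 * Cdec.
  have sqt : Num.sqrt t <= (2 * u) ^+ n1.
    apply: le_trans tm2; rewrite -[leRHS](sqr_sqrtr (ltW t0)) expr2 ler_peMr ?sqrtr_ge0//.
    by rewrite -[leLHS]sqrtr1 ler_wsqrtr.
  have Tu : u * u ^+ n1 <= T ^+ (n1 + 1).
    by rewrite -exprS addn1 /T lerXn2r ?nnegrE ?(ltW u0) ?(ltW T0)// -[leLHS]expr1 ler_weXn2l// /tau_exp addnC.
  have := HCdec T (ltW T0); set ex := expR _ => HC.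
  have ex0 : 0 <= ex by exact: expR_ge0.
  apply: (@le_trans _ _ (ex * (3 * (u * (2 * u) ^+ n1)))).
    by rewrite ler_wpM2l// ler_wpM2l// ler_wpM2l// ltW.
  rewrite exprMn (_ : ex * _ = 3 * 2 ^+ n1 * (u * u ^+ n1 * ex)); last by ring.
  rewrite ler_wpM2l ?mulr_ge0 ?exprn_ge0//; apply: le_trans HC.
  by rewrite ler_wpM2r.
have Mr1 : 1 <= Mr by rewrite -[leLHS]mulr1 ler_pM.
have rMr : r <= Mr by rewrite ler_peMl// ltW.
have DC0 : 0 <= 3 * 2 ^+ n1 * Cdec by rewrite !mulr_ge0 ?exprn_ge0// ltW.
have Xa1 w : G w -> enorm (X a1 w) <= (3 + 3 * 2 ^+ n1 * Cdec) * Mr.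
  move=> Gw; have [Nw [g1 [g2 g3]]] := Gw; have [cXw dXw] := HN0 w Nw.
  have H := subcritical_decay beta0 gamma1 lambda0 cXw dXw r1 rt t1 a00 (ltW T0) (M := Mr).
  rewrite a01 in H; apply: le_trans (H _ _ _) _ => //.
    by move=> v /andP[av va]; apply: HG3 => //; rewrite av (le_trans va).
  have : Num.max (2 * Mr) (expR (- (cdec * T)) * enorm (X a0 w)) <= (2 + 3 * 2 ^+ n1 * Cdec) * Mr.
    rewrite ge_max; apply/andP; split; rewrite [leRHS]mulrDl.
      by rewrite lerDl mulr_ge0// ltW.
    apply: (@le_trans _ _ (3 * 2 ^+ n1 * Cdec)).
      by apply: le_trans decay; rewrite ler_wpM2l ?expR_ge0// Xa0.
    apply: ler_wpDl; first by rewrite mulr_ge0// ltW.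
    by rewrite ler_peMr.
  rewrite -/cdec => H2; apply: le_trans (lerD H2 (lexx _)) _.
  by apply: le_of_eq; ring.
have GX w v : G w -> a1 <= v <= t -> enorm (X v w) <= A * Mr.
  move=> Gw /andP[av vt]; have [Nw [g1 [g2 g3]]] := Gw; have [cXw dXw] := HN0 w Nw.
  have M20 : 0 <= 2 * Mr by rewrite mulr_ge0// ltW.
  have H := subcritical_stable lambda0 cXw dXw a10 av M20.
  apply: le_trans (H _) _.
    move=> s /andP[as_ sv]; apply: le_trans (enorm_triangle (L a0 w) _ _) _.
    rewrite mulr_natl mulr2n; apply: lerD; last rewrite enormBC.
      by apply: HG3 => //; rewrite (le_trans a01' as_) (le_trans sv).
    by apply: HG3 => //; rewrite a01' a1t.
  have : Num.max (2 * (2 * Mr)) (enorm (X a1 w)) <= (7 + 3 * 2 ^+ n1 * Cdec) * Mr.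
    rewrite ge_max; apply/andP; split.
      by rewrite mulrA ler_wpM2r ?(ltW Mr0)// ler_wpDr// -natrM ler_nat.
    by apply: le_trans (Xa1 w Gw) _; rewrite ler_wpM2r ?(ltW Mr0)// lerD2r ler_nat.
  move=> H2; apply: le_trans (lerD H2 (lexx _)) _.
  by apply: le_of_eq; rewrite /A; ring.
pose Lam := A * u ^+ rho_exp p.
have Lam0 : 0 <= Lam by rewrite mulr_ge0// ltW.
have GXL w v : G w -> a1 <= v <= t -> enorm (X v w) <= Lam * r.
  by move=> Gw va; rewrite /Lam -mulrA; exact: GX.
have gp : gamma - 1 <= p%:R by rewrite -qE.
have Ap : 0 <= A + 1 by rewrite addr_ge0.
have LamU : Lam + 1 <= (A + 1) * u ^+ rho_exp p by rewrite mulrDl mul1r lerD2l.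
have [e1 [Gam [e10 Gam0 e1U GamU HBB]]] :=
  @power_drift_bounds R d beta gamma lambda p gamma1 lambda0 gp Lam (A + 1) ce u u1' Lam0 ce0 Ap LamU.
(* Frozen time factor: [(1 + v) / t] differs from 1 by at most [u^(- E0)] on the last window. *)
have om v : a1 <= v <= t -> `|r `^ (1 + gamma) * (1 + v) `^ (- beta) - 1| <= ce / u ^+ small_exp p.
  move=> /andP[v1 v2]; have v0 : 0 <= v by apply: le_trans v1.
  pose y := (1 + v) / t.
  have y0 : 0 <= y by rewrite divr_ge0// ?addr_ge0// ltW.
  have -> : r `^ (1 + gamma) * (1 + v) `^ (- beta) = y `^ (- beta).
    rewrite rt (_ : 1 + v = y * t); last by rewrite divfK// gt_eqF.
    rewrite powRM// ?(ltW t0)// mulrCA [t `^ (- beta)]powRN mulfV ?mulr1// gt_eqF// powR_gt0//.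
  have yE : `|y - 1| <= (u ^+ E0)^-1.
    have -> : y - 1 = (1 + v - t) / t by rewrite mulrBl divff// gt_eqF.
    rewrite normrM normfV (gtr0_norm t0) ler_pdivrMr// mulrC.
    have tE : 1 <= t / u ^+ E0.
      rewrite ler_pdivlMr// mul1r; apply: le_trans rE0 _.
      rewrite -[leRHS](powRr1 (ltW t0)); exact: ler_powR.
    have va : t - T * r ^+ 2 <= v by [].
    rewrite ler_norml; apply/andP; split.
      by rewrite lerNl opprB; apply: le_trans TrS; rewrite lerBlDr (le_trans (_ : _ <= T * r ^+ 2 + v)) ?lerD2l ?lerDr// addrC -lerBlDr.
    by apply: le_trans tE; rewrite -addrA gerDl subr_le0.
  have y4 : (u ^+ E0)^-1 <= 4^-1 by rewrite lef_pV2 ?posrE.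
  have y23 : 2^-1 <= y <= 3.
    exact: near_one_bounds (le_trans yE y4).
  apply: le_trans (powR_near1 _ y23) _; rewrite /ce.
  have k1 : 0 <= 2 * `|- beta| * expR (2 * `|- beta|) by rewrite !mulr_ge0 ?expR_ge0.
  apply: (@le_trans _ _ (2 * `|- beta| * expR (2 * `|- beta|) * (2 / u ^+ small_exp p))); last by rewrite mulrA.
  rewrite ler_wpM2l//; apply: le_trans yE _.
  apply: (@le_trans _ _ (u ^+ small_exp p)^-1).
    by rewrite lef_pV2 ?posrE// ler_weXn2l// leq_addr.
  by rewrite ler_peMl ?ler1n// invr_ge0 ltW.
have [Ac0 cGc0 cEc0 cDc0] := sum5_bounds A0 cG0 cE0 cD0; rewrite -/c0 in Ac0 cGc0 cEc0 cDc0.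
have c01 : 1 <= c0 by apply: le_trans Ac0.
have rg : (rho_exp p <= gam_exp p)%N by rewrite /gam_exp mulnS leq_addr.
have AU : Lam <= c0 * u ^+ gam_exp p.
  by rewrite /Lam ler_pM// ?(ltW (un _))// ler_weXn2l.
have GamU1 : Gam <= c0 * u ^+ gam_exp p.
  apply: (@le_trans _ _ (cG * u ^+ gam_exp p)); last by rewrite ler_wpM2r// ltW.
  by apply: le_trans GamU; rewrite ler_peMr// lerDl.
have GamU2 : Gam * Lam <= c0 * u ^+ gam_exp p.
  apply: (@le_trans _ _ (cG * u ^+ gam_exp p)); last by rewrite ler_wpM2r// ltW.
  by apply: le_trans GamU; rewrite ler_wpM2l// lerDr.
have HD0 (zz : nat -> V) (x : V) : enorm x <= Lam ->
    enorm (euler kap ell q (fun=> h) zz x K - euler kap ell q (fun=> h) zz 0 K) <= c0 / u.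
  move=> xL.
  have uV0 : 0 <= u^-1 by rewrite invr_ge0 ltW.
  have := @euler_contract_max R d kap ell q kap0 ell0 q0 (fun=> h) zz x 0 K u^-1 (fun=> ltW h0) uV0.
  rewrite subr0; set D := enorm _; have D0 : 0 <= D by exact: enorm_ge0.
  case=> [H|]; first by apply: le_trans H _; rewrite ler_peMl.
  rewrite sumr_const card_ord -[h *+ K]mulr_natl KhE kapE add0r ellE => H.
  apply: (@le_trans _ _ (cD / u)); last by rewrite ler_wpM2r.
  pose S := (2 * u) ^+ p; have S0 : 0 < S by rewrite exprn_gt0// mulr_gt0.
  have HS : S^-1 <= (2^-1 * u^-1) `^ q.
    have u20 : 0 < 2 * u by rewrite mulr_gt0.
    rewrite -invfM (_ : (2 * u)^-1 `^ q = ((2 * u) `^ q)^-1); last first.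
      by rewrite -(powR_inv1 (ltW u20)) -powRrM mulN1r powRN.
    rewrite lef_pV2 ?posrE ?powR_gt0// /S -(powR_mulrn _ (ltW u20)); apply: ler_powR => //.
    by rewrite (le_trans u1')// ler_peMl ?(ltW u0)// ler1n.
  have {}H : D * (T * (- lambda * (2^-1 * S^-1))) <= Lam.
    apply: le_trans xL; apply: le_trans H; rewrite ler_wpM2l//.
    apply: (@le_trans _ _ (T * (- lambda * (2^-1 * (2^-1 * u^-1) `^ q)))); last by rewrite lerDr.
    by rewrite ler_wpM2l ?(ltW T0)// ler_wpM2l ?(ltW l0)// ler_wpM2l.
  have TE : T = u ^+ rho_exp p * u ^+ p * u.
    by rewrite /T -exprD -exprSr tau_sum.
  move: H; rewrite -ler_pdivlMr; last by rewrite !mulr_gt0// ?invr_gt0.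
  move=> H; apply: le_trans H _; apply: le_of_eq.
  rewrite /cD /Lam TE /S exprMn exprS; by apply: contraction_rate_identity; rewrite ?exprn_gt0.
have HDu (zz : nat -> V) (x : V) : enorm x <= u ->
    enorm (euler kap ell q (fun=> h) zz x K - euler kap ell q (fun=> h) zz 0 K) <= c0 / u.
  move=> xu; apply: HD0; apply: le_trans xu _; rewrite /Lam -[leLHS]mul1r ler_pM// ?(ltW u0)//.
  by rewrite -[leLHS]expr1 ler_weXn2l// /rho_exp addn4.
have b2E (y : V) : bbar kap ell q y = bbar 0 (- lambda) (gamma - 1) y - 0 *: y.
  by rewrite scale0r subr0 kapE ellE qE.
have kap1 : (0 : R) <= (0 : R) <= 1 by rewrite lexx ler01.
have rk0 (k : nat) : 0 < (fun=> r) k by [].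
have rSS (k : nat) : `|(fun=> r) k.+1 / (fun=> r) k - 1 - 0 * h| <= h ^+ 2.
  by rewrite divff ?gt_eqF// subrr mul0r subr0 normr0 sqr_ge0.
have rdel' k : (k < K)%N -> u ^+ decay_exp d p <= ((fun=> r) k) `^ del by [].
have := @process_invariant R d kap ell q p kap0 ell0 q0 qp disp Omega P s2 W s20 nW cW m h c0 m0 h0 Kh c00 HDu
  pi M M0 pi_moment pi_invariant disp' Omega' P' psi L del mm LN psi0 psi2 del0 del1 mm0 psi_est tk (fun=> r) tk0 rk0 tkS rdel'
  X F (bbar 0 (- lambda) (gamma - 1)) 0 Lam Gam e1 Lam ((Mmu + 3 * (d%:R * s2)) / u) G
  mX Lam0 Gam0 e10 kap1 rSS b2E mG PG.
move=> PI.
have {}PI := PI _ _ _ _ _ HD0 AU GamU1 GamU2 _ Cd f (ler0n _ _) fC.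
rewrite tkK -powRN -/th in PI.
apply: le_trans (PI _ _ _ _ _ _) _.
- by move=> w [Nw _]; have [] := HN0 w Nw.
- by move=> w k v Gw kK vk; apply: GXL => //; exact: rngt vk.
- by move=> w k Gw kK; apply: GXL => //; rewrite tka tkt.
- by move=> w Gw; apply: GXL => //; rewrite tka tkt.
- move=> k v y y' kK vk yL y'L; apply: HBB => //.
  by apply: om; exact: rngt vk.
- exact: le_trans e1U cEc0.
rewrite -/C1 mulrA -mulrDl ler_wpM2r ?invr_ge0 ?(ltW u0)//.
by rewrite /C2 -[leRHS]addrA; apply: lerD (ler_norm _) _; rewrite lerDl.
Qed.

End limits.

(** * A priori growth of solutions *)

Section apriori.
Variables (R : realType) (d : nat) (beta gamma lambda : R).
Local Notation V := 'rV[R]_d.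
Local Notation F := (@drift R d beta gamma lambda).

Lemma apriori_bound_dissipative : lambda < 0 -> apriori_bound d beta gamma lambda 3.
Proof.
move=> l0 x z t M cx dx t0 M0 zM.
have := subcritical_stable l0 cx dx (lexx 0) t0 M0 zM.
have := sqrtr_ge0 (1 + t); have := enorm_ge0 (x 0).
move: (enorm (x 0)) (enorm (x t)) (Num.sqrt _) => a b e a0 e0.
by case: (leP (2 * M) a) => H; lra.
Qed.

(** Two convexity bounds, [ln (1 + y) >= y / 2] and [1 - 1 / (1 + w) >= w / 2], each lose a factor
    2. *)
Lemma powR_decrease (eta y : R) : 0 < eta -> 0 <= y -> y <= 1 -> eta * y <= 1 ->
  eta * y / 4 <= 1 - (1 + y) `^ (- eta).
Proof.
move=> eta0 y0 y1 ey; have y10 : 0 < 1 + y by rewrite ltr_pwDl.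
pose w := eta * y / 2; have w0 : 0 <= w by rewrite divr_ge0// mulr_ge0// ltW.
have w1 : w <= 1 by rewrite /w; move: ey w0; rewrite /w; lra.
have lny : y / 2 <= ln (1 + y).
  have yV : 0 < (1 + y)^-1 by rewrite invr_gt0.
  have := ln_le_sub1 yV; rewrite lnV ?posrE// => H.
  have : y / 2 <= 1 - (1 + y)^-1.
    have -> : 1 - (1 + y)^-1 = y / (1 + y) by field; rewrite gt_eqF.
    by rewrite ler_wpM2l// lef_pV2 ?posrE// ; lra.
  lra.
have Ew : (1 + y) `^ (- eta) <= expR (- w).
  by rewrite /powR gt_eqF// ler_expR mulNr lerN2 /w -mulrA ler_wpM2l// ltW.
have : expR (- w) <= (1 + w)^-1.
  by rewrite expRN lef_pV2 ?posrE ?expR_gt0 ?ltr_pwDl// expR_ge1Dx.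
have : w / 2 <= 1 - (1 + w)^-1.
  have -> : 1 - (1 + w)^-1 = w / (1 + w) by field; rewrite gt_eqF// ltr_pwDl.
  by rewrite ler_wpM2l// lef_pV2 ?posrE ?ltr_pwDl//; lra.
have -> : eta * y / 4 = w / 2 by rewrite /w; field.
lra.
Qed.

(** For [gamma <= 1] the drift is linearised above the diffusive scale:
    [Y^gamma <= (1 + r)^((gamma - 1) / 2) Y] once [Y >= sqrt (1 + r)]. The resulting growth rate is
    integrable in time when [beta > (1 + gamma) / 2]. *)
Lemma drift_sublinear (r Y : R) (x : V) : 0 < lambda -> gamma <= 1 -> 0 < gamma -> 0 <= r ->
  Num.sqrt (1 + r) <= Y -> enorm x <= Y ->
  enorm (F r x) <= lambda * (1 + r) `^ (- 1 - (beta - (1 + gamma) / 2)) * Y.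
Proof.
move=> l0 g1 g0 r0 rY xY.
have r10 : 0 < 1 + r by rewrite ltr_pwDl.
have Y0 : 0 < Y by apply: lt_le_trans rY; rewrite sqrtr_gt0.
rewrite /drift enormZ !normrM !(ger0_norm (powR_ge0 _ _)) (gtr0_norm l0).
have -> : - 1 - (beta - (1 + gamma) / 2) = - beta + (gamma - 1) / 2 by field.
rewrite powRD; last by rewrite (gt_eqF r10) implybT.
have key : (1 + enorm x ^+ 2) `^ (2^-1 * (gamma - 1)) * enorm x <= (1 + r) `^ ((gamma - 1) / 2) * Y.
  have [->|x0] := eqVneq (enorm x) 0; first by rewrite mulr0 mulr_ge0 ?powR_ge0// ltW.
  have {}x0 : 0 < enorm x by rewrite lt_neqAle eq_sym x0 enorm_ge0.
  have e1 : (1 + enorm x ^+ 2) `^ (2^-1 * (gamma - 1)) <= enorm x `^ (gamma - 1).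
    rewrite (_ : enorm x `^ (gamma - 1) = (enorm x ^+ 2) `^ (2^-1 * (gamma - 1))); last first.
      by rewrite -(powR_mulrn 2 (ltW x0)) -powRrM mulrA divff// mul1r.
    rewrite -[2^-1 * _]opprK !(powRN _ (- _)) lef_pV2 ?posrE ?powR_gt0 ?ltr_pwDl ?sqr_ge0 ?exprn_gt0//.
    by apply: powR_mono; rewrite ?sqr_ge0// ?lerDr//; lra.
  have e2 : Y `^ (gamma - 1) <= (1 + r) `^ ((gamma - 1) / 2).
    rewrite [_ / 2]mulrC powRrM (powR12_sqrt (ltW r10)).
    rewrite -[gamma - 1]opprK !(powRN _ (- _)) lef_pV2 ?posrE ?powR_gt0 ?sqrtr_gt0//.
    by apply: powR_mono; rewrite ?sqrtr_ge0//; lra.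
  have xg (y : R) : 0 < y -> y `^ (gamma - 1) * y = y `^ gamma.
    move=> y0; rewrite -{2}(powRr1 (ltW y0)) -powRD ?subrK//.
    by rewrite (gt_eqF y0) implybT.
  apply: (@le_trans _ _ (enorm x `^ (gamma - 1) * enorm x)); first by rewrite ler_wpM2r// ltW.
  rewrite xg//; apply: (@le_trans _ _ (Y `^ gamma)); first by apply: powR_mono => //; exact: ltW.
  by rewrite -xg// ler_wpM2r// ltW.
rewrite [leLHS](_ : _ = lambda * (1 + r) `^ (- beta) *
  ((1 + enorm x ^+ 2) `^ (2^-1 * (gamma - 1)) * enorm x)); last by ring.
rewrite [leRHS](_ : _ = lambda * (1 + r) `^ (- beta) * ((1 + r) `^ ((gamma - 1) / 2) * Y)); last by ring.
by rewrite ler_wpM2l// mulr_ge0 ?powR_ge0// ltW.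
Qed.

(** The integrable rate [kp] has the integrating factor [exp (K (1 + r)^(- eta))], which stays
    between 1 and [exp K]; hence a growth factor independent of time. *)
Lemma apriori_bound_sublinear : 0 < lambda -> 0 < gamma -> gamma <= 1 -> (1 + gamma) / 2 < beta ->
  exists2 A : R, 1 <= A & apriori_bound d beta gamma lambda A.
Proof.
move=> l0 g0 g1 bg; pose eta := beta - (1 + gamma) / 2; have eta0 : 0 < eta by rewrite subr_gt0.
(* The 4 compensates the constant lost in [powR_decrease]. *)
pose K := 4 * lambda / eta; have K0 : 0 < K by rewrite divr_gt0// mulr_gt0.
pose E (r : R) := expR (K * (1 + r) `^ (- eta)).
exists (expR K) => [|x z t M cx dx t0 M0 zM]; first by rewrite -expR0 ler_expR ltW.
pose kp (r : R) := lambda * (1 + r) `^ (- 1 - eta).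
have pow1 (r : R) : 0 <= r -> (1 + r) `^ (- eta) <= 1.
  move=> r0; rewrite powRN invf_le1 ?powR_gt0 ?ltr_pwDl//.
  rewrite [leLHS](_ : _ = 1 `^ eta); last by rewrite powR1.
  by apply: powR_mono; rewrite ?lerDl// ltW.
have E1 (r : R) : 0 <= r -> 1 <= E r <= expR K.
  move=> r0; rewrite -expR0 !ler_expR mulr_ge0 ?powR_ge0 ?(ltW K0)//=.
  by rewrite ler_piMr ?pow1// ltW.
have bc := @drift_jointly_continuous R d beta gamma lambda.
have sq0 := sqrtr_ge0 (1 + t).
have H := @drift_growth R d F x z bc cx dx (z 0) 0 t M (Num.sqrt (1 + t)) (expR K) kp E (lexx 0) t0 sq0 M0.
have {}H : (enorm (x t - (z t - z 0)) + M) * E t <=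
   Num.max (Num.sqrt (1 + t) * expR K) ((enorm (x 0 - (z 0 - z 0)) + M) * E 0).
  apply: H.
  - move=> r e /andP[r0 rt] e0.
    have r10 : 0 < 1 + r by rewrite ltr_pwDl.
    have /cvgrPdist_lt/(_ _ e0) := @continuous_expR R (K * (1 + r) `^ (- eta)).
    move=> /nbhs_ballP[e1 /= e10 He1].
    have eK : 0 < e1 / K by rewrite divr_gt0.
    have [del del0 Hdel] := powR_continuous_at (- eta) r10 eK.
    exists del => // r' _ rr'; rewrite distrC; apply: He1; rewrite /ball/= distrC -mulrBr normrM.
    rewrite (gtr0_norm K0) mulrC -ltr_pdivlMr//; apply: Hdel.
    by rewrite (_ : 1 + r' - (1 + r) = r' - r)//; ring.
  - by move=> r /andP[r0 _]; have /andP[H1 ->] := E1 r r0; rewrite (lt_le_trans ltr01 H1).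
  - move=> r /andP[r0 rt]; have r10 : 0 < 1 + r by rewrite ltr_pwDl.
    exists (Num.min 1 eta^-1); first by rewrite lt_min ltr01 invr_gt0.
    move=> r' /andP[rr' r'd] _.
    pose y := (r' - r) / (1 + r).
    have y0 : 0 <= y by rewrite divr_ge0 ?subr_ge0// ltW.
    have yr : y <= r' - r.
      by rewrite ler_pdivrMr// ler_peMr ?lerDl// subr_ge0 ltW.
    have : r' - r < Num.min 1 eta^-1 by rewrite ltrBlDl.
    rewrite lt_min => /andP[d1 d2].
    have y1 : y <= 1 by apply: le_trans yr (ltW d1).
    have y2 : eta * y <= 1.
      by rewrite mulrC -ler_pdivlMr// mul1r (le_trans yr)// ltW.
    have P := powR_decrease eta0 y0 y1 y2.
    have r'E : 1 + r' = (1 + y) * (1 + r) by rewrite /y; field; rewrite gt_eqF.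
    rewrite /E r'E powRM ?(ltW r10) ?addr_ge0//.
    set q := (1 + r) `^ (- eta); have q0 : 0 <= q by exact: powR_ge0.
    have kE : (r' - r) * kp r = lambda * y * q.
      rewrite /kp powRD; last by rewrite (gt_eqF r10) implybT.
      by rewrite -/q powRN powRr1 ?(ltW r10)// /y; field; rewrite gt_eqF.
    rewrite kE; apply: (@le_trans _ _ (expR (lambda * y * q) * expR (K * ((1 + y) `^ (- eta) * q)))).
      by rewrite ler_wpM2r ?expR_ge0// expR_ge1Dx.
    rewrite -expRD ler_expR.
    have -> : lambda * y * q = K * (eta * y / 4) * q by rewrite /K; field; rewrite gt_eqF.
    rewrite [K * (_ * q)]mulrA -mulrDl ler_wpM2r// -[leRHS]mulr1 -mulrDr ler_wpM2l ?(ltW K0)//.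
    by rewrite -lerBrDr.
  - move=> r /andP[r0 rt] rY; exists 1 => // h /andP[h0 _].
    have tr : 0 <= r <= t by rewrite r0 ltW.
    have xr : enorm (x r) <= enorm (x r - (z r - z 0)) + M.
      by have := ler_enorm_sub (x r) (z r - z 0); have := zM _ tr; lra.
    have sr : Num.sqrt (1 + r) <= enorm (x r - (z r - z 0)) + M.
      by apply: le_trans rY; rewrite ler_wsqrtr// lerD2l ltW.
    have := drift_sublinear l0 g1 g0 r0 sr xr; rewrite -/eta -/(kp r) => Fr.
    apply: le_trans (lerD (ler_enormD _ _) (lexx _)) _.
    rewrite enormZ (gtr0_norm h0) addrAC mulrDl mul1r lerD2l -mulrA ler_wpM2l//.
    exact: ltW.
have tt : 0 <= t <= t by rewrite t0 lexx.
have xt := ler_enorm_sub (x t) (z t - z 0).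
have /andP[Et1 _] := E1 t t0; have /andP[_ E0K] := E1 0 (lexx 0).
rewrite subrr subr0 in H.
have H1 : enorm (x t - (z t - z 0)) + M <= (enorm (x t - (z t - z 0)) + M) * E t.
  by rewrite ler_peMr// addr_ge0// enorm_ge0.
have H2 : Num.max (Num.sqrt (1 + t) * expR K) ((enorm (x 0) + M) * E 0) <=
   expR K * (Num.sqrt (1 + t) + enorm (x 0) + M).
  rewrite ge_max; apply/andP; split.
    by rewrite mulrC ler_wpM2l ?expR_ge0// -addrA lerDl addr_ge0// enorm_ge0.
  apply: (@le_trans _ _ ((enorm (x 0) + M) * expR K)).
    by rewrite ler_wpM2l// addr_ge0// enorm_ge0.
  by rewrite mulrC ler_wpM2l ?expR_ge0// -addrA lerDr.
have := zM _ tt; lra.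
Qed.

End apriori.

(** * Drift asymptotics in cases (a) and (b) *)

Section critical_drift.
Variables (R : realType) (d : nat) (beta gamma lambda A : R) (p : nat).
Local Notation V := 'rV[R]_d.
Local Notation F := (@drift R d beta gamma lambda).
Hypotheses (beta0 : 0 < beta) (gamma0 : 0 < gamma) (A1 : 1 <= A).

(** The rescaled drift is of order [Lam^gamma r^(- eta)] with [r >= u^N]; [N] is chosen so that
    [u^(N eta)] beats [u^(tau_exp + 1)] together with the growth [u^(3 gamma)] of [Lam^gamma]. *)
Lemma critical_drift_vanishing : (1 + gamma) / 2 < beta ->
  exists cb : R, exists2 N : nat, 0 <= cb & drift_asymptotics d beta gamma lambda 0 1 A cb p N.
Proof.
move=> bg; have A0 : 0 <= A by exact: le_trans A1.
pose eta := 2 * beta - (1 + gamma); have eta0 : 0 < eta by rewrite /eta; move: bg; lra.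
pose b := (tau_exp p).+1%:R + 3 * gamma.
pose N := (Num.truncn (b / eta)).+1.
have Nb : b <= N%:R * eta by rewrite -ler_pdivrMr// ltW// truncnS_gt.
pose cb := `|lambda| * (5 * A) `^ gamma.
have cb0 : 0 <= cb by rewrite mulr_ge0// powR_ge0.
exists cb, N => // m h m0 h0 h1 _.
pose u : R := m%:R; rewrite -/u.
have u1 : 1 <= u by rewrite ler1n.
have u0 : 0 < u by apply: lt_le_trans u1.
have un k : 0 < u ^+ k by rewrite exprn_gt0.
have L0 : 0 <= 4 * A * u ^+ 3 by rewrite !mulr_ge0// ltW.
have L1 : 1 + 4 * A * u ^+ 3 <= 5 * A * u ^+ 3.
  have : 1 <= A * u ^+ 3 by rewrite -[leLHS]mulr1 ler_pM// exprn_ege1.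
  rewrite -!mulrA; lra.
exists (`|lambda| * (1 + 4 * A * u ^+ 3) `^ gamma * (u ^+ N) `^ (- eta)), 0; split => //.
- by rewrite !mulr_ge0 ?powR_ge0.
- have H1 : (1 + 4 * A * u ^+ 3) `^ gamma <= (5 * A) `^ gamma * u `^ (3 * gamma).
    rewrite powRrM (powR_mulrn 3 (ltW u0)) -powRM ?mulr_ge0// ?(ltW (un _))//.
    by apply: powR_mono => //; [exact: ltW|exact: addr_ge0].
  have H2 : u ^+ (tau_exp p).+1 * (u `^ (3 * gamma) * (u ^+ N) `^ (- eta)) <= 1.
    rewrite -(powR_mulrn N (ltW u0)) -powRrM -(powR_mulrn _ (ltW u0)).
    rewrite -!powRD ?(gt_eqF u0) ?implybT// -[leRHS](powRr0 u); apply: ler_powR => //.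
    by move: Nb; rewrite /b; lra.
  apply: (@le_trans _ _ (u ^+ (tau_exp p).+1 * (`|lambda| * ((5 * A) `^ gamma * u `^ (3 * gamma)) * (u ^+ N) `^ (- eta)))).
    by rewrite ler_wpM2l ?(ltW (un _))// ler_wpM2r ?powR_ge0// ler_wpM2l.
  rewrite [leLHS](_ : _ = cb * (u ^+ (tau_exp p).+1 * (u `^ (3 * gamma) * (u ^+ N) `^ (- eta)))); last by rewrite /cb; ring.
  by rewrite -[leRHS]mulr1 ler_wpM2l.
- by rewrite mul0r mulr_ge0// ltW.
- move=> r v y y' ur /andP[rv _] yL _.
  have r1 : 1 <= r by apply: le_trans ur; rewrite exprn_ege1.
  have -> : bbar 0 0 1 y' = 0 :> V by rewrite /bbar mul0r addr0 oppr0 scale0r.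
  rewrite subr0 mul0r addr0.
  apply: le_trans (drift_small lambda (ltW beta0) gamma0 r1 rv yL) _.
  have -> : 1 + gamma - 2 * beta = - eta by rewrite /eta opprB.
  rewrite ler_wpM2l ?mulr_ge0 ?powR_ge0// !(powRN _ eta) lef_pV2 ?posrE ?powR_gt0//.
    by apply: powR_mono => //; exact: ltW.
  exact: lt_le_trans r1.
Qed.

(** At criticality the time factor is [x^(- beta)] with [x = (1 + v) / r^2], and
    [x - 1 <= h + r^-2]. Both terms are below [u^(- small_exp)]: the first by the fineness of the
    mesh, the second because [r >= u^small_exp]. *)
Lemma critical_drift_power : beta = (1 + gamma) / 2 -> lambda < 0 -> 1 < gamma -> gamma - 1 <= p%:R ->
  exists cb : R, exists2 N : nat, 0 <= cb &
    drift_asymptotics d beta gamma lambda (- lambda) (gamma - 1) A cb p N.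
Proof.
move=> bE l0 g1 gp; have A0 : 0 <= A by exact: le_trans A1.
have exps : (small_exp p + tau_exp p <= step_exp p)%N.
  by rewrite /small_exp /step_exp; clear; lia.
have rho3 : (3 <= rho_exp p)%N by rewrite /rho_exp addnC.
pose k := 2 * `|- beta| * expR (2 * `|- beta|); have k0 : 0 <= k by rewrite !mulr_ge0 ?expR_ge0.
pose ce := k * 2; have ce0 : 0 <= ce by rewrite mulr_ge0.
pose c := 4 * A + 1; have c0 : 0 <= c by rewrite addr_ge0// mulr_ge0.
pose l := - lambda * c ^+ p.+1.
have lc0 : 0 <= l by rewrite mulr_ge0 ?exprn_ge0// oppr_ge0 ltW.
pose cE := l * (ce + gamma); pose cG := l * (gamma + 1).
have cE0 : 0 <= cE by rewrite mulr_ge0// addr_ge0// ltW.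
have cG0 : 0 <= cG by rewrite mulr_ge0// addr_ge0// ltW.
exists (cE + cG), (small_exp p); first exact: addr_ge0.
move=> m h m0 h0 h1 hs; pose u : R := m%:R; rewrite -/u in hs *.
have u1 : 1 <= u by rewrite ler1n.
have u0 : 0 < u by apply: lt_le_trans u1.
have un i : 0 < u ^+ i by rewrite exprn_gt0.
have L0 : 0 <= 4 * A * u ^+ 3 by rewrite !mulr_ge0// ltW.
have LU : 4 * A * u ^+ 3 + 1 <= c * u ^+ rho_exp p.
  rewrite [leRHS]mulrDl mul1r lerD ?exprn_ege1// ler_wpM2l ?mulr_ge0//.
  by rewrite ler_weXn2l.
have [e1 [Gam [e10 Gam0 e1U GamU HBB]]] :=
  @power_drift_bounds R d beta gamma lambda p g1 l0 gp _ c ce u u1 L0 ce0 c0 LU.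
exists e1, Gam; split => //.
- by apply: le_trans e1U _; rewrite lerDl.
- by apply: le_trans GamU _; rewrite ler_wpM2r ?(ltW (un _))// lerDr.
move=> r v y y' ur /andP[rv vr] yL y'L; apply: HBB => //.
have r1 : 1 <= r by apply: le_trans ur; rewrite exprn_ege1.
have r0 : 0 < r by apply: lt_le_trans r1.
have r20 : 0 < r ^+ 2 by rewrite exprn_gt0.
pose x := (1 + v) / r ^+ 2.
have x0 : 0 <= x by rewrite divr_ge0 ?(ltW r20)// addr_ge0// (le_trans (ltW r20)).
have -> : r `^ (1 + gamma) * (1 + v) `^ (- beta) = x `^ (- beta).
  rewrite (_ : 1 + v = x * r ^+ 2); last by rewrite divfK// gt_eqF.
  rewrite powRM ?(ltW r20)// -(powR_mulrn 2 (ltW r0)) -powRrM mulrCA.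
  rewrite (_ : 2 * - beta = - (1 + gamma)); last by rewrite bE; field.
  by rewrite [r `^ (- (1 + gamma))]powRN mulfV ?mulr1// gt_eqF// powR_gt0.
have S0 := un (small_exp p).
have hS : h <= (u ^+ small_exp p)^-1.
  rewrite -[leRHS]mul1r ler_pdivlMr// -(ler_pM2r (un (tau_exp p))) mul1r -mulrA -exprD.
  by apply: le_trans hs; rewrite ler_wpM2l// ler_weXn2l.
have rS : (r ^+ 2)^-1 <= (u ^+ small_exp p)^-1.
  rewrite lef_pV2 ?posrE//; apply: le_trans ur _.
  by rewrite expr2 ler_peMl// ltW.
have r2V : (r ^+ 2)^-1 <= 1 by rewrite invf_le1// exprn_ege1.
have x1 : 1 <= x.
  by rewrite ler_pdivlMr// mul1r (le_trans rv)// lerDr.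
have x2 : x <= 1 + h + (r ^+ 2)^-1.
  rewrite ler_pdivrMr// [leRHS]mulrDl mulVf ?gt_eqF// addrC lerD2r//.
have x3 : 2^-1 <= x <= 3.
  by rewrite (le_trans _ x1) ?invf_le1 ?ler1n//= (le_trans x2)// (natrD _ 2 1) lerD// (natrD _ 1 1) lerD.
apply: le_trans (powR_near1 _ x3) _; rewrite -/k (_ : ce / _ = k * (2 / u ^+ small_exp p)); last by rewrite /ce mulrA.
rewrite ler_wpM2l//.
rewrite ger0_norm ?subr_ge0// mulr2n mulrDl mul1r; apply: le_trans (lerD hS rS).
by rewrite lerBlDl addrA.
Qed.

End critical_drift.

Lemma bbar_power_drift (R : realType) (d : nat) (kap gamma lambda : R) :
  @bbar R d kap (- lambda) (gamma - 1) = fun y => - kap *: y + power_drift gamma lambda y.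
Proof. by apply/funext => y; rewrite /bbar /power_drift -scalerDl; congr (_ *: _); ring. Qed.

Theorem theorem1p3 (R : realType) (d : nat) (d_ge1 : (1 <= d)%N)
  (alpha : \bar R) (alpha_gt2 : (2%:E < alpha)%E)
  (c : R) (c_gt0 : 0 < c)
  (a : 'rV[R]_d -> \bar R)
  (a_meas : measurable_fun (@unit_ball R d) a)
  (a_ge0 : forall z, enorm z <= 1 -> (0 <= a z)%E)
  (a_radial : is_radial_on_ball a)
  (a_mom : (\int[lebesgue_rV R d]_(z in @unit_ball R d)
              ((enorm z ^+ 2)%:E * a z) < +oo)%E)
  (nu : {measure set 'rV[R]_d -> \bar R})
  (nuE : forall A, measurable A ->
     nu A = (\int[lebesgue_rV R d]_(z in A) levy_density a c alpha z)%E)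
  (nu_neq0 : nu setT != 0%E)
  (beta gamma lambda : R) (beta_gt0 : 0 < beta) (gamma_gt0 : 0 < gamma)
  (lambda_neq0 : lambda != 0)
  (wellposed : has_unique_strong_solution nu (drift beta gamma lambda))
  (disp : measure_display) (Omega : measurableType disp)
  (P : probability Omega R) (B : R -> Omega -> 'rV[R]_d)
  (B_brownian : is_brownian P ((second_moment nu / d%:R)%:M) B) :
  [/\ (* case (a) *)
      (1 + gamma) / 2 < beta ->
      (0 < lambda /\ gamma <= 1) \/ (lambda < 0 /\ (gamma%:E < alpha)%E) ->
      exists2 pi : probability 'rV[R]_d R,
        is_unique_invariant P (fun y => - 2^-1 *: y) B pi &
        polynomial_convergence nu (drift beta gamma lambda) gamma 2^-1 pi,
      (* case (b) *)
      beta = (1 + gamma) / 2 -> lambda < 0 ->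
      Num.max 1 (3 - d%:R / 2) < gamma -> (gamma%:E < alpha)%E ->
      exists2 pi : probability 'rV[R]_d R,
        is_unique_invariant P
          (fun y => - 2^-1 *: y + power_drift gamma lambda y) B pi &
        polynomial_convergence nu (drift beta gamma lambda) gamma 2^-1 pi &
      (* case (c) *)
      beta < (1 + gamma) / 2 -> lambda < 0 ->
      Num.max 1 (3 - d%:R / 2) < gamma -> (gamma%:E < alpha)%E ->
      exists2 pi : probability 'rV[R]_d R,
        is_unique_invariant P (power_drift gamma lambda) B pi &
        polynomial_convergence nu (drift beta gamma lambda) gamma
          (beta / (1 + gamma)) pi].
Proof.
pose s2 := second_moment nu / d%:R.
have s20 : 0 <= s2.
  rewrite divr_ge0// /second_moment; apply: Rintegral_ge0 => z _; exact: sqr_ge0.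
have [del [mm [/andP[del0 del1] mm0 sym]]] :=
  levy_symbol_est alpha_gt2 c_gt0 a_meas a_ge0 a_radial a_mom nuE d_ge1.
have sreal xi : complex.Im (levy_symbol nu xi) = 0 by have [] := sym xi.
have psi0 xi : 0 <= complex.Re (levy_symbol nu xi) by have [] := sym xi.
have psi2 xi : complex.Re (levy_symbol nu xi) <= s2 / 2 * enorm xi ^+ 2 by have [] := sym xi.
have psiE xi : `|complex.Re (levy_symbol nu xi) - s2 / 2 * enorm xi ^+ 2| <= mm * enorm xi `^ (2 + del).
  by have [] := sym xi.
have M0 (b : R) : 0 < b -> 0 <= d%:R * s2 / b + 1.
  by move=> b0; apply: addr_ge0 => //; apply: divr_ge0; [exact: mulr_ge0|exact: ltW].
have half0 : 0 <= 2^-1 :> R by rewrite invr_ge0.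
pose p := (Num.truncn (gamma - 1)).+1.
have qp : gamma - 1 <= p%:R by rewrite ltW// truncnS_gt.
split.
- move=> bg cases.
  have [A A1 HA] : exists2 A : R, 1 <= A & apriori_bound d beta gamma lambda A.
    case: cases => [[l0 g1]|[l0 _]]; first exact: apriori_bound_sublinear.
    by exists 3; [rewrite ler1n|exact: apriori_bound_dissipative].
  (* In case (a) the limit is an Ornstein-Uhlenbeck process: [ell = 0], with 1 as default value of
     the exponent [q]. *)
  have hp : 0 < 2^-1 + 0 :> R by rewrite addr0 invr_gt0.
  have [pi [W [piU piM nW cW piI]]] := brownian_invariant half0 (lexx 0) ltr01 hp s20 B_brownian.
  exists pi.
    rewrite (_ : (fun y => _) = bbar 2^-1 0 1)//; apply/funext => y.
    by rewrite /bbar mul0r addr0.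
  have [cb [N cb0 HB]] := @critical_drift_vanishing R d beta gamma lambda A 1 beta_gt0 gamma_gt0 A1 bg.
  have q1 : (1 : R) <= 1%:R by [].
  exact: (critical_case sreal s20 psi0 psi2 del0 del1 mm0 psiE gamma_gt0 half0 (lexx 0) ltr01 q1 nW cW
    (M0 _ hp) piM piI erefl A1 HA cb0 HB).
- move=> bE l0; rewrite gt_max => /andP[g1 _] _.
  have ell0 : 0 <= - lambda by rewrite oppr_ge0 ltW.
  have q0 : 0 < gamma - 1 by rewrite subr_gt0.
  have A1 : 1 <= 3 :> R by rewrite ler1n.
  have HA := @apriori_bound_dissipative R d beta gamma lambda l0.
  have hp : 0 < 2^-1 + - lambda by rewrite addr_gt0 ?invr_gt0// oppr_gt0.
  have [pi [W [piU piM nW cW piI]]] := brownian_invariant half0 ell0 q0 hp s20 B_brownian.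
  exists pi; first by rewrite bbar_power_drift in piU.
  have [cb [N cb0 HB]] := @critical_drift_power R d beta gamma lambda 3 p gamma_gt0 A1 bE l0 g1 qp.
  exact: (critical_case sreal s20 psi0 psi2 del0 del1 mm0 psiE gamma_gt0 half0 ell0 q0 qp nW cW
    (M0 _ hp) piM piI erefl A1 HA cb0 HB).
- move=> bE l0; rewrite gt_max => /andP[g1 _] _.
  have ell0 : 0 <= - lambda by rewrite oppr_ge0 ltW.
  have q0 : 0 < gamma - 1 by rewrite subr_gt0.
  have hp : 0 < 0 + - lambda by rewrite add0r oppr_gt0.
  have [pi [W [piU piM nW cW piI]]] := brownian_invariant (lexx 0) ell0 q0 hp s20 B_brownian.
  exists pi.
    rewrite bbar_power_drift (_ : (fun y => _) = power_drift gamma lambda)// in piU.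
    by apply/funext => y; rewrite oppr0 scale0r add0r.
  exact: (subcritical_case sreal s20 psi0 psi2 del0 del1 mm0 psiE beta_gt0 gamma_gt0 (lexx 0) ell0 q0 qp nW cW
    (M0 _ hp) piM piI g1 l0 bE erefl erefl erefl).
Qed.
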